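(* (Morley nonconforming FEM, forward problem.) Let $V_h=V_{\mathrm M}$ be the Morley finite element space and let $T_h$ be the corresponding discrete solution operator. Let $k\in\mathbb{N}_0$ and suppose there is $s\ge2$ such that for every $g\in H^k(\Omega)$, $Tg\in H^s(\Omega)$ and $\|Tg\|_s\le C\|g\|_k$ with $C$ independent of $g$. Suppose the functions $\xi_i\in V$ defined by $a(\xi_i,v)=(\phi_i,v)$ for all $v\in V$ lie in $H^r(\Omega)$ with $r\ge2$, $i=1,\dots,N$, and are fixed. Then there are constants $C>0$ and $C(N)>0$, independent of $h$ and $f$, such that for every $f\in H^k(\Omega)$ $$\|Tf-T_hf\|_{\mathrm{NC}}\le C\,h^{\min\{1,s-2\}}\|f\|_k$$ and $$\|\Phi Tf-\Phi T_hf\|\le C(N)\,h^{\min\{1,s-2\}+\min\{1,r-2\}}\|f\|_k .$$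
   Context: $\Omega\subset\mathbb{R}^2$ is a bounded (polygonal) domain with Lipschitz boundary; $\|\cdot\|_t$ is the $H^t(\Omega)$ norm, $(\cdot,\cdot)$ the $L^2(\Omega)$ inner product, and $\|\cdot\|$ the Euclidean norm on $\mathbb{R}^N$. $V:=H^2_0(\Omega)$, $V':=H^{-2}(\Omega)$, $a(v,w):=\int_\Omega\Delta v\,\Delta w\,dx$. $T:V'\to L^2(\Omega)$: $Tf\in V$ is the unique solution of $a(Tf,v)=\langle f,v\rangle$ for all $v\in V$. Fixed $\phi_1,\dots,\phi_N\in L^2(\Omega)$ are given and $\Phi v:=((\phi_1,v),\dots,(\phi_N,v))^{\top}\in\mathbb{R}^N$. $\mathcal{T}_h$ is a regular and conforming triangulation of $\overline\Omega$ into closed triangles, $h$ the maximal element diameter. $V_{\mathrm M}$ is the space of piecewise polynomials $v$ of degree $\le2$ on $\mathcal{T}_h$ such that $v$ is continuous at the interior vertices and vanishes at the vertices on $\partial\Omega$, and the piecewise gradient $D_{\mathrm{NC}}v$ is continuous at the midpoints of interior edges and vanishes at the midpoints of the edges on $\partial\Omega$. With $D^2_{\mathrm{NC}}$ the piecewise Hessian, $\|v\|_{\mathrm{NC}}:=\big(\sum_{K\in\mathcal{T}_h}\|D^2_{\mathrm{NC}}v\|_{L^2(K)}^2\big)^{1/2}$ and $a_{\mathrm{NC}}(v,w):=\sum_{K\in\mathcal{T}_h}\int_KD^2v:D^2w\,dx$ on $V+V_{\mathrm M}$, where $:$ is the scalar product of matrices. $T_h:L^2(\Omega)\to V_{\mathrm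 M}$: $T_hf$ is the unique solution of $a_{\mathrm{NC}}(T_hf,v_h)=(f,v_h)$ for all $v_h\in V_{\mathrm M}$. *)

(* Defs.v *)
From HB Require Import structures.
From mathcomp Require Import all_boot all_order all_algebra.
From mathcomp Require Import all_classical all_reals all_analysis.

Set Implicit Arguments.
Unset Strict Implicit.
Unset Printing Implicit Defensive.

Import Order.TTheory GRing.Theory Num.Theory.
Import numFieldNormedType.Exports.

Local Open Scope classical_set_scope.
Local Open Scope ring_scope.

Section Plane.
Context {R : realType}.
Implicit Types (x y : R * R) (A : set (R * R)).

Definition mu2 : {measure set (measurableTypeR R * measurableTypeR R) -> \bar R} :=
  (@lebesgue_measure R \x @lebesgue_measure R)%E.

(* The norm provided by the library on R * R is the sup norm; only its topology
   is used, all metric quantities are Euclidean. *)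
Definition edist x y : R :=
  Num.sqrt ((x.1 - y.1) ^+ 2 + (x.2 - y.2) ^+ 2).

Definition segment x y : set (R * R) :=
  [set z | exists t : R, 0 <= t <= 1 /\ z = (1 - t) *: x + t *: y].

(* Meant for open sets. *)
Definition bd A : set (R * R) := closure A `\` A.

Definition domain A : Prop := [/\ open A, connected A & A !=set0].

(* Near each boundary point, A is the strict epigraph of a Lipschitz function
   in the coordinates rotated by the unit vector (c, d). *)
Definition lipschitz_boundary A : Prop :=
  forall x, bd A x ->
    exists (e c d L : R) (g : R -> R),
      [/\ 0 < e, c ^+ 2 + d ^+ 2 = 1, L.-lipschitz g &
          forall y, edist x y < e ->
            (A y <-> g (c * y.1 + d * y.2) < c * y.2 - d * y.1)].

Definition polygonal A : Prop :=
  exists E : seq ((R * R) * (R * R)),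
    bd A = [set x | exists2 e, e \in E & segment e.1 e.2 x].

Definition bounded_polygonal_lipschitz_domain A : Prop :=
  [/\ domain A, bounded_set A, polygonal A & lipschitz_boundary A].

End Plane.

Section Sobolev.
Context {R : realType}.
Implicit Types (D : set (R * R)) (u v g : R * R -> R) (a : nat * nat).

Definition pd (i : 'I_2) u : R * R -> R :=
  fun x => 'D_((i == 0)%:R, (i == 1)%:R) u x.

Definition Dclassical a u : R * R -> R :=
  iter a.1 (pd 0) (iter a.2 (pd 1) u).

Definition smooth u : Prop :=
  forall (l : seq 'I_2) x, differentiable (foldr pd u l) x.

Definition test_function D u : Prop :=
  smooth u /\
  exists K : set (R * R),
    [/\ compact K, K `<=` D & forall x, ~ K x -> u x = 0].

(* Elements of L^2(D) are represented by functions on the whole plane, whose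
   values outside D are irrelevant. *)
Definition L2 D u : Prop :=
  measurable_fun D u /\ mu2.-integrable D (EFin \o (fun x => u x ^+ 2)).

Definition ip D u v : R := \int[mu2]_(x in D) (u x * v x).

Definition L2norm D u : R := Num.sqrt (ip D u u).

(* g is the weak derivative of u of order a on D. *)
Definition weak_derivative D a u g : Prop :=
  forall p, test_function D p ->
    ip D u (Dclassical a p) = (-1) ^+ (a.1 + a.2) * ip D g p.

(* The weak derivative in L^2(D), a function determined almost everywhere on D;
   the zero function if there is none. *)
Definition wD D a u : R * R -> R :=
  xget (cst 0) [set g | L2 D g /\ weak_derivative D a u g].

(* The square of the Sobolev-Slobodeckij seminorm of order t in ]0, 1[. *)
Definition slobodeckij D (t : R) u : \bar R :=
  (\int[mu2]_(x in D) \int[mu2]_(y in D)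
     (((u x - u y) ^+ 2 / edist x y `^ (2 + 2 * t))%:E))%E.

(* H^s(D) for real s >= 0, with integer part m := Num.truncn s. *)
Definition sobolev (s : R) D u : Prop :=
  let m := Num.truncn s in
  [/\ L2 D u,
      forall a, (a.1 + a.2 <= m)%N -> exists g, L2 D g /\ weak_derivative D a u g &
      m%:R < s -> forall a, (a.1 + a.2)%N = m ->
        (slobodeckij D (s - m%:R) (wD D a u) < +oo)%E].

Definition sobolev_norm (s : R) D u : R :=
  let m := Num.truncn s in
  Num.sqrt
    (\sum_(i < m.+1) \sum_(j < m.+1 | (i + j <= m)%N)
        L2norm D (wD D (i : nat, j : nat) u) ^+ 2
     + (if m%:R < s then
          \sum_(i < m.+1) fine (slobodeckij D (s - m%:R) (wD D (i : nat, m - i)%N u))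
        else 0)).

(* H^2_0(D), the closure of C_c^infty(D) in H^2(D). *)
Definition H20 D u : Prop :=
  sobolev 2 D u /\
  forall e : R, 0 < e -> exists p,
    test_function D p /\ sobolev_norm 2 D (fun x => u x - p x) < e.

(* H^{-2}(D), the bounded linear functionals on H^2_0(D); their values outside
   H^2_0(D) are irrelevant. *)
Definition Hm2 D (F : (R * R -> R) -> R) : Prop :=
  (forall (c : R) u v, H20 D u -> H20 D v ->
     F (fun x => c * u x + v x) = c * F u + F v) /\
  exists M : R, forall v, H20 D v -> `|F v| <= M * sobolev_norm 2 D v.

Definition laplacian D u : R * R -> R :=
  fun x => wD D (2, 0)%N u x + wD D (0, 2)%N u x.

Definition bilaplace_form D u v : R := ip D (laplacian D u) (laplacian D v).

Definition hessian D u (x : R * R) : 'M[R]_2 :=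
  \matrix_(i, j) wD D ((i == 0%R) + (j == 0%R), (i == 1%R) + (j == 1%R))%N u x.

Definition mxscalar (A B : 'M[R]_2) : R := \sum_i \sum_j A i j * B i j.

Definition solution_operator D (T : ((R * R -> R) -> R) -> R * R -> R) : Prop :=
  forall F, Hm2 D F ->
    H20 D (T F) /\ forall v, H20 D v -> bilaplace_form D (T F) v = F v.

Definition enorm (N : nat) (z : 'cV[R]_N) : R := Num.sqrt (\sum_i z i 0 ^+ 2).

Definition Phi D (N : nat) (phi : 'I_N -> R * R -> R) v : 'cV[R]_N :=
  \col_i ip D (phi i) v.

End Sobolev.

Section Morley.
Context {R : realType}.

(* A triangle is given by its vertices. *)
Definition triangle := {ffun 'I_3 -> R * R}.
Definition mesh := seq triangle.

Implicit Types (K : triangle) (M : mesh) (D : set (R * R)) (u v : R * R -> R).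

Definition tri K : set (R * R) :=
  [set x | exists l : 'I_3 -> R,
     [/\ forall i, 0 <= l i, \sum_i l i = 1 & x = \sum_i l i *: K i]].

Definition diam (A : set (R * R)) : R :=
  sup [set d | exists x y, [/\ A x, A y & d = edist x y]].

(* Supremum of the diameters of the discs contained in A. *)
Definition indiam (A : set (R * R)) : R :=
  sup [set d | 0 <= d /\ exists x, forall y, edist x y <= d / 2 -> A y].

Definition meshsize M : R := \big[Num.max/0]_(K <- M) diam (tri K).

(* Two distinct triangles are disjoint or share exactly one common vertex or
   one common edge. *)
Definition conforming M : Prop :=
  forall K K', K \in M -> K' \in M -> K <> K' ->
    [\/ tri K `&` tri K' = set0,
        exists i i', K i = K' i' /\ tri K `&` tri K' = [set K i] |
        exists i j i' j', [/\ i != j, i' != j', K i = K' i', K j = K' j' &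
                              tri K `&` tri K' = segment (K i) (K j)]].

Definition triangulation D M : Prop :=
  [/\ uniq M,
      forall K, K \in M -> interior (tri K) !=set0,
      closure D = [set x | exists2 K, K \in M & tri K x] &
      conforming M].

Definition regular_family (TT : set mesh) : Prop :=
  exists kappa : R, forall M, TT M ->
    forall K, K \in M -> diam (tri K) <= kappa * indiam (tri K).

Definition poly_le2 u : Prop :=
  exists c : nat -> nat -> R, forall x : R * R,
    u x = \sum_(i < 3) \sum_(j < 3 | (i + j <= 2)%N) c i j * x.1 ^+ i * x.2 ^+ j.

Definition vertex M (z : R * R) : Prop := exists2 K, K \in M & exists i, z = K i.

Definition edge_midpoint M (z : R * R) : Prop :=
  exists2 K, K \in M & exists i j, i != j /\ z = 2^-1 *: (K i + K j).

(* For a function w given on each closed triangle separately. *)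
Definition pw_continuous_at M (w : triangle -> R * R -> R) z : Prop :=
  forall K K', K \in M -> K' \in M -> tri K z -> tri K' z -> w K z = w K' z.

Definition pw_zero_at M (w : triangle -> R * R -> R) z : Prop :=
  forall K, K \in M -> tri K z -> w K z = 0.

(* p K is the polynomial that v coincides with on the triangle K; the values of
   v on the edges, where v may jump, are irrelevant. *)
Definition morley D M v : Prop :=
  exists p : triangle -> R * R -> R,
    [/\ forall K, K \in M ->
          poly_le2 (p K) /\ forall x, interior (tri K) x -> v x = p K x,
        forall z, vertex M z -> D z -> pw_continuous_at M p z,
        forall z, vertex M z -> bd D z -> pw_zero_at M p z,
        forall z i, edge_midpoint M z -> D z ->
          pw_continuous_at M (fun K => pd i (p K)) z &
        forall z i, edge_midpoint M z -> bd D z ->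
          pw_zero_at M (fun K => pd i (p K)) z].

Definition aNC M u v : R :=
  \sum_(K <- M) \int[mu2]_(x in interior (tri K))
    mxscalar (hessian (interior (tri K)) u x) (hessian (interior (tri K)) v x).

Definition normNC M v : R := Num.sqrt (aNC M v v).

Definition discrete_solution_operator D M
    (Th : (R * R -> R) -> R * R -> R) : Prop :=
  forall f, L2 D f ->
    morley D M (Th f) /\ forall v, morley D M v -> aNC M (Th f) v = ip D f v.

End Morley.

Arguments triangle R : clear implicits.
Arguments mesh R : clear implicits.

(* Main.v *)
From HB Require Import structures.
Require Import Defs.
From mathcomp Require Import all_boot all_order all_algebra.
From mathcomp Require Import all_classical all_reals all_analysis.
From mathcomp Require Import measurable_realfun ring lra zify.
Import Order.TTheory GRing.Theory Num.Theory.
Import numFieldNormedType.Exports.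
Set Implicit Arguments.
Unset Strict Implicit.
Unset Printing Implicit Defensive.
Local Open Scope classical_set_scope.
Local Open Scope ring_scope.

(* Let H denote the piecewise Hessian, P0 the mean value on each triangle, u the
   solution and u_h the discrete one. The Morley interpolant w of a test function
   p close to u satisfies H w = P0 (H p), so that ||H (u - w)|| is controlled by
   the oscillation of H u. For a Morley function e there is a companion test
   function J e that has the same mean Hessian as e on each triangle and satisfies
   ||e - J e|| <= C h^2 ||H e|| and ||H J e|| <= C ||H e||.
   With e := w - u_h and H w piecewise constant,
     ||H e||^2 = (H w, H J e) - (f, e) = (H (w - u), H J e) + (f, J e - e),
   which is the energy estimate; no trace or regularity theory is needed. The
   functional is treated by the same device applied to u and to xi, where
     (H z, H e) = (H (u - w), H (z - q)) + (f, q - z) up to small terms,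
   for the interpolant z of a test function q close to xi.
   J e is obtained by gluing, with cut-off functions, affine functions attached
   to the edges and vertices to the pieces of e; the cut-off at a vertex is
   chosen such that the edge means of the gradient do not change. Finally the
   oscillation of H u is O(h^min(1,s-2)), directly from the Slobodeckij seminorm
   for s < 3 and from a Poincare inequality otherwise. *)

(** Test functions take the place of trace theory: [u] and [xi] are approximated up to e by smooth
    functions with compact support, the continuous equations are tested with such functions only,
    and e tends to 0 at the very end. Hence the companion must itself be a test function, smooth
    across edges and vertices. Its mean Hessians are correct because, by the fundamental theorem,
    the mean Hessian on a triangle depends only on the edge means of the gradient; for a Morley
    function these are the midpoint gradients, common to both neighbours and 0 on the boundary. The
    obstacle is to bound the companion by the Hessians of nearby pieces. At a vertex the gradients
    of the pieces differ; they are compared along chains of triangles that cross edges through the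
    vertex, or with a boundary edge, where the midpoint gradient is 0. Around an interior vertex
    such chains reach every triangle; otherwise they reach a boundary edge, because a Lipschitz
    domain is the interior of its closure. Shape regularity bounds the number of triangles at a
    vertex by a multiple of kappa^2, so that the constants of the companion depend on kappa only. *)

Notation Pl R := (measurableTypeR R * measurableTypeR R)%type.

(** * Integration in the plane *)

Section PlaneIntegration.
Context {R : realType}.
Notation mu := (@mu2 R).
Implicit Types (D A N : set (Pl R)) (u v w : R * R -> R).

Definition L1 D u := mu.-integrable D (EFin \o u).
Definition Int D u : R := \int[mu]_(x in D) u x.

Definition box (a b c d : R) : set (Pl R) :=
  (`]a, b[%classic `*` `]c, d[%classic).

Lemma measurable_box a b c d : measurable (box a b c d).
Proof. by apply: measurableX; exact: measurable_itv. Qed.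

Lemma mu2_box a b c d : a <= b -> c <= d ->
  mu (box a b c d) = ((b - a) * (d - c))%:E.
Proof.
move=> ab cd; rewrite /mu2 /= product_measure1E//= !lebesgue_measure_itv /= !lte_fin.
have -> : (if a < b then (b%:E - a%:E)%E else 0%E) = (b - a)%:E :> \bar R.
  case: ltP => // ba; rewrite (_ : b = a) ?subrr //; apply/eqP; lra.
have -> : (if c < d then (d%:E - c%:E)%E else 0%E) = (d - c)%:E :> \bar R.
  case: ltP => // ba; rewrite (_ : d = c) ?subrr //; apply/eqP; lra.
by rewrite EFinM.
Qed.

Lemma open_nbhs_box (D : set (R * R)) x : open D -> D x ->
  exists q : (rat * rat) * (rat * rat),
   box (ratr q.1.1) (ratr q.1.2) (ratr q.2.1) (ratr q.2.2) x /\
   box (ratr q.1.1) (ratr q.1.2) (ratr q.2.1) (ratr q.2.2) `<=` D.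
Proof.
move=> oD Dx; have /nbhs_ballP[e /= e0 He] : nbhs x D by exact: open_nbhs_nbhs.
have rat_near (t : R) : exists p q : rat, [/\ t - e < ratr p, ratr p < t, t < ratr q & ratr q < t + e].
  have [p] := @rat_in_itvoo R (t - e) t ltac:(lra).
  have [q] := @rat_in_itvoo R t (t + e) ltac:(lra).
  by rewrite !in_itv /= => /andP[? ?] /andP[? ?]; exists p, q.
have [p1 [q1 [h1 h2 h3 h4]]] := rat_near x.1.
have [p2 [q2 [k1 k2 k3 k4]]] := rat_near x.2.
exists ((p1, q1), (p2, q2)); split => /=.
  by split; rewrite /= in_itv /=; apply/andP.
move=> y [/=]; rewrite !in_itv /= => /andP[? ?] /andP[? ?].
apply: He; split; rewrite /ball /= ltr_norml; apply/andP; split; lra.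
Qed.

(** The measurable structure is the product one. An open set is the union of the countably many
    rational boxes inside it; boxes that are not inside are replaced by the empty set, so that the
    union runs over all codes. *)
Lemma open_measurable2 (D : set (R * R)) : open D -> measurable (D : set (Pl R)).
Proof.
move=> oD.
pose B (q : (rat * rat) * (rat * rat)) : set (Pl R) :=
  box (ratr q.1.1) (ratr q.1.2) (ratr q.2.1) (ratr q.2.2).
pose F (o : option ((rat * rat) * (rat * rat))) : set (Pl R) :=
  if o is Some q then (if `[< B q `<=` D >] then B q else set0) else set0.
have Fm o : measurable (F o).
  rewrite /F; case: o => [q|]; last exact: measurable0.
  by case: asboolP => _; [exact: measurable_box|exact: measurable0].
have FS q : B q `<=` D -> F (Some q) = B q by rewrite /F; case: asboolP.
have FD o : F o `<=` D.
  rewrite /F; case: o => [q|]; last exact: sub0set.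
  by case: asboolP => // _; exact: sub0set.
clearbody F.
have -> : (D : set (Pl R)) = \bigcup_n F (unpickle n).
  apply/seteqP; split => [x Dx|x [n _]]; last exact: FD.
  have [q [qx qD]] := open_nbhs_box oD Dx.
  by exists (pickle q); [|rewrite pickleK (FS _ qD)].
by apply: bigcup_measurable => n _; exact: Fm.
Qed.

Lemma closed_measurable2 (D : set (R * R)) : closed D -> measurable (D : set (Pl R)).
Proof.
move=> cD; rewrite -(setCK D); apply: measurableC.
by apply: open_measurable2; rewrite openC.
Qed.

Lemma continuous_measurable2 u D : continuous u -> measurable_fun D u.
Proof.
move=> cu; apply: measurable_funTS => /=.
apply: (measurability _ (RGenOpens.measurableE R)).
move=> _ [_ [a [b ->] <-]]; rewrite setTI; apply: open_measurable2.
by move/continuousP : cu; apply; exact: interval_open.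
Qed.

Lemma bounded_set_box (D : set (R * R)) : bounded_set D ->
  exists2 r : R, 0 < r & D `<=` box (- r) r (- r) r.
Proof.
move=> [M [_ HM]]; exists (`|M| + 2); first by rewrite ltr_pwDr.
have MM : M < `|M| + 1 by rewrite (le_lt_trans (ler_norm M))// ltrDl.
move=> x Dx; have /= := HM _ MM x Dx.
rewrite prod_normE ge_max !ler_norml => /andP[/andP[? ?] /andP[? ?]].
by split; rewrite /= in_itv /=; apply/andP; split; lra.
Qed.

Lemma mu2_bounded_lty D : measurable D -> bounded_set (D : set (R * R)) ->
  (mu D < +oo)%E.
Proof.
move=> mD /bounded_set_box[r r0 h].
apply: (@le_lt_trans _ _ (mu (box (-r) r (-r) r))).
  by apply: le_measure; rewrite ?inE //; exact: measurable_box.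
by rewrite mu2_box ?ltry//; lra.
Qed.

Lemma L1_measurable D u : L1 D u -> measurable_fun D u.
Proof. by move=> /measurable_int /measurable_EFinP. Qed.

Lemma L1S D A u : measurable D -> measurable A -> A `<=` D -> L1 D u -> L1 A u.
Proof. by move=> mD mA AD; exact: integrableS. Qed.

Lemma eq_L1 D u v : measurable D -> (forall x, D x -> u x = v x) -> L1 D u -> L1 D v.
Proof.
by move=> mD uv; apply: eq_integrable => // x; rewrite inE => Dx /=; rewrite uv.
Qed.

Lemma L1D D u v : measurable D -> L1 D u -> L1 D v -> L1 D (fun x => u x + v x).
Proof.
move=> mD hu hv; have := integrableD mD hu hv.
by apply: eq_integrable => // x _ /=; rewrite EFinD.
Qed.

Lemma L1Z D c u : measurable D -> L1 D u -> L1 D (fun x => c * u x).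
Proof.
move=> mD hu; have := integrableZl mD c hu.
by apply: eq_integrable => // x _ /=; rewrite EFinM.
Qed.

Lemma L1N D u : measurable D -> L1 D u -> L1 D (fun x => - u x).
Proof.
by move=> mD /(L1Z (-1) mD); apply: eq_L1 => // x _; rewrite mulN1r.
Qed.

Lemma L1B D u v : measurable D -> L1 D u -> L1 D v -> L1 D (fun x => u x - v x).
Proof. by move=> mD hu hv; apply: L1D => //; exact: L1N. Qed.

Lemma L10 D : measurable D -> L1 D (fun=> 0).
Proof. by move=> mD; exact: integrable0. Qed.

Lemma L1_sum D (I : Type) (s : seq I) (P : pred I) (F : I -> R * R -> R) :
  measurable D -> (forall i, P i -> L1 D (F i)) -> L1 D (fun x => \sum_(i <- s | P i) F i x).
Proof.
move=> mD h; elim: s => [|i s IH].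
  by apply: (eq_L1 _ _ (L10 mD)) => // x _; rewrite big_nil.
case Pi : (P i).
  by apply: (eq_L1 _ _ (L1D mD (h i Pi) IH)) => // x _; rewrite big_cons Pi.
by apply: (eq_L1 _ _ IH) => // x _; rewrite big_cons Pi.
Qed.

Lemma le_L1 D u v : measurable D -> measurable_fun D u ->
  (forall x, D x -> `|u x| <= v x) -> L1 D v -> L1 D u.
Proof.
move=> mD mu_ uv hv; apply: (le_integrable mD _ _ hv).
  exact/measurable_EFinP.
by move=> x Dx /=; rewrite lee_fin (le_trans (uv _ Dx))// ler_norm.
Qed.

Lemma L1_cst D c : measurable D -> (mu D < +oo)%E -> L1 D (fun=> c).
Proof.
move=> mD Doo; apply/integrableP; split; first exact/measurable_EFinP.
rewrite /= (integral_cst mu mD `|c|%:E); exact: lte_mul_pinfty.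
Qed.

Lemma L1_bounded D u M : measurable D -> (mu D < +oo)%E -> measurable_fun D u ->
  (forall x, D x -> `|u x| <= M) -> L1 D u.
Proof. by move=> mD Doo mu_ h; apply: (le_L1 (v := fun=> M)) => //; exact: L1_cst. Qed.

Lemma IntD D u v : measurable D -> L1 D u -> L1 D v ->
  Int D (fun x => u x + v x) = Int D u + Int D v.
Proof. by move=> mD; exact: RintegralD. Qed.

Lemma IntZ D c u : measurable D -> L1 D u -> Int D (fun x => c * u x) = c * Int D u.
Proof. by move=> mD; exact: RintegralZl. Qed.

Lemma IntB D u v : measurable D -> L1 D u -> L1 D v ->
  Int D (fun x => u x - v x) = Int D u - Int D v.
Proof. by move=> mD; exact: RintegralB. Qed.

Lemma IntN D u : measurable D -> L1 D u -> Int D (fun x => - u x) = - Int D u.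
Proof.
move=> mD h; rewrite -mulN1r -IntZ //; congr Rintegral.
by apply/funext => x; rewrite mulN1r.
Qed.

Lemma eq_Int D u v : (forall x, D x -> u x = v x) -> Int D u = Int D v.
Proof. by move=> h; apply: eq_Rintegral => x; rewrite inE => /h. Qed.

Lemma Int0 D : Int D (fun=> 0) = 0.
Proof. by rewrite /Int /Rintegral integral0. Qed.

Lemma Int_sum D (I : Type) (s : seq I) (P : pred I) (F : I -> R * R -> R) :
  measurable D -> (forall i, P i -> L1 D (F i)) ->
  Int D (fun x => \sum_(i <- s | P i) F i x) = \sum_(i <- s | P i) Int D (F i).
Proof.
move=> mD h; elim: s => [|i s IH].
  by rewrite big_nil; apply: etrans (Int0 D); apply: eq_Int => x _; rewrite big_nil.
case Pi : (P i).
  rewrite big_cons Pi -IH -IntD //; [|exact: h|exact: L1_sum].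
  by apply: eq_Int => x _; rewrite big_cons Pi.
by rewrite big_cons Pi -IH; apply: eq_Int => x _; rewrite big_cons Pi.
Qed.

Lemma le_Int D u v : measurable D -> L1 D u -> L1 D v ->
  (forall x, D x -> u x <= v x) -> Int D u <= Int D v.
Proof. by move=> mD; exact: le_Rintegral. Qed.

Lemma Int_ge0 D u : (forall x, D x -> 0 <= u x) -> 0 <= Int D u.
Proof. exact: Rintegral_ge0. Qed.

Lemma Int_mkcond D u : Int D u = Int setT (u \_ D).
Proof. exact: Rintegral_mkcond. Qed.

Lemma Int_cst D c : measurable D -> Int D (fun=> c) = c * fine (mu D).
Proof. by move=> mD; exact: Rintegral_cst. Qed.

Lemma Int_EFin D u : measurable D -> L1 D u ->
  (\int[mu]_(x in D) (u x)%:E)%E = (Int D u)%:E.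
Proof. by move=> mD h; rewrite /Int /Rintegral fineK //; exact: integrable_fin_num. Qed.

Lemma Int_subset_le A D u : measurable A -> measurable D -> A `<=` D -> L1 D u ->
  (forall x, D x -> 0 <= u x) -> Int A u <= Int D u.
Proof.
move=> mA mD AD h u0; rewrite -lee_fin -!Int_EFin //; last exact: L1S h.
apply: ge0_subset_integral => //.
by apply/measurable_EFinP; exact: L1_measurable h.
Qed.

Lemma ge0_L1 D u : measurable D -> measurable_fun D u -> (forall x, D x -> 0 <= u x) ->
  (\int[mu]_(x in D) (u x)%:E < +oo)%E -> L1 D u.
Proof.
move=> mD mu_ u0 h; apply/integrableP; split; first exact/measurable_EFinP.
rewrite (_ : (\int[mu]_(x in D) `|(EFin \o u) x|)%E = (\int[mu]_(x in D) (u x)%:E)%E) //.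
by apply: eq_integral => x; rewrite inE => Dx /=; rewrite ger0_norm ?u0.
Qed.

Import HBNNSimple.

(* [f] need not be measurable: Morley functions are arbitrary on the edges. *)
Lemma integral_setD_null D N (f : Pl R -> \bar R) : measurable D -> measurable N ->
  mu N = 0%E -> (\int[mu]_(x in D) f x = \int[mu]_(x in D `\` N) f x)%E.
Proof.
move=> mD mN N0.
suff ge0 (g : Pl R -> \bar R) : (forall x, (0 <= g x)%E) ->
    (\int[mu]_(x in D) g x = \int[mu]_(x in D `\` N) g x)%E.
  by rewrite integralE [RHS]integralE !ge0.
move=> g0; apply/le_anti/andP; split; last first.
  rewrite [leLHS]integral_mkcond [leRHS]integral_mkcond !ge0_integralTE; last 2 first.
  - by move=> x; rewrite patchE; case: ifP.
  - by move=> x; rewrite patchE; case: ifP.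
  apply: le_ereal_sup => _ [h hg <-]; exists h => //= x.
  apply: le_trans (hg x) _; rewrite !patchE; case: ifPn => [|_].
    by rewrite inE => -[Dx _]; rewrite mem_set.
  by case: ifP.
rewrite [leLHS]integral_mkcond [leRHS]integral_mkcond ge0_integralTE; last first.
  by move=> x; rewrite patchE; case: ifP.
apply: ge_ereal_sup => _ [h hg <-].
rewrite ge0_integralTE; last by move=> x; rewrite patchE; case: ifP.
have mNC : measurable (~` N) by exact: measurableC.
(* Cutting the simple function [h] off on [N] keeps its integral and brings it below the function
   restricted to the complement of [N]. *)
pose k := mul_nnsfun h (indic_nnsfun R mNC).
have hk : (sintegral mu h <= sintegral mu k)%E.
  rewrite -!integralT_nnsfun le_eqVlt; apply/orP; left; apply/eqP.
  apply: ge0_ae_eq_integral => //=.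
  - by apply/measurable_EFinP.
  - by apply/measurable_EFinP; apply: measurable_funM => //; exact: measurable_indic.
  - by move=> x _; rewrite lee_fin.
  - by move=> x _; rewrite lee_fin mulr_ge0 // indicE ler0n.
  exists N; split => // x /= /not_implyP[_]; apply: contra_notP => xN.
  by rewrite /mindic indicE mem_set ?mulr1.
apply: (le_trans hk).
  apply: ereal_sup_ubound; exists k => //= x.
  rewrite /= /mindic indicE patchE in_setC; have := hg x; rewrite patchE.
  case: ifPn => [/set_mem Dx|nDx].
    case: (boolP (x \in N)) => xN /=.
      by rewrite mulr0; case: ifP.
    by rewrite mulr1 mem_set //; split => // /mem_set Nx; rewrite Nx in xN.
  move=> hx; apply: (@le_trans _ _ 0%E); last by case: ifP.
  rewrite lee_fin; move: hx; rewrite lee_fin => hx.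
  by apply: mulr_le0_ge0 => //; rewrite ler0n.
Qed.

Lemma Int_setD_null D N u : measurable D -> measurable N ->
  mu N = 0%E -> Int D u = Int (D `\` N) u.
Proof. by move=> mD mN N0; congr fine; exact: integral_setD_null. Qed.

Lemma Int_ae_eq D u v : measurable D -> measurable_fun D u -> measurable_fun D v ->
  {ae mu, forall x, D x -> u x = v x} -> Int D u = Int D v.
Proof.
move=> mD mu_ mv uv; congr fine; apply: ae_eq_integral => //.
- exact/measurable_EFinP.
- exact/measurable_EFinP.
- by apply: filterS uv => x h Dx; rewrite h.
Qed.

End PlaneIntegration.

(** * Smooth functions and cut-off profiles *)

Section SmoothFunctions.
Context {R : realType}.
Implicit Types (V : normedModType R).

(** Smoothness by a witness set of differentiable functions that is stable under all directional
    derivatives; no order of differentiation has to be counted. *)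
Definition cinf V (f : V -> R) := exists2 S : set (V -> R), S f &
  forall g, S g -> (forall x, differentiable g x) /\ forall v, S (fun x => 'D_v g x).

(** The algebra without scalars generated by [B]. Product and chain rules lead out of a set of base
    functions but not out of this algebra, so stability under derivatives has to be checked on base
    functions only. *)
Inductive gen V (B : set (V -> R)) : (V -> R) -> Prop :=
| gen_base f : B f -> gen B f
| gen_add f g : gen B f -> gen B g -> gen B (fun x => f x + g x)
| gen_mul f g : gen B f -> gen B g -> gen B (fun x => f x * g x).

Lemma derive_addE V (f g : V -> R) v : (forall x, differentiable f x) ->
  (forall x, differentiable g x) ->
  (fun x => 'D_v (fun x => f x + g x) x) = (fun x => 'D_v f x + 'D_v g x).
Proof.
by move=> df dg; apply/funext => x; rewrite deriveD //; exact: diff_derivable.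
Qed.

Lemma derive_mulE V (f g : V -> R) v : (forall x, differentiable f x) ->
  (forall x, differentiable g x) ->
  (fun x => 'D_v (fun x => f x * g x) x) = (fun x => f x * 'D_v g x + g x * 'D_v f x).
Proof.
move=> df dg; apply/funext => x.
have hf : derivable f x v by exact: diff_derivable.
have hg : derivable g x v by exact: diff_derivable.
exact: (deriveM hf hg).
Qed.

Lemma gen_diff V (B : set (V -> R)) :
  (forall b, B b -> (forall x, differentiable b x) /\ forall v, gen B (fun x => 'D_v b x)) ->
  forall f, gen B f -> (forall x, differentiable f x) /\ forall v, gen B (fun x => 'D_v f x).
Proof.
move=> HB f; elim => {f} [f /HB//|f g _ [df hf] _ [dg hg]|f g gf [df hf] gg [dg hg]].
  split=> [x|v]; first exact: differentiableD.
  by rewrite derive_addE //; apply: gen_add.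
split=> [x|v]; first exact: differentiableM.
by rewrite derive_mulE //; apply: gen_add; apply: gen_mul.
Qed.

Lemma cinf_gen V (B : set (V -> R)) :
  (forall b, B b -> (forall x, differentiable b x) /\ forall v, gen B (fun x => 'D_v b x)) ->
  forall f, gen B f -> cinf f.
Proof. by move=> HB f gf; exists (gen B) => // g; exact: gen_diff. Qed.

Lemma cinf_diff V (f : V -> R) x : cinf f -> differentiable f x.
Proof. by move=> [S Sf HS]; have [h _] := HS _ Sf. Qed.

Lemma cinf_continuous V (f : V -> R) : cinf f -> continuous f.
Proof. by move=> cf x; exact/differentiable_continuous/cinf_diff. Qed.

Lemma cinf_derive V (f : V -> R) v : cinf f -> cinf (fun x => 'D_v f x).
Proof. by move=> [S Sf HS]; have [_ h] := HS _ Sf; exists S. Qed.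

Lemma gen_cinf V (B : set (V -> R)) f : (forall b, B b -> cinf b) -> gen B f -> cinf f.
Proof.
move=> HB gf; apply: (@cinf_gen _ (@cinf V)); last first.
  by elim: gf => {f} [f /HB|f g _ ? _ ?|f g _ ? _ ?]; [exact: gen_base|exact: gen_add|exact: gen_mul].
move=> b cb; split => [x|v]; first exact: cinf_diff.
by apply: gen_base; exact: cinf_derive.
Qed.

Lemma cinfD V (f g : V -> R) : cinf f -> cinf g -> cinf (fun x => f x + g x).
Proof.
by move=> cf cg; apply: (@gen_cinf _ (@cinf V)) => //; apply: gen_add; apply: gen_base.
Qed.

Lemma cinfM V (f g : V -> R) : cinf f -> cinf g -> cinf (fun x => f x * g x).
Proof.
by move=> cf cg; apply: (@gen_cinf _ (@cinf V)) => //; apply: gen_mul; apply: gen_base.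
Qed.

Lemma cinf_cst V (c : R) : cinf (fun _ : V => c).
Proof.
exists [set f | exists c, f = fun=> c]; first by exists c.
move=> _ [d ->]; split => [x|v]; first exact: differentiable_cst.
by exists 0; apply/funext => x; rewrite derive_cst.
Qed.

Lemma cinfZ V c (f : V -> R) : cinf f -> cinf (fun x => c * f x).
Proof. by apply: cinfM; exact: cinf_cst. Qed.

Lemma cinfN V (f : V -> R) : cinf f -> cinf (fun x => - f x).
Proof.
move=> /(cinfZ (-1)); rewrite (_ : (fun x => - f x) = (fun x => -1 * f x)) //.
by apply/funext => x; rewrite mulN1r.
Qed.

Lemma cinfB V (f g : V -> R) : cinf f -> cinf g -> cinf (fun x => f x - g x).
Proof. by move=> cf cg; apply: cinfD => //; exact: cinfN. Qed.

Lemma cinf_sum V (I : Type) (s : seq I) (P : pred I) (F : I -> V -> R) :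
  (forall i, cinf (F i)) -> cinf (fun x => \sum_(i <- s | P i) F i x).
Proof.
move=> h; elim: s => [|i s IH].
  rewrite (_ : (fun x => _) = fun=> 0); first exact: cinf_cst.
  by apply/funext => x; rewrite big_nil.
rewrite (_ : (fun x => _) =
  fun x => (if P i then F i x else 0) + \sum_(i <- s | P i) F i x).
  by apply: cinfD => //; case: (P i) => //; exact: cinf_cst.
by apply/funext => x; rewrite big_cons; case: ifP => // _; rewrite add0r.
Qed.

Lemma cinf_lin V (f : {linear V -> R}) : continuous f -> cinf f.
Proof.
move=> cf.
exists [set g : V -> R | g = (f : V -> R) \/ exists c, g = fun=> c]; first by left.
move=> g [->|[c ->]]; split => [x|v].
- exact: linear_differentiable.
- right; exists (f v); apply/funext => x; rewrite deriveE; last exact: linear_differentiable.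
  by rewrite diff_lin.
- exact: differentiable_cst.
- by right; exists 0; apply/funext => x; rewrite derive_cst.
Qed.

Lemma derive_scale1 (b : R -> R) v x : differentiable b x -> 'D_v b x = v * 'D_1 b x.
Proof.
move=> db; rewrite !deriveE //.
by rewrite -{1}(mulr1 v) -[v * 1]/(v *: (1 : R)) linearZ.
Qed.

Lemma derive_compE V (b : R -> R) (g : V -> R) v x :
  differentiable b (g x) -> differentiable g x ->
  'D_v (fun x => b (g x)) x = 'D_1 b (g x) * 'D_v g x.
Proof.
move=> db dg; have dbg : differentiable (b \o g) x by exact: differentiable_comp.
rewrite -[fun x => b (g x)]/(b \o g) deriveE // diff_comp //= -!deriveE //.
by rewrite derive_scale1 // mulrC.
Qed.

Lemma cinf_comp V (b : R -> R) (g : V -> R) : cinf b -> cinf g -> cinf (fun x => b (g x)).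
Proof.
move=> cb cg.
pose B := [set h : V -> R | cinf h \/ exists2 b, cinf b & h = fun x => b (g x)].
apply: (@cinf_gen _ B); last by apply: gen_base; right; exists b.
move=> h [ch|[{cb}b cb ->]]; split => [x|v].
- exact: cinf_diff.
- by apply: gen_base; left; exact: cinf_derive.
- by apply: (@differentiable_comp _ _ _ _ g b); exact: cinf_diff.
- rewrite (_ : (fun x => _) = (fun x => 'D_1 b (g x) * 'D_v g x)).
    apply: gen_mul; apply: gen_base; last by left; exact: cinf_derive.
    by right; exists (fun t => 'D_1 b t) => //; exact: cinf_derive.
  by apply/funext => x; apply: derive_compE; exact: cinf_diff.
Qed.

Lemma cinf_inv V (g : V -> R) : cinf g -> (forall x, g x != 0) -> cinf (fun x => (g x)^-1).
Proof.
move=> cg g0; pose B := [set h : V -> R | cinf h \/ h = fun x => (g x)^-1].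
apply: (@cinf_gen _ B); last by apply: gen_base; right.
move=> h [ch|->]; split => [x|v].
- exact: cinf_diff.
- by apply: gen_base; left; exact: cinf_derive.
- by apply: (@differentiableV _ _ g) => //; exact: cinf_diff.
- rewrite (_ : (fun x => _) = (fun x => (g x)^-1 * ((g x)^-1 * (-1 * 'D_v g x)))).
    apply: gen_mul; first by apply: gen_base; right.
    apply: gen_mul; first by apply: gen_base; right.
    by apply: gen_base; left; apply: cinfZ; exact: cinf_derive.
  apply/funext => x.
  have hg : derivable g x v by apply: diff_derivable; exact: cinf_diff.
  rewrite (deriveV (g0 x) hg).
  rewrite -[_ *: _]/(_ * _) expr2 invfM; ring.
Qed.

(** The index n is there to make the family stable: each derivative is a combination of the members
    n + 1 and n + 2. Only the member 0 is of interest. *)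
Definition expinv (n : nat) (t : R) : R := if 0 < t then t^-1 ^+ n * expR (- t^-1) else 0.

(** Comes from exp x >= x^(n+2) / (n+2)! at x = 1/t. Decay of second order is what makes the
    derivative at the origin exist and vanish. *)
Lemma expinv_bound n t : `|expinv n t| <= n.+2`!%:R * t ^+ 2.
Proof.
rewrite /expinv; case: ifPn => [t0|_]; last first.
  by rewrite normr0 mulr_ge0 ?ler0n ?sqr_ge0.
rewrite ger0_norm; last by rewrite mulr_ge0 ?expR_ge0 ?exprn_ge0 ?invr_ge0 ?ltW.
rewrite expRN.
have h := @expR_ge1Dxn R t^-1 n.+1 ltac:(by rewrite invr_ge0 ltW).
have f0 : 0 < n.+2`!%:R :> R by rewrite ltr0n fact_gt0.
have e0 := expR_gt0 t^-1.
rewrite ler_pdivrMr // mulrAC.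
have : t^-1 ^+ n.+2 <= n.+2`!%:R * expR t^-1.
  rewrite -ler_pdivrMl // mulrC; apply: le_trans h; lra.
have -> : t^-1 ^+ n.+2 = t^-1 ^+ n * t^-1 ^+ 2 by rewrite -exprD addn2.
by rewrite (exprVn t 2) ler_pdivrMr ?exprn_gt0.
Qed.

Lemma expinv_is_derive n (t : R) :
  is_derive t 1 (expinv n) (- n%:R * expinv n.+1 t + expinv n.+2 t).
Proof.
case: (ltgtP 0 t) => [t0|t0|<-].
- have tn0 : t != 0 by rewrite gt_eqF.
  apply: (near_eq_is_derive (f := fun t : R => t^-1 ^+ n * expR (- t^-1))).
  + near=> s; rewrite /expinv ifT //; near: s; exact: lt_nbhsr.
  have dinv : is_derive t 1 (fun t : R => t^-1) (- t ^- 2).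
    have := @is_deriveV _ (id : R -> R) t 1 1 tn0 (is_derive_id _ _).
    by rewrite -[_ *: _]/(_ * _) mulr1.
  have dX := @is_deriveX _ _ _ n t 1 _ dinv.
  have dE : is_derive t 1 (expR \o (fun t : R => - t^-1)) (expR (- t^-1) * - (- t ^- 2)).
    by apply: is_derive1_comp; exact: is_deriveN.
  have -> : (fun t : R => t^-1 ^+ n * expR (- t^-1)) =
      (fun t : R => t^-1) ^+ n * (expR \o (fun t : R => - t^-1)).
    by apply/funext => s; rewrite fctE exprfctE.
  apply: (is_derive_eq (is_deriveM dX dE)).
  rewrite exprfctE /expinv t0 /= -![_ *: _]/(_ * _).
  rewrite -exprVn; case: n {dX} => [|n]; first by rewrite !expr0 mul0r; ring.
  by rewrite /= !exprS -natr1; ring.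
- apply: (near_eq_is_derive (f := fun=> 0 : R)).
  + near=> s; rewrite /expinv ifF //; apply/negbTE; rewrite -leNgt ltW //.
    by near: s; exact: lt_nbhsl.
  rewrite /expinv ifF; last by apply/negbTE; rewrite -leNgt ltW.
  rewrite ifF; last by apply/negbTE; rewrite -leNgt ltW.
  by rewrite mulr0 addr0; exact: is_derive_cst.
- rewrite /expinv ltxx mulr0 addr0.
  pose C : R := n.+2`!%:R.
  have C0 : 0 <= C by rewrite ler0n.
  have lim0 : h^-1 *: ((expinv n \o shift 0) (h *: (1 : R)) - expinv n 0) @[h --> 0^'] --> (0 : R).
    apply/cvgrPdist_le => /= e e0; near=> h.
    rewrite sub0r normrN /= addr0 {2}/expinv ltxx subr0 -[h *: 1]/(h * 1) mulr1.
    rewrite -[_ *: _]/(_ * _) normrM normfV.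
    have h0 : h != 0 by near: h; exact: nbhs_dnbhs_neq.
    have nh0 : 0 < `|h| by rewrite normr_gt0.
    rewrite mulrC ler_pdivrMr //; apply: le_trans (expinv_bound _ _) _.
    rewrite -real_normK ?num_real // expr2 mulrA ler_wpM2r //.
    have : `|h| <= e / (C + 1).
      near: h; apply: dnbhs0_le; apply: divr_gt0 => //; lra.
    rewrite ler_pdivlMr; last lra.
    rewrite mulrDr mulr1 [`|h| * C]mulrC -/C; lra.
  apply: DeriveDef; first by apply/cvg_ex; exists 0.
  exact: cvg_lim.
Unshelve. all: by end_near.
Qed.

Lemma cinf_expinv : cinf (expinv 0 : R -> R).
Proof.
pose B := [set h : R -> R | cinf h \/ exists n, h = expinv n].
apply: (@cinf_gen _ B); last by apply: gen_base; right; exists 0%N.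
move=> h [ch|[n ->]]; split => [x|v].
- exact: cinf_diff.
- by apply: gen_base; left; exact: cinf_derive.
- by apply/derivable1_diffP; have [] := expinv_is_derive n x.
- rewrite (_ : (fun x => _) =
    (fun x => v * (- n%:R * expinv n.+1 x + expinv n.+2 x))).
    have gc c : gen B (fun=> c) by apply: gen_base; left; exact: cinf_cst.
    apply: gen_mul; first exact: gc.
    apply: gen_add; last by apply: gen_base; right; exists n.+2.
    apply: gen_mul; first exact: gc.
    by apply: gen_base; right; exists n.+1.
  apply/funext => x; have [h1 h2] := expinv_is_derive n x.
  rewrite derive_scale1 ?h2 //; exact/derivable1_diffP.
Qed.

Lemma expinv0_gt0 (t : R) : 0 < t -> 0 < expinv 0 t.
Proof. by move=> t0; rewrite /expinv t0 expr0 mul1r expR_gt0. Qed.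

Lemma expinv0_ge0 (t : R) : 0 <= expinv 0 t.
Proof. by rewrite /expinv; case: ifP => // _; rewrite expr0 mul1r expR_ge0. Qed.

Lemma expinv0_eq0 (t : R) : t <= 0 -> expinv 0 t = 0.
Proof. by move=> t0; rewrite /expinv ltNge t0. Qed.

(** A smooth transition from 0 for t <= 0 to 1 for t >= 1; the denominator is positive since t and 1
    - t are never both nonpositive. *)
Definition step (t : R) : R := expinv 0 t / (expinv 0 t + expinv 0 (1 - t)).

Let step_den (t : R) : 0 < expinv 0 t + expinv 0 (1 - t).
Proof.
have [t0|t0] := ltP 0 t.
  by rewrite ltr_pwDl ?expinv0_gt0 // expinv0_ge0.
by rewrite ltr_wpDl ?expinv0_ge0 // expinv0_gt0; lra.
Qed.

Lemma cinf_id : cinf (id : R -> R).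
Proof.
exists [set g : R -> R | g = id \/ exists c, g = fun=> c]; first by left.
move=> g [->|[c ->]]; split => [x|v].
- by apply/derivable1_diffP; exact: derivable_id.
- by right; exists v; apply/funext => x; rewrite derive_id.
- exact: differentiable_cst.
- by right; exists 0; apply/funext => x; rewrite derive_cst.
Qed.

Lemma cinf_step : cinf step.
Proof.
have h : cinf (fun t : R => expinv 0 (1 - t)).
  apply: (cinf_comp cinf_expinv); apply: cinfB; [exact: cinf_cst|exact: cinf_id].
apply: cinfM; first exact: cinf_expinv.
apply: cinf_inv => [|t]; last by rewrite gt_eqF.
by apply: cinfD => //; exact: cinf_expinv.
Qed.

Lemma step_le0 t : t <= 0 -> step t = 0.
Proof. by move=> t0; rewrite /step expinv0_eq0 // mul0r. Qed.

Lemma step_ge1 t : 1 <= t -> step t = 1.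
Proof.
move=> t1; have := step_den t; rewrite /step (@expinv0_eq0 (1 - t)); last lra.
by rewrite addr0 => h; rewrite divff // gt_eqF.
Qed.

Lemma step_bound t : 0 <= step t <= 1.
Proof.
rewrite /step; apply/andP; split; first by rewrite divr_ge0 ?expinv0_ge0 ?ltW.
by rewrite ler_pdivrMr // mul1r lerDl expinv0_ge0.
Qed.

Definition cut (t : R) : R := step (2 - t).

Lemma cinf_cut : cinf cut.
Proof.
apply: (cinf_comp cinf_step); apply: cinfB; [exact: cinf_cst|exact: cinf_id].
Qed.

Lemma cut_le1 t : t <= 1 -> cut t = 1.
Proof. by move=> t1; apply: step_ge1; lra. Qed.

Lemma cut_ge2 t : 2 <= t -> cut t = 0.
Proof. by move=> t1; apply: step_le0; lra. Qed.

End SmoothFunctions.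

(** * Partial derivatives in the plane *)

Section PlaneCalculus.
Context {R : realType}.
Implicit Types (D : set (R * R)) (u v w : R * R -> R) (i j : 'I_2).

Definition e_ i : R * R := ((i == 0)%:R, (i == 1)%:R).

Lemma pdE i u x : pd i u x = 'D_(e_ i) u x. Proof. by []. Qed.

Lemma smooth_cinf u : cinf u -> smooth u.
Proof.
move=> cu l; elim: l u cu => [|i l IH] u cu x /=; first exact: cinf_diff.
have : cinf (foldr pd u l).
  elim: l {IH x} => //= j l IH; exact: cinf_derive.
by move=> h; apply: cinf_diff; exact: cinf_derive.
Qed.

Lemma fst_continuous : continuous (fst : R * R -> R).
Proof. by case=> a b; exact: cvg_fst. Qed.

Lemma snd_continuous : continuous (snd : R * R -> R).
Proof. by case=> a b; exact: cvg_snd. Qed.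

Lemma cinf_fst : cinf (fst : R * R -> R).
Proof. exact: (@cinf_lin _ _ (fst : {linear _ -> _}) fst_continuous). Qed.

Lemma cinf_snd : cinf (snd : R * R -> R).
Proof. exact: (@cinf_lin _ _ (snd : {linear _ -> _}) snd_continuous). Qed.

Lemma derive_fst (v x : R * R) : 'D_v fst x = v.1.
Proof.
rewrite deriveE; last exact: (@linear_differentiable _ _ _ (fst : {linear _ -> _}) x fst_continuous).
by rewrite (@diff_lin _ _ _ (fst : {linear _ -> _}) x fst_continuous).
Qed.

Lemma derive_pd u (v x : R * R) : differentiable u x ->
  'D_v u x = v.1 * pd 0 u x + v.2 * pd 1 u x.
Proof.
move=> du; rewrite !pdE !deriveE //.
have -> : v = v.1 *: e_ 0 + v.2 *: e_ 1.
  rewrite /e_; case: v => a b /=; congr pair => /=;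
  rewrite /= ?eqxx -![_ *: _]/(_ * _) /=; ring.
rewrite !linearD !linearZ /= -![_ *: _]/(_ * _).
by rewrite !mulr1 !mulr0 ?addr0 ?add0r.
Qed.

(** [smooth] iterates coordinate derivatives only. A directional derivative combines two of them
    with constant coefficients, so the witness is the algebra generated by all iterated partial
    derivatives and by the [cinf] functions, which supply the constants. *)
Lemma smooth_iff_cinf u : smooth u <-> cinf u.
Proof.
split; last exact: smooth_cinf.
move=> su; apply: (@gen_cinf _ _ (gen (fun w => (exists l, w = foldr pd u l) \/ cinf w))) => //.
  move=> b gb; apply: (@cinf_gen _ _ (fun w => (exists l, w = foldr pd u l) \/ cinf w)) => //.
  move=> {gb}b [[l ->]|cb]; split => [x|v].
  - exact: su.
  - rewrite (_ : (fun x => _) =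
      (fun x => v.1 * foldr pd u (0 :: l) x + v.2 * foldr pd u (1 :: l) x)).
      apply: gen_add; (apply: gen_mul; apply: gen_base; first by right; exact: cinf_cst).
        by left; exists (0 :: l).
      by left; exists (1 :: l).
    by apply/funext => x; rewrite derive_pd //; exact: su.
  - exact: cinf_diff.
  - by apply: gen_base; right; exact: cinf_derive.
by apply: gen_base; apply: gen_base; left; exists [::].
Qed.

End PlaneCalculus.

(** * Calculus along lines and equality of mixed derivatives *)

Section LineCalculus.
Context {R : realType}.
Implicit Types (u v w : R * R -> R) (x z : R * R).

Lemma line_is_derive u x z (t : R) : differentiable u (x + t *: z) ->
  is_derive t 1 (fun t => u (x + t *: z)) ('D_z u (x + t *: z)).
Proof.
move=> du; have h : derivable u (x + t *: z) z by exact: diff_derivable.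
have e : (fun h : R => h^-1 *: (((fun t => u (x + t *: z)) \o shift t) (h *: (1 : R)) - u (x + t *: z))) =
  (fun h : R => h^-1 *: ((u \o shift (x + t *: z)) (h *: z) - u (x + t *: z))).
  apply/funext => s /=; rewrite -[s *: (1 : R)]/(s * 1) mulr1 scalerDl.
  by rewrite addrCA.
apply: DeriveDef; first by rewrite /derivable e.
by rewrite /derive e.
Qed.

Lemma derivable_oo_LRcontinuous_everywhere (f : R -> R) (a b : R) :
  (forall t : R, derivable f t 1) -> derivable_oo_LRcontinuous f a b.
Proof.
move=> h; have c t : {for t, continuous f}.
  by apply: differentiable_continuous; apply/derivable1_diffP.
split; first by move=> t _; exact: h.
- by apply: cvg_at_right_filter; exact: c.
- by apply: cvg_at_left_filter; exact: c.
Qed.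

Lemma FTC_everywhere (f g : R -> R) (a b : R) : a < b ->
  (forall t : R, is_derive t 1 f (g t)) -> continuous g ->
  (\int[lebesgue_measure]_(t in `[a, b]) (g t)%:E)%E = (f b - f a)%:E.
Proof.
move=> ab df cg; rewrite (@continuous_FTC2 _ g f) ?EFinB //.
- exact: continuous_subspaceT.
- by apply: derivable_oo_LRcontinuous_everywhere => t; have [] := df t.
- by move=> t _; rewrite derive1E; have [] := df t.
Qed.

Lemma derive_shiftE (V : normedModType R) (f : V -> R) (c v y : V) :
  'D_v (fun y => f (y + c)) y = 'D_v f (y + c).
Proof.
have e : (fun h : R => h^-1 *: (((fun y => f (y + c)) \o shift y) (h *: v) - f (y + c))) =
    (fun h : R => h^-1 *: ((f \o shift (y + c)) (h *: v) - f (y + c))).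
  by apply/funext => r /=; rewrite addrA.
by rewrite /derive e.
Qed.

Lemma cinf_shift (V : normedModType R) (f : V -> R) (c : V) : cinf f -> cinf (fun y => f (y + c)).
Proof.
move=> [S Sf HS].
exists [set g | exists2 f, S f & g = fun y => f (y + c)]; first by exists f.
move=> _ [{Sf}f Sf ->]; have [h1 h2] := HS _ Sf; split=> [y|v].
  apply: (@differentiable_comp _ _ _ _ (fun y => y + c) f) => //.
by exists (fun y => 'D_v f y) => //; apply/funext => y; rewrite derive_shiftE.
Qed.

Lemma line_continuous x z : continuous (fun t : R => x + t *: z).
Proof.
by move=> t; apply: cvgD; [exact: cvg_cst|exact: scalel_continuous].
Qed.

Lemma line_FTC u x z : cinf u ->
  (\int[lebesgue_measure]_(t in `[0%R, 1%R]) ('D_z u (x + t *: z))%:E)%E =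
  (u (x + z) - u x)%:E.
Proof.
move=> cu; have d (t : R) : is_derive t 1 (fun t => u (x + t *: z)) ('D_z u (x + t *: z)).
  by apply: line_is_derive; exact: cinf_diff.
rewrite (FTC_everywhere ltr01 d) ?scale1r ?scale0r ?addr0 //.
move=> t; apply: (@continuous_comp _ _ _ (fun t : R => x + t *: z) (fun y => 'D_z u y)).
  exact: line_continuous.
exact: (cinf_continuous (cinf_derive z cu)).
Qed.

Lemma line_MVT u x z : cinf u ->
  exists2 t : R, 0 <= t <= 1 & u (x + z) - u x = 'D_z u (x + t *: z).
Proof.
move=> cu; have [] := @MVT R (fun t => u (x + t *: z)) (fun t => 'D_z u (x + t *: z)) 0 1 ltr01.
- by move=> t _; apply: line_is_derive; exact: cinf_diff.
- apply: continuous_subspaceT => t.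
  apply: (@continuous_comp _ _ _ (fun t : R => x + t *: z) u).
    exact: line_continuous.
  exact: (cinf_continuous cu).
move=> t; rewrite in_itv /= => /andP[t0 t1].
rewrite scale1r scale0r addr0 subr0 mulr1 => ->.
by exists t; rewrite ?ltW.
Qed.

Lemma dist_le_of_halves (a b c e : R) :
  `|c - a| < e / 2 -> `|c - b| < e / 2 -> `|a - b| <= e.
Proof.
rewrite !ltr_norml ler_norml => /andP[? ?] /andP[? ?]; apply/andP; split; lra.
Qed.

(* Both mixed derivatives are limits of the same second difference quotient. *)
Lemma pd_comm u : cinf u -> pd 0 (pd 1 u) = pd 1 (pd 0 u).
Proof.
move=> cu; apply/funext => x.
have key (i j : 'I_2) (h : R) : exists s t : R, [/\ 0 <= s <= 1, 0 <= t <= 1 &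
    u (x + h *: e_ i + h *: e_ j) - u (x + h *: e_ j) - u (x + h *: e_ i) + u x
     = h ^+ 2 * pd j (pd i u) (x + (s * h) *: e_ i + (t * h) *: e_ j)].
  pose w y := u (y + h *: e_ j) - u y.
  have cw : cinf w.
    apply: cinfB => //.
    exact: cinf_shift.
  have [s s01 hs] := line_MVT x (h *: e_ i) cw.
  have [t t01 ht] := line_MVT (x + s *: (h *: e_ i)) (h *: e_ j) (cinf_derive (e_ i) cu).
  exists s, t; split => //.
  have e1 : 'D_(h *: e_ i) w (x + s *: (h *: e_ i)) =
    h * ('D_(e_ i) u (x + s *: (h *: e_ i) + h *: e_ j) - 'D_(e_ i) u (x + s *: (h *: e_ i))).
    rewrite deriveE; last exact: cinf_diff.
    rewrite linearZ -deriveE; last exact: cinf_diff.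
    rewrite -[LHS]/(_ * _); congr (_ * _).
    have du f y : cinf f -> derivable f y (e_ i) by move=> cf; apply: diff_derivable; exact: cinf_diff.
    rewrite /w deriveB; [|exact: du (cinf_shift _ cu)|exact: du].
    by rewrite derive_shiftE.
  have e2 y : 'D_(h *: e_ j) (fun y => 'D_(e_ i) u y) y = h * pd j (pd i u) y.
    rewrite deriveE; last by apply: cinf_diff; exact: cinf_derive.
    by rewrite linearZ -deriveE //; apply: cinf_diff; exact: cinf_derive.
  have := hs; rewrite e1 ht e2 /w => hh.
  rewrite -!scalerA expr2 -mulrA -hh [x + _ + h *: e_ j]addrAC. ring.
have lim (i j : 'I_2) (e : R) : 0 < e -> exists2 d, 0 < d & forall h : R, `|h| < d ->
  forall s t : R, 0 <= s <= 1 -> 0 <= t <= 1 ->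
   `|pd j (pd i u) (x + (s * h) *: e_ i + (t * h) *: e_ j) - pd j (pd i u) x| < e.
  move=> e0; have := cinf_continuous (cinf_derive (e_ j) (cinf_derive (e_ i) cu)) (x := x).
  rewrite -[fun x => _]/(pd j (pd i u)); move: (pd j (pd i u)) => {key} g cg.
  have /nbhs_ballP[d /= d0 Hd] : nbhs x [set y | `|g x - g y| < e].
    by move/cvgrPdist_lt : cg; exact.
  exists (d / 2); first by rewrite divr_gt0.
  move=> h hd s t /andP[s0 s1] /andP[t0 t1]; rewrite distrC; apply: Hd.
  have sh : `|s * h| < d / 2.
    by rewrite normrM (ger0_norm s0) (le_lt_trans _ hd)// ler_piMl.
  have th : `|t * h| < d / 2.
    by rewrite normrM (ger0_norm t0) (le_lt_trans _ hd)// ler_piMl.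
  have bnd (a b : bool) : `|s * h * a%:R + t * h * b%:R| < d.
    apply: le_lt_trans (ler_normD _ _) _.
    by case: a; case: b; rewrite ?mulr1 ?mulr0 ?normr0; lra.
  split; rewrite /ball /= distrC -![_ *: _]/(_ * _).
    by rewrite (_ : _ - _ = s * h * (i == 0)%:R + t * h * (j == 0)%:R) //; ring.
  by rewrite (_ : _ - _ = s * h * (i == 1)%:R + t * h * (j == 1)%:R) //; ring.
apply/eqP; rewrite -subr_eq0 -normr_le0; apply/ler_addgt0Pr => e e0; rewrite add0r.
have e20 : 0 < e / 2 by rewrite divr_gt0.
have [d1 d10 H1] := lim 0 1 _ e20; have [d2 d20 H2] := lim 1 0 _ e20.
pose h := Num.min d1 d2 / 2.
have m0 : 0 < Num.min d1 d2 by rewrite lt_min d10.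
have h0 : 0 < h by rewrite /h; lra.
have hm : `|h| < Num.min d1 d2 by rewrite gtr0_norm // /h; lra.
move: hm; rewrite lt_min => /andP[hm1 hm2].
have [s [t [s01 t01 E1]]] := key 0 1 h.
have [s' [t' [s01' t01' E2]]] := key 1 0 h.
have := H1 h hm1 s t s01 t01.
have := H2 h hm2 s' t' s01' t01'.
have -> : pd 1 (pd 0 u) (x + (s * h) *: e_ 0 + (t * h) *: e_ 1) =
          pd 0 (pd 1 u) (x + (s' * h) *: e_ 1 + (t' * h) *: e_ 0).
  apply: (@mulfI _ (h ^+ 2)); first by rewrite expf_neq0 // gt_eqF.
  apply: etrans (esym E1) _; apply: etrans E2.
  have -> : x + h *: e_ 1 + h *: e_ 0 = x + h *: e_ 0 + h *: e_ 1 by rewrite addrAC.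
  by move: (u _) (u _) (u _) (u _) => a b c d; ring.
exact: dist_le_of_halves.
Qed.

End LineCalculus.

(** * Integrals of compactly supported smooth functions *)

Section PlaneIntegralCalculus.
Context {R : realType}.
Notation mu := (@mu2 R).
Notation lb := (@lebesgue_measure R).
Implicit Types (D A : set (Pl R)) (u v w : R * R -> R).

Lemma continuous_bounded u (A : set (R * R)) : continuous u -> bounded_set A ->
  exists2 M, 0 < M & forall x, A x -> `|u x| <= M.
Proof.
move=> cu /bounded_set_box[r r0 Ar].
have cK : compact (`[- r, r] `*` `[- r, r] : set (R * R)).
  by apply: compact_setX; exact: segment_compact.
have := continuous_compact (continuous_subspaceT cu) cK.
move=> /compact_bounded[M [_ HM]]; exists (`|M| + 1) => [|x /Ar [/= h1 h2]].
  by rewrite ltr_wpDl.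
apply: (HM (`|M| + 1)); first by rewrite (le_lt_trans (ler_norm M))// ltrDl.
by exists x => //; split; apply: subset_itv_oo_cc.
Qed.

Lemma L1_continuous D u : measurable D -> bounded_set (D : set (R * R)) ->
  continuous u -> L1 D u.
Proof.
move=> mD bD cu; have [M M0 HM] := continuous_bounded cu bD.
apply: (L1_bounded (M := M)) => //; first exact: mu2_bounded_lty.
exact: continuous_measurable2.
Qed.

(** Compact support phrased by coordinates, because the fundamental theorem is applied on every
    horizontal or vertical line separately. *)
Definition zero_out (r : R) u := forall x, (r < `|x.1|) || (r < `|x.2|) -> u x = 0.

Lemma bounded_support_zero_out u (A : set (R * R)) : bounded_set A ->
  (forall x, ~ A x -> u x = 0) -> exists2 r, 0 < r & zero_out r u.
Proof.
move=> /bounded_set_box[r r0 Ar] h; exists r => // x hx; apply: h => /Ar[/=].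
rewrite !in_itv /= -!ltr_norml => h1 h2.
by move: hx; rewrite !ltNge (ltW h1) (ltW h2).
Qed.

Lemma open_out (r : R) : open [set x : R * R | (r < `|x.1|) || (r < `|x.2|)].
Proof.
have h (f : R * R -> R) : continuous f -> open [set x | r < `|f x|].
  move=> cf; rewrite (_ : [set x | _] = (fun x => `|f x|) @^-1` `]r, +oo[%classic).
    have cn : continuous (fun x => `|f x|) by move=> x; apply: cvg_norm; exact: cf.
    by move/continuousP : cn; apply; exact: interval_open.
  by apply/seteqP; split => x /=; rewrite in_itv /= andbT.
rewrite (_ : [set x | _] = [set x | r < `|x.1|] `|` [set x | r < `|x.2|]).
  by apply: openU; apply: h; [exact: fst_continuous|exact: snd_continuous].
by apply/seteqP; split => x /= => [/orP[]|[->|->]] //; rewrite ?orbT //; [left|right].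
Qed.

Lemma eq_open_derive (A : set (R * R)) u w (x v : R * R) : open A -> A x ->
  (forall y, A y -> u y = w y) -> 'D_v u x = 'D_v w x.
Proof.
move=> oA Ax uw; apply: near_eq_derive.
by have : nbhs x A by [exact: open_nbhs_nbhs]; apply: filterS => y; exact: uw.
Qed.

Lemma zero_out_derive (r : R) u (v : R * R) : zero_out r u -> zero_out r (fun x => 'D_v u x).
Proof.
move=> h x hx; rewrite (@eq_open_derive _ u (fun=> 0) x v (@open_out r) hx).
  by rewrite derive_cst.
exact: h.
Qed.

Lemma zero_out_L1 (r : R) u D : measurable D -> continuous u -> zero_out r u -> L1 D u.
Proof.
move=> mD cu h; apply: (L1S (D := setT)) => //.
pose B : set (R * R) := ~` [set x : R * R | (r < `|x.1|) || (r < `|x.2|)].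
have mB : measurable (B : set (Pl R)).
  by apply: measurableC; apply: open_measurable2; exact: open_out.
have bB : bounded_set B.
  exists r; split; first exact: num_real.
  move=> s rs x /=; rewrite /B /= => /negP; rewrite negb_or -!leNgt => /andP[h1 h2].
  by rewrite prod_normE ge_max !(le_trans _ (ltW rs)).
have [M M0 HM] := continuous_bounded cu bB.
apply: (le_L1 (v := fun x => M * \1_B x)) => //.
- exact: continuous_measurable2.
- move=> x _; rewrite indicE; case: (boolP (x \in B)) => [/set_mem/HM|xB].
    by rewrite mulr1.
  rewrite mulr0 h ?normr0 //; apply: contraNT xB => hx; exact/mem_set/negP.
- apply: L1Z => //; apply: ge0_L1 => //.
  by rewrite integral_indic // setIT; exact: mu2_bounded_lty.
Qed.

Lemma Int_Fubini12 u : L1 setT u ->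
  (Int setT u)%:E = (\int[lb]_x \int[lb]_y (u (x, y))%:E)%E.
Proof. by move=> h; rewrite -Int_EFin // /mu2 -(integral12_prod_meas1 h). Qed.

Lemma Int_Fubini21 u : L1 setT u ->
  (Int setT u)%:E = (\int[lb]_y \int[lb]_x (u (x, y))%:E)%E.
Proof. by move=> h; rewrite -Int_EFin // /mu2 -(integral21_prod_meas1 h). Qed.

Lemma line_integral0 (r : R) u (z v : R * R) : cinf u -> 0 < r ->
  (forall t : R, r < `|t| -> u (z + t *: v) = 0) ->
  (\int[lb]_t ('D_v u (z + t *: v))%:E = 0)%E.
Proof.
move=> cu r0 h.
have d (t : R) : is_derive t 1 (fun t => u (z + t *: v)) ('D_v u (z + t *: v)).
  by apply: line_is_derive; exact: cinf_diff.
have z0 (t : R) : r < `|t| -> 'D_v u (z + t *: v) = 0.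
  move=> rt; have [_ <-] := d t.
  rewrite (@near_eq_derive _ _ _ _ (fun=> 0)) ?derive_cst //.
  near=> s; apply: h; near: s.
  have : open [set s : R | r < `|s|].
    rewrite (_ : [set s | _] = (fun s : R => `|s|) @^-1` `]r, +oo[%classic).
      have /continuousP := @norm_continuous R R; apply; exact: interval_open.
    by apply/seteqP; split => x /=; rewrite in_itv /= andbT.
  by move=> oA; exact: open_nbhs_nbhs.
have -> : (\int[lb]_t ('D_v u (z + t *: v))%:E =
     \int[lb]_(t in `[(- (r + 1))%R, (r + 1)%R]) ('D_v u (z + t *: v))%:E)%E.
  rewrite [RHS]integral_mkcond; apply: eq_integral => t _.
  rewrite patchE; case: ifPn => // /negP; rewrite inE /= in_itv /= -ler_norml => /negP.
  by rewrite -ltNge => rt; rewrite z0 //; lra.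
rewrite (FTC_everywhere _ d); last 2 first.
- lra.
- move=> t; apply: (@continuous_comp _ _ _ (fun t : R => z + t *: v) (fun y => 'D_v u y)).
    exact: line_continuous.
  exact: (cinf_continuous (cinf_derive v cu)).
rewrite !h ?subrr //; rewrite ?normrN ger0_norm; lra.
Unshelve. all: by end_near. Qed.

(** Fubini with the inner integral in the direction of the derivative; on each line the end values
    are 0. *)
Lemma Int_pd0 (r : R) i u : 0 < r -> cinf u -> zero_out r u -> Int setT (pd i u) = 0.
Proof.
move=> r0 cu zu; have cdu := cinf_derive (e_ i) cu.
have L : L1 setT (pd i u).
  by apply: (zero_out_L1 (r := r)) => //; [exact: cinf_continuous|exact: zero_out_derive].
apply: EFin_inj; case: (boolP (i == 0)) => i0.
  rewrite Int_Fubini21 //; apply: integral0_eq => y _.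
  rewrite -[RHS](@line_integral0 r u (0, y) (e_ 0) cu r0).
    apply: eq_integral => x _; rewrite (eqP i0); congr (_%:E); congr (pd _ _ _).
    by rewrite /e_ /=; congr pair; rewrite /= -[_ *: _]/(_ * _); ring.
  move=> t rt; apply: zu => /=; rewrite -[_ *: _]/(_ * _) /= add0r mulr1.
  by rewrite rt.
have i1 : i = 1 by apply/val_inj; case: i i0 {cdu L} => -[|[|]].
rewrite Int_Fubini12 //; apply: integral0_eq => x _.
rewrite -[RHS](@line_integral0 r u (x, 0) (e_ 1) cu r0).
  apply: eq_integral => y _; rewrite i1; congr (_%:E); congr (pd _ _ _).
  by rewrite /e_ /=; congr pair; rewrite /= -[_ *: _]/(_ * _); ring.
move=> t rt; apply: zu => /=; rewrite -[X in _ || (_ < `|_ + X|)]/(_ * _) /= add0r mulr1.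
by rewrite rt orbT.
Qed.

End PlaneIntegralCalculus.

(** * Affine changes of variables *)

Section ChangeOfVariables.
Context {R : realType}.
Notation mu := (@mu2 R).
Notation lb := (@lebesgue_measure R).
Implicit Types (D A : set (Pl R)) (u v w : R * R -> R).

Let aff (a d : R) (t : measurableTypeR R) : measurableTypeR R := a * t + d.

Let maff a d : measurable_fun setT (aff a d).
Proof.
apply: (@continuous_measurable_fun R (fun t => a * t + d)) => t.
by apply: cvgD; [apply: cvgM; [exact: cvg_cst|exact: cvg_id]|exact: cvg_cst].
Qed.

(** The scaled image measure agrees with Lebesgue measure on half-open intervals and uniqueness does
    the rest. For a < 0 the preimage is closed at the other end, which does not change its
    length. *)
Let lebesgue_affine a d (A : set (measurableTypeR R)) : a != 0 -> measurable A ->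
  (lb A = `|a|%:E * lb (aff a d @^-1` A))%E.
Proof.
move=> a0 mA.
pose m : {measure set (measurableTypeR R) -> \bar R} :=
  mscale (NngNum (normr_ge0 a)) (pushforward lb (aff a d)).
suff : lb A = m (maff a d) A by [].
apply: lebesgue_measure_unique mA => // _ [[p q] /= _ <-].
rewrite /m /mscale /= /pushforward.
case: (ltgtP 0 a) (a0) => // [a_gt0|a_lt0] _.
  have -> : aff a d @^-1` `]p, q] = `](p - d) / a, (q - d) / a]%classic.
    apply/seteqP; split => t /=; rewrite /aff !in_itv /= ltr_pdivrMr // ler_pdivlMr //;
    move=> /andP[h1 h2]; apply/andP; split; lra.
  rewrite !lebesgue_measure_itv /= !lte_fin ltr_pM2r ?invr_gt0 // ltrD2r.
  case: ifP => [pq|]; last by rewrite mule0.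
  rewrite -!EFinB -EFinM; congr (_%:E); rewrite gtr0_norm //; field; lra.
have -> : aff a d @^-1` `]p, q] = `[(q - d) / a, (p - d) / a[%classic.
  apply/seteqP; split => t /=; rewrite /aff !in_itv /= ltr_ndivlMr // ler_ndivrMr //;
  move=> /andP[h1 h2]; apply/andP; split; lra.
rewrite !lebesgue_measure_itv /= !lte_fin ltr_nM2r ?invr_lt0 // ltrD2r.
case: ifP => [pq|]; last by rewrite mule0.
rewrite -!EFinB -EFinM; congr (_%:E); rewrite ltr0_norm //; field; lra.
Qed.

Lemma integral_affine1 (a d : R) (F : R -> \bar R) : a != 0 ->
  measurable_fun setT F -> (forall t, (0 <= F t)%E) ->
  (\int[lb]_t F t = `|a|%:E * \int[lb]_t F (a * t + d)%R)%E.
Proof.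
move=> a0 mF F0.
have := @ge0_integral_pushforward _ _ _ _ R (aff a d) (maff a d) lb setT F measurableT mF _.
rewrite preimage_setT => <-; last by move=> t _; exact: F0.
pose m : {measure set (measurableTypeR R) -> \bar R} := pushforward lb (aff a d).
have /= := ge0_integral_mscale (m (maff a d)) measurableT (NngNum (normr_ge0 a)) mF (fun x _ => F0 x).
move=> e; apply: etrans e.
by apply: eq_measure_integral => A mA _; rewrite /mscale /= (lebesgue_affine d a0).
Qed.

Definition affine2 (a b c d p q : R) (x : Pl R) : Pl R :=
  (a * x.1 + b * x.2 + p, c * x.1 + d * x.2 + q).

Lemma measurable_affine2 a b c d p q : measurable_fun setT (affine2 a b c d p q).
Proof.
have h (k l r : R) : measurable_fun setT (fun x : Pl R => k * x.1 + l * x.2 + r).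
  apply: continuous_measurable2 => x.
  apply: cvgD; last exact: cvg_cst.
  by apply: cvgD; (apply: cvgM; first exact: cvg_cst); [exact: fst_continuous|exact: snd_continuous].
exact: (measurable_fun_pair (h a b p) (h c d q)).
Qed.

Let shear1 (F : Pl R -> \bar R) (a b p : R) : a != 0 ->
  measurable_fun setT F -> (forall t, (0 <= F t)%E) ->
  (\int[mu]_x F x = `|a|%:E * \int[mu]_x F (affine2 a b 0 1 p 0 x))%E.
Proof.
move=> a0 mF F0; rewrite /mu2 !fubini_tonelli2 //; last first.
  by apply: measurableT_comp => //; exact: measurable_affine2.
rewrite -ge0_integralZl //; last 2 first.
- apply: (@measurable_fun_fubini_tonelli_G _ _ _ _ R lb (F \o affine2 a b 0 1 p 0)) => //.
    by apply: measurableT_comp => //; exact: measurable_affine2.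
  by move=> y; exact: F0.
- by move=> y _; apply: integral_ge0 => x _; exact: F0.
apply: eq_integral => y _; rewrite /fubini_G.
rewrite (@integral_affine1 a (b * y + p) (fun x => F (x, y))) //; last first.
  exact: measurable_fun_pair1.
congr (_ * _)%E; apply: eq_integral => x _; congr F.
by rewrite /affine2 /= mul0r mul1r add0r addr0 addrA.
Qed.

Let swap_integral (F : Pl R -> \bar R) :
  measurable_fun setT F -> (forall t, (0 <= F t)%E) ->
  (\int[mu]_x F x = \int[mu]_x F (affine2 0 1 1 0 0 0 x))%E.
Proof.
move=> mF F0; have mFs : measurable_fun setT (F \o affine2 0 1 1 0 0 0).
  by apply: measurableT_comp => //; exact: measurable_affine2.
rewrite /mu2 fubini_tonelli1 //.
rewrite (fubini_tonelli2 (F \o affine2 0 1 1 0 0 0) mFs (fun x => F0 _)).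
apply: eq_integral => y _; apply: eq_integral => x _; congr F.
by rewrite /affine2 /= !mul0r !mul1r !add0r !addr0.
Qed.

Let shear2 (F : Pl R -> \bar R) (c d q : R) : d != 0 ->
  measurable_fun setT F -> (forall t, (0 <= F t)%E) ->
  (\int[mu]_x F x = `|d|%:E * \int[mu]_x F (affine2 1 0 c d 0 q x))%E.
Proof.
move=> d0 mF F0; have ms := measurable_affine2 0 1 1 0 0 0.
rewrite swap_integral // (shear1 c q d0) //; last exact: measurableT_comp.
congr (_ * _)%E; rewrite [RHS]swap_integral //; last first.
  by apply: measurableT_comp => //; exact: measurable_affine2.
apply: eq_integral => x _; congr F.
by rewrite /affine2 /= !mul0r !mul1r !add0r !addr0 (addrC (d * _)).
Qed.

(** Gaussian elimination: for a nonzero first entry the map is a horizontal shear followed by a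
    vertical one, with factors a and det/a, and each is a one-dimensional substitution by Tonelli.
    If a = 0 the coordinates are exchanged first, and b becomes the pivot. *)
Lemma integral_affine2 (a b c d p q : R) (F : Pl R -> \bar R) : a * d - b * c != 0 ->
  measurable_fun setT F -> (forall t, (0 <= F t)%E) ->
  (\int[mu]_x F x = `|(a * d - b * c)%R|%:E * \int[mu]_x F (affine2 a b c d p q x))%E.
Proof.
have key (a' b' c' d' p' q' : R) (G : Pl R -> \bar R) : a' != 0 -> a' * d' - b' * c' != 0 ->
  measurable_fun setT G -> (forall t, (0 <= G t)%E) ->
  (\int[mu]_x G x = `|(a' * d' - b' * c')%R|%:E * \int[mu]_x G (affine2 a' b' c' d' p' q' x))%E.
  move=> a0 D0 mG G0.
  have e0 : (a' * d' - b' * c') / a' != 0 by rewrite mulf_neq0 // invr_eq0.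
  rewrite (shear2 (c' / a') (q' - c' * p' / a') e0) //.
  rewrite (shear1 b' p' a0) //; last first.
    by apply: measurableT_comp => //; exact: measurable_affine2.
  rewrite muleA -EFinM -normrM divfK //; congr (_ * _)%E.
  apply: eq_integral => x _; congr G.
  by rewrite /affine2 /=; congr pair; field.
move=> D0 mF F0; case: (eqVneq a 0) => [a0|a0]; last exact: key.
have b0 : b != 0 by apply: contraNneq D0 => ->; rewrite a0 !mul0r subrr.
have e : a * d - b * c = - (b * c - 0 * d) by rewrite a0; ring.
rewrite e normrN (key b 0 d c p q) //; last by rewrite -oppr_eq0 -e.
congr (_ * _)%E; rewrite [LHS]swap_integral //; last first.
  by apply: measurableT_comp => //; exact: measurable_affine2.
apply: eq_integral => x _; congr F.
by rewrite /affine2 /= a0; congr pair; ring.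
Qed.

Lemma integral_affine2_in (a b c d p q : R) D (F : Pl R -> \bar R) : a * d - b * c != 0 ->
  measurable D -> measurable_fun D F -> (forall t, D t -> (0 <= F t)%E) ->
  (\int[mu]_(x in D) F x = `|(a * d - b * c)%R|%:E *
    \int[mu]_(x in affine2 a b c d p q @^-1` D) F (affine2 a b c d p q x))%E.
Proof.
move=> D0 mD mF F0; rewrite integral_mkcond (integral_affine2 p q D0); last 2 first.
- exact/(measurable_restrictT F mD).
- by move=> t; rewrite patchE; case: ifPn => // /set_mem; exact: F0.
congr (_ * _)%E; rewrite [RHS]integral_mkcond; apply: eq_integral => x _.
by rewrite !patchE; congr (if _ then _ else _); apply/idP/idP => /set_mem h; apply/mem_set.
Qed.

Lemma measurable_affine2_preimage (a b c d p q : R) D : measurable D ->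
  measurable (affine2 a b c d p q @^-1` D).
Proof. by move=> mD; rewrite -[X in measurable X]setTI; exact: measurable_affine2. Qed.

Lemma affine2_L1 (a b c d p q : R) u D : a * d - b * c != 0 -> measurable D -> L1 D u ->
  L1 (affine2 a b c d p q @^-1` D) (u \o affine2 a b c d p q).
Proof.
move=> D0 mD hu; have mu_ := L1_measurable hu.
have mA := measurable_affine2_preimage a b c d p q mD.
apply/integrableP; split.
  apply/(measurable_restrictT _ mA).
  rewrite (_ : _ \_ _ = ((EFin \o u) \_ D) \o affine2 a b c d p q).
    apply: measurableT_comp; last exact: measurable_affine2.
    by apply/(measurable_restrictT _ mD); exact/measurable_EFinP.
  apply/funext => x; rewrite /= !patchE.
  by congr (if _ then _ else _); apply/idP/idP => /set_mem h; apply/mem_set.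
case/integrableP : hu => mE.
rewrite (integral_affine2_in p q D0) //; last exact: measurableT_comp.
rewrite ltNge => h; rewrite ltNge; apply: contra h => /=.
rewrite leye_eq => /eqP ->.
by rewrite gt0_muley // lte_fin normr_gt0.
Qed.

Lemma Int_affine2 (a b c d p q : R) u D : a * d - b * c != 0 -> measurable D -> L1 D u ->
  Int D u = `|a * d - b * c| * Int (affine2 a b c d p q @^-1` D) (u \o affine2 a b c d p q).
Proof.
move=> D0 mD hu; have mE : measurable_fun D (EFin \o u).
  by apply/measurable_EFinP; exact: L1_measurable hu.
have hA := affine2_L1 p q D0 mD hu.
have mA := measurable_affine2_preimage a b c d p q mD.
apply: EFin_inj; rewrite EFinM -!Int_EFin // [LHS]integralE [in RHS]integralE.
rewrite (integral_affine2_in p q D0) //; last exact: measurable_funepos.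
rewrite [X in (_ - X)%E](integral_affine2_in p q D0) //; last exact: measurable_funeneg.
rewrite -muleBr //; last first.
  apply: fin_num_adde_defl; rewrite fin_numN.
  rewrite (_ : (\int[mu]_(x in _) _)%E = (\int[mu]_(x in affine2 a b c d p q @^-1` D)
      (EFin \o (u \o affine2 a b c d p q))^\- x)%E).
    exact: (integrable_neg_fin_num mA hA).
  by apply: eq_integral => x _; rewrite !funenegE.
by congr (_ * (_ - _))%E; apply: eq_integral => x _; rewrite ?funenegE ?funeposE.
Qed.

End ChangeOfVariables.

(** * The space L^2 *)

Section L2Theory.
Context {R : realType}.
Notation mu := (@mu2 R).
Notation lb := (@lebesgue_measure R).
Implicit Types (D A : set (Pl R)) (u v w : R * R -> R).

(** The common core of the Cauchy-Schwarz inequalities for [ip] and, later, for the Hessian product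
    [B]. *)
Lemma quadratic_ge0_discr (a b c : R) : (forall t, 0 <= a + 2 * t * b + t ^+ 2 * c) ->
  `|b| <= Num.sqrt a * Num.sqrt c.
Proof.
move=> h; have a0 : 0 <= a by have := h 0; rewrite mulr0 mul0r expr0n /= mul0r !addr0.
have c0 : 0 <= c.
  (* Chosen such that t >= 1 and t (-c) >= a + 1 + 2 |b|; the polynomial is then at most a - t (a +
     1) < 0. *)
  rewrite leNgt; apply/negP => c0; pose t : R := (a + 1) / - c + 2 * `|b| / - c + 1.
  have cN : 0 < - c by rewrite oppr_gt0.
  have x0 : 0 <= (a + 1) / - c by rewrite divr_ge0 // ?ltW // ltr_wpDl.
  have y0 : 0 <= 2 * `|b| / - c by rewrite divr_ge0 ?mulr_ge0 // ltW.
  have := h t; apply/negP; rewrite -ltNge.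
  have t1 : 1 <= t by rewrite /t; lra.
  have : t * (- c) >= a + 1 + 2 * `|b|.
    rewrite /t !mulrDl !divfK ?gt_eqF // mul1r; lra.
  have := ler_norm b; have : b <= `|b| by exact: ler_norm.
  have : t * b <= t * `|b| by rewrite ler_pM2l ?ler_norm //; lra.
  nra.
rewrite -sqrtrM // -sqrtr_sqr ler_wsqrtr //.
have [c_gt0|] := ltP 0 c; last first.
  move=> cle; have cE : c = 0 by apply/eqP; rewrite eq_le cle c0.
  rewrite cE mulr0; have := h (- (a + 1) * b); rewrite cE mulr0 addr0 => h1.
  have [b0|b0] := eqVneq b 0; first by rewrite b0 expr0n.
  have b2 : 0 < b ^+ 2 by rewrite exprn_even_gt0.
  (* For c = 0 the polynomial takes the value -1 at this point. *)
  have h2 := h (- (a + 1) / (2 * b)); rewrite cE mulr0 addr0 in h2.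
  have : 2 * (- (a + 1) / (2 * b)) * b = - (a + 1) by field.
  lra.
have := h (- b / c).
have -> : a + 2 * (- b / c) * b + (- b / c) ^+ 2 * c = (a * c - b ^+ 2) / c by field; rewrite gt_eqF.
by rewrite pmulr_lge0 ?invr_gt0 // subr_ge0.
Qed.

Lemma L2_L1sq D u : L2 D u -> L1 D (fun x => u x ^+ 2).
Proof. by case. Qed.

Lemma L2_measurable D u : L2 D u -> measurable_fun D u.
Proof. by case. Qed.

Lemma L2_mul D u v : measurable D -> L2 D u -> L2 D v -> L1 D (fun x => u x * v x).
Proof.
move=> mD [mu_ iu] [mv iv].
apply: (le_L1 (v := fun x => u x ^+ 2 + v x ^+ 2)) => //; last exact: L1D.
  exact: measurable_funM.
move=> x _; rewrite ler_norml; apply/andP; split; nra.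
Qed.

Lemma L2D D u v : measurable D -> L2 D u -> L2 D v -> L2 D (fun x => u x + v x).
Proof.
move=> mD hu hv; split; first exact: measurable_funD (L2_measurable hu) (L2_measurable hv).
apply: (eq_L1 (u := fun x => (u x ^+ 2 + v x ^+ 2) + 2 * (u x * v x))) => //.
  by move=> x _; ring.
by apply: L1D => //; [apply: L1D => //; exact: L2_L1sq|apply: L1Z => //; exact: L2_mul].
Qed.

Lemma L2Z D c u : measurable D -> L2 D u -> L2 D (fun x => c * u x).
Proof.
move=> mD [mu_ hu]; split; first by apply: measurable_funM.
apply: (eq_L1 (u := fun x => c ^+ 2 * u x ^+ 2)) => //; first by move=> x _; ring.
exact: L1Z.
Qed.

Lemma eq_L2 D u v : measurable D -> (forall x, D x -> u x = v x) -> L2 D u -> L2 D v.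
Proof.
move=> mD uv [mu_ hu]; split.
  by apply: eq_measurable_fun mu_ => x; rewrite inE => /uv.
by apply: eq_L1 hu => // x /uv ->.
Qed.

Lemma L2N D u : measurable D -> L2 D u -> L2 D (fun x => - u x).
Proof. by move=> mD /(L2Z (-1) mD); apply: eq_L2 => // x _; rewrite mulN1r. Qed.

Lemma L2B D u v : measurable D -> L2 D u -> L2 D v -> L2 D (fun x => u x - v x).
Proof. by move=> mD hu hv; apply: L2D => //; exact: L2N. Qed.

Lemma L20 D : measurable D -> L2 D (fun=> 0 : R).
Proof.
move=> mD; split => //; apply: (eq_L1 (u := fun=> 0)) => //; last exact: L10.
by move=> x _; rewrite expr0n.
Qed.

Lemma L2S D A u : measurable D -> measurable A -> A `<=` D -> L2 D u -> L2 A u.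
Proof.
by move=> mD mA AD [h1 h2]; split; [exact: measurable_funS h1|exact: L1S h2].
Qed.

Lemma L2_sum D (I : Type) (s : seq I) (P : pred I) (F : I -> R * R -> R) :
  measurable D -> (forall i, P i -> L2 D (F i)) -> L2 D (fun x => \sum_(i <- s | P i) F i x).
Proof.
move=> mD h; elim: s => [|i s IH].
  by apply: (eq_L2 mD _ (L20 mD)) => x _; rewrite big_nil.
case Pi : (P i).
  by apply: (eq_L2 mD _ (L2D mD (h i Pi) IH)) => x _; rewrite big_cons Pi.
by apply: (eq_L2 mD _ IH) => x _; rewrite big_cons Pi.
Qed.

Lemma L2_continuous D u : measurable D -> bounded_set (D : set (R * R)) ->
  continuous u -> L2 D u.
Proof.
move=> mD bD cu; split; first exact: continuous_measurable2.
apply: L1_continuous => // x; apply: (@cvgM _ _ _ _ u u); exact: cu.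
Qed.

Lemma ipE D u v : ip D u v = Int D (fun x => u x * v x). Proof. by []. Qed.

Lemma ipC D u v : ip D u v = ip D v u.
Proof. by rewrite !ipE; apply: eq_Int => x _; rewrite mulrC. Qed.

Lemma ipDl D u v w : measurable D -> L2 D u -> L2 D v -> L2 D w ->
  ip D (fun x => u x + v x) w = ip D u w + ip D v w.
Proof.
move=> mD hu hv hw; rewrite !ipE -IntD //; [|exact: L2_mul|exact: L2_mul].
by apply: eq_Int => x _; rewrite mulrDl.
Qed.

Lemma ipZl D c u w : measurable D -> L2 D u -> L2 D w ->
  ip D (fun x => c * u x) w = c * ip D u w.
Proof.
move=> mD hu hw; rewrite !ipE -IntZ //; last exact: L2_mul.
by apply: eq_Int => x _; rewrite mulrA.
Qed.

Lemma ipNl D u w : measurable D -> L2 D u -> L2 D w ->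
  ip D (fun x => - u x) w = - ip D u w.
Proof.
move=> mD hu hw; rewrite -mulN1r -ipZl //.
by rewrite !ipE; apply: eq_Int => x _; rewrite mulN1r.
Qed.

Lemma ipBl D u v w : measurable D -> L2 D u -> L2 D v -> L2 D w ->
  ip D (fun x => u x - v x) w = ip D u w - ip D v w.
Proof. by move=> mD hu hv hw; rewrite ipDl ?ipNl //; exact: L2N. Qed.

Lemma ipDr D u v w : measurable D -> L2 D u -> L2 D v -> L2 D w ->
  ip D w (fun x => u x + v x) = ip D w u + ip D w v.
Proof. by move=> mD hu hv hw; rewrite ipC ipDl // !(ipC _ w). Qed.

Lemma ipZr D c u w : measurable D -> L2 D u -> L2 D w ->
  ip D w (fun x => c * u x) = c * ip D w u.
Proof. by move=> mD hu hw; rewrite ipC ipZl // ipC. Qed.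

Lemma ipBr D u v w : measurable D -> L2 D u -> L2 D v -> L2 D w ->
  ip D w (fun x => u x - v x) = ip D w u - ip D w v.
Proof. by move=> mD hu hv hw; rewrite ipC ipBl // !(ipC _ w). Qed.

Lemma eq_ip D u u' v v' : (forall x, D x -> u x = u' x) -> (forall x, D x -> v x = v' x) ->
  ip D u v = ip D u' v'.
Proof. by move=> h1 h2; apply: eq_Int => x Dx; rewrite h1 // h2. Qed.

Lemma ip_ge0 D u : 0 <= ip D u u.
Proof. by apply: Int_ge0 => x _; rewrite -expr2 sqr_ge0. Qed.

Lemma L2norm_sq D u : L2norm D u ^+ 2 = ip D u u.
Proof. by rewrite sqr_sqrtr // ip_ge0. Qed.

Lemma L2norm_ge0 D u : 0 <= L2norm D u. Proof. exact: sqrtr_ge0. Qed.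

Lemma ip_norm_le D u v : measurable D -> L2 D u -> L2 D v ->
  `|ip D u v| <= L2norm D u * L2norm D v.
Proof.
move=> mD hu hv; apply: quadratic_ge0_discr => t.
have := ip_ge0 D (fun x => u x + t * v x).
have htv : L2 D (fun x => t * v x) by exact: L2Z.
have hs : L2 D (fun x => u x + t * v x) by exact: L2D.
rewrite ipDl // !ipDr // !ipZr // !ipZl // (ipC D v u) => h.
by apply: le_trans h _; rewrite le_eqVlt; apply/orP; left; apply/eqP; ring.
Qed.

Lemma L2normD D u v : measurable D -> L2 D u -> L2 D v ->
  L2norm D (fun x => u x + v x) <= L2norm D u + L2norm D v.
Proof.
move=> mD hu hv; rewrite -(ler_pXn2r (n := 2)) //; rewrite ?nnegrE ?addr_ge0 ?L2norm_ge0 //.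
have := le_trans (ler_norm _) (ip_norm_le mD hu hv).
have hs : L2 D (fun x => u x + v x) by exact: L2D.
rewrite L2norm_sq ipDl // !ipDr // sqrrD !L2norm_sq (ipC D v u); lra.
Qed.

Lemma Int_dominated D (U : nat -> R * R -> R) u g : measurable D ->
  (forall n, measurable_fun D (U n)) -> measurable_fun D u ->
  (forall x, D x -> (U n x) @[n --> \oo] --> u x) -> L1 D g ->
  (forall n x, D x -> `|U n x| <= g x) ->
  Int D (U n) @[n --> \oo] --> Int D u.
Proof.
move=> mD mU mu_ Uu Lg Ug.
have [i1 _ h] : [/\ mu.-integrable D (EFin \o u),
   [sequence (\int[mu]_(x in D) `|(U n x)%:E - (u x)%:E|)%E]_n @ \oo --> 0%E &
   [sequence (\int[mu]_(x in D) (U n x)%:E)%E]_n @ \oo --> (\int[mu]_(x in D) (u x)%:E)%E].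
  apply: (@dominated_convergence _ _ _ mu D mD (fun n x => (U n x)%:E)
    (fun x => (u x)%:E) (fun x => (g x)%:E)) => //.
  - by move=> n; exact/measurable_EFinP.
  - exact/measurable_EFinP.
  - by apply: aeW => x Dx; apply: cvg_EFin; [near=> n|exact: Uu].
  - by apply: aeW => x n Dx /=; rewrite lee_fin; exact: Ug.
by rewrite (Int_EFin mD i1) in h; exact: (fine_cvg h).
Unshelve. all: by end_near. Qed.

Lemma Int_sq_dominated D (U : nat -> R * R -> R) u g : measurable D ->
  (forall n, measurable_fun D (U n)) -> measurable_fun D u ->
  (forall x, D x -> (U n x) @[n --> \oo] --> u x) -> L1 D (fun x => g x ^+ 2) ->
  (forall n x, D x -> `|U n x| <= g x) ->
  ip D (fun x => u x - U n x) (fun x => u x - U n x) @[n --> \oo] --> (0 : R).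
Proof.
move=> mD mU mu_ Uu Lg Ug.
have ug x : D x -> `|u x| <= g x.
  move=> Dx; have h : `|U n x| @[n --> \oo] --> `|u x| by apply: cvg_norm; exact: Uu.
  rewrite -(cvg_lim _ h) //; apply: limr_le; first by apply/cvg_ex; eexists; exact: h.
  by near=> n; exact: Ug.
rewrite -(Int0 D).
apply: (Int_dominated (g := fun x => 4 * g x ^+ 2)) => //.
- by move=> n; apply: measurable_funM; apply: measurable_funB.
- move=> x Dx; rewrite -[X in _ --> X](mulr0 (0 : R)).
  have h : u x - U n x @[n --> \oo] --> (0 : R).
    by rewrite -(subrr (u x)); apply: cvgB; [exact: cvg_cst|exact: Uu].
  exact: (cvgM h h).
- exact: L1Z.
- move=> n x Dx; rewrite normrM -expr2.
  have h : `|u x - U n x| <= 2 * g x.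
    by rewrite (le_trans (ler_normB _ _))// mulr2n mulrDl mul1r lerD // ?ug // Ug.
  rewrite (_ : 4 * g x ^+ 2 = (2 * g x) ^+ 2); last by ring.
  by rewrite ler_pXn2r // nnegrE // (le_trans _ h).
Unshelve. all: by end_near. Qed.

End L2Theory.

(** * Test functions and smooth exhaustions of open sets *)

Section TestFunctions.
Context {R : realType}.
Notation mu := (@mu2 R).
Implicit Types (D A : set (R * R)) (u v w p q : R * R -> R).

Lemma test_cinf D p : test_function D p -> cinf p.
Proof. by move=> [/smooth_iff_cinf]. Qed.

Lemma test_cst0 D : test_function D (fun=> 0).
Proof.
split; first by apply/smooth_cinf; exact: cinf_cst.
by exists set0; split => //; exact: compact0.
Qed.

Lemma testD D p q : test_function D p -> test_function D q ->
  test_function D (fun x => p x + q x).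
Proof.
move=> [sp [K [cK KD hK]]] [sq [L [cL LD hL]]]; split.
  by apply/smooth_cinf; apply: cinfD; exact/smooth_iff_cinf.
exists (K `|` L); split; first exact: compactU.
  by move=> x [/KD|/LD].
by move=> x /not_orP[h1 h2]; rewrite hK // hL // addr0.
Qed.

Lemma testMr D p q : test_function D p -> cinf q -> test_function D (fun x => p x * q x).
Proof.
move=> [sp [K [cK KD hK]]] sq; split.
  by apply/smooth_cinf; apply: cinfM => //; exact/smooth_iff_cinf.
by exists K; split => // x /hK ->; rewrite mul0r.
Qed.

Lemma testZ D c p : test_function D p -> test_function D (fun x => c * p x).
Proof.
move=> tp; rewrite (_ : (fun x => _) = (fun x => p x * c)); last by apply/funext => x; rewrite mulrC.
by apply: testMr => //; exact: cinf_cst.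
Qed.

Lemma testN D p : test_function D p -> test_function D (fun x => - p x).
Proof.
move=> /(testZ (-1)); congr test_function; by apply/funext => x; rewrite mulN1r.
Qed.

Lemma testB D p q : test_function D p -> test_function D q ->
  test_function D (fun x => p x - q x).
Proof. by move=> tp tq; apply: testD => //; exact: testN. Qed.

Lemma test_derive D p (v : R * R) : test_function D p -> test_function D (fun x => 'D_v p x).
Proof.
move=> tp; have cp := test_cinf tp; case: tp => sp [K [cK KD hK]]; split.
  by apply/smooth_cinf; exact: cinf_derive.
exists K; split => // x Kx; have oK : open (~` K).
  by rewrite openC; apply: compact_closed => //; exact: norm_hausdorff.
by rewrite (@eq_open_derive _ (~` K) p (fun=> 0) x v oK) ?derive_cst.
Qed.

Lemma test_subset D A p : A `<=` D -> test_function A p -> test_function D p.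
Proof. by move=> AD [sp [K [cK KA hK]]]; split => //; exists K; split => // x /KA/AD. Qed.

Lemma test_zero_out D p : test_function D p -> exists2 r : R, 0 < r & zero_out r p.
Proof.
move=> [sp [K [cK _ hK]]]; apply: (bounded_support_zero_out (A := K)) => //.
exact: compact_bounded.
Qed.

Lemma test_notin D p x : test_function D p -> ~ D x -> p x = 0.
Proof. by move=> [sp [K [cK KD hK]]] nDx; apply: hK => /KD. Qed.

Lemma test_L1 D (A : set (Pl R)) p : measurable A -> test_function D p -> L1 A p.
Proof.
move=> mA tp; have [r r0 h] := test_zero_out tp.
by apply: (zero_out_L1 (r := r)) => //; apply: cinf_continuous; exact: test_cinf tp.
Qed.

Lemma test_L2 D (A : set (Pl R)) p : measurable A -> test_function D p -> L2 A p.
Proof.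
move=> mA tp; split.
  by apply: continuous_measurable2; apply: cinf_continuous; exact: test_cinf tp.
by apply: (@test_L1 D) => //; apply: testMr => //; exact: test_cinf tp.
Qed.

(** A smooth version of the indicator of a box: 0 outside the closed box, and 1 at every point that
    is at least 1/m away from its sides. *)
Definition bump (a b c d m : R) (x : R * R) : R :=
  (step (m * (x.1 - a)) * step (m * (b - x.1))) * (step (m * (x.2 - c)) * step (m * (d - x.2))).

Lemma cinf_bump a b c d m : cinf (bump a b c d m).
Proof.
have c1 (f : R * R -> R) : cinf f -> cinf (fun x => step (m * f x)).
  by move=> cf; apply: (cinf_comp cinf_step); exact: cinfZ.
apply: cinfM; apply: cinfM; apply: c1; apply: cinfB;
  by [exact: cinf_cst|exact: cinf_fst|exact: cinf_snd].
Qed.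

Lemma bump_ge0_le1 a b c d m x : 0 <= bump a b c d m x <= 1.
Proof.
have h (s t : R) : 0 <= s <= 1 -> 0 <= t <= 1 -> 0 <= s * t <= 1.
  by move=> /andP[? ?] /andP[? ?]; rewrite mulr_ge0 // mulr_ile1.
by apply: (h); apply: (h); exact: step_bound.
Qed.

Lemma bump_eq0 a b c d m x : 0 <= m -> ~ ((`[a, b] `*` `[c, d]) : set (R * R)) x ->
  bump a b c d m x = 0.
Proof.
move=> m0 h; rewrite /bump.
have z (t : R) : t <= 0 -> step (m * t) = 0.
  by move=> t0; apply: step_le0; rewrite mulr_ge0_le0.
have [h1|h1] := ltP x.1 a; first by rewrite z ?mul0r //; lra.
have [h2|h2] := ltP b x.1; first by rewrite (z (b - x.1)) ?mulr0 ?mul0r //; lra.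
have [h3|h3] := ltP x.2 c; first by rewrite (z (x.2 - c)) ?mul0r ?mulr0 //; lra.
have [h4|h4] := ltP d x.2; first by rewrite (z (d - x.2)) ?mulr0 //; lra.
by exfalso; apply: h; split; rewrite /= in_itv /= ?h1 ?h2 ?h3 ?h4.
Qed.

Lemma bump_eq1 a b c d x : box a b c d x -> exists M, forall m, M <= m -> bump a b c d m x = 1.
Proof.
move=> [/=]; rewrite !in_itv /= => /andP[h1 h2] /andP[h3 h4].
have inv (t m : R) : 0 < t -> t^-1 <= m -> step (m * t) = 1.
  by move=> t0 tm; apply: step_ge1; rewrite -ler_pdivrMr // mul1r.
exists (Num.max (Num.max (x.1 - a)^-1 (b - x.1)^-1) (Num.max (x.2 - c)^-1 (d - x.2)^-1)).
move=> m; rewrite !ge_max => /andP[/andP[? ?] /andP[? ?]].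
by rewrite /bump !inv ?mul1r //; rewrite subr_gt0.
Qed.

Let qbox (r : (rat * rat) * (rat * rat)) : set (R * R) :=
  `[ratr r.1.1, ratr r.1.2] `*` `[ratr r.2.1, ratr r.2.2].

Let qbump D (k n : nat) : R * R -> R :=
  if unpickle k is Some r then
    (if `[< qbox r `<=` D >] then bump (ratr r.1.1) (ratr r.1.2) (ratr r.2.1) (ratr r.2.2) n%:R
     else fun=> 0)
  else fun=> 0.

(** The recursion is 1 - (1 - e)(1 - q), a smooth union of the first m bumps on rational boxes whose
    closure is inside [D]. It stays in [0, 1] and is 1 as soon as one of the bumps is. *)
Fixpoint exhaust D (m n : nat) (x : R * R) : R :=
  if m is k.+1 then exhaust D k n x + qbump D k n x - exhaust D k n x * qbump D k n x else 0.

Let qbump_test D k n : test_function D (qbump D k n).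
Proof.
rewrite /qbump; case: (unpickle k) => [r|]; last exact: test_cst0.
case: asboolP => h; last exact: test_cst0.
split; first by apply/smooth_cinf; exact: cinf_bump.
exists (qbox r); split => //.
  by apply: compact_setX; exact: segment_compact.
by move=> x hx; apply: bump_eq0 hx.
Qed.

Let qbump_bound D k n x : 0 <= qbump D k n x <= 1.
Proof.
rewrite /qbump; case: (unpickle k) => [r|]; last by rewrite lexx ler01.
by case: asboolP => h; [exact: bump_ge0_le1|rewrite lexx ler01].
Qed.

Lemma exhaust_test D m n : test_function D (exhaust D m n).
Proof.
elim: m => [|k IH]; first exact: test_cst0.
apply: testB; first by apply: testD.
by apply: testMr => //; exact: test_cinf (qbump_test D k n).
Qed.

Lemma exhaust_bound D m n x : 0 <= exhaust D m n x <= 1.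
Proof.
elim: m => [|k /= /andP[h1 h2]]; first by rewrite /= lexx ler01.
have /andP[h3 h4] := qbump_bound D k n x; apply/andP; split; nra.
Qed.

Lemma exhaust_cvg D x : open D -> D x -> exists N, forall n, (N <= n)%N -> exhaust D n n x = 1.
Proof.
move=> oD Dx.
have [r [rx rD]] : exists r : (rat * rat) * (rat * rat),
   box (ratr r.1.1) (ratr r.1.2) (ratr r.2.1) (ratr r.2.2) x /\ qbox r `<=` D.
  have /nbhs_ballP[e /= e0 He] : nbhs x D by exact: open_nbhs_nbhs.
  have e20 : 0 < e / 2 by rewrite divr_gt0.
  have ob : open (ball x (e / 2)) by exact: ball_open.
  have [r [rx rD]] := open_nbhs_box ob (ballxx x e20).
  exists r; split => // y [/=]; rewrite !in_itv /= => /andP[y1 y2] /andP[y3 y4].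
  case: rx => /=; rewrite !in_itv /= => /andP[x1 x2] /andP[x3 x4].
  apply: He.
  have bb z : box (ratr r.1.1) (ratr r.1.2) (ratr r.2.1) (ratr r.2.2) z -> ball x (e / 2) z by exact: rD.
  pose z := 2^-1 *: (x + y).
  have [/=] : ball x (e / 2) z.
    apply: bb; split => /=; rewrite in_itv /= -[_ *: _]/(_ * _); apply/andP; split; lra.
  rewrite /ball /= -![_ *: _]/(_ * _) !ltr_norml => /andP[? ?] /andP[? ?].
  split; rewrite /ball /= ltr_norml; apply/andP; split; lra.
have [M HM] := bump_eq1 rx.
have [N HN] : exists N : nat, M <= N%:R.
  by exists (Num.truncn `|M|).+1; rewrite (le_trans (ler_norm _))// ltW // truncnS_gt.
exists (maxn (pickle r).+1 N) => n; rewrite geq_max => /andP[n1 n2].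
have q1 : qbump D (pickle r) n x = 1.
  rewrite /qbump pickleK; case: asboolP => // _; apply: HM.
  by rewrite (le_trans HN)// ler_nat.
move: (pickle r) q1 n1 => k q1 n1.
have : forall m, (k.+1 <= m)%N -> exhaust D m n x = 1.
  elim=> // m IH; rewrite ltnS leq_eqVlt => /predU1P[<-|/IH] /=.
    by rewrite q1; ring.
  by move=> ->; ring.
exact.
Qed.

End TestFunctions.

(** * Density of the test functions in L^2 *)

Section Density.
Context {R : realType}.
Notation mu := (@mu2 R).
Variable D : set (R * R).
Hypotheses (oD : open D) (bD : bounded_set D).
Implicit Types (A : set (Pl R)) (u v w p q : R * R -> R).

Let mD : measurable (D : set (Pl R)). Proof. exact: open_measurable2. Qed.

Definition test_approx u := L2 D u /\
  forall e : R, 0 < e -> exists2 q, test_function D q & L2norm D (fun x => u x - q x) < e.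

Let approx_lim (U : nat -> R * R -> R) u : L2 D u -> (forall n, test_approx (U n)) ->
  ip D (fun x => u x - U n x) (fun x => u x - U n x) @[n --> \oo] --> (0 : R) ->
  test_approx u.
Proof.
move=> hu hU hl; split => // e e0.
have e2 : 0 < (e / 2) ^+ 2 by rewrite exprn_gt0 // divr_gt0.
have : \forall n \near \oo, ip D (fun x => u x - U n x) (fun x => u x - U n x) < (e / 2) ^+ 2.
  by apply: (cvgr_lt (0 : R)).
move=> /(@filter_ex _ _ _)[n hn].
have [L2U /(_ (e / 2))[|q tq hq]] := hU n; first by rewrite divr_gt0.
exists q => //.
have Lq : L2 D q by exact: (@test_L2 _ D).
have -> : (fun x => u x - q x) = (fun x => (u x - U n x) + (U n x - q x)).
  by apply/funext => x; ring.
apply: (le_lt_trans (L2normD mD (L2B mD hu L2U) (L2B mD L2U Lq))).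
have : L2norm D (fun x => u x - U n x) < e / 2.
  rewrite -(ltr_pXn2r (n := 2)) ?nnegrE ?L2norm_ge0 //; last by rewrite ltW // divr_gt0.
  by rewrite L2norm_sq.
lra.
Qed.

Let approx_test q : test_function D q -> test_approx q.
Proof.
move=> tq; split; first exact: (@test_L2 _ D).
move=> e e0; exists q => //; rewrite /L2norm ipE (eq_Int (v := fun=> 0)).
  by rewrite Int0 sqrtr0.
by move=> x _; rewrite subrr mulr0.
Qed.

Let approxD u v : test_approx u -> test_approx v -> test_approx (fun x => u x + v x).
Proof.
move=> [hu Hu] [hv Hv]; split; first exact: L2D.
move=> e e0; have e20 : 0 < e / 2 by rewrite divr_gt0.
have [p tp hp] := Hu _ e20; have [q tq hq] := Hv _ e20.
exists (fun x => p x + q x); first exact: testD.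
have Lp : L2 D p by exact: (@test_L2 _ D).
have Lq : L2 D q by exact: (@test_L2 _ D).
have -> : (fun x => u x + v x - (p x + q x)) = (fun x => (u x - p x) + (v x - q x)).
  by apply/funext => x; ring.
apply: (le_lt_trans (L2normD mD (L2B mD hu Lp) (L2B mD hv Lq))); lra.
Qed.

Let L2normZ c u : L2 D u -> L2norm D (fun x => c * u x) = `|c| * L2norm D u.
Proof.
move=> hu; rewrite /L2norm ipZl // ?ipZr //; last exact: L2Z.
by rewrite mulrA -expr2 sqrtrM ?sqr_ge0 // sqrtr_sqr.
Qed.

Let approxZ c u : test_approx u -> test_approx (fun x => c * u x).
Proof.
move=> [hu Hu]; split; first exact: L2Z.
move=> e e0; have c0 : 0 < `|c| + 1 by rewrite ltr_wpDl.
have [p tp hp] := Hu _ (divr_gt0 e0 c0).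
exists (fun x => c * p x); first exact: testZ.
have Lp : L2 D p by exact: (@test_L2 _ D).
have -> : (fun x => c * u x - c * p x) = (fun x => c * (u x - p x)).
  by apply/funext => x; ring.
rewrite L2normZ; last exact: L2B.
apply: (@le_lt_trans _ _ ((`|c| + 1) * L2norm D (fun x => u x - p x))).
  by rewrite ler_wpM2r ?L2norm_ge0 // lerDl.
by rewrite mulrC -ltr_pdivlMr.
Qed.

Let eq_approx u v : (forall x, D x -> u x = v x) -> test_approx u -> test_approx v.
Proof.
move=> uv [hu Hu]; split; first exact: eq_L2 hu.
move=> e e0; have [p tp hp] := Hu _ e0; exists p => //.
by rewrite /L2norm (eq_ip (u' := fun x => u x - p x) (v' := fun x => u x - p x)) // => x Dx; rewrite uv.
Qed.

Let L1_1 (c : R) : L1 D (fun=> c).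
Proof. by apply: L1_cst => //; exact: mu2_bounded_lty. Qed.

Let approx_open (U : set (R * R)) : open U -> test_approx \1_U.
Proof.
move=> oU; have oUD : open (U `&` D) by exact: openI.
have mU : measurable (U : set (Pl R)) by exact: open_measurable2.
have mind : measurable_fun (D : set (Pl R)) (\1_U : R * R -> R).
  exact: (@measurable_indic _ (Pl R)).
apply: (@approx_lim (fun n => exhaust (U `&` D) n n)).
- split => //; apply: (L1_bounded (M := 1)) => //.
  + exact: mu2_bounded_lty.
  + by apply: measurable_funM.
  + by move=> x _; rewrite indicE; case: (x \in U); rewrite ?expr0n ?expr1n ?normr0 ?normr1.
- move=> n; apply: approx_test; apply: (@test_subset _ _ (U `&` D)); first by move=> x [].
  exact: exhaust_test.
- apply: (Int_sq_dominated (g := fun=> 1)) => //.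
  + move=> n; apply: continuous_measurable2; apply: cinf_continuous.
    exact: test_cinf (exhaust_test _ _ _).
  + move=> x Dx; rewrite indicE; case: (boolP (x \in U)) => [/set_mem Ux|xU] /=.
      have [N HN] := exhaust_cvg oUD (conj Ux Dx).
      by apply: (@cvg_near_cst _ R); exists N => // n /= /HN.
    apply: (@cvg_near_cst _ R); near=> n; apply: (test_notin (exhaust_test (U `&` D) n n)).
    by move=> [Ux _]; move/negP: xU; apply; exact/mem_set.
  + by move=> n x _; have /andP[h1 h2] := exhaust_bound (U `&` D) n n x; rewrite ger0_norm.
Unshelve. all: by end_near. Qed.

(** Replaces rectangles by open sets as generator; these are stable under intersection and their
    indicators are limits of [exhaust], as the induction over measurable sets requires. *)
Lemma measurable_plane_open : @measurable _ (Pl R) = <<s (open : set (set (R * R))) >>.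
Proof.
apply/seteqP; split; last first.
  apply: smallest_sub; first exact: sigma_algebra_measurable.
  by move=> U oU; exact: open_measurable2.
rewrite measurable_prod_measurableType; apply: smallest_sub; first exact: smallest_sigma_algebra.
have pre (f : R * R -> R) : continuous f -> forall A : set (measurableTypeR R), measurable A ->
    <<s (open : set (set (R * R))) >> (f @^-1` A).
  move=> cf A; rewrite (_ : measurable A = <<s @RGenOpens.G R >> A); last first.
    by rewrite -[RHS](congr1 (fun P => P A) (RGenOpens.measurableE R)).
  move: A; apply: smallest_sub.
    split.
    - rewrite /= preimage_set0.
      by have [h _ _] := smallest_sigma_algebra setT (open : set (set (R * R))); exact: h.
    - move=> A /= hA; rewrite (_ : f @^-1` (setT `\` A) = setT `\` f @^-1` A) //.
      by have [_ h _] := smallest_sigma_algebra setT (open : set (set (R * R))); exact: h.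
    - move=> F /= hF; rewrite preimage_bigcup.
      by have [_ _ h] := smallest_sigma_algebra setT (open : set (set (R * R))); exact: h.
  move=> _ [a [b ->]]; apply: sub_sigma_algebra.
  by move/continuousP : cf; apply; exact: interval_open.
move=> _ [A mA [B mB <-]].
rewrite (_ : A `*` B = (fst : R * R -> R) @^-1` A `&` (snd : R * R -> R) @^-1` B) //.
have := pre _ fst_continuous _ mA; have := pre _ snd_continuous _ mB.
move: (_ @^-1` B) (_ @^-1` A) => X Y hX hY.
have := @measurableI _ (g_sigma_algebraType (open : set (set (R * R)))) Y X; exact.
Qed.

(** Approximable indicators are stable under complements and disjoint countable unions and include
    those of open sets, so the pi-lambda theorem applies. *)
Let approx_indic A : measurable A -> test_approx \1_A.
Proof.
rewrite {1}measurable_plane_open; move: A.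
apply: (@dynkin_induction _ (Pl R) (open : set (set (R * R)))
  (fun A : set (Pl R) => test_approx (\1_A : R * R -> R))).
- exact: measurable_plane_open.
- by move=> U V oU oV; exact: openI.
- apply: approx_open; exact: openT.
- by move=> U oU; exact: approx_open.
- move=> S mS hS; apply: (@eq_approx (fun x => 1 + -1 * \1_S x)).
    move=> x _; rewrite !indicE in_setC; case: (x \in S) => /=; ring.
  apply: approxD; last exact: approxZ.
  apply: (@eq_approx \1_setT); first by move=> x _; rewrite indicE in_setT.
  by apply: approx_open; exact: openT.
- move=> F mF tF hF.
  pose U n (x : R * R) : R := \sum_(i < n) \1_(F i) x.
  have UE n x : U n x = \1_(\bigcup_(i in `I_n) F i) x.
    rewrite /U; elim: n => [|n IH].
      by rewrite big_ord0 II0 bigcup_set0 indicE in_set0.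
    rewrite big_ord_recr IH /= IIS bigcup_setU bigcup_set1 !indicE in_setU.
    case: (boolP (x \in F n)) => [/set_mem xn|_]; last by rewrite orbF addr0.
    case: (boolP (x \in _)) => [/set_mem[m /= mn Fm]|_]; last by rewrite add0r.
    have := tF m n I I (ex_intro _ x (conj Fm xn)) => mn'; by rewrite mn' ltnn in mn.
  have mUF : measurable (\bigcup_k F k) by exact: bigcup_measurable.
  have Ubound n x : `|U n x| <= 1.
    by rewrite UE indicE; case: (_ \in _); rewrite ?normr0 ?normr1.
  have aU n : test_approx (U n).
    rewrite /U; elim: n => [|n IH].
      apply: (@eq_approx (fun x => 0)); first by move=> x _; rewrite big_ord0.
      exact: approx_test (test_cst0 _).
    apply: (@eq_approx (fun x => \sum_(i < n) \1_(F i) x + \1_(F n) x)).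
      by move=> x _; rewrite big_ord_recr.
    exact: approxD.
  apply: (@approx_lim U) => //.
    split; first exact: (@measurable_indic _ (Pl R)).
    apply: (L1_bounded (M := 1)) => //.
    + exact: mu2_bounded_lty.
    + by apply: measurable_funM; exact: (@measurable_indic _ (Pl R)).
    + by move=> x _; rewrite indicE; case: (x \in _); rewrite ?expr0n ?expr1n ?normr0 ?normr1.
  apply: (Int_sq_dominated (g := fun=> 1)) => //.
  + by move=> n; have [/L2_measurable] := aU n.
  + move=> x Dx; rewrite indicE; case: (boolP (x \in _)) => [/set_mem[k _ Fk]|xU] /=.
      apply: (@cvg_near_cst _ R); exists k.+1 => // n /= kn; rewrite UE indicE mem_set //.
      by exists k.
    apply: (@cvg_near_cst _ R); near=> n; rewrite UE indicE memNset // => -[k _ Fk].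
    by move/negP: xU; apply; apply/mem_set; exists k.
Unshelve. all: by end_near. Qed.

Import HBNNSimple.

Let approx_nnsfun (f : {nnsfun Pl R >-> R}) : test_approx f.
Proof.
apply: (@eq_approx (fun x => \sum_(y \in range f) y * \1_(f @^-1` [set y]) x)).
  by move=> x _; rewrite -fimfunE.
have fr : finite_set (range f) by exact: fimfunP.
have key (s : seq R) : test_approx (fun x => \sum_(y <- s) y * \1_(f @^-1` [set y]) x).
  elim: s => [|y s IH].
    apply: (@eq_approx (fun x => 0)); first by move=> x _; rewrite big_nil.
    exact: approx_test (test_cst0 _).
  apply: (@eq_approx (fun x => y * \1_(f @^-1` [set y]) x + \sum_(y <- s) y * \1_(f @^-1` [set y]) x)).
    by move=> x _; rewrite big_cons.
  by apply: approxD => //; apply: approxZ; exact: approx_indic.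
by apply: eq_approx (key (finmap.enum_fset (fset_set (range f)))) => x _; rewrite fsbig_finite.
Qed.

Let approx_ge0 w : L2 D w -> (forall x, 0 <= w x) -> test_approx w.
Proof.
move=> hw w0; have mw : measurable_fun (D : set (Pl R)) (EFin \o (w : Pl R -> R)).
  by apply/measurable_EFinP; exact: L2_measurable.
pose f : {nnsfun Pl R >-> R}^nat := nnsfun_approx mD mw.
have w0' t : D t -> (0 <= (EFin \o w) t)%E by rewrite lee_fin.
have fw n x : D x -> 0 <= f n x <= w x.
  move=> Dx; rewrite /f nnsfun_approxE; apply/andP; split.
    by rewrite -(nnsfun_approxE mD mw).
  by rewrite -lee_fin; exact: le_approx.
apply: (@approx_lim (fun n => f n)) => //.
apply: (Int_sq_dominated (g := w)) => //.
- by move=> n; apply: measurable_funTS.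
- exact: L2_measurable.
- move=> x Dx; have := cvg_nnsfun_approx mD mw w0' Dx.
  by move=> /fine_cvg.
- exact: L2_L1sq.
- by move=> n x /(fw n)/andP[h1 h2]; rewrite ger0_norm.
Qed.

Lemma test_dense w : L2 D w ->
  forall e : R, 0 < e -> exists2 q, test_function D q & L2norm D (fun x => w x - q x) < e.
Proof.
move=> hw; suff : test_approx w by case.
have habs : L2 D (fun x => `|w x|).
  split; first by apply: measurableT_comp => //; exact: L2_measurable.
  by apply: eq_L1 (L2_L1sq hw) => // x _; rewrite real_normK // num_real.
have h c : L2 D (fun x => 2^-1 * (`|w x| + c * w x)).
  by apply: L2Z => //; apply: L2D => //; exact: L2Z.
(* Positive part minus negative part, written with the absolute value. *)
apply: (@eq_approx (fun x => 2^-1 * (`|w x| + 1 * w x) + -1 * (2^-1 * (`|w x| + -1 * w x)))).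
  by move=> x _; field.
apply: approxD; [|apply: approxZ]; apply: approx_ge0 => // x; rewrite mulr_ge0 ?invr_ge0 //.
  by rewrite mul1r -lerBlDl sub0r lerNnormlW.
by rewrite mulN1r subr_ge0 ler_norm.
Qed.

(** By density the norm is already attained as a supremum over test functions. This duality turns
    information on weak derivatives, which speak of test functions only, into norm bounds. *)
Lemma test_ip_bound w (M : R) : L2 D w -> 0 <= M ->
  (forall q, test_function D q -> `|ip D w q| <= M * L2norm D q) -> L2norm D w <= M.
Proof.
move=> hw M0 H; apply/ler_addgt0Pr => e e0.
set N := L2norm D w; have N0 : 0 <= N by exact: L2norm_ge0.
have [->|Nn0] := eqVneq N 0; first by lra.
have Np : 0 < N by rewrite lt_neqAle eq_sym Nn0.
(* The error terms add up to eta (N + M), which this choice keeps below e N / 2. *)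
pose d : R := Num.min N (e * N / (2 * N + 2 * M)).
have den : 0 < 2 * N + 2 * M by lra.
have d0 : 0 < d by rewrite lt_min Np divr_gt0 // mulr_gt0.
have [q tq hq] := test_dense hw d0.
have Lq : L2 D q by exact: (@test_L2 _ D).
have Lwq : L2 D (fun x => w x - q x) by exact: L2B.
have e1 : ip D w w = ip D w q + ip D w (fun x => w x - q x).
  by rewrite -ipDr //; apply: eq_ip => // x _; ring.
have e2 : L2norm D q <= N + L2norm D (fun x => w x - q x).
  rewrite -(_ : L2norm D (fun x => q x - w x) = L2norm D (fun x => w x - q x)); last first.
    by rewrite /L2norm; congr Num.sqrt; apply: eq_Int => x _; ring.
  rewrite {1}(_ : q = fun x => w x + (q x - w x)); last by apply/funext => x; ring.
  by apply: L2normD => //; exact: L2B.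
have e3 := le_trans (ler_norm _) (H _ tq).
have e4 := le_trans (ler_norm _) (ip_norm_le mD hw Lwq).
move: hq; rewrite lt_min => /andP[h1 h2].
set eta := L2norm D (fun x => w x - q x) in e2 e4 h1 h2.
have eta0 : 0 <= eta by exact: L2norm_ge0.
have h3 : eta * (2 * N + 2 * M) <= e * N by rewrite -ler_pdivlMr // ltW.
have NN : N ^+ 2 = ip D w w by exact: L2norm_sq.
rewrite -(ler_pM2l Np) -expr2 NN e1.
have : M * L2norm D q <= M * (N + eta) by rewrite ler_wpM2l.
rewrite -/N in e4; nra.
Qed.

Lemma test_orth_ae0 w : L2 D w -> (forall q, test_function D q -> ip D w q = 0) ->
  {ae mu, forall x, D x -> w x = 0}.
Proof.
move=> hw H; have : L2norm D w <= 0.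
  by apply: test_ip_bound => // q /H ->; rewrite normr0 mul0r.
rewrite -[X in _ <= X -> _]sqrtr0 ler_sqrt // => ww.
have i0 : ip D w w = 0 by apply/eqP; rewrite eq_le ww ip_ge0.
have L : L1 D (fun x => w x * w x) by exact: L2_mul.
have : (\int[mu]_(x in D) `|(w x * w x)%:E| = 0)%E.
  rewrite -[RHS](congr1 EFin i0) ipE -Int_EFin //; apply: eq_integral => x _.
  by rewrite gee0_abs // lee_fin -expr2 sqr_ge0.
move/ae_eq_integral_abs => /(_ mD ((measurable_EFinP _ _).2 (L1_measurable L))).
apply: filterS => x /= h Dx; apply/eqP.
have e : (w x * w x)%:E = 0%E := h Dx.
by have := EFin_inj e; move/eqP; rewrite mulf_eq0 orbb.
Qed.

End Density.

(** * Weak derivatives *)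

Section WeakDerivatives.
Context {R : realType}.
Notation mu := (@mu2 R).
Implicit Types (D A : set (R * R)) (u v w p q g : R * R -> R) (a : nat * nat).

Lemma ae_imp (P Q : R * R -> Prop) : (forall x, P x -> Q x) ->
  {ae mu, forall x, P x} -> {ae mu, forall x, Q x}.
Proof. by move=> h [N [mN N0 sN]]; exists N; split => // x nQ; apply: sN => /= /h. Qed.

Lemma ae_and (P Q : R * R -> Prop) :
  {ae mu, forall x, P x} -> {ae mu, forall x, Q x} -> {ae mu, forall x, P x /\ Q x}.
Proof.
move=> [A [mA A0 sA]] [B [mB B0 sB]]; exists (A `|` B); split.
- exact: measurableU.
- exact: null_set_setU.
- by move=> x /= /not_andP[h|h]; [left; exact: sA|right; exact: sB].
Qed.

Lemma cinf_pd i u : cinf u -> cinf (pd i u).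
Proof. exact: cinf_derive. Qed.

Lemma cinf_iter_pd i n u : cinf u -> cinf (iter n (pd i) u).
Proof. by move=> cu; elim: n => //= n IH; exact: cinf_pd. Qed.

Lemma cinf_Dclassical a u : cinf u -> cinf (Dclassical a u).
Proof. by move=> cu; apply: cinf_iter_pd; exact: cinf_iter_pd. Qed.

Lemma ord2P (i : 'I_2) : i = 0 \/ i = 1.
Proof. by case: i => -[|[|//]] h; [left|right]; exact/val_inj. Qed.

(** The invariant [P] is smoothness: the two partial derivatives commute on smooth functions
    only. *)
Lemma iter_commute (T : Type) (P : T -> Prop) (f g : T -> T) :
  (forall x, P x -> P (f x)) -> (forall x, P x -> P (g x)) ->
  (forall x, P x -> f (g x) = g (f x)) ->
  forall n m x, P x -> iter n f (iter m g x) = iter m g (iter n f x).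
Proof.
move=> Pf Pg fg n m.
have Pi k h x : (forall x, P x -> P (h x)) -> P x -> P (iter k h x).
  by move=> Ph Px; elim: k => //= k /Ph.
have one k x : P x -> f (iter k g x) = iter k g (f x).
  by move=> Px; elim: k => //= k <-; rewrite fg //; exact: Pi.
elim: n => //= n IH x Px; rewrite IH // one //; exact: Pi.
Qed.

Lemma iter_iter_commute (T : Type) (P : T -> Prop) (f g : T -> T) :
  (forall x, P x -> P (f x)) -> (forall x, P x -> P (g x)) ->
  (forall x, P x -> f (g x) = g (f x)) ->
  forall (a1 a2 b1 b2 : nat) x, P x ->
    iter a1 f (iter a2 g (iter b1 f (iter b2 g x))) = iter (a1 + b1) f (iter (a2 + b2) g x).
Proof.
move=> Pf Pg fg a1 a2 b1 b2 x Px.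
have Pgx : P (iter b2 g x) by elim: b2 => //= k /Pg.
by rewrite -(iter_commute Pf Pg fg) // !iterD.
Qed.

Lemma Dclassical_Dclassical a b u : cinf u ->
  Dclassical a (Dclassical b u) = Dclassical (a.1 + b.1, a.2 + b.2)%N u.
Proof.
exact: (iter_iter_commute (P := @cinf R _) (f := pd 0) (g := pd 1) (@cinf_pd 0) (@cinf_pd 1) (@pd_comm R)).
Qed.

Lemma pd_test i D p : test_function D p -> test_function D (pd i p).
Proof. exact: test_derive. Qed.

Lemma Dclassical_test a D p : test_function D p -> test_function D (Dclassical a p).
Proof.
move=> tp; rewrite /Dclassical; elim: a.1 => /= [|n IH]; last exact: pd_test.
by elim: a.2 => //= n IH; exact: pd_test.
Qed.

Lemma Int_setT_of_zero (A : set (Pl R)) u : (forall x, ~ A x -> u x = 0) -> Int A u = Int setT u.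
Proof.
move=> h; rewrite Int_mkcond; apply: eq_Int => x _; rewrite patchE.
by case: ifPn => // /negP xA; rewrite h // => /mem_set.
Qed.

(** The derivative of p u, which has compact support, integrates to 0 over the plane. *)
Lemma ibp D u p i : cinf u -> test_function D p ->
  ip D u (pd i p) = - ip D (pd i u) p.
Proof.
move=> cu tp; have cp := test_cinf tp.
have tup : test_function D (fun x => p x * u x) by exact: testMr.
have t1 : test_function D (fun x => pd i p x * u x) by apply: testMr => //; exact: pd_test.
have t2 : test_function D (fun x => p x * pd i u x) by apply: testMr => //; exact: cinf_pd.
rewrite !ipE (Int_setT_of_zero (A := D)); last first.
  by move=> x nDx; rewrite (test_notin (pd_test i tp)) ?mulr0.
rewrite [in RHS](Int_setT_of_zero (A := D)); last first.
  by move=> x nDx; rewrite (test_notin tp) ?mulr0.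
have [r r0 zr] := test_zero_out tup.
have := Int_pd0 i r0 (test_cinf tup) zr.
have -> : pd i (fun x => p x * u x) = (fun x => p x * pd i u x + pd i p x * u x).
  apply/funext => x; have := congr1 (fun f => f x) (derive_mulE (e_ i) (fun x => cinf_diff x cp) (fun x => cinf_diff x cu)).
  by rewrite /= -!pdE [u x * _]mulrC.
rewrite IntD //; [|exact: (test_L1 _ t2)|exact: (test_L1 _ t1)].
have -> : Int setT (fun x => p x * pd i u x) = Int setT (fun x => pd i u x * p x).
  by apply: eq_Int => x _; rewrite mulrC.
have -> : Int setT (fun x => pd i p x * u x) = Int setT (fun x => u x * pd i p x).
  by apply: eq_Int => x _; rewrite mulrC.
by move=> /eqP; rewrite addrC addr_eq0 => /eqP.
Qed.

Lemma weak_derivative_classical D a u : cinf u -> weak_derivative D a u (Dclassical a u).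
Proof.
move=> cu p tp.
have iterP i n w q : cinf w -> test_function D q ->
    ip D w (iter n (pd i) q) = (-1) ^+ n * ip D (iter n (pd i) w) q.
  elim: n w q => [|n IH] w q cw tq; first by rewrite expr0 mul1r.
  have tn : test_function D (iter n (pd i) q) by elim: n {IH} => //= n IH; exact: pd_test.
  have E := ibp i cw tn; apply: etrans E _.
  by rewrite (IH (pd i w) q (cinf_pd i cw) tq) exprS mulN1r mulNr -iterSr.
have tp2 n : test_function D (iter n (pd 1) p) by elim: n => //= n; exact: pd_test.
have E1 := iterP 0 a.1 u (iter a.2 (pd 1) p) cu (tp2 a.2).
have E2 := iterP 1 a.2 (iter a.1 (pd 0) u) p (cinf_iter_pd 0 a.1 cu) tp.
rewrite /Dclassical; apply: (etrans E1).
apply: (etrans (congr1 (fun t => (-1) ^+ a.1 * t) E2)).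
have E3 := iter_commute (P := @cinf R _) (f := pd 1) (g := pd 0) (@cinf_pd 1) (@cinf_pd 0)
  (fun x cx => esym (pd_comm cx)) a.2 a.1 cu.
apply: (etrans (congr1 (fun w => (-1) ^+ a.1 * ((-1) ^+ a.2 * ip D w p)) E3)).
move: (ip D _ p) => t.
by rewrite mulrA -exprD.
Qed.

Lemma eq_weak_derivative D a u v g : (forall x, D x -> u x = v x) ->
  weak_derivative D a u g -> weak_derivative D a v g.
Proof.
move=> uv h p tp; rewrite -h //; apply: eq_ip => // x Dx; by rewrite uv.
Qed.

Lemma ip_test_subset D A u p : A `<=` D -> test_function A p -> ip A u p = ip D u p.
Proof.
move=> AD tp; rewrite !ipE (Int_setT_of_zero (A := A)); last first.
  by move=> x nDx; rewrite (test_notin tp) ?mulr0.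
rewrite (Int_setT_of_zero (A := D)) // => x nDx.
by rewrite (test_notin tp) ?mulr0 // => /AD.
Qed.

Lemma weak_derivative_subset D A a u g : A `<=` D ->
  weak_derivative D a u g -> weak_derivative A a u g.
Proof.
move=> AD h p tp.
rewrite !(ip_test_subset _ AD) //; last exact: Dclassical_test.
by apply: h; exact: test_subset tp.
Qed.

Lemma weak_derivativeB D a u v g k : measurable (D : set (Pl R)) ->
  L2 D u -> L2 D v -> L2 D g -> L2 D k ->
  weak_derivative D a u g -> weak_derivative D a v k ->
  weak_derivative D a (fun x => u x - v x) (fun x => g x - k x).
Proof.
move=> mD hu hv hg hk h1 h2 p tp.
have Lp : L2 D p by exact: test_L2 tp.
have Lq : L2 D (Dclassical a p) by apply: (@test_L2 _ D) => //; exact: Dclassical_test.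
by rewrite !ipBl // h1 // h2 // mulrBr.
Qed.

(** The difference is orthogonal to all test functions, which are dense. *)
Lemma weak_derivative_uniq D a u g k : open D -> bounded_set D -> L2 D g -> L2 D k ->
  weak_derivative D a u g -> weak_derivative D a u k ->
  {ae mu, forall x, D x -> g x = k x}.
Proof.
move=> oD bD hg hk h1 h2; have mD : measurable (D : set (Pl R)) by exact: open_measurable2.
have := test_orth_ae0 oD bD (L2B mD hg hk).
have h q : test_function D q -> ip D (fun x => g x - k x) q = 0.
  move=> tq; have Lq : L2 D q by exact: test_L2 tq.
  rewrite ipBl //; apply/eqP; rewrite subr_eq0; apply/eqP.
  by have := h1 q tq; rewrite h2 // => /mulfI ->//; rewrite signr_eq0.
by move=> /(_ h); apply: ae_imp => x /= hx /hx /eqP; rewrite subr_eq0 => /eqP.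
Qed.

Lemma wDP D a u : (exists g, L2 D g /\ weak_derivative D a u g) ->
  L2 D (wD D a u) /\ weak_derivative D a u (wD D a u).
Proof. by move=> h; have := xgetPex (cst 0) h. Qed.

Lemma wD_ae D a u g : open D -> bounded_set D -> L2 D g -> weak_derivative D a u g ->
  {ae mu, forall x, D x -> wD D a u x = g x}.
Proof.
move=> oD bD hg hw; have [h1 h2] := wDP (ex_intro _ g (conj hg hw)).
exact: weak_derivative_uniq h2 hw.
Qed.

Lemma ip_ae_eq D u u' v v' : measurable (D : set (Pl R)) ->
  L2 D u -> L2 D u' -> L2 D v -> L2 D v' ->
  {ae mu, forall x, D x -> u x = u' x} -> {ae mu, forall x, D x -> v x = v' x} ->
  ip D u v = ip D u' v'.
Proof.
move=> mD hu hu' hv hv' eu ev; rewrite !ipE; apply: Int_ae_eq => //.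
- exact: L1_measurable (L2_mul mD hu hv).
- exact: L1_measurable (L2_mul mD hu' hv').
by apply: ae_imp (ae_and eu ev) => x [h1 h2] Dx; rewrite h1 // h2.
Qed.

(** Test the first relation with the derivative of p of order b. The lemma relates the derivatives
    [wD] of different orders, which are chosen independently of each other. *)
Lemma weak_derivative_add D a b u g k : 
  weak_derivative D a u g -> weak_derivative D (a.1 + b.1, a.2 + b.2)%N u k ->
  weak_derivative D b g k.
Proof.
move=> h1 h2 p tp; have cp := test_cinf tp.
have := h1 _ (Dclassical_test b tp); rewrite Dclassical_Dclassical // h2 //= => e.
have : (-1) ^+ (a.1 + a.2) * ((-1) ^+ (a.1 + a.2) * ip D g (Dclassical b p)) =
   (-1) ^+ (a.1 + a.2) * ((-1) ^+ (a.1 + b.1 + (a.2 + b.2)) * ip D k p) :> R by rewrite e.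
rewrite !mulrA -!exprD addnn -mul2n exprM sqrrN expr1n expr1n mul1r => ->.
congr (_ * _); rewrite (_ : (_ + _)%N = (a.1 + a.2).*2 + (b.1 + b.2))%N; last by lia.
by rewrite exprD -mul2n exprM sqrrN expr1n expr1n mul1r.
Qed.

End WeakDerivatives.

Ltac plane_ring := rewrite [LHS]surjective_pairing [RHS]surjective_pairing;
  congr pair; rewrite /= -?[_ *: _]/(_ * _); ring.

(** * Triangles *)

Section Triangles.
Context {R : realType}.
Implicit Types (x y z v : R * R) (K : triangle R) (i j k : 'I_3).

Definition cross x y : R := x.1 * y.2 - x.2 * y.1.
Definition dot x y : R := x.1 * y.1 + x.2 * y.2.
Definition en x : R := Num.sqrt (x.1 ^+ 2 + x.2 ^+ 2).

Lemma edistE x y : Defs.edist x y = en (x - y). Proof. by []. Qed.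

Lemma en_ge0 x : 0 <= en x. Proof. exact: sqrtr_ge0. Qed.

Lemma en_sq x : en x ^+ 2 = x.1 ^+ 2 + x.2 ^+ 2.
Proof. by rewrite sqr_sqrtr // addr_ge0 ?sqr_ge0. Qed.

Lemma le_en (c : R) x : 0 <= c -> x.1 ^+ 2 + x.2 ^+ 2 <= c ^+ 2 -> en x <= c.
Proof.
by move=> c0 h; rewrite -(ler_pXn2r (n := 2)) ?nnegrE ?en_ge0 // en_sq.
Qed.

Lemma en_gt0 x : x != 0 -> 0 < en x.
Proof.
move=> x0; rewrite sqrtr_gt0 lt_neqAle addr_ge0 ?sqr_ge0 // andbT eq_sym.
rewrite paddr_eq0 ?sqr_ge0 // !sqrf_eq0; apply: contra x0 => /andP[/eqP h1 /eqP h2].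
by apply/eqP; case: x h1 h2 => a b /= -> ->.
Qed.

Lemma dot_le x y : `|dot x y| <= en x * en y.
Proof.
rewrite -(ler_pXn2r (n := 2)) ?nnegrE ?mulr_ge0 ?en_ge0 //.
rewrite real_normK ?num_real // exprMn !en_sq /dot.
have := sqr_ge0 (x.1 * y.2 - x.2 * y.1); nra.
Qed.

Lemma cross_le x y : `|cross x y| <= en x * en y.
Proof.
rewrite -(ler_pXn2r (n := 2)) ?nnegrE ?mulr_ge0 ?en_ge0 //.
rewrite real_normK ?num_real // exprMn !en_sq /cross.
have := sqr_ge0 (x.1 * y.1 + x.2 * y.2); nra.
Qed.

Lemma enD x y : en (x + y) <= en x + en y.
Proof.
apply: le_en; first by rewrite addr_ge0 ?en_ge0.
rewrite [leRHS]sqrrD !en_sq /=; have := le_trans (ler_norm _) (dot_le x y); rewrite /dot; nra.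
Qed.

Lemma enZ (c : R) x : en (c *: x) = `|c| * en x.
Proof.
rewrite /en /= -![_ *: _]/(_ * _) !exprMn -mulrDr sqrtrM ?sqr_ge0 //.
by rewrite sqrtr_sqr.
Qed.

Lemma enN x : en (- x) = en x.
Proof. by rewrite /en /= !sqrrN. Qed.

Lemma en0 : en 0 = 0.
Proof. by rewrite /en /= expr0n /= addr0 sqrtr0. Qed.

Lemma norm1_le_en x : `|x.1| <= en x.
Proof. by rewrite -sqrtr_sqr ler_wsqrtr // lerDl sqr_ge0. Qed.

Lemma norm2_le_en x : `|x.2| <= en x.
Proof. by rewrite -sqrtr_sqr ler_wsqrtr // lerDr sqr_ge0. Qed.

Lemma norm_le_en x : `|x| <= en x.
Proof. by rewrite prod_normE ge_max norm1_le_en norm2_le_en. Qed.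

Lemma en_le_norm x : en x <= 2 * `|x|.
Proof.
apply: le_en; first by rewrite mulr_ge0.
have h1 : `|x.1| <= `|x| by rewrite prod_normE le_max lexx.
have h2 : `|x.2| <= `|x| by rewrite prod_normE le_max lexx orbT.
rewrite -(real_normK (num_real x.1)) -(real_normK (num_real x.2)).
have := normr_ge0 x.1; have := normr_ge0 x.2; nra.
Qed.

(** Vertices are indexed cyclically: i + 1 and i + 1 + 1 are the two others, and edge i is the one
    opposite to vertex i. *)
Definition o2 : 'I_3 := 1 + 1.

Lemma o2S : o2 + 1 = 0. Proof. exact/val_inj. Qed.
Lemma o1S : 1 + 1 = o2. Proof. by []. Qed.
Lemma o0S : 0 + 1 = 1 :> 'I_3. Proof. exact: add0r. Qed.

Lemma ord3P i : [\/ i = 0, i = 1 | i = o2].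
Proof.
by case: i => -[|[|[|//]]] h; [apply: Or31|apply: Or32|apply: Or33]; exact/val_inj.
Qed.

Lemma sum3 (V : zmodType) (F : 'I_3 -> V) : \sum_i F i = F 0 + F 1 + F o2.
Proof.
rewrite !big_ord_recl big_ord0 addr0 addrA; congr (F _ + F _ + F _); exact/val_inj.
Qed.

Lemma neqS i : i + 1 != i. Proof. by case: (ord3P i) => ->. Qed.
Lemma neqSS i : i + 1 + 1 != i. Proof. by case: (ord3P i) => ->. Qed.

Lemma ord3_other i j : j != i -> j = i + 1 \/ j = i + 1 + 1.
Proof.
by case: (ord3P i) => ->; case: (ord3P j) => -> // _; [left|right|right|left|left|right]; exact/val_inj.
Qed.

Definition det K : R := cross (K 1 - K 0) (K o2 - K 0).

(** The gradient of the barycentric coordinate [lam K i]: the opposite edge turned by a right angle,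
    over twice the signed area. *)
Definition glam K i : R * R :=
  ((K (i + 1) - K (i + 1 + 1)).2 / det K, - (K (i + 1) - K (i + 1 + 1)).1 / det K).

(** The barycentric coordinate as a quotient of signed areas. *)
Definition lam K i x : R := cross (K (i + 1) - x) (K (i + 1 + 1) - x) / det K.

Lemma det_cyc K i : cross (K (i + 1) - K i) (K (i + 1 + 1) - K i) = det K.
Proof.
by case: (ord3P i) => ->; rewrite ?o0S ?o1S ?o2S ?o0S /det /cross /=; ring.
Qed.

Lemma lamB K i x y : lam K i x - lam K i y = dot (glam K i) (x - y).
Proof.
rewrite /lam /dot /glam /cross /=; move: (K _) (K _) (det K)^-1 => a b d; ring.
Qed.

Lemma lam_line K i x y (t : R) :
  lam K i (x + t *: y) = lam K i x + t * dot (glam K i) y.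
Proof.
rewrite -[LHS](subrK (lam K i x)) lamB addrC /dot /= -![_ *: _]/(_ * _); ring.
Qed.

Lemma lam_vertex K i j : det K != 0 -> lam K i (K j) = (i == j)%:R.
Proof.
move=> d0; have [->|ij] := eqVneq i j.
  by rewrite /lam det_cyc divff.
rewrite /lam; have [->|->] := ord3_other (i := i) (j := j) ltac:(by rewrite eq_sym).
  by rewrite /cross /= !subrr !mul0r subrr mul0r.
by rewrite /cross /= !subrr !mulr0 subrr mul0r.
Qed.

Lemma sum_lam K x : det K != 0 -> \sum_i lam K i x = 1.
Proof.
move=> d0; rewrite sum3 /lam -!mulrDl ?o0S ?o1S ?o2S ?o0S; apply: (canLR (mulfK d0)).
rewrite mul1r /det /cross /=; ring.
Qed.

Lemma sum_lam_vertex K x : det K != 0 -> \sum_i lam K i x *: K i = x.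
Proof.
move=> d0; rewrite sum3 /lam ?o0S ?o1S ?o2S ?o0S.
move: d0; rewrite /det; move: (K 0) (K 1) (K o2) => [a1 a2] [b1 b2] [c1 c2].
case: x => x1 x2; rewrite /cross /= => d0.
by congr pair; rewrite /= -![_ *: _]/(_ * _); field.
Qed.

Lemma lam_bary K (l : 'I_3 -> R) i : det K != 0 -> \sum_j l j = 1 ->
  lam K i (\sum_j l j *: K j) = l i.
Proof.
move=> d0 l1.
have -> : lam K i (\sum_j l j *: K j) = \sum_j l j * lam K i (K j).
  apply/eqP; rewrite -subr_eq0; apply/eqP; rewrite sum3.
  have l0 : l 0 = 1 - l 1 - l o2 by move: l1; rewrite sum3 => <-; ring.
  rewrite sum3 l0; rewrite /lam.
  move: (K 0) (K 1) (K o2) (K (i + 1)) (K (i + 1 + 1)) (det K)^-1 => a b c e f d.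
  rewrite /cross /= -![_ *: _]/(_ * _); ring.
rewrite (bigD1 i) //= lam_vertex // eqxx mulr1 big1 ?addr0 // => j ji.
by rewrite lam_vertex // eq_sym (negbTE ji) mulr0.
Qed.

Lemma triP K x : det K != 0 -> tri K x <-> forall i, 0 <= lam K i x.
Proof.
move=> d0; split => [[l [l0 l1 ->]] i|h]; first by rewrite lam_bary.
by exists (fun i => lam K i x); rewrite sum_lam // sum_lam_vertex.
Qed.

Lemma lam_le1 K x i : det K != 0 -> tri K x -> lam K i x <= 1.
Proof.
move=> d0 /(triP _ d0) h; rewrite -(sum_lam x d0) (bigD1 i) //= lerDl.
by apply: sumr_ge0 => j _.
Qed.

Lemma lam_continuous K i : continuous (lam K i).
Proof.
have -> : lam K i = fun x => dot (glam K i) x + lam K i 0.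
  by apply/funext => x; have := lamB K i x 0; rewrite subr0 => <-; ring.
move=> x; apply: cvgD; last exact: cvg_cst.
by apply: cvgD; apply: cvgM; try exact: cvg_cst; [exact: fst_continuous|exact: snd_continuous].
Qed.

Lemma glam_neq0 K i : det K != 0 -> glam K i != 0.
Proof.
move=> d0; apply/eqP => g0; have := lamB K i (K i) (K (i + 1)).
rewrite g0 /dot /= !mul0r addr0 !lam_vertex // eqxx eq_sym (negbTE (neqS i)) subr0.
by move/eqP; rewrite oner_eq0.
Qed.

Lemma half_scale (e n : R) : 0 < n -> e / (2 * n) * n = e / 2.
Proof. by move=> n0; field; rewrite gt_eqF. Qed.

(** From an interior point a short step against the gradient of [lam K i] stays in the triangle, so
    the coordinate was positive before it. The converse is continuity of the three coordinates. *)
Lemma interior_triP K x : det K != 0 -> (tri K)° x <-> forall i, 0 < lam K i x.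
Proof.
move=> d0; split => [intx i|h].
  have : nbhs x (tri K) by [].
  move=> /nbhs_ballP[e /= e0 He].
  pose g := glam K i; have g0 : 0 < en g by exact/en_gt0/glam_neq0.
  have n0 : 0 < `|g| by rewrite normr_gt0 glam_neq0.
  pose t := e / (2 * `|g|).
  have t0 : 0 < t by rewrite divr_gt0 // mulr_gt0.
  have : tri K (x + (- t) *: g).
    apply: He; rewrite -ball_normE /= opprD addrA subrr add0r scaleNr opprK normrZ.
    by rewrite gtr0_norm // /t half_scale //; lra.
  move/(triP _ d0)/(_ i); rewrite lam_line.
  have : 0 < t * dot g g by rewrite mulr_gt0 // /dot -!expr2 -en_sq exprn_gt0.
  rewrite -/g; lra.
have op i : nbhs x [set y | 0 < lam K i y].
  have := lam_continuous (K := K) (i := i) (x := x).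
  by move=> /cvgr_gt; apply; exact: h.
have : nbhs x ([set y | 0 < lam K 0 y] `&` [set y | 0 < lam K 1 y] `&` [set y | 0 < lam K o2 y]).
  by apply: filterI; [apply: filterI|].
apply: filterS => y [[h0 h1] h2]; apply/(triP _ d0) => i.
by case: (ord3P i) => ->; rewrite ltW.
Qed.

Lemma collinear_normal K : det K = 0 -> exists2 n : R * R, n != 0 & forall i, dot n (K i) = dot n (K 0).
Proof.
move=> d0; have [e|ne] := eqVneq (K 1) (K 0).
  have [e2|ne2] := eqVneq (K o2) (K 0).
    exists (1, 0); first by rewrite xpair_eqE oner_eq0.
    by move=> i; case: (ord3P i) => ->; rewrite ?e ?e2.
  exists ((K o2 - K 0).2, - (K o2 - K 0).1).
    apply: contra ne2; rewrite xpair_eqE => /andP[/eqP h2]; rewrite oppr_eq0 => /eqP h1.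
    by rewrite -subr_eq0; apply/eqP; rewrite [LHS]surjective_pairing h1 h2.
  by move=> i; case: (ord3P i) => ->; rewrite ?e // /dot /=; ring.
exists ((K 1 - K 0).2, - (K 1 - K 0).1).
  apply: contra ne; rewrite xpair_eqE => /andP[/eqP h2]; rewrite oppr_eq0 => /eqP h1.
  by rewrite -subr_eq0; apply/eqP; rewrite [LHS]surjective_pairing h1 h2.
move=> i; case: (ord3P i) => -> //; first by rewrite /dot /=; ring.
by move: d0; rewrite /det /cross /dot /= => d0; apply/eqP; rewrite -subr_eq0 -oppr_eq0 -d0; apply/eqP; ring.
Qed.

(** A degenerate triangle lies on a line, and a step along the normal of that line leaves it. *)
Lemma interior_det K : (tri K)° !=set0 -> det K != 0.
Proof.
move=> [x intx]; apply/eqP => /collinear_normal[n n0 hn].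
have line y : tri K y -> dot n y = dot n (K 0).
  move=> [l [l0 l1 ->]].
  have : dot n (\sum_i l i *: K i) = \sum_i l i * dot n (K i).
    by rewrite !sum3 /dot /= -![_ *: _]/(_ * _); ring.
  by move=> ->; under eq_bigr do rewrite hn; rewrite -mulr_suml l1 mul1r.
have : nbhs x (tri K) by [].
move=> /nbhs_ballP[e /= e0 He].
have nn0 : 0 < `|n| by rewrite normr_gt0.
pose t := e / (2 * `|n|).
have t0 : 0 < t by rewrite divr_gt0 // mulr_gt0.
have h1 : tri K x by apply: He; exact: ballxx.
have : tri K (x + t *: n).
  apply: He; rewrite -ball_normE /= opprD addrA subrr add0r normrN normrZ.
  by rewrite gtr0_norm // /t half_scale //; lra.
move/line; rewrite -(line _ h1) /dot /= -![_ *: _]/(_ * _) => h.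
have : 0 < t * en n ^+ 2 by rewrite mulr_gt0 // exprn_gt0 // en_gt0.
rewrite en_sq; nra.
Qed.

Lemma tri_vertex K i : det K != 0 -> tri K (K i).
Proof. by move=> d0; apply/(triP _ d0) => j; rewrite lam_vertex // ler0n. Qed.

Lemma en_sum3 (l : 'I_3 -> R) (V : 'I_3 -> R * R) :
  en (\sum_i l i *: V i) <= \sum_i `|l i| * en (V i).
Proof.
rewrite !sum3; apply: le_trans (enD _ _) _; rewrite -enZ lerD //; last by rewrite enZ.
by apply: le_trans (enD _ _) _; rewrite -!enZ.
Qed.

Lemma tri_en_le K x : tri K x -> en x <= \sum_i en (K i).
Proof.
move=> [l [l0 l1 ->]]; apply: le_trans (en_sum3 _ _) _; apply: ler_sum => i _.
rewrite ger0_norm //; rewrite -[leRHS]mul1r ler_wpM2r ?en_ge0 //.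
by rewrite -l1 (bigD1 i) //= lerDl sumr_ge0.
Qed.

Lemma tri_bounded K : bounded_set (tri K).
Proof.
exists (\sum_i en (K i)); split; first exact: num_real.
move=> M hM x /= hx; apply: le_trans (norm_le_en x) _.
exact: le_trans (tri_en_le hx) (ltW hM).
Qed.

Lemma tri_diam K x y : tri K x -> tri K y -> en (x - y) <= diam (tri K).
Proof.
move=> hx hy; apply: ub_le_sup; last by exists x, y.
exists (2 * \sum_i en (K i)) => _ [a [b [ha hb ->]]]; rewrite edistE.
by rewrite (le_trans (enD _ _))// enN mulr2n mulrDl mul1r lerD // tri_en_le.
Qed.

Lemma diam_gt0 K : det K != 0 -> 0 < diam (tri K).
Proof.
move=> d0; apply: lt_le_trans (tri_diam (tri_vertex 1 d0) (tri_vertex 0 d0)).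
apply: en_gt0; apply: contra d0 => /eqP e; rewrite /det e.
by rewrite /cross /= !mul0r subrr.
Qed.

Let discs K := [set d : R | 0 <= d /\ exists x, forall y, Defs.edist x y <= d / 2 -> tri K y].

Let discs0 K : det K != 0 -> discs K 0.
Proof.
move=> d0; split => //; exists (K 0) => y; rewrite mul0r edistE => h.
have -> : y = K 0; last exact: tri_vertex.
apply/esym/eqP; rewrite -subr_eq0; apply/eqP; apply: contrapT => /eqP/en_gt0.
by rewrite ltNge h.
Qed.

(** Along the diameter of the disc in the direction of the gradient [lam K i] grows by d times the
    length of the gradient, while it stays between 0 and 1. *)
Let glam_disc K i d : det K != 0 -> discs K d -> d <= (en (glam K i))^-1.
Proof.
move=> d0 [dge [x hx]]; have g0 := en_gt0 (glam_neq0 i d0).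
rewrite -[leRHS]mul1r ler_pdivlMr //.
pose g := glam K i.
pose y := x + (d / 2 / en g) *: g; pose z := x + (- (d / 2 / en g)) *: g.
have nn : 0 <= d / 2 / en g by rewrite divr_ge0 ?en_ge0 // divr_ge0.
have ty : tri K y.
  apply: hx; rewrite edistE /y opprD addrA subrr add0r enN enZ ger0_norm //.
  by rewrite divfK // gt_eqF.
have tz : tri K z.
  apply: hx; rewrite edistE /z opprD addrA subrr add0r enN enZ normrN ger0_norm //.
  by rewrite divfK // gt_eqF.
have := lam_le1 i d0 ty; have /(triP _ d0)/(_ i) := tz.
rewrite /y /z !lam_line -/g (_ : dot g g = en g ^+ 2); last by rewrite en_sq /dot !expr2.
have -> : d / 2 / en g * en g ^+ 2 = d / 2 * en g by field; rewrite gt_eqF.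
rewrite mulNr (_ : d / 2 / en g * en g ^+ 2 = d / 2 * en g); last by field; rewrite gt_eqF.
lra.
Qed.

Lemma glam_indiam K i : det K != 0 -> en (glam K i) * indiam (tri K) <= 1.
Proof.
move=> d0; have g0 := en_gt0 (glam_neq0 i d0).
rewrite mulrC -ler_pdivlMr // mul1r; apply: ge_sup; first by exists 0; exact: discs0.
by move=> d; exact: glam_disc.
Qed.

Definition shape_regular (kappa : R) K := diam (tri K) <= kappa * indiam (tri K).

Lemma shape_regular_gt0 kappa K : det K != 0 -> shape_regular kappa K -> 0 < kappa.
Proof.
move=> d0 sr; have := lt_le_trans (diam_gt0 d0) sr.
have i0 : 0 <= indiam (tri K).
  apply: ub_le_sup; last exact: discs0.
  by exists ((en (glam K 0))^-1) => d; exact: glam_disc.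
by move=> h; rewrite ltNge; apply/negP => k0; move: h; rewrite ltNge mulr_le0_ge0.
Qed.

(** Source of all shape estimates: the barycentric coordinates have slope at most kappa / diam.
    Lower bounds for edges and for the area follow. *)
Lemma glam_le kappa K i : det K != 0 -> shape_regular kappa K ->
  en (glam K i) * diam (tri K) <= kappa.
Proof.
move=> d0 sr; have k0 := ltW (shape_regular_gt0 d0 sr).
apply: le_trans (_ : en (glam K i) * (kappa * indiam (tri K)) <= _).
  by rewrite ler_wpM2l ?en_ge0.
by rewrite mulrCA -[leRHS]mulr1 ler_wpM2l // glam_indiam.
Qed.

Lemma lamB_le kappa K i x y : det K != 0 -> shape_regular kappa K ->
  `|lam K i x - lam K i y| * diam (tri K) <= kappa * en (x - y).
Proof.
move=> d0 sr; rewrite lamB; apply: le_trans (_ : en (glam K i) * en (x - y) * diam (tri K) <= _).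
  by rewrite ler_wpM2r ?dot_le // ltW // diam_gt0.
by rewrite mulrAC ler_wpM2r ?en_ge0 // glam_le.
Qed.

Lemma edge_ge kappa K i j : det K != 0 -> shape_regular kappa K -> i != j ->
  diam (tri K) <= kappa * en (K i - K j).
Proof.
move=> d0 sr ij; have := lamB_le i (K i) (K j) d0 sr.
by rewrite !lam_vertex // eqxx (negbTE ij) subr0 normr1 mul1r.
Qed.

Lemma en_glam K i : en (glam K i) = en (K (i + 1) - K (i + 1 + 1)) / `|det K|.
Proof.
have -> : en (glam K i) = en (((det K)^-1) *: ((K (i + 1) - K (i + 1 + 1)).2, - (K (i + 1) - K (i + 1 + 1)).1)).
  by congr en; rewrite /glam; congr pair; rewrite /= -[RHS]/(_ * _) mulrC.
rewrite enZ mulrC normfV; congr (_ / _).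
by rewrite /en /= sqrrN addrC.
Qed.

Lemma det_ge kappa K : det K != 0 -> shape_regular kappa K ->
  diam (tri K) ^+ 2 <= kappa ^+ 2 * `|det K|.
Proof.
move=> d0 sr; have k0 := shape_regular_gt0 d0 sr.
have h1 := glam_le 0 d0 sr.
have h2 : diam (tri K) <= kappa * en (K (0 + 1) - K (0 + 1 + 1)).
  by apply: edge_ge => //; rewrite eq_sym neqS.
have D0 : 0 < `|det K| by rewrite normr_gt0.
rewrite en_glam mulrAC ler_pdivrMr // in h1.
have h0 := diam_gt0 d0.
rewrite !expr2 -mulrA; apply: le_trans (_ : kappa * (en (K (0 + 1) - K (0 + 1 + 1)) * diam (tri K)) <= _).
  by rewrite mulrA ler_pM2r.
by rewrite ler_pM2l.
Qed.

Lemma det_le K : det K != 0 -> `|det K| <= diam (tri K) ^+ 2.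
Proof.
move=> d0; apply: le_trans (cross_le _ _) _; rewrite expr2.
by apply: ler_pM; rewrite ?en_ge0 //; apply: tri_diam; exact: tri_vertex.
Qed.

End Triangles.

(** * Integrals over triangles and edge means *)

Section TriangleIntegrals.
Context {R : realType}.
Notation mu := (@mu2 R).
Notation lb := (@lebesgue_measure R).
Implicit Types (x y z : R * R) (K : triangle R) (i j k : 'I_3) (u w : R * R -> R).

(** Affine maps with vector coefficients, for which the chain rule takes a directional derivative to
    a directional derivative. *)
Definition amap (p q r : R * R) (x : R * R) : R * R := x.1 *: p + x.2 *: q + r.

Lemma amap_derive w p q r (v x : R * R) :
  'D_v (fun x => w (amap p q r x)) x = 'D_(v.1 *: p + v.2 *: q) w (amap p q r x).
Proof.
have e : (fun h : R => h^-1 *: (((fun x => w (amap p q r x)) \o shift x) (h *: v) - w (amap p q r x))) =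
    (fun h : R => h^-1 *: ((w \o shift (amap p q r x)) (h *: (v.1 *: p + v.2 *: q)) - w (amap p q r x))).
  apply/funext => h /=; congr (_ *: (w _ - _)).
  by rewrite /amap /= !scalerDr !scalerA !scalerDl -!addrA; congr (_ + _); rewrite [RHS]addrCA; congr (_ + _).
by rewrite /derive e.
Qed.

Lemma cinf_amap w p q r : cinf w -> cinf (fun x => w (amap p q r x)).
Proof.
move=> [S Sw HS]; exists [set g | exists2 f, S f & g = fun x => f (amap p q r x)]; first by exists w.
move=> _ [f Sf ->]; have [h1 h2] := HS _ Sf; split=> [x|v].
  apply: (@differentiable_comp _ _ _ _ (amap p q r) f) => //.
  apply: (@differentiableD _ _ _ (fun x => x.1 *: p + x.2 *: q) (cst r)); last exact: differentiable_cst.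
  apply: (@differentiableD _ _ _ (fun x => x.1 *: p) (fun x => x.2 *: q)).
    by apply: (differentiableZl (k := fst)); exact: cinf_diff cinf_fst.
  by apply: (differentiableZl (k := snd)); exact: cinf_diff cinf_snd.
by exists (fun x => 'D_(v.1 *: p + v.2 *: q) f x) => //; apply/funext => x; rewrite amap_derive.
Qed.

Definition T0 : set (Pl R) := [set x | [/\ 0 < x.1, 0 < x.2 & x.1 + x.2 < 1]].

Definition tmap K : R * R -> R * R := amap (K 1 - K 0) (K o2 - K 0) (K 0).

Lemma tmap_affine2 K : tmap K = affine2 (K 1 - K 0).1 (K o2 - K 0).1 (K 1 - K 0).2 (K o2 - K 0).2 (K 0).1 (K 0).2.
Proof.
apply/funext => x; rewrite /tmap /amap /affine2; congr pair => /=;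
by rewrite -![_ *: _]/(_ * _) ![x.1 * _]mulrC ![x.2 * _]mulrC.
Qed.

Lemma lam_tmap K x : det K != 0 ->
  [/\ lam K 0 (tmap K x) = 1 - x.1 - x.2, lam K 1 (tmap K x) = x.1 & lam K o2 (tmap K x) = x.2].
Proof.
move=> d0; pose l i : R := if i == 0 then 1 - x.1 - x.2 else if i == 1 then x.1 else x.2.
have ls : \sum_i l i = 1 by rewrite sum3 /l /=; ring.
have -> : tmap K x = \sum_i l i *: K i.
  rewrite sum3 /l /= /tmap /amap; move: (K 0) (K 1) (K o2) => a b c.
  by rewrite [LHS]surjective_pairing [RHS]surjective_pairing; congr pair; rewrite /= -![_ *: _]/(_ * _); ring.
by rewrite !lam_bary.
Qed.

Lemma tmap_preimage K : det K != 0 -> tmap K @^-1` ((tri K)° : set (R * R)) = T0.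
Proof.
move=> d0; apply/seteqP; split => x /=.
  move/(interior_triP _ d0) => h; have [h0 h1 h2] := lam_tmap x d0.
  have := h 0; have := h 1; have := h o2; rewrite h0 h1 h2 => ? ? ?; split => //; lra.
move=> [h1 h2 h3]; apply/(interior_triP _ d0) => i; have [e0 e1 e2] := lam_tmap x d0.
by case: (ord3P i) => ->; rewrite ?e0 ?e1 ?e2 //; lra.
Qed.

Lemma open_T0 : open T0.
Proof.
have h (f : R * R -> R) : continuous f -> open [set x | 0 < f x].
  move=> cf; rewrite (_ : [set x | _] = f @^-1` `]0, +oo[%classic).
    by move/continuousP : cf; apply; exact: interval_open.
  by apply/seteqP; split => x /=; rewrite in_itv /= andbT.
rewrite (_ : T0 = [set x | 0 < x.1] `&` [set x | 0 < x.2] `&` [set x : R * R | 0 < 1 - (x.1 + x.2)]).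
  apply: openI; first by apply: openI; apply: h; [exact: fst_continuous|exact: snd_continuous].
  apply: h => x; apply: cvgB; first exact: cvg_cst.
  by apply: cvgD; [exact: fst_continuous|exact: snd_continuous].
by apply/seteqP; split => x /=; [move=> [? ? ?]; rewrite subr_gt0|move=> [[? ?]]; rewrite subr_gt0 => ?].
Qed.

Lemma measurable_T0 : measurable T0. Proof. exact: open_measurable2 open_T0. Qed.

Lemma measurable_tri K : measurable ((tri K)° : set (Pl R)).
Proof. by apply: open_measurable2; exact: open_interior. Qed.

Lemma bounded_tri K : bounded_set ((tri K)° : set (R * R)).
Proof.
have [M [rM hM]] := tri_bounded K; exists M; split => // r Mr x /interior_subset.
exact: hM.
Qed.

Lemma tri_L1 K w : continuous w -> L1 (tri K)° w.
Proof. by move=> cw; apply: L1_continuous => //; [exact: measurable_tri|exact: bounded_tri]. Qed.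

Lemma tri_L2 K w : continuous w -> L2 (tri K)° w.
Proof. by move=> cw; apply: L2_continuous => //; [exact: measurable_tri|exact: bounded_tri]. Qed.

Lemma det_affine K : (K 1 - K 0).1 * (K o2 - K 0).2 - (K o2 - K 0).1 * (K 1 - K 0).2 = det K.
Proof. by rewrite /det /cross; ring. Qed.

Lemma Int_tri K w : det K != 0 -> continuous w ->
  Int (tri K)° w = `|det K| * Int T0 (fun x => w (tmap K x)).
Proof.
move=> d0 cw; have h : (K 1 - K 0).1 * (K o2 - K 0).2 - (K o2 - K 0).1 * (K 1 - K 0).2 != 0.
  by rewrite det_affine.
rewrite (Int_affine2 (K 0).1 (K 0).2 h (measurable_tri K) (tri_L1 K cw)).
by rewrite -tmap_affine2 tmap_preimage // det_affine.
Qed.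

Lemma bounded_T0 : bounded_set (T0 : set (R * R)).
Proof.
exists 1; split; first exact: num_real.
move=> M hM x /= [h1 h2 h3]; rewrite prod_normE ge_max !ger0_norm ?ltW //; lra.
Qed.

Definition seg_mean w x y : R := \int[lb]_(t in `[0, 1]) w (x + t *: (y - x)).

Lemma L1_itv (f : R -> R) : continuous f -> lb.-integrable `[0, 1] (EFin \o f).
Proof.
move=> cf; apply: continuous_compact_integrable; first exact: segment_compact.
exact: continuous_subspaceT.
Qed.

Lemma seg_continuous w x y : continuous w -> continuous (fun t : R => w (x + t *: (y - x))).
Proof.
move=> cw t; apply: (@continuous_comp _ _ _ (fun t : R => x + t *: (y - x)) w); first exact: line_continuous.
exact: cw.
Qed.

Lemma seg_mean_sym w x y : continuous w -> seg_mean w x y = seg_mean w y x.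
Proof.
move=> cw; rewrite /seg_mean.
have := @Rintegration_by_substitution_onem R (fun t => w (x + t *: (y - x))) 1.
rewrite unstable.onem1 => -> //.
- congr Rintegral; apply/funext => t; congr w.
  by rewrite /unstable.onem; case: x y => [x1 x2] [y1 y2]; plane_ring.
- by rewrite lexx ler01.
- by apply: continuous_subspaceT; exact: seg_continuous.
Qed.

Let Int_T0_itv (f : R * R -> R) : continuous f -> L1 setT (f \_ T0).
Proof.
move=> cf; have := L1_continuous measurable_T0 bounded_T0 cf.
move/(integrable_mkcond _ measurable_T0); apply: eq_integrable => // x _ /=.
by rewrite !patchE; case: ifP.
Qed.

(** The horizontal section of the reference triangle at height y is the interval from 0 to 1 - y;
    outside 0 < y < 1 it is empty. *)
Let inner (f : R -> R) (y : R) (g : R -> R) (G : R -> R) :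
  (forall t : R, is_derive t 1 G (f t)) -> continuous f ->
  (forall t : R, g t = if (0 < t) && (0 < y) && (t + y < 1) then f t else 0) ->
  (\int[lb]_t (g t)%:E = (if (0 < y < 1)%R then (G (1 - y) - G 0)%R%:E else 0))%E.
Proof.
move=> dG cf gE; case: ifPn => [/andP[y0 y1]|hy]; last first.
  rewrite integral0_eq // => x _; rewrite gE; case: ifPn => // /andP[/andP[x0 y0] xy].
  by move: hy; rewrite y0 /= -leNgt => y1; exfalso; move: (lt_le_trans xy y1); rewrite gtrDr ltNge ltW.
rewrite -(FTC_everywhere _ dG cf); last lra.
rewrite (@integral_itv_bndoo R _ _ _ true false); last first.
  by apply/measurable_EFinP; apply: measurable_funTS; exact: continuous_measurable_fun.
rewrite [RHS]integral_mkcond; apply: eq_integral => x _.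
rewrite gE patchE y0 andbT; case: ifPn => h.
  by rewrite ifT // inE /= in_itv /=; case/andP: h => -> /=; rewrite -ltrBrDr.
rewrite ifF //; apply/negP; rewrite inE /= in_itv /= ltrBrDr => h2.
by rewrite h2 in h.
Qed.

Let outer (g : R -> R) : continuous g ->
  (\int[lb]_t (if (0 < t < 1)%R then (g t)%:E else 0) = \int[lb]_(t in `[0%R, 1%R]) (g t)%:E)%E.
Proof.
move=> cg; rewrite (@integral_itv_bndoo R _ _ _ true false); last first.
  by apply/measurable_EFinP; apply: measurable_funTS; exact: continuous_measurable_fun.
rewrite [RHS]integral_mkcond; apply: eq_integral => y _.
by rewrite patchE mem_setE /= in_itv.
Qed.

Let pair_continuous (f g : R -> R) w : continuous f -> continuous g -> continuous w ->
  continuous (fun t => w (f t, g t)).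
Proof.
move=> cf cg cw t; apply: (@continuous_comp _ _ _ (fun t => (f t, g t)) w); last exact: cw.
exact: (cvg_pair (cf t) (cg t)).
Qed.

Let id_continuous : continuous (fun t : R => t). Proof. by move=> t; exact: cvg_id. Qed.
Let cst_cont (c : R) : continuous (fun t : R => c). Proof. by move=> t; exact: cvg_cst. Qed.
Let onem_continuous : continuous (fun t : R => 1 - t).
Proof. by move=> t; apply: cvgB; [exact: cvg_cst|exact: cvg_id]. Qed.

(** Fubini and the fundamental theorem on the sections; what remains is the integral over the
    hypotenuse minus the one over a leg, both parametrised by t. *)
Lemma Int_T0_pd0 w : cinf w ->
  Int T0 (pd 0 w) = \int[lb]_(t in `[0, 1]) (w (1 - t, t) - w (0, t)).
Proof.
move=> cw; have cpd : continuous (pd 0 w) by apply: cinf_continuous; exact: cinf_derive.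
have cW := cinf_continuous cw.
rewrite /Rintegral -outer; last first.
  by move=> t; apply: cvgB; exact: pair_continuous.
rewrite -[LHS]/(fine (Int T0 (pd 0 w))%:E) Int_mkcond Int_Fubini21; last exact: Int_T0_itv.
congr fine; apply: eq_integral => y _.
have dG (t : R) : is_derive t 1 (fun t : R => w (t, y)) (pd 0 w (t, y)).
  have e (s : R) : (0, y) + s *: e_ 0 = (s, y).
    by rewrite /e_; congr pair; rewrite /= -[_ *: _]/(_ * _) /=; ring.
  have := @line_is_derive R w (0, y) (e_ 0) t (cinf_diff _ cw).
  by rewrite e (_ : (fun t => w ((0, y) + t *: e_ 0)) = fun t : R => w (t, y)) //; apply/funext => s; rewrite e.
have cG : continuous (fun t : R => pd 0 w (t, y)) by exact: pair_continuous.
rewrite (inner (y := y) dG cG) // => t.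
rewrite patchE; case: ifPn => [/set_mem[/= -> -> ->]//|].
by rewrite notin_setE /T0 /= => h; case: ifPn => // /andP[/andP[h1 h2] h3]; exfalso; apply: h.
Qed.

Lemma Int_T0_pd1 w : cinf w ->
  Int T0 (pd 1 w) = \int[lb]_(t in `[0, 1]) (w (t, 1 - t) - w (t, 0)).
Proof.
move=> cw; have cpd : continuous (pd 1 w) by apply: cinf_continuous; exact: cinf_derive.
have cW := cinf_continuous cw.
rewrite /Rintegral -outer; last first.
  by move=> t; apply: cvgB; exact: pair_continuous.
rewrite -[LHS]/(fine (Int T0 (pd 1 w))%:E) Int_mkcond Int_Fubini12; last exact: Int_T0_itv.
congr fine; apply: eq_integral => x _.
have dG (t : R) : is_derive t 1 (fun t : R => w (x, t)) (pd 1 w (x, t)).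
  have e (s : R) : (x, 0) + s *: e_ 1 = (x, s).
    by rewrite /e_; congr pair; rewrite /= -[_ *: _]/(_ * _) /=; ring.
  have := @line_is_derive R w (x, 0) (e_ 1) t (cinf_diff _ cw).
  by rewrite e (_ : (fun t => w ((x, 0) + t *: e_ 1)) = fun t : R => w (x, t)) //; apply/funext => s; rewrite e.
have cG : continuous (fun t : R => pd 1 w (x, t)) by exact: pair_continuous.
rewrite (inner (y := x) dG cG) // => t.
rewrite patchE; case: ifPn => [/set_mem[/= -> ->]|].
  by rewrite addrC => ->.
by rewrite notin_setE /T0 /= => h; case: ifPn => // /andP[/andP[h1 h2] h3]; exfalso; apply: h; split => //; rewrite addrC.
Qed.

Lemma RintB (f g : R -> R) : continuous f -> continuous g ->
  \int[lb]_(t in `[0, 1]) (f t - g t) = \int[lb]_(t in `[0, 1]) f t - \int[lb]_(t in `[0, 1]) g t.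
Proof. by move=> cf cg; apply: RintegralB => //; exact: L1_itv. Qed.

(** The form in which the divergence theorem is used: pulled back to the reference triangle, the
    derivative along an edge vector is a coordinate derivative, and only means over the other two
    edges survive. Normals and arc length do not occur. *)
Lemma Int_tri_derive1 K w : det K != 0 -> cinf w ->
  Int (tri K)° (fun x => 'D_(K 1 - K 0) w x) =
  `|det K| * (seg_mean w (K 1) (K o2) - seg_mean w (K 0) (K o2)).
Proof.
move=> d0 cw; rewrite Int_tri //; last exact: cinf_continuous (cinf_derive _ cw).
congr (_ * _); have cW := cinf_amap (K 1 - K 0) (K o2 - K 0) (K 0) cw.
rewrite (eq_Int (v := pd 0 (fun x => w (tmap K x)))); last first.
  by move=> x _; rewrite pdE amap_derive /= scale1r scale0r addr0.
rewrite Int_T0_pd0 // /seg_mean -RintB; try (by apply: seg_continuous; exact: cinf_continuous).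
congr Rintegral; apply/funext => t; congr (w _ - w _); rewrite /tmap /amap /=.
  by move: (K 0) (K 1) (K o2) => a b c; plane_ring.
by rewrite scale0r add0r addrC.
Qed.

Lemma Int_tri_derive2 K w : det K != 0 -> cinf w ->
  Int (tri K)° (fun x => 'D_(K o2 - K 0) w x) =
  `|det K| * (seg_mean w (K 1) (K o2) - seg_mean w (K 0) (K 1)).
Proof.
move=> d0 cw; rewrite Int_tri //; last exact: cinf_continuous (cinf_derive _ cw).
congr (_ * _); have cW := cinf_amap (K 1 - K 0) (K o2 - K 0) (K 0) cw.
rewrite (eq_Int (v := pd 1 (fun x => w (tmap K x)))); last first.
  by move=> x _; rewrite pdE amap_derive /= scale1r scale0r add0r.
rewrite Int_T0_pd1 // (seg_mean_sym (K 1)); last exact: cinf_continuous.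
rewrite /seg_mean -RintB; try (by apply: seg_continuous; exact: cinf_continuous).
congr Rintegral; apply/funext => t; congr (w _ - w _); rewrite /tmap /amap /=.
  by move: (K 0) (K 1) (K o2) => a b c; plane_ring.
by rewrite scale0r addr0 addrC.
Qed.

End TriangleIntegrals.

#[local] Opaque pd.

(** * Mean gradients and second-order Taylor expansion on a triangle *)

Section TriangleEstimates.
Context {R : realType}.
Notation mu := (@mu2 R).
Notation lb := (@lebesgue_measure R).
Implicit Types (x y z v : R * R) (K : triangle R) (u w : R * R -> R).

Lemma Int_T0_1 : Int T0 (fun=> 1) = 2^-1 :> R.
Proof.
have e : (fun=> 1) = pd 0 (fst : R * R -> R).
  by apply/funext => x; rewrite pdE derive_fst.
rewrite e Int_T0_pd0 /=; last exact: cinf_fst.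
have d (t : R) : is_derive t 1 (fun t : R => t - 2^-1 * (t * t)) (1 - t - 0).
  have h1 : is_derive t 1 (fun t : R => t * t) (t *: 1 + t *: 1).
    exact: (is_deriveM (is_derive_id t 1) (is_derive_id t 1)).
  have h := is_deriveB (is_derive_id t 1) (is_deriveM (is_derive_cst (2^-1 : R^o) t 1) h1).
  by apply: is_derive_eq h _; rewrite /= -![_ *: _]/(_ * _); field.
rewrite /Rintegral (FTC_everywhere ltr01 d) /=; first by field.
by move=> t; apply: cvgB; [apply: cvgB; [exact: cvg_cst|exact: cvg_id]|exact: cvg_cst].
Qed.

Definition area K : R := fine (mu (tri K)°).

Lemma areaE K : det K != 0 -> area K = `|det K| / 2.
Proof.
move=> d0; have := Int_cst 1 (measurable_tri K); rewrite mul1r -/(area K) => <-.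
by rewrite Int_tri ?Int_T0_1 // => x; exact: cvg_cst.
Qed.

Lemma area_gt0 K : det K != 0 -> 0 < area K.
Proof. by move=> d0; rewrite areaE // divr_gt0 // normr_gt0. Qed.

Lemma Int_tri_cst K c : Int (tri K)° (fun=> c) = c * area K.
Proof. by rewrite Int_cst //; exact: measurable_tri. Qed.

Lemma derive_pdE w v : cinf w -> (fun x => 'D_v w x) = (fun x => v.1 * pd 0 w x + v.2 * pd 1 w x).
Proof. by move=> cw; apply/funext => x; rewrite derive_pd //; exact: cinf_diff. Qed.

Lemma pd_continuous i w : cinf w -> continuous (pd i w).
Proof. by move=> cw; apply: cinf_continuous; exact: cinf_pd. Qed.

Lemma Int_tri_derive K w v : cinf w ->
  Int (tri K)° (fun x => 'D_v w x) = v.1 * Int (tri K)° (pd 0 w) + v.2 * Int (tri K)° (pd 1 w).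
Proof.
move=> cw; have mK := measurable_tri K.
have L i : L1 (tri K)° (pd i w) by apply: tri_L1; exact: pd_continuous.
rewrite (derive_pdE _ cw) (IntD mK (L1Z _ mK (L 0)) (L1Z _ mK (L 1))).
by congr (_ + _); [exact: (IntZ _ mK (L 0))|exact: (IntZ _ mK (L 1))].
Qed.

(** The mean derivative along each of two edge vectors is a multiple of a difference of edge
    means. *)
Lemma seg_mean_pd_eq K w : det K != 0 -> cinf w -> (forall i, Int (tri K)° (pd i w) = 0) ->
  seg_mean w (K 1) (K o2) = seg_mean w (K 0) (K o2) /\
  seg_mean w (K 1) (K o2) = seg_mean w (K 0) (K 1).
Proof.
move=> d0 cw h; have n0 : `|det K| != 0 by rewrite normr_eq0.
have := Int_tri_derive1 d0 cw; rewrite (Int_tri_derive _ _ cw) !h !mulr0 addr0 => /esym/eqP e1.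
have := Int_tri_derive2 d0 cw; rewrite (Int_tri_derive _ _ cw) !h !mulr0 addr0 => /esym/eqP e2.
move: e1 e2; rewrite !mulf_eq0 (negbTE n0) /= !subr_eq0 => /eqP e1 /eqP e2.
by split.
Qed.

Lemma seg_mean_derive w x y : cinf w -> seg_mean (fun z => 'D_(y - x) w z) x y = w y - w x.
Proof.
move=> cw; rewrite /seg_mean /Rintegral line_FTC //=.
by rewrite [x + _]addrC subrK.
Qed.

Lemma seg_mean_lin w x y v : cinf w ->
  seg_mean (fun z => 'D_v w z) x y = v.1 * seg_mean (pd 0 w) x y + v.2 * seg_mean (pd 1 w) x y.
Proof.
move=> cw; rewrite derive_pdE // /seg_mean.
have L i : lb.-integrable `[0, 1] (EFin \o (fun t : R => pd i w (x + t *: (y - x)))).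
  by apply: L1_itv; apply: seg_continuous; exact: pd_continuous.
have LZ c i : lb.-integrable `[0, 1] (EFin \o (fun t : R => c * pd i w (x + t *: (y - x)))).
  apply: L1_itv => t; apply: cvgM; first exact: cvg_cst.
  by apply: seg_continuous; exact: pd_continuous.
rewrite (RintegralD _ (LZ v.1 0) (LZ v.2 1)) //.
by congr (_ + _); [exact: (RintegralZl _ _ (L 0))|exact: (RintegralZl _ _ (L 1))].
Qed.

Lemma det_solve K X Y : det K != 0 -> (K o2 - K 0).1 * X + (K o2 - K 0).2 * Y = 0 ->
  (K 1 - K 0).1 * X + (K 1 - K 0).2 * Y = 0 -> X = 0 /\ Y = 0.
Proof.
rewrite /det /cross => d0 E2 E1; split; apply: (mulIf d0); rewrite mul0r.
  by rewrite [LHS](_ : _ = ((K 1 - K 0).1 * X + (K 1 - K 0).2 * Y) * (K o2 - K 0).2 -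
    ((K o2 - K 0).1 * X + (K o2 - K 0).2 * Y) * (K 1 - K 0).2);
    [rewrite E1 E2 !mul0r subrr|ring].
by rewrite [LHS](_ : _ = ((K o2 - K 0).1 * X + (K o2 - K 0).2 * Y) * (K 1 - K 0).1 -
    ((K 1 - K 0).1 * X + (K 1 - K 0).2 * Y) * (K o2 - K 0).1);
    [rewrite E1 E2 !mul0r subrr|ring].
Qed.

Lemma det_solve_means K (a b c a' b' c' : R) : det K != 0 ->
  a = b -> a = c -> a' = b' -> a' = c' ->
  (K 1 - K 0).1 * c + (K 1 - K 0).2 * c' = 0 -> (K o2 - K 0).1 * b + (K o2 - K 0).2 * b' = 0 ->
  [/\ a = 0, b = 0 & c = 0] /\ [/\ a' = 0, b' = 0 & c' = 0].
Proof.
move=> d0 <- <- <- <- F1 F2; have [a0 b0] := det_solve d0 F2 F1.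
by clear F1 F2; rewrite a0 b0.
Qed.

(* The gradient of [w] has the same mean on the three edges, and that mean is
   orthogonal to every edge. *)
Lemma seg_mean_pd0 K w : det K != 0 -> cinf w -> (forall i, w (K i) = 0) ->
  (forall i j, Int (tri K)° (pd i (pd j w)) = 0) ->
  forall j, [/\ seg_mean (pd j w) (K 1) (K o2) = 0, seg_mean (pd j w) (K 0) (K o2) = 0 &
     seg_mean (pd j w) (K 0) (K 1) = 0].
Proof.
move=> d0 cw wK h j.
have e jj := seg_mean_pd_eq d0 (cinf_pd jj cw) (fun i => h i jj).
have H x y : w x = 0 -> w y = 0 ->
    (y - x).1 * seg_mean (pd 0 w) x y + (y - x).2 * seg_mean (pd 1 w) x y = 0.
  by move=> wx wy; rewrite -seg_mean_lin // seg_mean_derive // wx wy subrr.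
have E1 := H _ _ (wK 0) (wK 1); have E2 := H _ _ (wK 0) (wK o2).
have [e01 e02] := e 0; have [e11 e12] := e 1.
have [p q] := det_solve_means d0 e01 e02 e11 e12 E1 E2.
by case: (ord2P j) => ->; [exact: p|exact: q].
Qed.

(** Converse direction of the link between mean gradients and edge means. Applied to first
    derivatives, it controls the mean Hessian of the companion. *)
Lemma Int_pd_eq0 K w : det K != 0 -> cinf w ->
  seg_mean w (K 1) (K o2) = 0 -> seg_mean w (K 0) (K o2) = 0 -> seg_mean w (K 0) (K 1) = 0 ->
  forall i, Int (tri K)° (pd i w) = 0.
Proof.
move=> d0 cw h1 h2 h3 i.
have := etrans (esym (Int_tri_derive K _ cw)) (Int_tri_derive1 d0 cw); rewrite h1 h2 subrr mulr0.
have := etrans (esym (Int_tri_derive K _ cw)) (Int_tri_derive2 d0 cw); rewrite h1 h3 subrr mulr0.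
move=> E2 E1; have [X0 Y0] := det_solve d0 E2 E1.
by case: (ord2P i) => ->; [exact: X0|exact: Y0].
Qed.

(** Squared Frobenius norm of the classical Hessian. *)
Definition hess2 w x : R := (pd 0 (pd 0 w) x ^+ 2 + pd 0 (pd 1 w) x ^+ 2) +
  (pd 1 (pd 0 w) x ^+ 2 + pd 1 (pd 1 w) x ^+ 2).

Lemma hess2_ge0 w x : 0 <= hess2 w x.
Proof. by rewrite /hess2 !addr_ge0 ?sqr_ge0. Qed.

Lemma hess2_continuous w : cinf w -> continuous (hess2 w).
Proof.
move=> cw; apply: cinf_continuous.
have h i j : cinf (fun x => pd i (pd j w) x ^+ 2).
  by apply: cinfM; apply: cinf_pd; exact: cinf_pd.
exact: (cinfD (cinfD (h _ _) (h _ _)) (cinfD (h _ _) (h _ _))).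
Qed.

Lemma pd_lin i (p q : R) u w x : cinf u -> cinf w ->
  pd i (fun y => p * u y + q * w y) x = p * pd i u x + q * pd i w x.
Proof.
move=> cu cw; pose e := ((i == 0)%:R : R, (i == 1)%:R : R).
have du : derivable u x e by apply: diff_derivable; exact: cinf_diff.
have dw : derivable w x e by apply: diff_derivable; exact: cinf_diff.
have := is_deriveD (is_deriveZ p (derivableP du)) (is_deriveZ q (derivableP dw)).
by move=> /@derive_val.
Qed.

Lemma quadratic_form_le (p q a b c d : R) :
  (p * (p * a + q * b) + q * (p * c + q * d)) ^+ 2 <=
  (p ^+ 2 + q ^+ 2) * (p ^+ 2 + q ^+ 2) * ((a ^+ 2 + b ^+ 2) + (c ^+ 2 + d ^+ 2)).
Proof.
have CS (k l r s : R) : (k * r + l * s) ^+ 2 <= (k ^+ 2 + l ^+ 2) * (r ^+ 2 + s ^+ 2).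
  have := sqr_ge0 (k * s - l * r); nra.
apply: le_trans (CS _ _ _ _) _; rewrite -mulrA ler_wpM2l //.
  by rewrite addr_ge0 ?sqr_ge0.
by rewrite mulrDr lerD // CS.
Qed.

Lemma derive2_le w v x : cinf w -> 'D_v (fun y => 'D_v w y) x ^+ 2 <= en v ^+ 4 * hess2 w x.
Proof.
move=> cw; have cd := cinf_derive v cw.
have pdd i : pd i (fun y => 'D_v w y) x = v.1 * pd i (pd 0 w) x + v.2 * pd i (pd 1 w) x.
  by rewrite (derive_pdE v cw); exact: pd_lin (cinf_pd 0 cw) (cinf_pd 1 cw).
have E := derive_pd v (cinf_diff x cd).
have E2 := etrans E (congr2 (fun a b => v.1 * a + v.2 * b) (pdd 0) (pdd 1)).
rewrite /= in E2.
rewrite (congr1 (fun a => a ^+ 2) E2).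
rewrite (_ : en v ^+ 4 = (v.1 ^+ 2 + v.2 ^+ 2) * (v.1 ^+ 2 + v.2 ^+ 2)); last first.
  by rewrite -en_sq -exprD.
exact: quadratic_form_le.
Qed.

(** The function (1 - t) w' + w along the line is an antiderivative of the integrand. *)
Lemma taylor2 w x v : cinf w ->
  w (x + v) - w x - 'D_v w x = \int[lb]_(t in `[0, 1]) ((1 - t) * 'D_v (fun y => 'D_v w y) (x + t *: v)).
Proof.
move=> cw; have cd := cinf_derive v cw; have cdd := cinf_derive v cd.
have d1 (t : R) := line_is_derive (cinf_diff (x + t *: v) cw).
have d2 (t : R) := line_is_derive (cinf_diff (x + t *: v) cd).
have d (t : R) : is_derive t 1 (fun t : R => (1 - t) * 'D_v w (x + t *: v) + w (x + t *: v))
   ((1 - t) * 'D_v (fun y => 'D_v w y) (x + t *: v)).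
  have h1 : is_derive t 1 (fun t : R => 1 - t) (0 - 1) by exact: is_deriveB.
  have h2 := is_deriveD (is_deriveM h1 (d2 t)) (d1 t).
  apply: is_derive_eq h2 _; move: (x + t *: v) => y.
  by move: ('D_v _ y) ('D_v _ y) => a b; rewrite /= -![_ *: _]/(_ * _); ring.
rewrite /Rintegral (FTC_everywhere ltr01 d) /=.
  rewrite scale1r scale0r addr0 subrr mul0r add0r subr0 mul1r; ring.
move=> t; apply: cvgM; first by apply: cvgB; [exact: cvg_cst|exact: cvg_id].
apply: (@continuous_comp _ _ _ (fun t : R => x + t *: v) (fun y => 'D_v (fun y => 'D_v w y) y)).
  exact: line_continuous.
exact: cinf_continuous cdd _.
Qed.

Lemma Rintegral_itv_sq (f : R -> R) : continuous f ->
  (\int[lb]_(t in `[0, 1]) f t) ^+ 2 <= \int[lb]_(t in `[0, 1]) (f t ^+ 2).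
Proof.
move=> cf; set m := \int[lb]_(t in `[0, 1]) f t.
have c2 : continuous (fun t => f t ^+ 2) by move=> t; apply: (@cvgM _ _ _ _ f f); exact: cf.
have cc (c : R) : lb.-integrable `[0, 1] (EFin \o (fun=> c)).
  by apply: L1_itv => t; exact: cvg_cst.
have i1 := L1_itv cf; have i2 := L1_itv c2.
have iz : lb.-integrable `[0, 1] (EFin \o (fun t => 2 * m * f t)).
  by apply: L1_itv => t; apply: cvgM; [exact: cvg_cst|exact: cf].
have ib : lb.-integrable `[0, 1] (EFin \o (fun t => f t ^+ 2 - 2 * m * f t)).
  by apply: L1_itv => t; apply: cvgB; [exact: c2|apply: cvgM; [exact: cvg_cst|exact: cf]].
have : 0 <= \int[lb]_(t in `[0, 1]) (f t ^+ 2 - 2 * m * f t + m ^+ 2).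
  apply: Rintegral_ge0 => t _; rewrite (_ : _ + _ = (f t - m) ^+ 2) ?sqr_ge0 //; ring.
rewrite RintegralD // RintegralB // RintegralZl // Rintegral_cst // -/m.
have -> : fine (lb `[0%R, 1%R]) = 1.
  by rewrite (congr1 fine (lebesgue_measure_itv `[0, 1])) /= lte_fin ltr01 /= subr0.
rewrite mulr1; nra.
Qed.

End TriangleEstimates.

Lemma hess2_explicit (R : realType) (w : R * R -> R) x :
  hess2 w x = (pd 0 (pd 0 w) x ^+ 2 + pd 0 (pd 1 w) x ^+ 2) +
  (pd 1 (pd 0 w) x ^+ 2 + pd 1 (pd 1 w) x ^+ 2).
Proof. by []. Qed.

#[local] Opaque pd hess2.

(** * Tonelli's theorem on product sets *)

Section TonelliOnSets.
Local Open Scope ereal_scope.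
Context d1 d2 (T1 : measurableType d1) (T2 : measurableType d2) (R : realType).
Variable m1 : {sigma_finite_measure set T1 -> \bar R}.
Variable m2 : {sigma_finite_measure set T2 -> \bar R}.
Variables (A : set T1) (B : set T2) (f : T1 * T2 -> \bar R).
Hypotheses (mA : measurable A) (mB : measurable B).
Hypotheses (mf : measurable_fun (A `*` B) f) (f0 : forall z, (A `*` B) z -> 0 <= f z).

Let F := f \_ (A `*` B).

Let mF : measurable_fun setT F.
Proof. by apply/(measurable_restrictT _ _).1 => //; exact: measurableX. Qed.

Let F0 z : 0 <= F z.
Proof. by rewrite /F patchE; case: ifPn => // /set_mem; exact: f0. Qed.

Let F1 x : \int[m2]_y F (x, y) = ((fun x => \int[m2]_(y in B) f (x, y)) \_ A) x.
Proof.
rewrite patchE; case: ifPn => xA.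
  rewrite [RHS]integral_mkcond; apply: eq_integral => y _; rewrite /F !patchE.
  by congr (if _ then _ else _); rewrite in_setX xA.
rewrite -[RHS](integral0 m2 setT); apply: eq_integral => y _.
by rewrite /F patchE in_setX (negbTE xA).
Qed.

Let F2 y : \int[m1]_x F (x, y) = ((fun y => \int[m1]_(x in A) f (x, y)) \_ B) y.
Proof.
rewrite patchE; case: ifPn => yB.
  rewrite [RHS]integral_mkcond; apply: eq_integral => x _; rewrite /F !patchE.
  by congr (if _ then _ else _); rewrite in_setX yB andbT.
rewrite -[RHS](integral0 m1 setT); apply: eq_integral => x _.
by rewrite /F patchE in_setX (negbTE yB) andbF.
Qed.

Lemma tonelli_in :
  \int[m1]_(x in A) \int[m2]_(y in B) f (x, y) = \int[m2]_(y in B) \int[m1]_(x in A) f (x, y).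
Proof.
rewrite [LHS]integral_mkcond [RHS]integral_mkcond.
rewrite -(eq_integral _ _ (fun x _ => F1 x)) -(eq_integral _ _ (fun y _ => F2 y)).
exact: fubini_tonelli.
Qed.

Lemma measurable_tonelli_in : measurable_fun A (fun x => \int[m2]_(y in B) f (x, y)).
Proof.
apply/(measurable_restrictT _ _).2 => //.
rewrite (_ : _ \_ _ = fun x => \int[m2]_y F (x, y)).
  exact: measurable_fun_fubini_tonelli_F.
by apply/funext => x; rewrite F1.
Qed.

End TonelliOnSets.

Lemma jensen3 (R : realType) (a b c p q r : R) : 0 <= a -> 0 <= b -> 0 <= c -> a + b + c = 1 ->
  (a * p + b * q + c * r) ^+ 2 <= p ^+ 2 + q ^+ 2 + r ^+ 2.
Proof.
move=> a0 b0 c0 s.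
have -> : (a * p + b * q + c * r) ^+ 2 = (a + b + c) * (a * p ^+ 2 + b * q ^+ 2 + c * r ^+ 2)
   - (a * b * (p - q) ^+ 2 + a * c * (p - r) ^+ 2 + b * c * (q - r) ^+ 2) by ring.
have h1 : 0 <= a * b * (p - q) ^+ 2 by rewrite mulr_ge0 ?sqr_ge0 ?mulr_ge0.
have h2 : 0 <= a * c * (p - r) ^+ 2 by rewrite mulr_ge0 ?sqr_ge0 ?mulr_ge0.
have h3 : 0 <= b * c * (q - r) ^+ 2 by rewrite mulr_ge0 ?sqr_ge0 ?mulr_ge0.
rewrite s mul1r; have := sqr_ge0 p; have := sqr_ge0 q; have := sqr_ge0 r; nra.
Qed.

(** * An L^2 Taylor estimate on triangles *)

Section Lebesgue2.
Context {R : realType}.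
Notation mu := (@mu2 R).
Notation lb := (@lebesgue_measure R).
Implicit Types (x y v : R * R) (K : triangle R) (u w : R * R -> R).

Lemma mu2_sigma_finite : sigma_finite setT mu.
Proof.
exists (fun n => box (- n%:R) n%:R (- n%:R) n%:R).
  apply/seteqP; split => // x _.
  have [n hn] : exists n : nat, Num.max `|x.1| `|x.2| < n%:R.
    by exists (Num.truncn (Num.max `|x.1| `|x.2|)).+1; rewrite truncnS_gt.
  exists n => //; move: hn; rewrite gt_max => /andP[]; rewrite !ltr_norml => h1 h2.
  by split; rewrite /= in_itv.
move=> n; split; first exact: measurable_box.
by rewrite mu2_box ?ltry // ge0_cp.
Qed.

(** The plane measure packed together with its sigma-finiteness, as Tonelli's theorem with a plane
    factor requires. *)
Definition mu2s : {sigma_finite_measure set (Pl R) -> \bar R} :=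
  HB.pack (Measure.sort mu) (Measure.class mu) (Measure_isSigmaFinite.Build _ _ _ mu mu2_sigma_finite).

Lemma tonelli_plane_itv D (f : Pl R * R -> \bar R) : measurable D ->
  measurable_fun setT f -> (forall z, (0 <= f z)%E) ->
  (\int[mu]_(x in D) \int[lb]_(t in `[0%R, 1%R]) f (x, t) =
   \int[lb]_(t in `[0%R, 1%R]) \int[mu]_(x in D) f (x, t))%E.
Proof.
move=> mD mf f0; apply: (@tonelli_in _ _ _ _ _ mu2s lb) => //.
exact: measurable_funTS.
Qed.

Lemma tonelli_plane D D' (f : Pl R * Pl R -> \bar R) : measurable D -> measurable D' ->
  measurable_fun (D `*` D') f -> (forall z, (D `*` D') z -> (0 <= f z)%E) ->
  (\int[mu]_(x in D) \int[mu]_(y in D') f (x, y) =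
   \int[mu]_(y in D') \int[mu]_(x in D) f (x, y))%E.
Proof. by move=> mD mD' mf f0; exact: (@tonelli_in _ _ _ _ _ mu2s mu2s). Qed.

Lemma taylor_sq w x v : cinf w ->
  (w (x + v) - w x - 'D_v w x) ^+ 2 <=
  en v ^+ 4 * \int[lb]_(t in `[0, 1]) ((1 - t) ^+ 2 * hess2 w (x + t *: v)).
Proof.
move=> cw; rewrite (taylor2 _ _ cw).
have c1 : continuous (fun t : R => 1 - t).
  by move=> t; apply: cvgB; [exact: cvg_cst|exact: cvg_id].
have cl u : continuous u -> continuous (fun t : R => u (x + t *: v)).
  move=> cu t; apply: (@continuous_comp _ _ _ (fun t : R => x + t *: v) u); last exact: cu.
  exact: line_continuous.
have cdd := cinf_continuous (cinf_derive v (cinf_derive v cw)).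
have cf : continuous (fun t : R => (1 - t) * 'D_v (fun y => 'D_v w y) (x + t *: v)).
  by move=> t; apply: cvgM; [exact: c1|exact: (cl _ cdd)].
apply: le_trans (Rintegral_itv_sq cf) _.
have ch : continuous (fun t : R => (1 - t) ^+ 2 * hess2 w (x + t *: v)).
  move=> t; apply: cvgM; first by apply: (@cvgM _ _ _ _ (fun t : R => 1 - t) (fun t : R => 1 - t)); exact: c1.
  exact: (cl _ (hess2_continuous cw)).
have ce : continuous (fun t : R => en v ^+ 4 * ((1 - t) ^+ 2 * hess2 w (x + t *: v))).
  by move=> t; apply: cvgM; [exact: cvg_cst|exact: ch].
have cf2 : continuous (fun t : R => ((1 - t) * 'D_v (fun y => 'D_v w y) (x + t *: v)) ^+ 2).
  by move=> t; apply: (@cvgM _ _ _ _ (fun t : R => (1 - t) * 'D_v (fun y => 'D_v w y) (x + t *: v))); exact: cf.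
rewrite -(RintegralZl _ _ (L1_itv ch)) //.
apply: (le_Rintegral _ (L1_itv cf2) (L1_itv ce)) => // t _.
by rewrite exprMn [leRHS]mulrCA ler_wpM2l ?sqr_ge0 ?derive2_le.
Qed.

Lemma measurable_line_comp d (T : measurableType d) (a : T -> R) (b : T -> Pl R)
    (h : R * R -> R) (z : R * R) : continuous h ->
  measurable_fun setT a -> measurable_fun setT b ->
  measurable_fun setT (fun q => ((1 - a q) ^+ 2 * h ((b q : R * R) + a q *: (z - b q)))%:E).
Proof.
move=> ch ma mb; apply/measurable_EFinP.
have mb1 : measurable_fun setT (fun q => (b q).1) by exact: (measurableT_comp measurable_fst).
have mb2 : measurable_fun setT (fun q => (b q).2) by exact: (measurableT_comp measurable_snd).
apply: measurable_funM; first by apply: measurable_funX; exact: measurable_funB.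
have mh : measurable_fun setT (h : Pl R -> R) by apply: continuous_measurable2.
apply: (measurableT_comp mh); apply/measurable_fun_pairP; split => /=.
  by apply: measurable_funD => //; apply: measurable_funM => //; exact: measurable_funB.
by apply: measurable_funD => //; apply: measurable_funM => //; exact: measurable_funB.
Qed.

(** The homothety of ratio 1 - t about a vertex maps the triangle into itself, and its Jacobian is
    exactly the weight (1 - t)^2 that the squared Taylor remainder carries. At t = 1 the map is
    constant and the weight is 0. *)
Lemma Int_shrink K i (h : R * R -> R) (t : R) : det K != 0 -> continuous h -> (forall x, 0 <= h x) ->
  0 <= t <= 1 ->
  (\int[mu]_(x in (tri K)°) ((1 - t) ^+ 2 * h (x + t *: (K i - x)))%:E <=
   \int[mu]_(x in (tri K)°) (h x)%:E)%E.
Proof.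
move=> d0 ch h0 /andP[t0 t1].
have mK := measurable_tri K.
have mh : measurable_fun (tri K)° (h : Pl R -> R) by apply: continuous_measurable2.
have [->|tn] := eqVneq t 1.
  rewrite integral0_eq ?integral_ge0 // => x _; last by rewrite subrr expr0n mul0r.
  by rewrite lee_fin.
have t1' : 0 < 1 - t by rewrite subr_gt0 lt_neqAle tn.
have D0 : (1 - t) * (1 - t) - 0 * 0 != 0 by rewrite mul0r subr0 mulf_neq0 ?gt_eqF.
have mhE : measurable_fun (tri K)° (fun x : Pl R => (h x)%:E) by exact/measurable_EFinP.
have := integral_affine2_in (t * (K i).1) (t * (K i).2) D0 mK mhE.
set A := affine2 _ _ _ _ _ _ => ->; last by move=> x _; rewrite lee_fin.
have AE x : A x = x + t *: (K i - x).
  rewrite /A /affine2; apply/pair_equal_spec; split; rewrite /= -![_ *: _]/(_ * _); ring.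
rewrite mul0r subr0 ger0_norm ?mulr_ge0 ?(ltW t1') // -ge0_integralZl //; last 4 first.
- exact: measurable_affine2_preimage.
- apply/measurable_EFinP; apply: (measurable_funS measurableT) => //.
  by apply: (measurableT_comp _ (measurable_affine2 _ _ _ _ _ _)); exact: continuous_measurable2.
- by move=> x _; rewrite lee_fin.
- by rewrite lee_fin mulr_ge0 // ltW.
apply: (@le_trans _ _ (\int[mu]_(x in (tri K)°) (((1 - t) * (1 - t))%:E * (h (A x))%:E))%E).
  by rewrite le_eqVlt; apply/orP; left; apply/eqP/eq_integral => x _; rewrite AE -EFinM -expr2.
apply: ge0_subset_integral => //.
- exact: measurable_affine2_preimage.
- apply: emeasurable_funM => //; apply/measurable_EFinP; apply: (measurable_funS measurableT) => //.
  by apply: (measurableT_comp _ (measurable_affine2 _ _ _ _ _ _)); exact: continuous_measurable2.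
- by move=> x _; rewrite lee_fin; apply: mulr_ge0; [exact: sqr_ge0|exact: h0].
move=> x /(interior_triP _ d0) hx; apply/(interior_triP _ d0) => j.
rewrite AE lam_line -lamB lam_vertex //; have := hx j.
by case: (j == i) => /=; nra.
Qed.

(* Expand around x in the direction of the three vertices; the barycentric
   combination of the expansions cancels the gradient of w. *)
Lemma L2_taylor K w : det K != 0 -> cinf w -> (forall i, w (K i) = 0) ->
  Int (tri K)° (fun x => w x ^+ 2) <= 3 * diam (tri K) ^+ 4 * Int (tri K)° (hess2 w).
Proof.
move=> d0 cw w0; have mK := measurable_tri K.
have cw2 : continuous (fun x => w x ^+ 2).
  by apply: cinf_continuous; exact: (cinfM cw cw).
have ch := hess2_continuous cw; have h0 := hess2_ge0 w.
pose g i x := \int[lb]_(t in `[0, 1]) ((1 - t) ^+ 2 * hess2 w (x + t *: (K i - x))).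
have g0 i x : 0 <= g i x.
  by apply: Rintegral_ge0 => t _; apply: mulr_ge0; [exact: sqr_ge0|exact: h0].
have cl i x : continuous (fun t : R => (1 - t) ^+ 2 * hess2 w (x + t *: (K i - x))).
  move=> t; apply: cvgM.
    by apply: (@cvgM _ _ _ _ (fun t : R => 1 - t) (fun t : R => 1 - t)); apply: cvgB; [exact: cvg_cst|exact: cvg_id|exact: cvg_cst|exact: cvg_id].
  apply: (@continuous_comp _ _ _ (fun t : R => x + t *: (K i - x)) (hess2 w)); last exact: ch.
  exact: line_continuous.
have gE i x : (g i x)%:E = (\int[lb]_(t in `[0%R, 1%R]) ((1 - t) ^+ 2 * hess2 w (x + t *: (K i - x)))%:E)%E.
  by rewrite /g /Rintegral fineK //; apply: integrable_fin_num => //; exact: L1_itv.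
have pt x : (tri K)° x -> w x ^+ 2 <= diam (tri K) ^+ 4 * \sum_i g i x.
  move=> intx; have hx := (interior_triP _ d0).1 intx.
  have tx : tri K x by exact: interior_subset.
  pose r i := w (x + (K i - x)) - w x - 'D_(K i - x) w x.
  have rs i : r i ^+ 2 <= diam (tri K) ^+ 4 * g i x.
    apply: le_trans (taylor_sq _ _ cw) _; apply: ler_wpM2r; first exact: g0.
    rewrite lerXn2r ?nnegrE ?en_ge0 ?(ltW (diam_gt0 d0)) //.
    by apply: tri_diam => //; exact: tri_vertex.
  have -> : w x = - \sum_i lam K i x * r i.
    have rE i : r i = - w x - ((K i - x).1 * pd 0 w x + (K i - x).2 * pd 1 w x).
      by rewrite /r [x + _]addrC subrK w0 sub0r derive_pd //; exact: cinf_diff.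
    have := sum_lam x d0; have := sum_lam_vertex x d0.
    rewrite !sum3 !rE; move: (lam K 0 x) (lam K 1 x) (lam K o2 x) => a b c.
    move: (w x) (pd 0 w x) (pd 1 w x) => q p1 p2 e s.
    have e1 : a * (K 0).1 + b * (K 1).1 + c * (K o2).1 = x.1 by rewrite -e.
    have e2 : a * (K 0).2 + b * (K 1).2 + c * (K o2).2 = x.2 by rewrite -e.
    rewrite /=; rewrite [RHS](_ : _ = (a + b + c) * q + p1 * ((a * (K 0).1 + b * (K 1).1 + c * (K o2).1) - (a + b + c) * x.1) + p2 * ((a * (K 0).2 + b * (K 1).2 + c * (K o2).2) - (a + b + c) * x.2)).
      by rewrite e1 e2 s !mul1r !subrr !mulr0 !addr0.
    ring.
  rewrite sqrrN; apply: (@le_trans _ _ (\sum_i r i ^+ 2)); last first.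
    by rewrite mulr_sumr; apply: ler_sum => i _; exact: rs.
  have l0 i := ltW (hx i); have := sum_lam x d0; have l00 := l0 0; have l01 := l0 1; have l02 := l0 o2.
  rewrite !sum3; move: l00 l01 l02; move: (lam K 0 x) (lam K 1 x) (lam K o2 x) (r 0) (r 1) (r o2).
  exact: jensen3.
have lhs := Int_EFin mK (tri_L1 K cw2).
have rhs := Int_EFin mK (tri_L1 K ch).
rewrite -lee_fin -lhs.
have dg := diam_gt0 d0.
have mg i : measurable_fun (tri K)° (fun x : Pl R => (g i x)%:E).
  under eq_fun do rewrite gE.
  apply: (@measurable_tonelli_in _ _ _ _ _ lb _ _ (fun q : Pl R * R => ((1 - q.2) ^+ 2 * hess2 w (q.1 + q.2 *: (K i - q.1)))%:E)) => //.
  - by apply: measurable_funTS; apply: measurable_line_comp.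
  - by move=> z _; rewrite lee_fin; apply: mulr_ge0; [exact: sqr_ge0|exact: h0].
have ig i : (\int[mu]_(x in (tri K)°) (g i x)%:E <= (Int (tri K)° (hess2 w))%:E)%E.
  under eq_integral do rewrite gE.
  (* With t outside, the inner integral is the one of [Int_shrink]. *)
  rewrite (@tonelli_plane_itv _ (fun q : Pl R * R => ((1 - q.2) ^+ 2 * hess2 w (q.1 + q.2 *: (K i - q.1)))%:E)) //; last 2 first.
  - by apply: measurable_line_comp.
  - by move=> z; rewrite lee_fin; apply: mulr_ge0; [exact: sqr_ge0|exact: h0].
  rewrite -rhs.
  apply: (@le_trans _ _ (\int[lb]_(t in `[0%R, 1%R]) cst (\int[mu]_(x in (tri K)°) (hess2 w x)%:E) t)%E).
    apply: ge0_le_integral => //.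
    - by move=> t _; apply: integral_ge0 => x _; rewrite lee_fin; apply: mulr_ge0; [exact: sqr_ge0|exact: h0].
    - apply: (@measurable_tonelli_in _ _ _ _ _ mu2s _ _ (fun q : R * Pl R => ((1 - q.1) ^+ 2 * hess2 w (q.2 + q.1 *: (K i - q.2)))%:E)) => //.
      + by apply: measurable_funTS; apply: measurable_line_comp.
      + by move=> q _; rewrite lee_fin; apply: mulr_ge0; [exact: sqr_ge0|exact: h0].
    - by move=> t; rewrite /= in_itv /= => ht; exact: Int_shrink.
  by rewrite integral_cst //= (lebesgue_measure_itv `[0, 1]) /= lte_fin ltr01 oppr0 adde0 mule1.
apply: (@le_trans _ _ (\int[mu]_(x in (tri K)°) ((diam (tri K) ^+ 4)%:E * \sum_i (g i x)%:E))%E).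
  apply: ge0_le_integral => //.
  - by move=> x _; rewrite lee_fin sqr_ge0.
  - by apply/measurable_EFinP; exact: continuous_measurable2.
  - by apply: emeasurable_funM => //; exact: emeasurable_sum.
  - by move=> x hx; rewrite sumEFin -EFinM lee_fin pt.
rewrite ge0_integralZl //; last 3 first.
- exact: emeasurable_sum.
- by move=> x _; rewrite sume_ge0 // => i _; rewrite lee_fin.
- by rewrite lee_fin exprn_ge0 // ltW.
rewrite ge0_integral_sum //; last by move=> i x _; rewrite lee_fin.
have -> : (3 * diam (tri K) ^+ 4 * Int (tri K)° (hess2 w))%:E =
    ((diam (tri K) ^+ 4)%:E * (3 * Int (tri K)° (hess2 w))%:E)%E.
  by rewrite -EFinM; congr EFin; move: (Int _ _) => I; ring.
rewrite lee_pmul2l ?lte_fin ?exprn_gt0 //.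
apply: (@le_trans _ _ (\sum_(i < 3) (Int (tri K)° (hess2 w))%:E)%E).
  by apply: lee_sum => i _; exact: ig.
by rewrite sumEFin lee_fin sumr_const card_ord mulr_natl.
Qed.

End Lebesgue2.

(** * Deviation from the mean *)

Section Oscillation.
Context {R : realType}.
Notation mu := (@mu2 R).
Implicit Types (x y v : R * R) (D : set (Pl R)) (g : R * R -> R).

Lemma L2_cst D (c : R) : measurable D -> (mu D < +oo)%E -> L2 D (fun=> c).
Proof. by move=> mD fD; split; [exact: measurable_cst|exact: L1_cst]. Qed.

Lemma L2_L1 D g : measurable D -> (mu D < +oo)%E -> L2 D g -> L1 D g.
Proof.
move=> mD fD hg; have := L2_mul mD hg (L2_cst 1 mD fD).
by under eq_fun do rewrite mulr1.
Qed.

(** Integrate X^2 >= 2 c X - c^2 over y, where X = g x - g y has the mean value c. *)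
Lemma osc_pt D g (x : R * R) : measurable D -> (mu D < +oo)%E -> 0 < fine (mu D) -> L2 D g ->
  fine (mu D) * (g x - Int D g / fine (mu D)) ^+ 2 <= Int D (fun y => (g x - g y) ^+ 2).
Proof.
move=> mD fD a0 hg; set a := fine (mu D); set c := g x - _.
have Lg := L2_L1 mD fD hg.
have Lc k : L1 D (fun=> k) by exact: L1_cst.
have L2d : L2 D (fun y => g x - g y) by apply: L2B => //; exact: L2_cst.
have Ld := L2_L1 mD fD L2d.
apply: (@le_trans _ _ (Int D (fun y => 2 * c * (g x - g y) - c ^+ 2))); last first.
  apply: le_Int => //.
  - by apply: L1B => //; exact: L1Z.
  - exact: L2_L1sq.
  - by move=> y _; have := sqr_ge0 (g x - g y - c); nra.
rewrite IntB //; last exact: L1Z.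
rewrite IntZ // IntB // !Int_cst // -/a.
have -> : Int D g = a * (g x - c) by rewrite /c subKr mulrC divfK // gt_eqF.
by rewrite le_eqVlt; apply/orP; left; apply/eqP; ring.
Qed.

Lemma measurable_comp_fst D D' g : measurable D -> measurable D' -> measurable_fun D g ->
  measurable_fun (D `*` D') (fun q : Pl R * Pl R => g q.1).
Proof.
move=> mD mD' mg; apply: (measurable_comp mD _ mg).
  by move=> _ [[a b] [/= h _] <-].
by apply: measurable_funTS; exact: measurable_fst.
Qed.

Lemma measurable_comp_snd D D' g : measurable D -> measurable D' -> measurable_fun D' g ->
  measurable_fun (D `*` D') (fun q : Pl R * Pl R => g q.2).
Proof.
move=> mD mD' mg; apply: (measurable_comp mD' _ mg).
  by move=> _ [[a b] [/= _ h] <-].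
by apply: measurable_funTS; exact: measurable_snd.
Qed.

Lemma measurable_diff_sq D g : measurable D -> measurable_fun D g ->
  measurable_fun (D `*` D) (fun q : Pl R * Pl R => (g q.1 - g q.2) ^+ 2).
Proof.
move=> mD mg; apply: measurable_funX; apply: measurable_funB.
  exact: measurable_comp_fst.
exact: measurable_comp_snd.
Qed.

Lemma oscillation D g : measurable D -> (mu D < +oo)%E -> 0 < fine (mu D) -> L2 D g ->
  ((fine (mu D) * Int D (fun x => (g x - Int D g / fine (mu D)) ^+ 2))%:E <=
   \int[mu]_(x in D) \int[mu]_(y in D) ((g x - g y) ^+ 2)%:E)%E.
Proof.
move=> mD fD a0 hg.
have L2d k : L2 D (fun y => k - g y) by apply: L2B => //; exact: L2_cst.
have L2m : L2 D (fun x => g x - Int D g / fine (mu D)) by apply: L2B => //; exact: L2_cst.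
have Lm := L2_L1sq L2m.
have m1 : measurable_fun D (fun x => ((g x - Int D g / fine (mu D)) ^+ 2)%:E).
  by apply/measurable_EFinP; exact: L1_measurable Lm.
have k0 : (0 <= (fine (mu D))%:E)%E by rewrite lee_fin ltW.
have n0 : forall x, D x -> (0 <= ((g x - Int D g / fine (mu D)) ^+ 2)%:E)%E.
  by move=> x _; rewrite lee_fin sqr_ge0.
rewrite EFinM -Int_EFin // -ge0_integralZl //.
apply: ge0_le_integral => //.
- by move=> x _; rewrite -EFinM lee_fin mulr_ge0 ?sqr_ge0 // ltW.
- by apply: emeasurable_funM => //; apply/measurable_EFinP; exact: L1_measurable Lm.
- apply: (@measurable_tonelli_in _ _ _ _ _ mu2s _ _ (fun q : Pl R * Pl R => ((g q.1 - g q.2) ^+ 2)%:E)) => //.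
  + by apply/measurable_EFinP; apply: measurable_diff_sq => //; exact: L2_measurable hg.
  + by move=> q _; rewrite lee_fin sqr_ge0.
- move=> x Dx; rewrite Int_EFin //; last exact: L2_L1sq.
  by rewrite -EFinM lee_fin osc_pt.
Qed.

(** In n equal steps the linear terms add up to A and the quadratic ones to B / n. This avoids
    differentiating an integral with respect to a translation. *)
Lemma lipschitz_from_local (F : R -> R) (A B : R) : 0 <= A -> 0 <= B ->
  (forall t e : R, 0 <= t -> 0 <= e -> t + e <= 1 -> `|F (t + e) - F t| <= e * A + e ^+ 2 * B) ->
  `|F 1 - F 0| <= A.
Proof.
move=> A0 B0 H; apply/ler_addgt0Pr => e e0.
pose n := (Num.truncn (B / e)).+1.
have nB : B / e < n%:R by exact: truncnS_gt.
have n0 : 0 < n%:R :> R by rewrite ltr0n.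
have step k : (k <= n)%N -> `|F (k%:R / n%:R) - F 0| <= k%:R / n%:R * (A + B / n%:R).
  elim: k => [|k IH] kn; first by rewrite mul0r subrr normr0 mul0r.
  have E : k.+1%:R / n%:R = k%:R / n%:R + n%:R^-1 :> R by rewrite -[in LHS]natr1 mulrDl mul1r.
  rewrite E -(subrKA (F (k%:R / n%:R))); apply: le_trans (ler_normD _ _) _.
  have h := IH (ltnW kn).
  have h2 : `|F (k%:R / n%:R + n%:R^-1) - F (k%:R / n%:R)| <= n%:R^-1 * A + n%:R^-1 ^+ 2 * B.
    apply: H; rewrite ?divr_ge0 ?invr_ge0 ?(ltW n0) // -E ler_pdivrMr // mul1r ler_nat //.
  rewrite mulrDl [leRHS]addrC; apply: lerD => //; apply: le_trans h2 _.
  by rewrite le_eqVlt; apply/orP; left; apply/eqP; rewrite mulrDr; ring.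
have := step n (leqnn n); rewrite divff ?gt_eqF // mul1r => h.
apply: le_trans h _; rewrite lerD2l ler_pdivrMr // mulrC -ler_pdivrMr //; exact: ltW.
Qed.

End Oscillation.

(** * Translations and a Poincare inequality on convex sets *)

Section Translation.
Context {R : realType}.
Notation mu := (@mu2 R).
Implicit Types (x y v : R * R) (g : R * R -> R).

Lemma shift_affine2 (v : R * R) : (fun x => x + v) = affine2 1 0 0 1 v.1 v.2 :> (Pl R -> Pl R).
Proof. by apply/funext => x; rewrite /affine2 !mul1r !mul0r addr0 add0r. Qed.

Lemma det1 : 1 * 1 - 0 * 0 != 0 :> R. Proof. by rewrite mulr1 mulr0 subr0 oner_eq0. Qed.

Lemma Int_shift (D : set (Pl R)) g v : measurable D -> L1 D g ->
  Int D g = Int [set x : R * R | D (x + v)] (fun x => g (x + v)).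
Proof.
move=> mD hg; rewrite (Int_affine2 v.1 v.2 det1 mD hg) mulr1 mulr0 subr0 normr1 mul1r.
by rewrite -shift_affine2.
Qed.

Lemma L2_shift (D : set (Pl R)) g v : measurable D -> L2 D g ->
  L2 [set x : R * R | D (x + v)] (fun x => g (x + v)).
Proof.
move=> mD [mg ig].
have m := measurable_affine2 1 0 0 1 v.1 v.2; have := affine2_L1 v.1 v.2 det1 mD ig.
rewrite -shift_affine2 in m * => i; split => //.
apply: (measurable_comp mD _ mg); first by move=> _ [x /= h <-].
exact: measurable_funTS.
Qed.

Lemma test_bounded D q : test_function D q -> exists2 M : R, 0 < M & forall x, `|q x| <= M.
Proof.
move=> tq; have cq := cinf_continuous (test_cinf tq); case: tq => _ [C [cC _ hC]].
have [M M0 HM] := continuous_bounded cq (compact_bounded cC).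
exists M => // x; have [Cx|nCx] := pselect (C x); first exact: HM.
by rewrite hC // normr0 ltW.
Qed.

Variables (K : set (R * R)).
Hypotheses (oK : open K) (bK : bounded_set K).
Hypothesis cK : forall x y (t : R), K x -> K y -> 0 <= t <= 1 -> K (x + t *: (y - x)).

Let mK : measurable (K : set (Pl R)). Proof. exact: open_measurable2. Qed.

Let fK : (mu K < +oo)%E. Proof. exact: mu2_bounded_lty. Qed.

(** The points where the difference g (x + v) - g x makes sense. *)
Let Kv v : set (R * R) := [set x | K x /\ K (x + v)].

Let oKv v : open (Kv v).
Proof.
rewrite (_ : Kv v = K `&` [set x | K (x + v)]) //; apply: openI => //.
rewrite (_ : [set x | _] = (fun x => x + v) @^-1` K) //; apply: open_comp => // x _.
by apply: cvgD; [exact: cvg_id|exact: cvg_cst].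
Qed.

Let bKv v : bounded_set (Kv v).
Proof. by case: bK => M [Mr HM]; exists M; split => // r hr x [Kx _]; exact: (HM r hr). Qed.

(** Convexity: a support whose points x have both x and x + v in [K] stays in [K] when moved by t v
    with 0 <= t <= 1. *)
Lemma test_translate v q (t : R) : test_function (Kv v) q -> 0 <= t <= 1 ->
  test_function K (fun y => q (y + (- (t *: v)))).
Proof.
move=> tq ht; have cq := test_cinf tq; case: tq => _ [C [cC CK hC]]; split.
  by apply/smooth_cinf; exact: cinf_shift.
exists ((fun x => x + t *: v) @` C); split.
- apply: continuous_compact => //; apply: continuous_subspaceT => x.
  by apply: cvgD; [exact: cvg_id|exact: cvg_cst].
- move=> _ [x /CK[Kx Kxv] <-]; have := cK Kx Kxv ht.
  by rewrite [x + v]addrC addrK.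
- move=> x nx; apply: hC => Cx; apply: nx; exists (x - t *: v) => //.
  by rewrite subrK.
Qed.

Lemma derive_taylor1 q v (M : R) (z : R * R) (e : R) : cinf q -> 0 <= e ->
  (forall x, `|'D_v (fun y => 'D_v q y) x| <= M) ->
  `|q (z - e *: v) - q z + e * 'D_v q z| <= e ^+ 2 * M.
Proof.
move=> cq e0 hM.
have dN (w : R * R -> R) (c : R) x : cinf w -> 'D_(c *: v) w x = c * 'D_v w x.
  by move=> cw; have dw := cinf_diff x cw; rewrite !derive_pd //= -!mulrA -mulrDr.
have [s hs] := line_MVT z (- (e *: v)) cq; rewrite -scaleNr dN // => ->.
have cd := cinf_derive v cq.
have [r hr] := line_MVT z ((s * - e) *: v) cd; rewrite dN // scalerA => E.
rewrite scalerA [X in `|X|](_ : _ = (- e) * ('D_v q (z + (s * - e) *: v) - 'D_v q z)); last by ring.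
rewrite E !normrM normrN; case/andP: hs => s0 s1.
rewrite (ger0_norm e0) (ger0_norm s0).
have M0 : 0 <= M by apply: le_trans (normr_ge0 _) (hM 0).
rewrite expr2 -!mulrA; apply: ler_wpM2l => //.
rewrite mulrCA; apply: ler_wpM2l => //.
by rewrite -[leRHS]mul1r; apply: ler_pM => //; exact: hM.
Qed.

Variables (g g1 g2 : R * R -> R).
Hypotheses (hg : L2 K g) (hg1 : L2 K g1) (hg2 : L2 K g2).
Hypotheses (w1 : weak_derivative K (1, 0)%N g g1) (w2 : weak_derivative K (0, 1)%N g g2).

Let N v := `|v.1| * L2norm K g1 + `|v.2| * L2norm K g2.

Lemma weak_derive_bound q v : test_function K q ->
  `|ip K g (fun y => 'D_v q y)| <= N v * L2norm K q.
Proof.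
move=> tq; have cq := test_cinf tq.
have L i : L2 K (pd i q) by apply: (test_L2 (D := K)) => //; exact: pd_test.
have Lq : L2 K q by exact: (test_L2 (D := K)).
have -> : ip K g (fun y => 'D_v q y) = v.1 * ip K g (pd 0 q) + v.2 * ip K g (pd 1 q).
  rewrite (derive_pdE v cq) (ipDr mK (L2Z _ mK (L 0)) (L2Z _ mK (L 1)) hg).
  by congr (_ + _); [exact: (ipZr _ mK (L 0) hg)|exact: (ipZr _ mK (L 1) hg)].
have e1 : ip K g (pd 0 q) = - ip K g1 q by have := w1 tq; rewrite /Dclassical /= expr1 mulN1r.
have e2 : ip K g (pd 1 q) = - ip K g2 q by have := w2 tq; rewrite /Dclassical /= expr1 mulN1r.
rewrite e1 e2; apply: le_trans (ler_normD _ _) _; rewrite !normrM !normrN /N mulrDl -!mulrA.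
by apply: lerD; apply: ler_wpM2l => //; exact: ip_norm_le.
Qed.

(** By duality it is enough to test with q. Moving q along t v leads from the product of g with q to
    the product of g (x + v) with q, and the rate of change is the product of g with a directional
    derivative of a test function, bounded by the weak derivatives. *)
Lemma translation_bound v : L2norm (Kv v) (fun x => g (x + v) - g x) <= N v.
Proof.
have N0 : 0 <= N v by rewrite /N addr_ge0 // mulr_ge0 ?L2norm_ge0.
have mKv : measurable (Kv v : set (Pl R)) by apply: open_measurable2.
have mKs : measurable ([set x | K (x + v)] : set (Pl R)).
  by apply: open_measurable2; rewrite (_ : [set x | _] = (fun x => x + v) @^-1` K) //;
    apply: open_comp => // x _; apply: cvgD; [exact: cvg_id|exact: cvg_cst].
have Lgs := L2_shift v mK hg.
have Lgv : L2 (Kv v) (fun x => g (x + v)) by apply: L2S Lgs => // x [].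
have Lgk : L2 (Kv v) g by apply: L2S hg => // x [].
apply: (test_ip_bound (D := Kv v)) => //; first exact: L2B.
move=> q tq; have cq := test_cinf tq.
have Lq : L2 (Kv v) q by exact: test_L2 tq.
have LqK : L2 K q by exact: test_L2 tq.
pose qt (t : R) y := q (y + (- (t *: v))).
have tqt t : 0 <= t <= 1 -> test_function K (qt t) by exact: test_translate.
pose F t := ip K g (qt t).
have F0 : F 0 = ip (Kv v) g q.
  rewrite /F (_ : qt 0 = q); last by apply/funext => y; rewrite /qt scale0r subr0.
  by rewrite (ip_test_subset (A := Kv v) (D := K)) // => x [].
have L2qt t : 0 <= t <= 1 -> L2 K (qt t) by move=> /tqt; exact: test_L2.
have F1 : F 1 = ip (Kv v) (fun x => g (x + v)) q.
  rewrite /F ipE (Int_shift v mK); last by apply: L2_mul => //; apply: L2qt; rewrite ler01 lexx.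
  rewrite (eq_Int (v := fun x => g (x + v) * q x)); last first.
    by move=> x _; rewrite /qt scale1r addrK.
  rewrite ipE [LHS]Int_mkcond [RHS]Int_mkcond; apply: eq_Int => x _.
  rewrite !patchE; case: ifPn => h1; case: ifPn => h2 //.
    rewrite (test_notin tq) ?mulr0 // => h; move/negP: h2; apply; exact: mem_set.
  by move/negP: h1; case; apply/mem_set; have /set_mem[] := h2.
have nqt t : L2norm K (qt t) <= L2norm (Kv v) q.
  rewrite ler_sqrt ?ip_ge0 // !ipE.
  have LT : L1 setT (fun x => q x * q x) by apply: L2_mul => //; exact: test_L2 tq.
  have -> : Int (Kv v) (fun x => q x * q x) = Int setT (fun x => q x * q x).
    by rewrite (Int_setT_of_zero (A := Kv v)) // => x nx; rewrite (test_notin tq) ?mulr0.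
  rewrite (Int_shift (- (t *: v)) measurableT LT).
  have [_ h] := L2_shift (- (t *: v)) measurableT (test_L2 measurableT tq).
  have E : [set x : R * R | [set: Pl R] (x + (- (t *: v)))] = setT by apply/seteqP; split.
  rewrite E in h *; by apply: Int_subset_le => // x _; rewrite -expr2 sqr_ge0.
have [M M0 HM] := test_bounded (test_derive v (test_derive v tq)).
have Lg := L2_L1 mK fK hg.
have Lag : L1 K (fun x => `|g x|).
  exact: (integrable_abse Lg).
rewrite (ipBl mKv Lgv Lgk Lq) -F0 -F1.
apply: (@lipschitz_from_local _ F _ (M * Int K (fun x => `|g x|))).
- by rewrite mulr_ge0 ?L2norm_ge0.
- by rewrite mulr_ge0 ?(ltW M0) // Int_ge0.
move=> t e t0 e0 te.
have ht : 0 <= t <= 1 by rewrite t0 /=; apply: le_trans te; rewrite lerDl.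
have hte : 0 <= t + e <= 1 by rewrite te andbT addr_ge0.
have Dq : (fun y => 'D_v (qt t) y) = (fun y => 'D_v q (y + (- (t *: v)))).
  by apply/funext => y; exact: derive_shiftE.
have Ld : L2 K (fun y => 'D_v (qt t) y) := test_L2 mK (test_derive v (tqt t ht)).
pose rho y := qt (t + e) y - qt t y + e * 'D_v (qt t) y.
have Lr : L2 K rho := L2D mK (L2B mK (L2qt _ hte) (L2qt _ ht)) (L2Z e mK Ld).
have E : F (t + e) - F t = ip K g rho - e * ip K g (fun y => 'D_v (qt t) y).
  have Lz : L2 K (fun y => e * 'D_v (qt t) y) := L2Z e mK Ld.
  have Lb : L2 K (fun y => qt (t + e) y - qt t y) := L2B mK (L2qt _ hte) (L2qt _ ht).
  rewrite (ipDr mK Lb Lz hg) (ipBr mK (L2qt _ hte) (L2qt _ ht) hg) (ipZr _ mK Ld hg).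
  by rewrite addrK.
rewrite E; apply: le_trans (ler_normB _ _) _; rewrite addrC; apply: lerD.
  rewrite normrM (ger0_norm e0) ler_wpM2l //; apply: le_trans (weak_derive_bound _ (tqt t ht)) _.
  exact: ler_wpM2l.
rewrite mulrA -IntZ // ipE.
have Lgr : L1 K (fun x => g x * rho x) by exact: L2_mul.
have LZ : L1 K (fun x => e ^+ 2 * M * `|g x|) by exact: L1Z.
have ub : forall x, K x -> `|g x * rho x| <= e ^+ 2 * M * `|g x|.
  move=> x _; rewrite normrM mulrC ler_wpM2r //.
  have := derive_taylor1 (x + - (t *: v)) cq e0 HM.
  have Dx := f_equal (fun w => w x) Dq.
  rewrite /rho Dx /qt (_ : x + - ((t + e) *: v) = x + - (t *: v) - e *: v) //.
  by rewrite scalerDl opprD addrA.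
rewrite ler_norml; apply/andP; split.
  rewrite -IntN //; apply: le_Int => //; first exact: L1N.
  by move=> x /ub; rewrite ler_norml => /andP[].
by apply: le_Int => // x /ub; rewrite ler_norml => /andP[].
Qed.

Variable d : R.
Hypotheses (d0 : 0 < d) (diamK : forall x y, K x -> K y -> en (y - x) <= d).

(** Substitute y = x + v and exchange the integrals: for each v the translation bound gives d^2
    (|g1| + |g2|)^2, and v ranges over a square of area 16 d^2. *)
Lemma poincare_double : 
  (\int[mu]_(x in K) \int[mu]_(y in K) ((g x - g y) ^+ 2)%:E <=
   (16 * d ^+ 4 * (L2norm K g1 + L2norm K g2) ^+ 2)%:E)%E.
Proof.
set S := L2norm K g1 + L2norm K g2.
have S0 : 0 <= S by rewrite addr_ge0 ?L2norm_ge0.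
pose gK : Pl R -> R := g \_ K.
have mgK : measurable_fun setT gK.
  by apply/(measurable_restrictT g mK); exact: L2_measurable hg.
have m1K : measurable_fun setT (\1_K : Pl R -> R) by exact: measurable_indic.
(* Extended by 0 and multiplied by an indicator, so that the integrand in (x, v) is measurable on
   the whole space. *)
pose f (q : Pl R * Pl R) := (gK q.1 - gK ((q.1 : R * R) + q.2)) ^+ 2 * \1_K ((q.1 : R * R) + q.2).
have f0 q : 0 <= f q by rewrite /f mulr_ge0 ?sqr_ge0 // indicE.
have ms : measurable_fun setT (fun q : Pl R * Pl R => ((q.1 : R * R) + q.2 : Pl R)).
  have p11 : measurable_fun setT (fun q : Pl R * Pl R => q.1.1).
    by apply: (measurableT_comp measurable_fst); exact: measurable_fst.
  have p12 : measurable_fun setT (fun q : Pl R * Pl R => q.1.2).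
    by apply: (measurableT_comp measurable_snd); exact: measurable_fst.
  have p21 : measurable_fun setT (fun q : Pl R * Pl R => q.2.1).
    by apply: (measurableT_comp measurable_fst); exact: measurable_snd.
  have p22 : measurable_fun setT (fun q : Pl R * Pl R => q.2.2).
    by apply: (measurableT_comp measurable_snd); exact: measurable_snd.
  by apply/measurable_fun_pairP; split; exact: measurable_funD.
have mf : measurable_fun setT f.
  apply: measurable_funM; last exact: measurableT_comp.
  apply: measurable_funX; apply: measurable_funB; first by apply: (measurableT_comp mgK); exact: measurable_fst.
  exact: measurableT_comp.
(* Half-side 2 d instead of d, because the box is open and differences may have length d. *)
pose B := box (- (2 * d)) (2 * d) (- (2 * d)) (2 * d).
have mB : measurable B by exact: measurable_box.
have inB v x : K x -> K (x + v) -> B v.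
  move=> Kx Kxv; have := diamK Kx Kxv; rewrite addrAC subrr add0r => h.
  have h1 := norm1_le_en v; have h2 := norm2_le_en v.
  have dd : d < 2 * d by rewrite mulr_natl mulr2n ltrDl.
  split; rewrite /= in_itv /= -ltr_norml.
    exact: le_lt_trans h1 (le_lt_trans h dd).
  exact: le_lt_trans h2 (le_lt_trans h dd).
have inner x : K x -> (\int[mu]_(y in K) ((g x - g y) ^+ 2)%:E = \int[mu]_(v in B) (f (x, v))%:E)%E.
  move=> Kx; have mi : measurable_fun K (fun y : Pl R => ((g x - g y) ^+ 2)%:E).
    apply/measurable_EFinP; apply: measurable_funX; apply: measurable_funB => //.
    exact: L2_measurable hg.
  have := integral_affine2_in x.1 x.2 det1 mK mi.
  have AE (v : Pl R) : affine2 1 0 0 1 x.1 x.2 v = (x : R * R) + v.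
    by rewrite -shift_affine2 addrC.
  move=> ->; last by move=> y _; rewrite lee_fin sqr_ge0.
  rewrite mulr1 mulr0 subr0 normr1 mul1e.
  rewrite [LHS]integral_mkcond [RHS]integral_mkcond; apply: eq_integral => v _.
  rewrite !patchE; case: ifPn => [/set_mem /= h|h].
    rewrite AE in h; rewrite mem_set; last exact: inB Kx h.
    by rewrite /f /= AE /gK !patchE !mem_set // indicE mem_set // mulr1.
  case: ifPn => // _; rewrite /f /= indicE memNset ?mulr0 //.
  by move=> h'; move/negP: h; apply; apply: mem_set; rewrite /= AE.
have -> : (\int[mu]_(x in K) \int[mu]_(y in K) ((g x - g y) ^+ 2)%:E =
    \int[mu]_(x in K) \int[mu]_(v in B) (f (x, v))%:E)%E.
  by apply: eq_integral => x /set_mem; exact: inner.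
rewrite (tonelli_plane mK mB (f := fun q => (f q)%:E)); last 2 first.
- by apply: measurable_funTS; exact/measurable_EFinP.
- by move=> q _; rewrite lee_fin.
have bnd v : (\int[mu]_(x in K) (f (x, v))%:E <= (d ^+ 2 * S ^+ 2)%:E)%E.
  have mKv : measurable (Kv v : set (Pl R)) by apply: open_measurable2.
  have Lgv : L2 (Kv v) (fun x => g (x + v)).
    have Lgs := L2_shift v mK hg; apply: L2S Lgs => //; last by move=> x [].
    apply: open_measurable2; rewrite (_ : [set x | _] = (fun x => x + v) @^-1` K) //.
    by apply: open_comp => // x _; apply: cvgD; [exact: cvg_id|exact: cvg_cst].
  have Lgk : L2 (Kv v) g by apply: L2S hg => // x [].
  have Ld : L2 (Kv v) (fun x => g (x + v) - g x) by exact: L2B.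
  have -> : (\int[mu]_(x in K) (f (x, v))%:E = (L2norm (Kv v) (fun x => g (x + v) - g x) ^+ 2)%:E)%E.
    rewrite L2norm_sq ipE -Int_EFin //; last exact: L2_mul.
    rewrite [LHS]integral_mkcond [RHS]integral_mkcond; apply: eq_integral => x _.
    rewrite !patchE; case: ifPn => [/set_mem Kx|nKx].
      case: ifPn => [/set_mem[_ Kxv]|h].
        rewrite /f /= /gK !patchE !mem_set // indicE mem_set // mulr1; congr EFin; ring.
      rewrite /f /= indicE memNset ?mulr0 // => Kxv.
      by move/negP: h; apply; exact: mem_set.
    case: ifPn => // /set_mem[Kx _]; move/negP: nKx; case; exact: mem_set.
  rewrite lee_fin -exprMn ler_pXn2r ?nnegrE ?L2norm_ge0 ?mulr_ge0 ?(ltW d0) //.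
  have [[x [Kx Kxv]]|no] := pselect (exists x, Kv v x); last first.
    rewrite /L2norm ipE (eq_Int (v := fun=> 0)) ?Int0 ?sqrtr0 ?mulr_ge0 ?(ltW d0) //.
    by move=> x hx; case: no; exists x.
  apply: le_trans (translation_bound v) _.
  have := diamK Kx Kxv; rewrite addrAC subrr add0r => h.
  rewrite /N /S mulrDr; apply: lerD; apply: ler_wpM2r; rewrite ?L2norm_ge0 //.
    by apply: le_trans h; exact: norm1_le_en.
  by apply: le_trans h; exact: norm2_le_en.
apply: (@le_trans _ _ (\int[mu]_(v in B) (cst (d ^+ 2 * S ^+ 2)%:E v))%E).
  apply: ge0_le_integral => //.
  - by move=> v _; apply: integral_ge0 => x _; rewrite lee_fin.
  - apply: (@measurable_tonelli_in _ _ _ _ _ mu2s _ _ (fun q : Pl R * Pl R => (f (q.2, q.1))%:E)) => //.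
    + apply: measurable_funTS; apply/measurable_EFinP; apply: (measurableT_comp mf).
      by apply: measurable_fun_pair; [exact: measurable_snd|exact: measurable_fst].
    + by move=> q _; rewrite lee_fin.
have dd : - (2 * d) <= 2 * d.
  by have := ltW d0; move=> d0'; rewrite -subr_ge0 opprK addr_ge0 // mulr_ge0.
rewrite integral_cst // (mu2_box dd dd).
by rewrite -EFinM lee_fin le_eqVlt; apply/orP; left; apply/eqP; ring.
Qed.

End Translation.

Lemma lee_sum_mem (R : realType) (I : eqType) (s : seq I) (f g : I -> \bar R) :
  (forall i, i \in s -> (f i <= g i)%E) -> (\sum_(i <- s) f i <= \sum_(i <- s) g i)%E.
Proof.
elim: s => [|a s IH] h; first by rewrite !big_nil.
rewrite !big_cons; apply: leeD; first by apply: h; rewrite inE eqxx.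
by apply: IH => i hi; apply: h; rewrite inE hi orbT.
Qed.

Lemma ler_sum_mem (R : realType) (I : eqType) (s : seq I) (f g : I -> R) :
  (forall i, i \in s -> f i <= g i) -> \sum_(i <- s) f i <= \sum_(i <- s) g i.
Proof.
elim: s => [|a s IH] h; first by rewrite !big_nil.
rewrite !big_cons; apply: lerD; first by apply: h; rewrite inE eqxx.
by apply: IH => i hi; apply: h; rewrite inE hi orbT.
Qed.

(** * Oscillation of Sobolev functions over a mesh *)

Section MeanOscillation.
Context {R : realType}.
Notation mu := (@mu2 R).
Implicit Types (x y v : R * R) (K : triangle R) (D : set (R * R)) (M : mesh R) (g u : R * R -> R).

Lemma fin_tri K : (mu (tri K)° < +oo)%E.
Proof. by apply: mu2_bounded_lty; [exact: measurable_tri|exact: bounded_tri]. Qed.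

Lemma interior_tri_convex K x y (t : R) : det K != 0 -> (tri K)° x -> (tri K)° y -> 0 <= t <= 1 ->
  (tri K)° (x + t *: (y - x)).
Proof.
move=> d0 /(interior_triP _ d0) hx /(interior_triP _ d0) hy /andP[t0 t1].
apply/(interior_triP _ d0) => i; rewrite lam_line -lamB; have := hx i; have := hy i.
move: (lam _ _ _) (lam _ _ _) => p q p0 q0.
have [->|tn] := eqVneq t 0; first by rewrite mul0r addr0.
have tp : 0 < t by rewrite lt_neqAle eq_sym tn.
have h1 : 0 < t * p by exact: mulr_gt0.
have h2 : 0 <= (1 - t) * q by rewrite mulr_ge0 ?subr_ge0 // ltW.
nra.
Qed.

Definition tmean K g : R := Int (tri K)° g / area K.

Definition dev K g : R := Int (tri K)° (fun x => (g x - tmean K g) ^+ 2).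

Lemma dev_le_sq K g : det K != 0 -> L2 (tri K)° g -> dev K g <= Int (tri K)° (fun x => g x ^+ 2).
Proof.
move=> d0 hg; have mK := measurable_tri K; have fK := fin_tri K; have a0 := area_gt0 d0.
have Lg := L2_L1 mK fK hg.
have Lc k : L1 (tri K)° (fun=> k) by exact: L1_cst.
rewrite /dev; set m := tmean K g.
rewrite (eq_Int (v := fun x => g x ^+ 2 - (2 * m * g x - m ^+ 2))); last by move=> x _; ring.
have L2g := L2_L1sq hg.
rewrite IntB //; last by apply: L1B => //; exact: L1Z.
rewrite IntB //; last exact: L1Z.
rewrite IntZ // Int_tri_cst.
have -> : Int (tri K)° g = m * area K by rewrite /m /tmean divfK // gt_eqF.
have := sqr_ge0 m; nra.
Qed.

Lemma area_ge kappa K : det K != 0 -> shape_regular kappa K ->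
  diam (tri K) ^+ 2 <= 2 * kappa ^+ 2 * area K.
Proof.
move=> d0 sr; apply: le_trans (det_ge d0 sr) _; rewrite areaE //.
by rewrite le_eqVlt; apply/orP; left; apply/eqP; field.
Qed.

Lemma dev_double K g : det K != 0 -> L2 (tri K)° g ->
  ((area K * dev K g)%:E <=
    \int[mu]_(x in (tri K)°) \int[mu]_(y in (tri K)°) ((g x - g y) ^+ 2)%:E)%E.
Proof.
move=> d0 hg.
exact: (oscillation (measurable_tri K) (fin_tri K) (area_gt0 d0) hg).
Qed.

(** The constant: (p + q)^2 <= 2 (p^2 + q^2) turns 16 d^4 into 32 d^4, and division by the area
    costs 2 kappa^2 / d^2. *)
Lemma dev_poincare kappa K g g1 g2 : det K != 0 -> shape_regular kappa K ->
  L2 (tri K)° g -> L2 (tri K)° g1 -> L2 (tri K)° g2 ->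
  weak_derivative (tri K)° (1, 0)%N g g1 -> weak_derivative (tri K)° (0, 1)%N g g2 ->
  dev K g <= 64 * kappa ^+ 2 * diam (tri K) ^+ 2 *
    (Int (tri K)° (fun x => g1 x ^+ 2) + Int (tri K)° (fun x => g2 x ^+ 2)).
Proof.
move=> d0 sr hg hg1 hg2 w1 w2; have a0 := area_gt0 d0; have dg := diam_gt0 d0.
have dd : forall x y, (tri K)° x -> (tri K)° y -> en (y - x) <= diam (tri K).
  by move=> x y hx hy; apply: tri_diam; exact: interior_subset.
have := le_trans (dev_double d0 hg) (poincare_double (open_interior (tri K)) (bounded_tri K)
  (fun x y t => @interior_tri_convex K x y t d0) hg hg1 hg2 w1 w2 dg dd).
have n1 := L2norm_sq (tri K)° g1; have n2 := L2norm_sq (tri K)° g2.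
have -> : Int (tri K)° (fun x => g1 x ^+ 2) = L2norm (tri K)° g1 ^+ 2 by rewrite n1.
have -> : Int (tri K)° (fun x => g2 x ^+ 2) = L2norm (tri K)° g2 ^+ 2 by rewrite n2.
rewrite lee_fin; have := area_ge d0 sr.
move: (L2norm _ _) (L2norm _ _) (dev K g) (area K) (diam _) a0 dg => p q e a d a0 dg h1 h2.
rewrite -(ler_pM2l a0); apply: le_trans h2 _.
have h3 : (p + q) ^+ 2 <= 2 * (p ^+ 2 + q ^+ 2) by have := sqr_ge0 (p - q); nra.
apply: (@le_trans _ _ (16 * d ^+ 4 * (2 * (p ^+ 2 + q ^+ 2)))).
  rewrite [q + p]addrC; apply: ler_wpM2l; last exact: h3.
  by apply: mulr_ge0 => //; rewrite exprn_ge0 // ltW.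
rewrite [leLHS](_ : _ = 32 * d ^+ 2 * (p ^+ 2 + q ^+ 2) * d ^+ 2); last by ring.
rewrite [leRHS](_ : _ = 32 * d ^+ 2 * (p ^+ 2 + q ^+ 2) * (2 * kappa ^+ 2 * a)); last by ring.
apply: ler_wpM2l; last exact: h1.
by apply: mulr_ge0; [apply: mulr_ge0 => //; exact: sqr_ge0|apply: addr_ge0; exact: sqr_ge0].
Qed.

Lemma en_eq0 x : en x = 0 -> x = 0.
Proof.
move=> e; have := en_sq x; rewrite e expr0n /= => /eqP; rewrite eq_sym paddr_eq0 ?sqr_ge0 //.
by rewrite !sqrf_eq0 => /andP[/eqP a /eqP b]; case: x a b {e} => a b /= -> ->.
Qed.

Definition slobker (t : R) g (q : Pl R * Pl R) : R :=
  (g q.1 - g q.2) ^+ 2 / Defs.edist q.1 q.2 `^ (2 + 2 * t).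

Lemma slobker_ge0 t g q : 0 <= slobker t g q.
Proof. by rewrite /slobker divr_ge0 ?sqr_ge0 ?powR_ge0. Qed.

Lemma measurable_slobker (t : R) g (D : set (Pl R)) : measurable D -> measurable_fun D g ->
  measurable_fun (D `*` D) (slobker t g).
Proof.
move=> mD mg; rewrite /slobker; apply: measurable_funM; first exact: measurable_diff_sq.
under eq_fun do rewrite -powRN.
apply: measurable_funTS; apply: (measurableT_comp (measurable_powR _)).
apply: (measurableT_comp (f := @Num.sqrt R)).
  by apply: continuous_measurable_fun; exact: sqrt_continuous.
have p11 : measurable_fun setT (fun q : Pl R * Pl R => q.1.1).
  by apply: (measurableT_comp measurable_fst); exact: measurable_fst.
have p12 : measurable_fun setT (fun q : Pl R * Pl R => q.1.2).
  by apply: (measurableT_comp measurable_snd); exact: measurable_fst.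
have p21 : measurable_fun setT (fun q : Pl R * Pl R => q.2.1).
  by apply: (measurableT_comp measurable_fst); exact: measurable_snd.
have p22 : measurable_fun setT (fun q : Pl R * Pl R => q.2.2).
  by apply: (measurableT_comp measurable_snd); exact: measurable_snd.
by apply: measurable_funD; apply: measurable_funX; exact: measurable_funB.
Qed.

(** Two points of the triangle are at most its diameter apart, so the squared difference is at most
    diam^(2 + 2t) times the kernel; two powers of the diameter are spent on the division by the
    area. *)
Lemma dev_slobodeckij kappa K g (t : R) : det K != 0 -> shape_regular kappa K -> 0 < t ->
  L2 (tri K)° g ->
  ((dev K g)%:E <= (2 * kappa ^+ 2 * (diam (tri K) `^ t) ^+ 2)%:E * slobodeckij (tri K)° t g)%E.
Proof.
move=> d0 sr t0 hg; have a0 := area_gt0 d0; have dg := diam_gt0 d0; have mK := measurable_tri K.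
pose c := diam (tri K) `^ (2 + 2 * t).
have c0 : 0 <= c by exact: powR_ge0.
have pt x y : (tri K)° x -> (tri K)° y -> (g x - g y) ^+ 2 <= c * slobker t g (x, y).
  move=> hx hy; rewrite /slobker /=.
  (* On the diagonal the difference in the numerator vanishes as well, whatever the quotient by 0
     means. *)
  have [e0|en0] := eqVneq (Defs.edist x y) 0.
    have -> : x = y by apply/eqP; rewrite -subr_eq0; apply/eqP; exact: en_eq0.
    by rewrite subrr expr0n /= mul0r mulr0.
  have ep : 0 < Defs.edist x y by rewrite lt_neqAle eq_sym en0 andTb; exact: sqrtr_ge0.
  rewrite mulrCA ler_peMr ?sqr_ge0 // ler_pdivlMr ?powR_gt0 // mul1r.
  apply: ge0_ler_powR; rewrite ?nnegrE ?(ltW dg) ?(ltW ep) //; first lra.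
  by apply: tri_diam; exact: interior_subset.
have mkk : measurable_fun ((tri K)° `*` (tri K)°) (fun q => (slobker t g q)%:E).
  by apply/measurable_EFinP; apply: measurable_slobker => //; exact: L2_measurable hg.
have mks x : (tri K)° x -> measurable_fun (tri K)° (fun y => (slobker t g (x, y))%:E).
  move=> hx; apply: (measurable_comp (F := (tri K)° `*` (tri K)°) _ _ mkk).
  - exact: measurableX.
  - by move=> _ [y hy <-].
  - by apply: measurable_funTS; exact: measurable_pair1.
have mi : measurable_fun (tri K)° (fun x => \int[mu]_(y in (tri K)°) (slobker t g (x, y))%:E)%E.
  apply: (@measurable_tonelli_in _ _ _ _ _ mu2s _ _ (fun q => (slobker t g q)%:E)) => //.
  by move=> q _; rewrite lee_fin slobker_ge0.
have h : ((area K * dev K g)%:E <= c%:E * slobodeckij (tri K)° t g)%E.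
  apply: le_trans (dev_double d0 hg) _.
  rewrite /slobodeckij -ge0_integralZl //; last first.
    by move=> x _; apply: integral_ge0 => y _; rewrite lee_fin; exact: (slobker_ge0 t g (x, y)).
  apply: ge0_le_integral => //.
  - by move=> x _; apply: integral_ge0 => y _; rewrite lee_fin sqr_ge0.
  - apply: (@measurable_tonelli_in _ _ _ _ _ mu2s _ _ (fun q : Pl R * Pl R => ((g q.1 - g q.2) ^+ 2)%:E)) => //.
    + by apply/measurable_EFinP; apply: measurable_diff_sq => //; exact: L2_measurable hg.
    + by move=> q _; rewrite lee_fin sqr_ge0.
  - by apply: emeasurable_funM => //.
  move=> x hx; rewrite -ge0_integralZl //; last 2 first.
  - exact: (mks x hx).
  - by move=> y _; rewrite lee_fin; exact: (slobker_ge0 t g (x, y)).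
  apply: ge0_le_integral => //.
  - by move=> y _; rewrite lee_fin sqr_ge0.
  - apply/measurable_EFinP; apply: measurable_funX; apply: measurable_funB => //.
    exact: L2_measurable hg.
  - by apply: emeasurable_funM => //; exact: (mks x hx).
  - by move=> y hy; rewrite -EFinM lee_fin; exact: pt.
have S0 : (0 <= slobodeckij (tri K)° t g)%E.
  by apply: integral_ge0 => x _; apply: integral_ge0 => y _; rewrite lee_fin; exact: (slobker_ge0 t g (x, y)).
have fa : (area K)%:E \is a fin_num by [].
have ea : (0 < (area K)%:E)%E by rewrite lte_fin.
rewrite -(lee_pmul2l fa ea) -EFinM; apply: le_trans h _.
rewrite muleA -EFinM; apply: lee_wpmul2r => //; rewrite lee_fin /c.
rewrite powRD; last by rewrite (gt_eqF dg) implybT.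
rewrite [2 * t]mulrC powRrM !powR_mulrn ?powR_ge0 ?(ltW dg) //.
have := area_ge d0 sr; have := sqr_ge0 (diam (tri K) `^ t); nra.
Qed.

(** All that sums over disjoint triangles require; unlike a triangulation it passes to sublists such
    as the star of a vertex. *)
Definition packed D M : Prop :=
  [/\ uniq M, (forall K, K \in M -> det K != 0), (forall K, K \in M -> (tri K)° `<=` D) &
      trivIset [set` M] (fun K => (tri K)° : set (Pl R))].

Lemma sum_integral_le D M (F : Pl R -> \bar R) : measurable (D : set (Pl R)) -> packed D M ->
  measurable_fun D F -> (forall x, D x -> (0 <= F x)%E) ->
  (\sum_(K <- M) \int[mu]_(x in (tri K)°) F x <= \int[mu]_(x in D) F x)%E.
Proof.
move=> mD [uM _ sM tM] mF F0.
have UD : \big[setU/set0]_(K <- M) ((tri K)° : set (Pl R)) `<=` D.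
  by move=> x; rewrite -bigcup_seq => -[K /= KM]; exact: sM.
rewrite -(@ge0_integral_bigsetU _ _ _ mu _ (fun K => (tri K)° : set (Pl R))) //.
- apply: ge0_subset_integral => //; apply: bigsetU_measurable => K _; exact: measurable_tri.
- by move=> K; exact: measurable_tri.
- by apply: (measurable_funS mD).
- by move=> x /UD; exact: F0.
Qed.

Lemma sum_Int_le D M (w : R * R -> R) : measurable (D : set (Pl R)) -> packed D M ->
  L1 D w -> (forall x, D x -> 0 <= w x) ->
  \sum_(K <- M) Int (tri K)° w <= Int D w.
Proof.
move=> mD pM hw w0; rewrite -lee_fin -sumEFin -Int_EFin //.
have -> : (\sum_(K <- M) (Int (tri K)° w)%:E = \sum_(K <- M) \int[mu]_(x in (tri K)°) (w x)%:E)%E.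
  case: pM => _ _ sM _; apply: eq_big_seq => K KM; rewrite Int_EFin //; first exact: measurable_tri.
  by apply: L1S hw => //; [exact: measurable_tri|exact: sM].
apply: sum_integral_le => //; apply/measurable_EFinP; exact: L1_measurable hw.
Qed.

(** Restricting the inner integral to the same triangle drops nonnegative interactions between
    different triangles. *)
Lemma slobodeckij_sum D M g (t : R) : measurable (D : set (Pl R)) -> packed D M -> L2 D g ->
  (\sum_(K <- M) slobodeckij (tri K)° t g <= slobodeckij D t g)%E.
Proof.
move=> mD pM hg; case: (pM) => _ _ sM _.
have mkk : measurable_fun (D `*` D) (fun q => (slobker t g q)%:E).
  by apply/measurable_EFinP; apply: measurable_slobker => //; exact: L2_measurable hg.
have mi : measurable_fun D (fun x => \int[mu]_(y in D) (slobker t g (x, y))%:E)%E.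
  apply: (@measurable_tonelli_in _ _ _ _ _ mu2s _ _ (fun q => (slobker t g q)%:E)) => //.
  by move=> q _; rewrite lee_fin slobker_ge0.
have nn x : (0 <= \int[mu]_(y in D) (slobker t g (x, y))%:E)%E.
  by apply: integral_ge0 => y _; rewrite lee_fin slobker_ge0.
apply: le_trans (sum_integral_le mD pM mi (fun x _ => nn x)).
apply: lee_sum_mem => K KM; have mK := measurable_tri K; have KD := sM K KM.
apply: ge0_le_integral => //.
- by move=> x _; apply: integral_ge0 => y _; rewrite lee_fin; exact: (slobker_ge0 t g (x, y)).
- apply: (@measurable_tonelli_in _ _ _ _ _ mu2s _ _ (fun q => (slobker t g q)%:E)) => //.
    apply: measurable_funS mkk; [exact: measurableX|by move=> q [/= h1 h2]; split; apply: KD].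
  by move=> q _; rewrite lee_fin slobker_ge0.
- exact: measurable_funS mi.
move=> x hx; have mx : measurable_fun D (fun y => (slobker t g (x, y))%:E).
  apply: (measurable_comp (F := D `*` D) _ _ mkk); first exact: measurableX.
    by move=> _ [y hy <-]; split => //; exact: KD.
  by apply: measurable_funTS; exact: measurable_pair1.
apply: ge0_subset_integral => //.
by move=> y _; rewrite lee_fin; exact: (slobker_ge0 t g (x, y)).
Qed.

Lemma diam_le_meshsize M K : K \in M -> diam (tri K) <= meshsize M.
Proof.
rewrite /meshsize; elim: M => // L M IH; rewrite inE big_cons le_max => /predU1P[->|/IH ->].
  by rewrite lexx.
by rewrite orbT.
Qed.

Lemma meshsize_ge0 M : 0 <= meshsize M.
Proof. exact: bigmax_ge_id. Qed.

Lemma sobolev_normsq s D u : sobolev_norm s D u ^+ 2 =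
    \sum_(i < (Num.truncn s).+1) \sum_(j < (Num.truncn s).+1 | (i + j <= Num.truncn s)%N)
        L2norm D (wD D (i : nat, j : nat) u) ^+ 2
     + (if (Num.truncn s)%:R < s then
          \sum_(i < (Num.truncn s).+1) fine (slobodeckij D (s - (Num.truncn s)%:R) (wD D (i : nat, Num.truncn s - i)%N u))
        else 0).
Proof.
rewrite sqr_sqrtr // addr_ge0 //.
  by apply: sumr_ge0 => i _; apply: sumr_ge0 => j _; exact: sqr_ge0.
case: ifP => // _; apply: sumr_ge0 => i _; apply: fine_ge0.
by apply: integral_ge0 => x _; apply: integral_ge0 => y _; rewrite lee_fin; exact: (slobker_ge0 _ _ (x, y)).
Qed.

Lemma fine_slobodeckij_ge0 D t g : 0 <= fine (slobodeckij D t g).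
Proof.
apply: fine_ge0; apply: integral_ge0 => x _; apply: integral_ge0 => y _.
by rewrite lee_fin; exact: (slobker_ge0 _ _ (x, y)).
Qed.

Lemma wD_le_sobolev_norm s D u i j : (i + j <= Num.truncn s)%N ->
  L2norm D (wD D (i, j) u) ^+ 2 <= sobolev_norm s D u ^+ 2.
Proof.
move=> ij; rewrite sobolev_normsq; apply: ler_wpDr.
  by case: ifP => // _; apply: sumr_ge0 => k _; exact: fine_slobodeckij_ge0.
have hi : (i < (Num.truncn s).+1)%N by rewrite ltnS (leq_trans _ ij) ?leq_addr.
have hj : (j < (Num.truncn s).+1)%N by rewrite ltnS (leq_trans _ ij) ?leq_addl.
rewrite (bigD1 (Ordinal hi)) //= (bigD1 (Ordinal hj)) //= -addrA lerDl addr_ge0 //.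
  by apply: sumr_ge0 => k _; exact: sqr_ge0.
by apply: sumr_ge0 => k _; apply: sumr_ge0 => l _; exact: sqr_ge0.
Qed.

Lemma slobodeckij_le_sobolev_norm s D u i : (Num.truncn s)%:R < s -> (i <= Num.truncn s)%N ->
  fine (slobodeckij D (s - (Num.truncn s)%:R) (wD D (i, Num.truncn s - i)%N u)) <= sobolev_norm s D u ^+ 2.
Proof.
move=> ms im; rewrite sobolev_normsq ms; apply: ler_wpDl.
  by apply: sumr_ge0 => k _; apply: sumr_ge0 => l _; exact: sqr_ge0.
have hi : (i < (Num.truncn s).+1)%N by [].
by rewrite (bigD1 (Ordinal hi)) //= lerDl; apply: sumr_ge0 => k _; exact: fine_slobodeckij_ge0.
Qed.

(** Three regimes: for s >= 3 third derivatives exist and Poincare gives one full power of the mesh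
    size; for 2 < s < 3 the seminorm of order s - 2 gives that power; for s = 2 the deviation is
    just bounded by the norm. *)
Lemma osc_bound kappa s D M u (a : nat * nat) : open D -> bounded_set D -> packed D M ->
  (forall K, K \in M -> shape_regular kappa K) -> 2 <= s -> sobolev s D u -> (a.1 + a.2 = 2)%N ->
  \sum_(K <- M) dev K (wD D a u) <=
    (1 + 128 * kappa ^+ 2) * (meshsize M `^ Num.min 1 (s - 2)) ^+ 2 * sobolev_norm s D u ^+ 2.
Proof.
move=> oD bD pM sr s2 su ha; have mD : measurable (D : set (Pl R)) by exact: open_measurable2.
case: (pM) => uM dM sM _.
have h0 := meshsize_ge0 M.
case: su; set m := Num.truncn s => Lu dU sU.
have s0 : 0 <= s by lra.
have m2 : (2 <= m)%N by rewrite /m truncn_ge_nat.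
have wP b : (b.1 + b.2 <= m)%N -> L2 D (wD D b u) /\ weak_derivative D b u (wD D b u).
  by move=> hb; apply: wDP; exact: dU.
have [Lg wg] : L2 D (wD D a u) /\ weak_derivative D a u (wD D a u) by apply: wP; rewrite ha.
have LK K g : K \in M -> L2 D g -> L2 (tri K)° g.
  by move=> KM hg; apply: L2S hg => //; [exact: measurable_tri|exact: sM].
have aE : a = (a.1, a.2) by case: (a).
have k20 := sqr_ge0 kappa.
have [s3|s3] := leP 3 s.
  have m3 : (3 <= m)%N by rewrite /m truncn_ge_nat.
  have -> : Num.min 1 (s - 2) = 1 by apply: min_idPl; lra.
  rewrite powRr1 //.
  have [L1g w1g] : L2 D (wD D (a.1 + 1, a.2 + 0)%N u) /\
     weak_derivative D (1, 0)%N (wD D a u) (wD D (a.1 + 1, a.2 + 0)%N u).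
    have hb : ((a.1 + 1)%N + (a.2 + 0)%N <= m)%N by rewrite addn0 addnAC ha.
    have [p1 p2] := wP (a.1 + 1, a.2 + 0)%N hb.
    by split; [exact: p1|exact: (@weak_derivative_add _ D a (1, 0)%N u _ _ wg p2)].
  have [L2g w2g] : L2 D (wD D (a.1 + 0, a.2 + 1)%N u) /\
     weak_derivative D (0, 1)%N (wD D a u) (wD D (a.1 + 0, a.2 + 1)%N u).
    have hb : ((a.1 + 0)%N + (a.2 + 1)%N <= m)%N by rewrite addn0 addnA ha.
    have [p1 p2] := wP (a.1 + 0, a.2 + 1)%N hb.
    by split; [exact: p1|exact: (@weak_derivative_add _ D a (0, 1)%N u _ _ wg p2)].
  set g1 := wD D _ u in L1g w1g; set g2 := wD D (a.1 + 0, _)%N u in L2g w2g.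
  have n1 : Int D (fun x => g1 x ^+ 2) <= sobolev_norm s D u ^+ 2.
    apply: le_trans (wD_le_sobolev_norm D u (i := (a.1 + 1)%N) (j := (a.2 + 0)%N) _).
      by rewrite L2norm_sq.
    by rewrite addn0 addnAC ha.
  have n2 : Int D (fun x => g2 x ^+ 2) <= sobolev_norm s D u ^+ 2.
    apply: le_trans (wD_le_sobolev_norm D u (i := (a.1 + 0)%N) (j := (a.2 + 1)%N) _).
      by rewrite L2norm_sq.
    by rewrite addn0 addnA ha.
  apply: (@le_trans _ _ (\sum_(K <- M) (64 * kappa ^+ 2 * meshsize M ^+ 2) *
     (Int (tri K)° (fun x => g1 x ^+ 2) + Int (tri K)° (fun x => g2 x ^+ 2)))).
    apply: ler_sum_mem => K KM.
    apply: le_trans (dev_poincare (dM _ KM) (sr _ KM) (LK _ _ KM Lg) (LK _ _ KM L1g) (LK _ _ KM L2g)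
      (weak_derivative_subset (sM _ KM) w1g) (weak_derivative_subset (sM _ KM) w2g)) _.
    apply: ler_wpM2r; first by rewrite addr_ge0 // Int_ge0 // => x _; exact: sqr_ge0.
    apply: ler_wpM2l; first exact: mulr_ge0.
    by apply: lerXn2r; rewrite ?nnegrE ?(ltW (diam_gt0 (dM _ KM))) // diam_le_meshsize.
  rewrite -mulr_sumr big_split /=.
  have q1 : \sum_(K <- M) Int (tri K)° (fun x => g1 x ^+ 2) <= sobolev_norm s D u ^+ 2.
    by apply: le_trans n1; apply: sum_Int_le => //; [exact: L2_L1sq|move=> x _; exact: sqr_ge0].
  have q2 : \sum_(K <- M) Int (tri K)° (fun x => g2 x ^+ 2) <= sobolev_norm s D u ^+ 2.
    by apply: le_trans n2; apply: sum_Int_le => //; [exact: L2_L1sq|move=> x _; exact: sqr_ge0].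
  have hh := sqr_ge0 (meshsize M); have N0 := sqr_ge0 (sobolev_norm s D u).
  move: (\sum_(K <- M) _) (\sum_(K <- M) _) (sobolev_norm s D u ^+ 2) (meshsize M ^+ 2) (kappa ^+ 2) q1 q2 hh N0 k20.
  move=> p q N h k q1 q2 hh N0 k0.
  apply: (@le_trans _ _ (64 * k * h * (N + N))).
    by apply: ler_wpM2l; [rewrite !mulr_ge0|exact: lerD].
  have : 0 <= h * N by exact: mulr_ge0.
  by rewrite mulrDl mul1r -!mulrA; nra.
have n0 : Int D (fun x => wD D a u x ^+ 2) <= sobolev_norm s D u ^+ 2.
  by have := @wD_le_sobolev_norm s D u a.1 a.2; rewrite ha -aE L2norm_sq; apply.
have [e2|ne2] := eqVneq s 2.
  have -> : Num.min 1 (s - 2) = 0 by rewrite e2 subrr; apply: min_idPr; lra.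
  rewrite powRr0 expr1n mulr1.
  apply: (@le_trans _ _ (\sum_(K <- M) Int (tri K)° (fun x => wD D a u x ^+ 2))).
    by apply: ler_sum_mem => K KM; apply: dev_le_sq; [exact: dM|exact: LK].
  apply: le_trans (sum_Int_le mD pM (L2_L1sq Lg) (fun x _ => sqr_ge0 _)) _.
  apply: le_trans n0 _; rewrite mulrDl mul1r lerDl; apply: mulr_ge0; last exact: sqr_ge0.
  exact: mulr_ge0.
have s2' : 2 < s by rewrite lt_neqAle eq_sym ne2.
(* The seminorm in the norm of order s then belongs to the second derivatives. *)
have mE : m = 2%N.
  by apply/eqP; rewrite eqn_leq m2 andbT -ltnS /m truncn_lt_nat.
have ms : m%:R < s by rewrite mE.
have -> : Num.min 1 (s - 2) = s - 2 by apply: min_idPr; lra.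
have t0 : 0 < s - 2 by lra.
have slD := slobodeckij_le_sobolev_norm (s := s) D u (i := a.1) ms _.
have aa : (2 - a.1)%N = a.2 by rewrite -ha addKn.
rewrite -/m mE aa -aE in slD.
have slF := sU ms a; rewrite mE in slF; have {}slF := slF ha.
have sl0 : (0 <= slobodeckij D (s - 2) (wD D a u))%E.
  apply: integral_ge0 => x _; apply: integral_ge0 => y _.
  by rewrite lee_fin; exact: (slobker_ge0 _ _ (x, y)).
set c := 2 * kappa ^+ 2 * (meshsize M `^ (s - 2)) ^+ 2.
have c0 : 0 <= c by apply: mulr_ge0; [exact: mulr_ge0|exact: sqr_ge0].
have H : ((\sum_(K <- M) dev K (wD D a u))%:E <= (c * sobolev_norm s D u ^+ 2)%:E)%E.
  rewrite -sumEFin.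
  apply: (@le_trans _ _ (\sum_(K <- M) c%:E * slobodeckij (tri K)° (s - 2) (wD D a u))%E).
    apply: lee_sum_mem => K KM.
    apply: le_trans (dev_slobodeckij (dM _ KM) (sr _ KM) t0 (LK _ _ KM Lg)) _.
    apply: lee_wpmul2r.
      apply: integral_ge0 => x _; apply: integral_ge0 => y _.
      by rewrite lee_fin; exact: (slobker_ge0 _ _ (x, y)).
    rewrite lee_fin /c; apply: ler_wpM2l; first exact: mulr_ge0.
    apply: lerXn2r; rewrite ?nnegrE ?powR_ge0 //; apply: ge0_ler_powR; rewrite ?nnegrE ?(ltW t0) ?(ltW (diam_gt0 (dM _ KM))) //.
    exact: diam_le_meshsize.
  rewrite -ge0_sume_distrr; last first.
    move=> K _; apply: integral_ge0 => x _; apply: integral_ge0 => y _.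
    by rewrite lee_fin; exact: (slobker_ge0 _ _ (x, y)).
  rewrite (EFinM c); apply: lee_wpmul2l; rewrite ?lee_fin //.
  apply: le_trans (slobodeckij_sum _ mD pM Lg) _.
  rewrite -[leLHS]fineK ?lee_fin; last by rewrite ge0_fin_numE.
  by apply: slD; rewrite -ha leq_addr.
move: H; rewrite lee_fin => H; apply: le_trans H _; apply: ler_wpM2r; first exact: sqr_ge0.
by rewrite /c; apply: ler_wpM2r; [exact: sqr_ge0|lra].
Qed.

End MeanOscillation.

(** * Meshes *)

Section MeshTopology.
Context {R : realType}.
Notation mu := (@mu2 R).
Implicit Types (x y v : R * R) (K : triangle R) (D : set (R * R)) (M : mesh R).

Lemma nbhs_enP x (A : set (R * R)) : nbhs x A <->
  exists2 e : R, 0 < e & forall y, en (y - x) < e -> A y.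
Proof.
split.
  move=> /nbhs_ballP[e /= e0 He]; exists e => // y h; apply: He.
  rewrite -ball_normE /=; apply: le_lt_trans h; rewrite distrC; exact: norm_le_en.
move=> [e e0 He]; apply/nbhs_ballP; exists (e / 2) => /=; first by rewrite divr_gt0.
move=> y; rewrite -ball_normE /= => h; apply: He; apply: le_lt_trans (en_le_norm _) _.
by rewrite distrC mulrC -ltr_pdivlMr.
Qed.

(** Excludes slits. Suppose a boundary point x has a neighbourhood in the closure, and go from x by
    t downwards, away from the epigraph. There must be points z of the domain within dl of the point
    reached, but dl (|L| + 1) = t / 4 keeps them below the graph. *)
Lemma lipschitz_interior_closure D : lipschitz_boundary D -> (closure D)° `<=` D.
Proof.
move=> lip x xi; apply: contrapT => nDx.
have clx : closure D x by exact: interior_subset.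
have [e [c [d [L [g [e0 cd hl hD]]]]]] := lip x (conj clx nDx).
have hg a b : `|g a - g b| <= `|L| * `|a - b|.
  apply: le_trans (hl (a, b) (conj I I)) _; apply: ler_wpM2r => //; exact: ler_norm.
have [r r0 hr] := (nbhs_enP _ _).1 xi.
pose t := Num.min (r / 2) (e / 4).
have t0 : 0 < t by rewrite lt_min !divr_gt0.
have tr : t < r by rewrite /t gt_min; apply/orP; left; rewrite ltr_pdivrMr //; lra.
have te : t <= e / 4 by rewrite ge_min lexx orbT.
(* The vector (-d, c) is the vertical direction of the rotated coordinates. *)
pose y : R * R := x + (- t) *: (- d, c).
have n1 : en ((- d, c) : R * R) = 1 by rewrite /en /= sqrrN addrC cd sqrtr1.
have cy : closure D y.
  by apply: hr; rewrite /y addrAC subrr add0r enZ n1 mulr1 normrN gtr0_norm.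
pose dl := t / (4 * (`|L| + 1)).
have L0 : 0 <= `|L| by [].
have dl0 : 0 < dl by rewrite divr_gt0 // mulr_gt0 //; lra.
have hdl : dl * (`|L| + 1) = t / 4 by rewrite /dl; field; rewrite gt_eqF //; lra.
have nby : nbhs y [set z | en (z - y) < dl] by apply/nbhs_enP; exists dl.
have [z [Dz hz]] := cy _ nby; rewrite /= in hz.
have yx : y - x = (- t) *: ((- d, c) : R * R) by rewrite /y addrAC subrr add0r.
have zx : z - x = (z - y) + (- t) *: ((- d, c) : R * R) by rewrite -yx addrA subrK.
have ez : Defs.edist x z < e.
  rewrite edistE -enN opprB zx; apply: le_lt_trans (enD _ _) _.
  rewrite enZ n1 mulr1 normrN gtr0_norm //.
  have : dl <= t / 4 by rewrite -hdl ler_peMr ?(ltW dl0) //; lra.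
  lra.
have /(hD z ez) h1 := Dz.
have h2 : ~ (g (c * x.1 + d * x.2) < c * x.2 - d * x.1).
  by move=> h; apply: nDx; apply/(hD x) => //; rewrite edistE subrr en0.
move/negP: h2; rewrite -leNgt => h2.
set w := z - y in hz zx.
have w1 := norm1_le_en w; have w2 := norm2_le_en w.
have z1 : z.1 = x.1 + w.1 + t * d.
  by have := congr1 fst zx; rewrite /= -![_ *: _]/(_ * _); lra.
have z2 : z.2 = x.2 + w.2 - t * c.
  by have := congr1 snd zx; rewrite /= -![_ *: _]/(_ * _); lra.
pose u : R * R := (c, d).
have nu : en u = 1 by rewrite /en /= cd sqrtr1.
have d1 : `|c * w.1 + d * w.2| <= dl.
  have := dot_le u w; rewrite nu mul1r /dot /= => /le_trans; apply; exact: ltW.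
have d2 : `|c * w.2 - d * w.1| <= dl.
  have := dot_le (- d, c) w; rewrite n1 mul1r /dot /= => h.
  by rewrite addrC -mulNr; apply: le_trans h (ltW hz).
have tz : c * z.1 + d * z.2 = c * x.1 + d * x.2 + (c * w.1 + d * w.2) by rewrite z1 z2; ring.
have nz : c * z.2 - d * z.1 = c * x.2 - d * x.1 + (c * w.2 - d * w.1) - t.
  by rewrite z1 z2 -[t in RHS]mulr1 -cd; ring.
have h3 := hg (c * x.1 + d * x.2) (c * z.1 + d * z.2).
have h4 : `|c * x.1 + d * x.2 - (c * z.1 + d * z.2)| <= dl by rewrite tz opprD addrA subrr sub0r normrN.
have h5 : g (c * x.1 + d * x.2) - g (c * z.1 + d * z.2) <= `|L| * dl.
  apply: le_trans (ler_norm _) _; apply: le_trans h3 _; exact: ler_wpM2l.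
rewrite nz in h1; move: d2; rewrite ler_norml => /andP[_ d2].
have h6 : `|L| * dl + dl = t / 4 by rewrite -hdl; ring.
lra.
Qed.

Lemma open_triP K i x : det K != 0 -> (tri K)° x -> lam K i x = 0 -> False.
Proof. by move=> d0 /(interior_triP _ d0)/(_ i) + e; rewrite e ltxx. Qed.

Lemma segment_lam0 K i j l x : det K != 0 -> l != i -> l != j ->
  segment (K i) (K j) x -> lam K l x = 0.
Proof.
move=> d0 li lj [t [_ ->]].
have -> : (1 - t) *: K i + t *: K j = K i + t *: (K j - K i).
  by rewrite scalerBl scale1r scalerBr addrA addrAC.
by rewrite lam_line -lamB !lam_vertex // (negbTE li) (negbTE lj) subrr mulr0 addr0.
Qed.

Lemma third i j : i != j -> exists l : 'I_3, l != i /\ l != j.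
Proof.
by case: (ord3P i) => ->; case: (ord3P j) => -> // _; [exists o2|exists 1|exists o2|exists 0|exists 1|exists 0].
Qed.

Lemma conforming_interior M K K' x : conforming M -> K \in M -> K' \in M -> det K != 0 ->
  (tri K)° x -> tri K' x -> K = K'.
Proof.
move=> cM KM K'M d0 ix tx; apply: contrapT => ne.
have txK : tri K x by exact: interior_subset.
have xx : (tri K `&` tri K') x by [].
case: (cM _ _ KM K'M ne) => [e|[i [i' [_ e]]]|[i [j [i' [j' [ij _ _ _ e]]]]]]; rewrite e in xx => //.
  apply: (open_triP (i := i + 1) d0 ix); rewrite xx lam_vertex //; by rewrite (negbTE (neqS i)).
have [l [li lj]] := third ij.
by apply: (open_triP (i := l) d0 ix); exact: segment_lam0 xx.
Qed.

Section Mesh.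
Variables (D : set (R * R)) (M : mesh R).
Hypotheses (oD : open D) (lip : lipschitz_boundary D) (tM : triangulation D M).

Lemma mesh_det K : K \in M -> det K != 0.
Proof. by case: tM => _ h _ _ /h; exact: interior_det. Qed.

Lemma mesh_closure K : K \in M -> tri K `<=` closure D.
Proof. by case: tM => _ _ -> _ KM x tx; exists K. Qed.

Lemma mesh_interior K : K \in M -> (tri K)° `<=` D.
Proof.
move=> KM x h; apply: lipschitz_interior_closure => //.
by apply: filterS h; exact: mesh_closure.
Qed.

Lemma mesh_packed : packed D M.
Proof.
case: (tM) => uM _ _ cM; split => //; first exact: mesh_det.
  exact: mesh_interior.
apply/trivIsetP => K K' /= KM K'M ne; apply/seteqP; split => // x [h1 h2].
move/eqP: ne; apply; apply: (conforming_interior cM KM K'M (mesh_det KM) h1).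
exact: interior_subset.
Qed.

Lemma mesh_cover x : D x -> exists2 K, K \in M & tri K x.
Proof.
case: tM => _ _ cl _ Dx; have : closure D x by exact: subset_closure.
by rewrite cl.
Qed.

Lemma closed_tri K : det K != 0 -> closed (tri K).
Proof.
move=> d0; rewrite (_ : tri K = \bigcap_i [set x | 0 <= lam K i x]); last first.
  by apply/seteqP; split => [x /(triP _ d0) h i _|x h]; [exact: h|apply/(triP _ d0) => i; exact: h].
apply: closed_bigI => i _.
rewrite (_ : [set x | _] = lam K i @^-1` [set t | 0 <= t]) //.
by apply: closed_comp; [move=> x _; exact: lam_continuous|exact: closed_ge].
Qed.

(** There are finitely many triangles and they are closed. *)
Lemma near_tri x : \forall y \near x, forall K, K \in M -> tri K y -> tri K x.
Proof.
have : forall N : mesh R, {subset N <= M} -> \forall y \near x, forall K, K \in N -> tri K y -> tri K x.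
  elim=> [|K N IH] sN; first by apply: filterE => y K; rewrite in_nil.
  have h1 : \forall y \near x, forall K, K \in N -> tri K y -> tri K x.
    by apply: IH => L hL; apply: sN; rewrite inE hL orbT.
  have KM : K \in M by apply: sN; rewrite inE eqxx.
  have h2 : \forall y \near x, tri K y -> tri K x.
    have [tx|ntx] := pselect (tri K x); first exact: filterE.
    have : nbhs x (~` tri K).
      by apply: open_nbhs_nbhs; split => //; apply: closed_openC; exact: closed_tri (mesh_det KM).
    by apply: filterS => y ny ty.
  by apply: filterS (filterI h1 h2) => y [g1 g2] L; rewrite inE => /predU1P[->|]; [exact: g2|exact: g1].
by apply.
Qed.

Definition open_edge K i : set (R * R) :=
  [set x | [/\ lam K i x = 0, 0 < lam K (i + 1) x & 0 < lam K (i + 1 + 1) x]].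

(** The same edge seen from two triangles, in either orientation. *)
Definition share K i K' i' : Prop :=
  (K (i + 1) = K' (i' + 1) /\ K (i + 1 + 1) = K' (i' + 1 + 1)) \/
  (K (i + 1) = K' (i' + 1 + 1) /\ K (i + 1 + 1) = K' (i' + 1)).

Lemma forall3 (P : 'I_3 -> Prop) i : P i -> P (i + 1) -> P (i + 1 + 1) -> forall j, P j.
Proof. by move=> h1 h2 h3 j; case: (eqVneq j i) => [->//|/ord3_other[->|->]]. Qed.

Lemma open_edge_tri K i : det K != 0 -> open_edge K i `<=` tri K.
Proof.
move=> d0 x [h1 h2 h3]; apply/(triP _ d0).
by apply: (@forall3 (fun j => 0 <= lam K j x) i); [rewrite h1|exact: ltW|exact: ltW].
Qed.

Lemma share_sym K i K' i' : share K i K' i' -> share K' i' K i.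
Proof. by rewrite /share; case=> [[-> ->]|[-> ->]]; [left|right]. Qed.

Lemma sum_cyc (F : 'I_3 -> R) i : \sum_j F j = F i + F (i + 1) + F (i + 1 + 1).
Proof.
rewrite sum3; case: (ord3P i) => ->; rewrite ?o0S ?o1S ?o2S ?o0S //; ring.
Qed.

Lemma lam_affine K i : exists c, forall z, lam K i z = dot (glam K i) z + c.
Proof. by exists (lam K i 0) => z; rewrite -{2}[z]subr0 -lamB subrK. Qed.

(** Both sides are affine and vanish at the two common vertices. The factor is the value at the
    remaining vertex of [K'], and its sign tells on which side of the edge [K'] lies. *)
Lemma share_lam K i K' i' x : det K != 0 -> det K' != 0 -> share K i K' i' ->
  lam K i x = lam K' i' x * lam K i (K' i').
Proof.
move=> d0 d0' sh; rewrite -{1}(sum_lam_vertex x d0').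
have -> : lam K i (\sum_j lam K' j x *: K' j) = \sum_j lam K' j x * lam K i (K' j).
  have [c e] := lam_affine K i.
  have s1 := sum_lam x d0'; rewrite !sum3 in s1 *; rewrite !e -[c in LHS]mul1r -s1 /dot /=.
  move: (glam K i) (lam K' 0 x) (lam K' 1 x) (lam K' o2 x) => g a b b'.
  rewrite -![_ *: _]/(_ * _); ring.
rewrite (sum_cyc _ i').
have z1 : lam K i (K' (i' + 1)) = 0.
  by case: sh => [[<- _]|[_ <-]]; rewrite lam_vertex // ?(eq_sym i) ?(negbTE (neqS i)) ?(negbTE (neqSS i)).
have z2 : lam K i (K' (i' + 1 + 1)) = 0.
  by case: sh => [[_ <-]|[<- _]]; rewrite lam_vertex // ?(eq_sym i) ?(negbTE (neqS i)) ?(negbTE (neqSS i)).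
by rewrite z1 z2 !mulr0 !addr0.
Qed.

Lemma conf_edge K K' i x : K \in M -> K' \in M -> K <> K' -> open_edge K i x -> tri K' x ->
  exists i', share K i K' i'.
Proof.
move=> KM K'M ne ox tx; have d0 := mesh_det KM; have d0' := mesh_det K'M.
case: (tM) => _ _ _ cM.
have txK := open_edge_tri d0 ox; have xx : (tri K `&` tri K') x by [].
case: ox => l0 l1 l2.
case: (cM _ _ KM K'M ne) => [e|[k [k' [_ e]]]|[k [j [k' [j' [kj kj' ek ej e]]]]]]; rewrite e in xx => //.
  exfalso; rewrite xx lam_vertex // in l1; rewrite xx lam_vertex // in l2.
  move: l1 l2; case: (eqVneq (i + 1) k) => [<-|]; last by rewrite ltxx.
  by rewrite (negbTE (neqS _)) ltxx.
have [l [lk lj]] := third kj.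
have zl := segment_lam0 d0 lk lj xx.
have il : l = i.
  case: (eqVneq l i) => // /ord3_other[E|E]; rewrite E in zl.
    by rewrite zl ltxx in l1.
  by rewrite zl ltxx in l2.
subst l; have [i' [ik' ij']] := third kj'; exists i'.
rewrite eq_sym in lk; rewrite eq_sym in lj; rewrite eq_sym in ik'; rewrite eq_sym in ij'.
rewrite /share.
case: (ord3_other lk) => Ek; case: (ord3_other lj) => Ej; case: (ord3_other ik') => Ek';
  case: (ord3_other ij') => Ej'; subst; rewrite ?eqxx in kj kj' => //; by [left|right].
Qed.

(** Step across the edge without leaving [D]. The point reached is covered by some triangle, which
    contains x if the step is short and therefore shares the edge by conformity. *)
Lemma edge_neighbour K i x : K \in M -> open_edge K i x -> D x ->
  exists K' i', [/\ K' \in M, share K i K' i' & lam K i (K' i') < 0].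
Proof.
move=> KM ox Dx; have d0 := mesh_det KM.
have nD : nbhs x D by exact: open_nbhs_nbhs.
have : nbhs x (D `&` [set y | forall K, K \in M -> tri K y -> tri K x]).
  by apply: filterI => //; exact: near_tri.
move=> /nbhs_enP[e e0 He].
have g0 := en_gt0 (glam_neq0 i d0).
pose t := e / (2 * en (glam K i)).
have t0 : 0 < t by rewrite divr_gt0 // mulr_gt0.
pose y := x + (- t) *: glam K i.
have ey : en (y - x) < e.
  rewrite /y addrAC subrr add0r enZ normrN gtr0_norm // /t half_scale //; lra.
have [Dy Hy] := He y ey.
have ly : lam K i y < 0.
  case: ox => l0 _ _; rewrite /y lam_line l0 add0r mulNr oppr_lt0 mulr_gt0 //.
  by rewrite /dot -!expr2 -en_sq exprn_gt0.
have [K' K'M ty] := mesh_cover Dy.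
have tx := Hy _ K'M ty.
have ne : K <> K' by move=> E; subst K'; move/(triP _ d0)/(_ i): ty; rewrite leNgt ly.
have [i' sh] := conf_edge KM K'M ne ox tx.
exists K', i'; split => //; have d0' := mesh_det K'M.
move: ly; rewrite (share_lam y d0 d0' sh) => h.
have := (triP _ d0').1 ty i'; rewrite le_eqVlt => /orP[/eqP E|p].
  by rewrite -E mul0r ltxx in h.
by rewrite pmulr_rlt0 in h.
Qed.

(** Near a point of the open edge the other coordinates of both triangles are positive, and the
    coordinates belonging to the edge have opposite signs. *)
Lemma edge_nbhs K K' i i' y : det K != 0 -> det K' != 0 -> share K i K' i' ->
  lam K i (K' i') < 0 -> open_edge K i y -> nbhs y (tri K `|` tri K').
Proof.
move=> d0 d0' sh neg [l0 l1 l2].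
have pos (L : triangle R) j : 0 < lam L j y -> \forall z \near y, 0 < lam L j z.
  move=> h; have := @lam_continuous _ L j y.
  by move=> /(_ [set t | 0 < t]); apply; apply: open_nbhs_nbhs; split => //; exact: open_gt.
have l0' : lam K' i' y = 0.
  have := share_lam y d0 d0' sh; rewrite l0 => /esym/eqP; rewrite mulf_eq0 (lt_eqF neg) orbF.
  by move/eqP.
have yE := sum_lam_vertex y d0.
have [l1' l2'] : 0 < lam K' (i' + 1) y /\ 0 < lam K' (i' + 1 + 1) y.
  have E : y = lam K (i + 1) y *: K (i + 1) + lam K (i + 1 + 1) y *: K (i + 1 + 1).
    rewrite -{1}yE; case: (ord3P i) l0 => -> l0; rewrite sum3 ?o0S ?o1S ?o2S ?o0S l0 scale0r ?add0r ?addr0 //.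
    by rewrite addrC.
  have S : lam K (i + 1) y + lam K (i + 1 + 1) y = 1.
    by have := sum_lam y d0; rewrite (sum_cyc _ i) l0 add0r.
  have F j : lam K' j y = lam K (i + 1) y * lam K' j (K (i + 1)) + lam K (i + 1 + 1) y * lam K' j (K (i + 1 + 1)).
    have [c e] := lam_affine K' j.
    rewrite {1}E !e -[c in LHS]mul1r -S /dot /=.
    move: (glam K' j) (lam K (i + 1) y) (lam K (i + 1 + 1) y) => g a b.
    rewrite -![_ *: _]/(_ * _); ring.
  have e11 : lam K' (i' + 1) (K' (i' + 1)) = 1 by rewrite lam_vertex // eqxx.
  have e22 : lam K' (i' + 1 + 1) (K' (i' + 1 + 1)) = 1 by rewrite lam_vertex // eqxx.
  have e21 : lam K' (i' + 1 + 1) (K' (i' + 1)) = 0 by rewrite lam_vertex // (negbTE (neqS _)).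
  have e12 : lam K' (i' + 1) (K' (i' + 1 + 1)) = 0 by rewrite lam_vertex // eq_sym (negbTE (neqS _)).
  move: (F (i' + 1)) (F (i' + 1 + 1)); clear F.
  by case: sh => [[-> ->]|[-> ->]]; rewrite e11 e12 e21 e22 !mulr1 !mulr0 ?addr0 ?add0r => -> ->.
near=> z.
case: (leP 0 (lam K i z)) => h.
  left; apply/(triP _ d0); apply: (@forall3 _ i) => //.
    by apply: ltW; near: z; exact: pos.
  by apply: ltW; near: z; exact: pos.
right; apply/(triP _ d0'); apply: (@forall3 _ i') => //.
- move: h; rewrite (share_lam z d0 d0' sh) nmulr_llt0 //; exact: ltW.
- by apply: ltW; near: z; exact: pos.
- by apply: ltW; near: z; exact: pos.
Unshelve. all: by end_near. Qed.

(** The two triangles at the edge are independent of the point on it, so around y too they fill a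
    neighbourhood, and the domain is the interior of its closure. An open edge is thus entirely
    interior or entirely on the boundary. *)
Lemma open_edge_D K i x y : K \in M -> open_edge K i x -> open_edge K i y -> D x -> D y.
Proof.
move=> KM ox oy Dx; have [K' [i' [K'M sh neg]]] := edge_neighbour KM ox Dx.
have h := edge_nbhs (mesh_det KM) (mesh_det K'M) sh neg oy.
apply: lipschitz_interior_closure => //; apply: filterS h => z [] tz.
  exact: (mesh_closure KM).
exact: (mesh_closure K'M).
Qed.

Lemma open_edge_point K i (t : R) : det K != 0 -> 0 < t < 1 ->
  open_edge K i (K (i + 1) + t *: (K (i + 1 + 1) - K (i + 1))).
Proof.
move=> d0 /andP[t0 t1]; split; rewrite lam_line -lamB !lam_vertex //.
- by rewrite ![i == _]eq_sym (negbTE (neqS i)) (negbTE (neqSS i)) subrr mulr0 addr0.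
- by rewrite eqxx [_ == _ + 1]eq_sym (negbTE (neqS _)) sub0r /=; lra.
- by rewrite eqxx (negbTE (neqS _)) subr0 mulr1 add0r.
Qed.

Lemma open_edge_point2 K i (t : R) : det K != 0 -> 0 < t < 1 ->
  open_edge K i (K (i + 1 + 1) + t *: (K (i + 1) - K (i + 1 + 1))).
Proof.
move=> d0 /andP[t0 t1].
have -> : K (i + 1 + 1) + t *: (K (i + 1) - K (i + 1 + 1)) =
    K (i + 1) + (1 - t) *: (K (i + 1 + 1) - K (i + 1)).
  by move: (K _) (K _) => a b; plane_ring.
by apply: open_edge_point => //; apply/andP; split; lra.
Qed.

(** Close to an end point in the open set [D] there are points of the open edge, and one of them
    decides for all. *)
Lemma edge_end_D K i j x : K \in M -> j != i -> D (K j) -> open_edge K i x -> D x.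
Proof.
move=> KM ji Dj ox; have d0 := mesh_det KM.
have nD : nbhs (K j) D by exact: open_nbhs_nbhs.
have [e e0 He] := (nbhs_enP _ _).1 nD.
pose t (n : R) := Num.min (2^-1) (e / (2 * (n + 1))).
have tP n : 0 <= n -> 0 < t n < 1 /\ t n * n < e.
  move=> n0; have p : 0 < 2 * (n + 1) by lra.
  split; first by rewrite /t lt_min invr_gt0 ltr0n divr_gt0 //= gt_min; apply/orP; left; lra.
  apply: (@le_lt_trans _ _ (e / (2 * (n + 1)) * n)).
    by rewrite ler_wpM2r // /t ge_min lexx orbT.
  rewrite mulrAC ltr_pdivrMr //; nra.
case: (ord3_other ji) => E; subst j.
  have [h1 h2] := tP _ (en_ge0 (K (i + 1 + 1) - K (i + 1))).
  apply: (open_edge_D KM (open_edge_point i d0 h1) ox); apply: He.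
  by rewrite addrAC subrr add0r enZ gtr0_norm //; case/andP: h1.
have [h1 h2] := tP _ (en_ge0 (K (i + 1) - K (i + 1 + 1))).
apply: (open_edge_D KM (open_edge_point2 i d0 h1) ox); apply: He.
by rewrite addrAC subrr add0r enZ gtr0_norm //; case/andP: h1.
Qed.

Lemma tri_cases K x : det K != 0 -> tri K x ->
  [\/ (tri K)° x, exists i, open_edge K i x | exists i, x = K i].
Proof.
move=> d0 tx; have h := (triP _ d0).1 tx.
have [all|] := pselect (forall i, 0 < lam K i x); first by apply: Or31; exact/(interior_triP _ d0).
move=> /existsNP[i /negP]; rewrite -leNgt => hi.
have i0 : lam K i x = 0 by apply/eqP; rewrite eq_le hi h.
have s := sum_lam x d0; rewrite (sum_cyc _ i) i0 add0r in s.
have e : \sum_j lam K j x *: K j = lam K i x *: K i + lam K (i + 1) x *: K (i + 1) + lam K (i + 1 + 1) x *: K (i + 1 + 1).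
  rewrite sum3; case: (ord3P i) => ->; rewrite ?o0S ?o1S ?o2S ?o0S //.
    by rewrite -addrA addrC.
  by rewrite addrC addrA.
rewrite sum_lam_vertex // i0 scale0r add0r in e.
have [z1|n1] := eqVneq (lam K (i + 1) x) 0.
  apply: Or33; exists (i + 1 + 1); rewrite z1 add0r in s.
  by rewrite e z1 s scale0r add0r scale1r.
have [z2|n2] := eqVneq (lam K (i + 1 + 1) x) 0.
  apply: Or33; exists (i + 1); rewrite z2 addr0 in s.
  by rewrite e z2 s scale0r addr0 scale1r.
by apply: Or32; exists i; split => //; rewrite lt_neqAle eq_sym ?n1 ?n2 h.
Qed.

Lemma mesh_diam_le (r : R) K : (forall x y, D x -> D y -> en (x - y) <= r) -> K \in M ->
  diam (tri K) <= r.
Proof.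
move=> Hr KM; have d0 := mesh_det KM; have dg := diam_gt0 d0.
apply: ge_sup.
  by exists 0; exists (K 0), (K 0); split; [exact: tri_vertex|exact: tri_vertex|rewrite edistE subrr en0].
move=> _ [x [y [tx ty ->]]]; rewrite edistE; apply/ler_addgt0Pr => e e0.
have ap z : tri K z -> exists2 z', D z' & en (z' - z) < e / 2.
  move=> /(mesh_closure KM)/(_ [set z' | en (z' - z) < e / 2])[|z' [h1 h2]]; last by exists z'.
  by apply/nbhs_enP; exists (e / 2) => //; rewrite divr_gt0.
have [x' Dx hx] := ap x tx; have [y' Dy hy] := ap y ty.
rewrite (_ : x - y = (x' - y') + ((x - x') + (y' - y))); last first.
  by move: x y x' y' {tx ty hx hy Dx Dy} => a b a' b'; plane_ring.
have h1 := Hr _ _ Dx Dy; have h2 := enD (x - x') (y' - y).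
have h3 := enD (x' - y') ((x - x') + (y' - y)); rewrite -(enN (x - x')) opprB in h2; lra.
Qed.

End Mesh.

End MeshTopology.

(** * The edges of a mesh form a null set *)

Section NullEdges.
Context {R : realType}.
Notation mu := (@mu2 R).
Notation lb := (@lebesgue_measure R).
Implicit Types (x y v : R * R) (K : triangle R) (D : set (R * R)) (M : mesh R).

Lemma line_null (n : R * R) (c : R) : n != 0 -> mu [set x : Pl R | dot n x = c] = 0%E.
Proof.
move=> n0.
have mL : measurable ([set x : Pl R | dot n x = c]).
  apply: closed_measurable2.
  rewrite (_ : [set x | _] = dot n @^-1` [set c]) //.
  apply: closed_comp; last exact: closed_eq.
  move=> x _; apply: cvgD; apply: cvgM; try exact: cvg_cst; [exact: fst_continuous|exact: snd_continuous].
have [n2|n2] := eqVneq n.2 0.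
  have n1 : n.1 != 0.
    apply: contra n0 => /eqP e1; move: e1 n2; case: n {mL} => a b /= -> ->; exact: eqxx.
  have -> : [set x : Pl R | dot n x = c] = [set c / n.1] `*` setT.
    apply/seteqP; split => x /=; rewrite /dot n2 mul0r addr0.
      by move=> <-; split => //; rewrite mulrC mulKf.
    by move=> [-> _]; rewrite mulrC divfK.
  by rewrite /mu2 /= product_measure1E //= lebesgue_measure_set1 mul0e.
rewrite /mu2 /product_measure1 /=; apply: integral0_eq => a _ /=.
have -> : xsection [set x : Pl R | dot n x = c] a = [set (c - n.1 * a) / n.2].
  apply/seteqP; split => b; rewrite /xsection /= ?inE /= /dot /=.
    by move=> <-; field.
  by move=> ->; field.
exact: lebesgue_measure_set1.
Qed.

Lemma lam0_null K i : det K != 0 -> mu [set x : Pl R | lam K i x = 0] = 0%E /\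
  measurable [set x : Pl R | lam K i x = 0].
Proof.
move=> d0; split.
  have [c e] := lam_affine K i.
  rewrite (_ : [set x | _] = [set x : Pl R | dot (glam K i) x = - c]).
    exact: line_null (glam_neq0 i d0).
  apply/seteqP; split => x /=; rewrite e; first by move/eqP; rewrite addr_eq0 => /eqP.
  by move=> ->; rewrite addNr.
apply: closed_measurable2; rewrite (_ : [set x | _] = lam K i @^-1` [set 0]) //.
by apply: closed_comp; [move=> x _; exact: lam_continuous|exact: closed_eq].
Qed.

Variables (D : set (R * R)) (M : mesh R).
Hypotheses (oD : open D) (lip : lipschitz_boundary D) (tM : triangulation D M).

(** The full lines through the edges: an easy null set that covers the part of [D] outside the open
    triangles. *)
Let skel : set (Pl R) := \big[setU/set0]_(K <- M) \big[setU/set0]_(i < 3) [set x : Pl R | lam K i x = 0].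

Lemma bigsetU_null (I : eqType) (s : seq I) (F : I -> set (Pl R)) :
  (forall i, i \in s -> mu (F i) = 0%E /\ measurable (F i)) ->
  mu (\big[setU/set0]_(i <- s) F i) = 0%E /\ measurable (\big[setU/set0]_(i <- s) F i).
Proof.
elim: s => [|i s IH] h; first by rewrite big_nil measure0; split => //; exact: measurable0.
rewrite big_cons; have [h1 h2] : mu (\big[setU/set0]_(i <- s) F i) = 0%E /\ measurable (\big[setU/set0]_(i <- s) F i).
  by apply: IH => j js; apply: h; rewrite inE js orbT.
have [h3 h4] : mu (F i) = 0%E /\ measurable (F i) by apply: h; rewrite inE eqxx.
split; last exact: measurableU.
apply/eqP; rewrite eq_le measure_ge0 andbT.
have e1 : (mu (\big[setU/set0]_(i <- s) F i) <= 0)%E by rewrite h1.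
have e3 : (mu (F i) <= 0)%E by rewrite h3.
by apply: le_trans (measureU2 _ h4 h2) _; have := leeD e3 e1; rewrite adde0.
Qed.

Lemma skel_null : mu skel = 0%E /\ measurable skel.
Proof.
apply: bigsetU_null => K KM; apply: bigsetU_null => i _.
exact: lam0_null (mesh_det tM KM).
Qed.

(* Points of another triangle's edge line may lie inside K, so only the edges
   of the triangle itself are removed. *)
Let skel2 : set (Pl R) := D `\` \big[setU/set0]_(K <- M) ((tri K)° : set (Pl R)).

Let mU : measurable (\big[setU/set0]_(K <- M) ((tri K)° : set (Pl R))).
Proof. by apply: bigsetU_measurable => K _; exact: measurable_tri. Qed.

Let mD : measurable (D : set (Pl R)). Proof. exact: open_measurable2. Qed.

Lemma skel2_null : mu skel2 = 0%E /\ measurable skel2.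
Proof.
have m2 : measurable skel2 by exact: measurableD.
split => //; have [s0 ms] := skel_null.
apply/eqP; rewrite eq_le measure_ge0 andbT -s0; apply: le_measure; rewrite ?inE //.
move=> x [Dx nx]; have [K KM tx] := mesh_cover tM Dx.
have d0 := mesh_det tM KM; rewrite /skel -bigcup_seq; exists K => //=.
rewrite -bigcup_seq; apply: contrapT => h; apply: nx; rewrite -bigcup_seq; exists K => //=.
apply/(interior_triP _ d0) => i; rewrite lt_neqAle (triP _ d0).1 // andbT eq_sym.
by apply/eqP => e; apply: h; exists i => //=; rewrite mem_index_enum.
Qed.

Lemma Int_mesh (w : R * R -> R) : (forall K, K \in M -> L1 (tri K)° w) ->
  Int D w = \sum_(K <- M) Int (tri K)° w.
Proof.
move=> hw; have [s0 ms] := skel2_null.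
have [uM _ sM tV] := mesh_packed lip tM.
rewrite (Int_setD_null _ mD ms s0).
have -> : D `\` skel2 = \big[setU/set0]_(K <- M) ((tri K)° : set (Pl R)).
  apply/seteqP; split => x.
    by move=> [Dx nx]; apply: contrapT => h; apply: nx.
  move=> h; split; last by case.
  by move: h; rewrite -bigcup_seq => -[K /= KM]; exact: sM.
have mw : measurable_fun (\big[setU/set0]_(K <- M) ((tri K)° : set (Pl R))) (EFin \o w).
  have : {subset M <= M} by [].
  elim: {1 3}M => [|K s IH] sub; first by rewrite big_nil; exact: measurable_fun_set0.
  rewrite big_cons; apply/measurable_funU => //; first exact: measurable_tri.
    by apply: bigsetU_measurable => L _; exact: measurable_tri.
  split; first by apply/measurable_EFinP; apply: L1_measurable (hw K _); apply: sub; rewrite inE eqxx.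
  by apply: IH => L h; apply: sub; rewrite inE h orbT.
rewrite /Int /Rintegral (integral_bigsetU_EFin mu (fun K => measurable_tri K) uM tV mw) //.
have -> : (\sum_(K <- M) \int[mu]_(x in (tri K)°) (w x)%:E = \sum_(K <- M) (Int (tri K)° w)%:E)%E.
  by apply: eq_big_seq => K KM; rewrite Int_EFin //; [exact: measurable_tri|exact: hw].
by rewrite sumEFin.
Qed.

End NullEdges.

(** * Number of triangles at a vertex *)

Section Star.
Context {R : realType}.
Notation mu := (@mu2 R).
Implicit Types (x y v z : R * R) (K : triangle R) (D : set (R * R)) (M : mesh R).

Definition has_vertex z K : bool := [exists i, K i == z].

Definition star M z : seq (triangle R) := [seq K <- M | has_vertex z K].

Lemma packed_sub D M N : packed D M -> uniq N -> {subset N <= M} -> packed setT N.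
Proof.
move=> [uM dM sM /trivIsetP tV] uN sN; split => // [K /sN|]; first exact: dM.
by apply/trivIsetP => K K' /= /sN h1 /sN h2; exact: tV.
Qed.

(** An area argument. With r the smallest diameter in the star, every triangle of the star contains
    a copy of itself shrunk towards z to diameter r, of area at least r^2 / (2 kappa^2). On it the
    cut-off [h] is 1, while the total integral of [h] is at most 16 r^2. *)
Lemma star_count kappa D M z : packed D M -> (forall K, K \in M -> shape_regular kappa K) ->
  (size (star M z))%:R <= 32 * kappa ^+ 2.
Proof.
move=> pM sr; set S := star M z.
have SM K : K \in S -> K \in M /\ exists i, K i = z.
  by rewrite mem_filter => /andP[/existsP[i /eqP <-] ->]; split => //; exists i.
have uS : uniq S by case: pM => uM _ _ _; exact: filter_uniq.
have pS : packed setT S by apply: (packed_sub pM uS) => K /SM[].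
have dS K : K \in S -> det K != 0 by case: pS => _ h _ _; exact: h.
have k20 : 0 <= 32 * kappa ^+ 2 by rewrite mulr_ge0 ?sqr_ge0.
have [->//|Sn] := eqVneq S [::].
(* The default of the minimum is the diameter of a member of the star, so it does not disturb the
   minimum. *)
pose r := \big[Num.min/diam (tri (head (nth [ffun=> 0] S 0) S))]_(K <- S) diam (tri K).
have hS : head (nth [ffun=> 0] S 0) S \in S by case: (S) Sn => //= a s _; rewrite inE eqxx.
have r0 : 0 < r.
  have gen s : {subset s <= S} ->
      0 < \big[Num.min/diam (tri (head (nth [ffun=> 0] S 0) S))]_(K <- s) diam (tri K).
    elim: s => [|K s IH] h; first by rewrite big_nil diam_gt0 // dS.
    have KS : K \in S by apply: h; rewrite inE eqxx.
    rewrite big_cons lt_min diam_gt0 ?dS //= IH // => L hL; apply: h; by rewrite inE hL orbT.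
  exact: gen.
have rS K : K \in S -> r <= diam (tri K).
  have gen s : K \in s -> \big[Num.min/diam (tri (head (nth [ffun=> 0] S 0) S))]_(K <- s) diam (tri K)
      <= diam (tri K).
    elim: s => // L s IH; rewrite inE big_cons ge_min => /predU1P[->|/IH ->].
      by rewrite lexx.
    by rewrite orbT.
  exact: gen.
pose h x : R := cut (((x - z).1 ^+ 2 + (x - z).2 ^+ 2) / r ^+ 2).
have r2 : 0 < r ^+ 2 by rewrite exprn_gt0.
have ch : cinf h.
  apply: (cinf_comp (g := fun x => ((x - z).1 ^+ 2 + (x - z).2 ^+ 2) / r ^+ 2)); first exact: cinf_cut.
  have c1 : cinf (fun x : R * R => (x - z).1) by apply: cinfB; [exact: cinf_fst|exact: cinf_cst].
  have c2 : cinf (fun x : R * R => (x - z).2) by apply: cinfB; [exact: cinf_snd|exact: cinf_cst].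
  by apply: cinfM; [apply: cinfD; exact: cinfM|exact: cinf_cst].
have cc := cinf_continuous ch.
have hb x : 0 <= h x <= 1 by exact: step_bound.
have h0 x : 0 <= h x by case/andP: (hb x).
pose B := box (z.1 - 2 * r) (z.1 + 2 * r) (z.2 - 2 * r) (z.2 + 2 * r).
have hB x : ~ B x -> h x = 0.
  move=> nB; apply: cut_ge2; rewrite ler_pdivlMr //.
  case: (leP `|(x - z).1| (3 / 2 * r)) => h1; last first.
    have := real_normK (num_real (x - z).1); have := sqr_ge0 (x - z).2; nra.
  case: (leP `|(x - z).2| (3 / 2 * r)) => h2; last first.
    have := real_normK (num_real (x - z).2); have := sqr_ge0 (x - z).1; nra.
  exfalso; apply: nB; move: h1 h2; rewrite !ler_norml /= => /andP[a1 a2] /andP[a3 a4].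
  by split; rewrite /= in_itv /=; apply/andP; split; lra.
have mB : measurable B by exact: measurable_box.
have L1h : L1 setT h.
  apply: (zero_out_L1 (r := `|z.1| + `|z.2| + 2 * r)) => // x hx; apply: hB => -[].
  rewrite /= !in_itv /= => /andP[a1 a2] /andP[a3 a4].
  have e1 := ler_norm z.1; have e2 := ler_norm (- z.1); have e3 := ler_norm z.2; have e4 := ler_norm (- z.2).
  rewrite normrN in e2; rewrite normrN in e4.
  move: hx => /orP[]; rewrite ltNge => /negP; apply; rewrite ler_norml; apply/andP; split;
    have := normr_ge0 z.1; have := normr_ge0 z.2; lra.
have muB : mu B = (16 * r ^+ 2)%:E.
  by rewrite mu2_box; [congr EFin; ring|lra|lra].
have fB : (mu B < +oo)%E by rewrite muB ltry.
have I1 : Int setT h <= 16 * r ^+ 2.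
  rewrite -(Int_setT_of_zero hB); apply: (@le_trans _ _ (Int B (fun=> 1))).
    apply: le_Int => //; [exact: L1S L1h|exact: L1_cst|by move=> x _; case/andP: (hb x)].
  by rewrite Int_cst // mul1r muB.
have I2 := sum_Int_le measurableT pS L1h (fun x _ => h0 x).
have I3 : \sum_(K <- S) (r ^+ 2 / (2 * kappa ^+ 2)) <= \sum_(K <- S) Int (tri K)° h.
  apply: ler_sum_mem => K KS; have [KM [i Ki]] := SM K KS; have d0 := dS K KS.
  have dg := diam_gt0 d0; have k0 := shape_regular_gt0 d0 (sr K KM).
  (* The homothety of ratio r / diam about z. *)
  pose t := 1 - r / diam (tri K).
  have t1 : 0 <= t <= 1.
    rewrite /t lerBlDr lerDl divr_ge0 ?(ltW dg) ?(ltW r0) // subr_ge0 ler_pdivrMr // mul1r rS //.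
  have := Int_shrink i d0 cc h0 t1; rewrite (Int_EFin (measurable_tri K) (tri_L1 K cc)).
  have -> : (\int[mu]_(x in (tri K)°) ((1 - t) ^+ 2 * h (x + t *: (K i - x)))%:E = ((1 - t) ^+ 2 * area K)%:E)%E.
    rewrite -Int_tri_cst -Int_EFin; [|exact: measurable_tri|exact: L1_cst (measurable_tri K) (fin_tri K)].
    apply: eq_integral => x /set_mem ix; rewrite /h cut_le1 ?mulr1 // ler_pdivrMr // mul1r -en_sq Ki.
    have E (a b : R * R) (c : R) : a + c *: (b - a) - b = (1 - c) *: (a - b) by plane_ring.
    rewrite (E x z t).
    have tx : en (x - z) <= diam (tri K).
      by rewrite -Ki; apply: tri_diam; [exact: interior_subset|exact: tri_vertex].
    rewrite /t opprB addrC subrK enZ ger0_norm ?divr_ge0 ?(ltW dg) ?(ltW r0) //.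
    rewrite lerXn2r ?nnegrE ?(ltW r0) //; first by rewrite mulr_ge0 ?en_ge0 // divr_ge0 ?(ltW dg) ?(ltW r0).
    by rewrite mulrAC ler_pdivrMr // ler_wpM2l // ltW.
  rewrite lee_fin; apply: le_trans; rewrite /t opprB addrC subrK.
  have := area_ge d0 (sr K KM); rewrite ler_pdivrMr ?mulr_gt0 ?exprn_gt0 // => ha.
  have d2 : 0 < diam (tri K) ^+ 2 by rewrite exprn_gt0.
  rewrite expr_div_n mulrAC -mulrA; rewrite [leRHS](_ : _ = r ^+ 2 * ((2 * kappa ^+ 2 * area K) / diam (tri K) ^+ 2)).
    by rewrite ler_peMr ?(ltW r2) // ler_pdivlMr // mul1r.
  by field; rewrite gt_eqF.
have := le_trans I3 (le_trans I2 I1).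
rewrite big_const_seq count_predT iter_addr addr0 -[X in X <= _ -> _]mulr_natr.
have k0 : 0 < kappa by apply: (shape_regular_gt0 (dS _ hS)); apply: sr; case: (SM _ hS).
have k2 : 0 < 2 * kappa ^+ 2 by rewrite mulr_gt0 // exprn_gt0.
rewrite mulrAC ler_pdivrMr // [leRHS](_ : _ = r ^+ 2 * (32 * kappa ^+ 2)); last by ring.
by rewrite ler_pM2l.
Qed.

End Star.

(** * Triangles around a vertex *)

Section Fan.
Context {R : realType}.
Implicit Types (x y v z : R * R) (K L : triangle R).
Variables (D : set (R * R)) (M : mesh R) (kappa : R).
Hypotheses (oD : open D) (lip : lipschitz_boundary D) (tM : triangulation D M).
Hypothesis sr : forall K, K \in M -> shape_regular kappa K.

Definition adjacent z : rel (triangle R) := fun K K' =>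
  `[< [/\ K \in M, K' \in M & exists i i', share K i K' i' /\ (z = K (i + 1) \/ z = K (i + 1 + 1))] >].

(** The component of K in the star of z under passages through edges that end at z. At a vertex in
    [D] it is the whole star; at a boundary vertex every component is treated on its own. *)
Definition fan z K L : Prop := exists2 p, path (adjacent z) K p & L = last K p.

Lemma adjacent_sym z K L : adjacent z K L -> adjacent z L K.
Proof.
move=> /asboolP[KM LM [i [i' [sh zi]]]]; apply/asboolP; split => //.
exists i', i; split; first exact: share_sym.
by case: sh zi => [[-> ->]|[-> ->]] [->|->]; [left|right|right|left].
Qed.

Lemma fan_refl z K : fan z K K. Proof. by exists [::]. Qed.

Lemma fan_trans z K L N : fan z K L -> fan z L N -> fan z K N.
Proof. by move=> [p hp ->] [q hq ->]; exists (p ++ q); rewrite ?cat_path ?hp // last_cat. Qed.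

Lemma fan_adjacent z K L : adjacent z K L -> fan z K L.
Proof. by move=> h; exists [:: L]; rewrite //= h. Qed.

Lemma fan_sym z K L : fan z K L -> fan z L K.
Proof.
move=> [p]; elim: p K L => [|N p IH] K L /=; first by move=> _ ->; exact: fan_refl.
move=> /andP[h hp] hL; apply: (@fan_trans _ _ N); first exact: IH hp hL.
by apply: fan_adjacent; exact: adjacent_sym.
Qed.

Lemma fan_M z K L : K \in M -> fan z K L -> L \in M.
Proof.
move=> + [p]; elim: p K => [|N p IH] K KM /=; first by move=> _ ->.
by move=> /andP[/asboolP[_ NM _] hp] hL; exact: IH NM hp hL.
Qed.

Lemma adjacent_vertex z K L : adjacent z K L -> has_vertex z K && has_vertex z L.
Proof.
move=> /asboolP[_ _ [i [i' [sh zi]]]]; apply/andP; split; apply/existsP.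
  by case: zi => ->; [exists (i + 1)|exists (i + 1 + 1)].
by case: sh zi => [[-> ->]|[-> ->]] [->|->];
  [exists (i' + 1)|exists (i' + 1 + 1)|exists (i' + 1 + 1)|exists (i' + 1)].
Qed.

Lemma fan_vertex z K L : has_vertex z K -> fan z K L -> has_vertex z L.
Proof.
move=> + [p]; elim: p K => [|N p IH] K zK /=; first by move=> _ ->.
by move=> /andP[/adjacent_vertex/andP[_ zN] hp] hL; exact: IH zN hp hL.
Qed.

Lemma fan_mem z K p L : path (adjacent z) K p -> L \in K :: p -> fan z K L.
Proof.
elim: p K => [|N p IH] K /=; first by rewrite inE => _ /eqP ->; exact: fan_refl.
move=> /andP[h hp]; rewrite inE => /predU1P[->|hL]; first exact: fan_refl.
by apply: fan_trans (fan_adjacent h) _; exact: IH.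
Qed.

Lemma fan_uniq z K L : fan z K L -> exists p, [/\ path (adjacent z) K p, L = last K p & uniq (K :: p)].
Proof. by move=> [p hp ->]; case/shortenP: hp => p' hp' up' _; exists p'. Qed.

Lemma ler_sum_uniq (I : eqType) (s t : seq I) (b : I -> R) : uniq s -> {subset s <= t} ->
  (forall i, 0 <= b i) -> \sum_(i <- s) b i <= \sum_(i <- t) b i.
Proof.
move=> us; elim: s us t => [|a s IH] /=.
  by move=> _ t _ b0; rewrite big_nil; apply: sumr_ge0.
move=> /andP[nas us] t st b0.
have ta : a \in t by apply: st; rewrite inE eqxx.
rewrite big_cons (perm_big _ (perm_to_rem ta)) /= big_cons lerD2l; apply: IH => // x xs.
have xt : x \in t by apply: st; rewrite inE xs orbT.
move: xt; rewrite (perm_mem (perm_to_rem ta)) inE => /predU1P[e|//].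
by rewrite -e xs in nas.
Qed.

Lemma fan_sum z K p (b : triangle R -> R) : K \in M -> path (adjacent z) K p -> uniq (K :: p) ->
  (forall L, 0 <= b L) ->
  \sum_(L <- K :: p) b L <= \sum_(L <- M | `[< fan z K L >]) b L.
Proof.
move=> KM hp up b0; rewrite -[leRHS]big_filter; apply: ler_sum_uniq => // L hL.
rewrite mem_filter (fan_M KM (fan_mem hp hL)) andbT; apply/asboolP; exact: fan_mem hp hL.
Qed.

(** Telescoping along a chain without repetition, in which each triangle enters at most two
    links. *)
Lemma chain_bound z K L (G : triangle R -> R * R) (b : triangle R -> R) : K \in M ->
  (forall A, 0 <= b A) ->
  (forall A B, adjacent z A B -> en (G A - G B) <= b A + b B) -> fan z K L ->
  en (G K - G L) <= 2 * \sum_(A <- M | `[< fan z K A >]) b A.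
Proof.
move=> KM b0 hG /fan_uniq[p [hp -> up]].
apply: le_trans (ler_wpM2l _ (fan_sum KM hp up b0)) => //.
(* The slack [b K] makes the induction work: a new link costs the bounds of both its triangles, and
   that of the old one is already counted. *)
suff : en (G K - G (last K p)) + b K <= 2 * \sum_(A <- K :: p) b A by have := b0 K; lra.
elim: p K {KM up} hp => [|N p IH] K /=.
  by move=> _; rewrite subrr en0 big_cons big_nil; have := b0 K; lra.
move=> /andP[h hp]; rewrite big_cons; have hN := IH _ hp.
have -> : G K - G (last N p) = (G K - G N) + (G N - G (last N p)) by rewrite addrA subrK.
have := enD (G K - G N) (G N - G (last N p)); have := hG _ _ h; lra.
Qed.

Lemma adjacent_diam z K L : adjacent z K L -> diam (tri L) <= kappa * diam (tri K).
Proof.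
move=> /asboolP[KM LM [i [i' [sh _]]]].
have dK := mesh_det tM KM; have dL := mesh_det tM LM.
have k0 := shape_regular_gt0 dL (sr LM).
have := @edge_ge _ kappa L (i' + 1 + 1) (i' + 1) dL (sr LM) (neqS _).
move/le_trans; apply; rewrite ler_pM2l //.
by case: sh => [[<- <-]|[<- <-]]; apply: tri_diam; exact: tri_vertex.
Qed.

Definition nstar : nat := (Num.truncn (32 * kappa ^+ 2)).+1.

Lemma star_le_nstar z : (size (star M z) <= nstar)%N.
Proof.
rewrite -(ler_nat R); apply: le_trans (star_count z (mesh_packed lip tM) sr) _.
exact/ltW/truncnS_gt.
Qed.

Lemma kappa_ge1 K : K \in M -> 1 <= kappa.
Proof.
move=> KM; have d0 := mesh_det tM KM; have dg := diam_gt0 d0.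
have k0 := shape_regular_gt0 d0 (sr KM).
have := @edge_ge _ kappa K 1 0 d0 (sr KM) isT.
have h := tri_diam (tri_vertex 1 d0) (tri_vertex 0 d0).
by rewrite -(ler_pM2r dg) mul1r => /le_trans; apply; rewrite ler_wpM2l // ltW.
Qed.

(** Neighbours differ by a factor of at most kappa, and a chain without repetition is no longer than
    the star. *)
Lemma fan_diam z K L : K \in M -> has_vertex z K -> fan z K L ->
  diam (tri L) <= kappa ^+ nstar * diam (tri K).
Proof.
move=> KM zK /fan_uniq[p [hp -> up]]; have k1 := kappa_ge1 KM.
have dg := diam_gt0 (mesh_det tM KM).
have sp : (size p <= nstar)%N.
  apply: leq_trans (star_le_nstar z); apply: leq_trans (leqnSn _) _.
  apply: (uniq_leq_size up) => N hN; rewrite mem_filter.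
  by rewrite (fan_vertex zK (fan_mem hp hN)) (fan_M KM (fan_mem hp hN)).
apply: (@le_trans _ _ (kappa ^+ size p * diam (tri K))); last first.
  by rewrite ler_wpM2r ?(ltW dg) // ler_weXn2l.
elim: p K {KM zK up sp dg} hp => [|N p IH] K /=; first by rewrite expr0 mul1r.
move=> /andP[h hp]; apply: le_trans (IH _ hp) _; rewrite exprSr -mulrA ler_wpM2l //.
  by rewrite exprn_ge0 // (le_trans _ k1).
exact: adjacent_diam h.
Qed.

(** A canonical member of the fan. Quantities computed from it agree on all triangles of the fan, in
    particular on both sides of an edge. *)
Definition fan_rep z K : triangle R := head K [seq L <- M | `[< fan z K L >]].

Lemma fan_repP z K : K \in M -> fan z K (fan_rep z K).
Proof.
move=> KM; rewrite /fan_rep; have : K \in [seq L <- M | `[< fan z K L >]].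
  by rewrite mem_filter KM andbT; apply/asboolP; exact: fan_refl.
case E : [seq _ <- _ | _] => [//|L s] _ /=.
have : L \in L :: s by rewrite inE eqxx.
by rewrite -E mem_filter => /andP[/asboolP].
Qed.

Lemma fan_rep_eq z K L : K \in M -> fan z K L -> fan_rep z K = fan_rep z L.
Proof.
move=> KM h; have LM := fan_M KM h; rewrite /fan_rep.
have -> : [seq N <- M | `[< fan z L N >]] = [seq N <- M | `[< fan z K N >]].
  apply: eq_filter => N; apply/asboolP/asboolP => hN.
    exact: fan_trans h hN.
  exact: fan_trans (fan_sym h) hN.
have : K \in [seq L <- M | `[< fan z K L >]].
  by rewrite mem_filter KM andbT; apply/asboolP; exact: fan_refl.
by case: [seq _ <- _ | _].
Qed.

Definition edge_at z K i : Prop := z = K (i + 1) \/ z = K (i + 1 + 1).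

Lemma cross_indep (f : R) (u w p : R * R) : 0 < f ->
  cross p (f *: u + (2 * f) *: w) = 0 -> cross p ((2 * f) *: u + f *: w) = 0 ->
  cross u w != 0 -> p = 0.
Proof.
rewrite /cross /= -![_ *: _]/(_ * _).
move: u w p => [u1 u2] [w1 w2] [p1 p2] /= f0 c1 c2 uw.
have k1 : p1 * u2 - p2 * u1 = 0.
  have : f * (p1 * u2 - p2 * u1) = 0 by nra.
  by move/eqP; rewrite mulf_eq0 (gt_eqF f0) => /eqP.
have k2 : p1 * w2 - p2 * w1 = 0.
  have : f * (p1 * w2 - p2 * w1) = 0 by nra.
  by move/eqP; rewrite mulf_eq0 (gt_eqF f0) => /eqP.
have q1 : p1 * (u1 * w2 - u2 * w1) = 0.
  by rewrite (_ : _ * _ = u1 * (p1 * w2 - p2 * w1) - w1 * (p1 * u2 - p2 * u1)); [rewrite k1 k2 !mulr0 subrr|ring].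
have q2 : p2 * (u1 * w2 - u2 * w1) = 0.
  by rewrite (_ : _ * _ = u2 * (p1 * w2 - p2 * w1) - w2 * (p1 * u2 - p2 * u1)); [rewrite k1 k2 !mulr0 subrr|ring].
by congr pair; [move/eqP: q1|move/eqP: q2]; rewrite mulf_eq0 (negbTE uw) orbF => /eqP.
Qed.

(** The segment can meet the vertex only if it is collinear with it. The two candidates near the
    vertex lie in independent directions, so one of them avoids the line through the vertex and
    y. *)
Lemma corner_point K i (r : R) y : det K != 0 -> 0 < r -> y != K i ->
  exists x, [/\ (tri K)° x, en (x - K i) < r &
    forall t : R, 0 <= t <= 1 -> x + t *: (y - x) != K i].
Proof.
move=> d0 r0 yz; set z := K i.
have dg := diam_gt0 d0.
pose e := Num.min (4^-1) (r / (4 * diam (tri K))).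
have e0 : 0 < e by rewrite lt_min invr_gt0 ltr0n divr_gt0 // mulr_gt0.
have e4 : e <= 4^-1 by rewrite ge_min lexx.
have er : e * (4 * diam (tri K)) <= r.
  by rewrite -ler_pdivlMr ?mulr_gt0 // ge_min lexx orbT.
pose u := K (i + 1) - z; pose w := K (i + 1 + 1) - z.
have uw : cross u w != 0 by rewrite /u /w /z det_cyc.
pose P (a b : R) := z + (a *: u + b *: w).
have inP a b : 0 < a -> 0 < b -> a + b < 1 -> (tri K)° (P a b).
  move=> a0 b0 ab; apply/(interior_triP _ d0).
  have L j : lam K j (P a b) = lam K j z + (a * (lam K j (K (i + 1)) - lam K j z) + b * (lam K j (K (i + 1 + 1)) - lam K j z)).
    have [c h] := lam_affine K j; rewrite !h /P /u /w /dot /= -![_ *: _]/(_ * _); ring.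
  apply: (@forall3 (fun j => 0 < lam K j (P a b)) i); rewrite L /z !lam_vertex //.
  - have [e1 e2] : (i == i + 1) = false /\ (i == i + 1 + 1) = false.
      by split; rewrite eq_sym; apply/negbTE; [exact: neqS|exact: neqSS].
    rewrite eqxx e1 e2 mulr0n mulr1n; lra.
  - have e1 : (i + 1 == i + 1 + 1) = false by rewrite eq_sym; apply/negbTE; exact: neqS.
    rewrite eqxx e1 (negbTE (neqS i)) mulr0n mulr1n; lra.
  - rewrite eqxx (negbTE (neqSS i)) (negbTE (neqS _)) mulr0n mulr1n; lra.
have du : en u <= diam (tri K) by apply: tri_diam; exact: tri_vertex.
have dw : en w <= diam (tri K) by apply: tri_diam; exact: tri_vertex.
have near a b : 0 < a -> 0 < b -> a + b < 4 * e -> en (P a b - z) < r.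
  move=> a0 b0 ab; rewrite /P addrAC subrr add0r; apply: le_lt_trans (enD _ _) _.
  rewrite !enZ !gtr0_norm //; have := en_ge0 u; have := en_ge0 w; nra.
have av a b : 0 < a -> 0 < b -> cross (y - z) (a *: u + b *: w) != 0 ->
    forall t : R, 0 <= t <= 1 -> P a b + t *: (y - P a b) != z.
  move=> a0 b0 c0 t _; apply/eqP => h.
  have E : (1 - t) *: (a *: u + b *: w) + t *: (y - z) = 0.
    have -> : (1 - t) *: (a *: u + b *: w) + t *: (y - z) = P a b + t *: (y - P a b) - z.
      by rewrite /P; move: (u) (w) (z) (y) => u' w' z' y'; plane_ring.
    by rewrite h subrr.
  have C : (1 - t) * cross (y - z) (a *: u + b *: w) = 0.
    have -> : (1 - t) * cross (y - z) (a *: u + b *: w) =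
        cross (y - z) ((1 - t) *: (a *: u + b *: w) + t *: (y - z)).
      move: (a *: u + b *: w) (y - z) => p q; rewrite /cross /= -![_ *: _]/(_ * _); ring.
    by rewrite E /cross /= !mulr0 subrr.
  have t1 : t = 1.
    by move/eqP: C; rewrite mulf_eq0 (negbTE c0) orbF subr_eq0 => /eqP ->.
  move: E; rewrite t1 subrr scale0r add0r scale1r => /eqP; rewrite subr_eq0.
  by rewrite (negbTE yz).
have [c1|c1] := eqVneq (cross (y - z) (e *: u + (2 * e) *: w)) 0; last first.
  exists (P e (2 * e)); split; [apply: inP; lra|apply: near; lra|apply: av => //; lra].
exists (P (2 * e) e); split; [apply: inP; lra|apply: near; lra|apply: av => //; first lra].
apply/eqP => c2; move/negP: yz; apply; rewrite -subr_eq0; apply/eqP.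
exact: (cross_indep e0 c1 c2 uw).
Qed.

(** Connectedness of a segment from a point of [K] to y that avoids z: the parameters covered by the
    fan form a closed set, and an open one because every edge met on the way has a neighbour that
    again belongs to the fan. *)
Lemma fan_cover z K : K \in M -> has_vertex z K ->
  (forall L i x, fan z K L -> edge_at z L i -> open_edge L i x -> D x) ->
  exists2 r : R, 0 < r & forall y, y != z -> en (y - z) < r -> exists2 L, fan z K L & tri L y.
Proof.
move=> KM zK hE.
(* So close to z the segment cannot meet the edge opposite to z in any triangle at z. *)
have lampos : \forall y \near z, forall L, L \in M -> forall i, L i = z -> 0 < lam L i y.
  have : forall N : mesh R, {subset N <= M} -> \forall y \near z, forall L, L \in N -> forall i, L i = z -> 0 < lam L i y.
    elim=> [|L N IH] sN; first by apply: filterE => y L; rewrite in_nil.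
    have LM : L \in M by apply: sN; rewrite inE eqxx.
    have h1 : \forall y \near z, forall L, L \in N -> forall i, L i = z -> 0 < lam L i y.
      by apply: IH => A hA; apply: sN; rewrite inE hA orbT.
    have h2 i : \forall y \near z, L i = z -> 0 < lam L i y.
      have [e|ne] := eqVneq (L i) z; last by apply: filterE => y /eqP; rewrite (negbTE ne).
      have : \forall y \near z, 0 < lam L i y.
        have := @lam_continuous _ L i z; move=> /(_ [set t | 0 < t]); apply.
        by apply: open_nbhs_nbhs; split; [exact: open_gt|rewrite /= -e lam_vertex ?eqxx ?(mesh_det tM LM)].
      by apply: filterS => y h _.
    apply: filterS (filterI h1 (filterI (h2 0) (filterI (h2 1) (h2 o2)))) => y [g1 [g2 [g3 g4]]] A.
    by rewrite inE => /predU1P[->|/g1 //] i; case: (ord3P i) => ->.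
  by apply.
have [r r0 hr] := (nbhs_enP _ _).1 (filterI lampos (near_tri tM z)).
exists r => // y yz yr.
have [i0 zi0] : exists i, K i = z by move/existsP: zK => [i /eqP]; exists i.
rewrite -zi0 in yz.
have [x [ix xr av]] := corner_point (mesh_det tM KM) r0 yz; rewrite zi0 in xr av yz.
pose f (t : R) := x + t *: (y - x).
pose U : set (R * R) := [set p | exists2 L, fan z K L & tri L p].
have cf : continuous f by exact: line_continuous.
have ball t : 0 <= t <= 1 -> en (f t - z) < r.
  move=> /andP[t0 t1]; have -> : f t - z = (1 - t) *: (x - z) + t *: (y - z).
    by rewrite /f; move: (x) (y) (z) => a b c; plane_ring.
  apply: le_lt_trans (enD _ _) _; rewrite !enZ !ger0_norm ?subr_ge0 //.
  case: (eqVneq t 0) => [->|tn]; first by rewrite subr0 mul1r mul0r addr0.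
  have tp : 0 < t by rewrite lt_neqAle eq_sym tn.
  have : t * en (y - z) < t * r by rewrite ltr_pM2l.
  have : (1 - t) * en (x - z) <= (1 - t) * r by rewrite ler_wpM2l ?subr_ge0 // ltW.
  lra.
have clU : closed U.
  have -> : U = \bigcup_(L in [set` [seq L <- M | `[< fan z K L >]]]) tri L.
    apply/seteqP; split => p.
      move=> [L fL tL]; exists L => //=; rewrite mem_filter (fan_M KM fL) andbT; exact/asboolP.
    by move=> [L /=]; rewrite mem_filter => /andP[/asboolP fL _] tL; exists L.
  apply: closed_bigcup; first exact: finite_seq.
  move=> L /=; rewrite mem_filter => /andP[_ LM]; exact: closed_tri (mesh_det tM LM).
(* Inside a triangle this is clear; on an open edge the neighbour is added; a vertex is impossible,
   as it would be z itself or lie on the edge opposite to z. *)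
have opU t : 0 <= t <= 1 -> U (f t) -> nbhs (f t) U.
  move=> ht [L fL tL]; have LM := fan_M KM fL; have d0 := mesh_det tM LM.
  have zL := fan_vertex zK fL.
  have [j zj] : exists j, L j = z by move/existsP: zL => [j /eqP]; exists j.
  have [lp _] := hr _ (ball t ht).
  case: (tri_cases d0 tL) => [it|[i ot]|[i et]].
  - by apply: filterS it => p tp; exists L.
  - have ji : j != i by apply/eqP => e; subst j; have := lp L LM i zj; case: ot => ->; rewrite ltxx.
    have ea : edge_at z L i by rewrite /edge_at -zj; case: (ord3_other ji) => ->; [left|right].
    have Dt := hE L i _ fL ea ot.
    have [L' [i' [L'M sh neg]]] := edge_neighbour oD tM LM ot Dt.
    have fL' : fan z K L'.
      apply: fan_trans fL _; apply: fan_adjacent; apply/asboolP; split => //.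
      by exists i, i'.
    apply: filterS (edge_nbhs d0 (mesh_det tM L'M) sh neg ot) => p [tp|tp]; by [exists L|exists L'].
  - exfalso; have := lp L LM j zj; rewrite et lam_vertex //.
    case: (eqVneq j i) => [e|]; last by rewrite ltxx.
    by subst j; move: (av t ht); rewrite -/(f t) et zj eqxx.
have conn : `[0%R, 1%R]%classic `&` f @^-1` U = (`[0%R, 1%R]%classic : set R).
  apply: (@segment_connected R 0 1).
  - exists 0; split; first by rewrite /= in_itv /= lexx ler01.
    by exists K; [exact: fan_refl|rewrite /f scale0r addr0; exact: interior_subset].
  - exists (f @^-1` U°); first by apply: open_comp; [move=> t _; exact: cf|exact: open_interior].
    apply/seteqP; split => t [ht hU]; (split; first by []).
      by apply: opU => //; move: ht; rewrite /= in_itv.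
    exact: interior_subset hU.
  - by exists (f @^-1` U) => //; apply: closed_comp => // t _; exact: cf.
have : (`[0%R, 1%R]%classic : set R) 1 by rewrite /= in_itv /= ler01 lexx.
by rewrite -conn => -[_ [L fL]]; rewrite /f scale1r addrC subrK => tL; exists L.
Qed.

(** All edges at a vertex in [D] lie in [D], so the fan of [K] covers points inside [L] near z, and
    conformity identifies the triangle found there with [L]. *)
Lemma fan_interior z K L : K \in M -> L \in M -> has_vertex z K -> has_vertex z L -> D z -> fan z K L.
Proof.
move=> KM LM zK zL Dz.
have [r r0 hr] := fan_cover KM zK (fun A i x fA ea oA =>
  let: conj a b := conj (fan_M KM fA) ea in
  match ea with
  | or_introl e => edge_end_D oD lip tM a (neqS i) (eq_ind _ D Dz _ e) oA
  | or_intror e => edge_end_D oD lip tM a (neqSS i) (eq_ind _ D Dz _ e) oA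
  end).
have [j zj] : exists j, L j = z by move/existsP: zL => [j /eqP]; exists j.
have dL := mesh_det tM LM.
have nz : L (j + 1) != L j.
  by apply/eqP => e; have := lam_vertex j (j + 1) dL; rewrite e lam_vertex // eqxx eq_sym (negbTE (neqS j)) => /eqP; rewrite oner_eq0.
have [x [ix xr av]] := corner_point dL r0 nz; rewrite zj in xr.
have xz : x != z.
  by rewrite -zj; have := av 0; rewrite scale0r addr0; apply; rewrite lexx ler01.
have [A fA tA] := hr x xz xr.
have AM := fan_M KM fA; case: (tM) => _ _ _ cM.
by rewrite (conforming_interior cM LM AM dL ix tA).
Qed.

(** Otherwise the fan would cover a neighbourhood of z, which would then be interior to the closure
    and belong to [D]. *)
Lemma fan_boundary z K : K \in M -> has_vertex z K -> ~ D z ->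
  exists L i, [/\ fan z K L, edge_at z L i & forall x, open_edge L i x -> ~ D x].
Proof.
move=> KM zK nDz; apply: contrapT => no; apply: nDz.
have [|r r0 hr] := @fan_cover z K KM zK.
  move=> L i x fL ea ox; apply: contrapT => nDx; apply: no; exists L, i; split => // y oy Dy.
  by apply: nDx; exact: (open_edge_D oD lip tM (fan_M KM fL) oy ox Dy).
apply: (lipschitz_interior_closure lip); apply/nbhs_enP; exists r => // y yr.
have [->|yz] := eqVneq y z.
  have [i zi] : exists j, K j = z by move/existsP: zK => [j /eqP]; exists j.
  by apply: (mesh_closure tM KM); rewrite -zi; exact: tri_vertex (mesh_det tM KM).
have [L fL tL] := hr y yz yr; exact: (mesh_closure tM (fan_M KM fL)).
Qed.

End Fan.

(** * Quadratic polynomials *)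

Section Quadratics.
Context {R : realType}.
Implicit Types (x y v : R * R) (K : triangle R) (u w : R * R -> R).

Definition quad (a b c d e f : R) : R * R -> R := fun x =>
  a + b * x.1 + c * x.2 + d * x.1 ^+ 2 + e * (x.1 * x.2) + f * x.2 ^+ 2.

Lemma cinf_quad a b c d e f : cinf (quad a b c d e f).
Proof.
have h1 := @cinf_fst R; have h2 := @cinf_snd R.
do !apply: cinfD; try exact: cinf_cst; (apply: cinfM; [exact: cinf_cst|]); try exact: h1; try exact: h2; exact: cinfM.
Qed.

Lemma derive_line u x v (L Q : R) : differentiable u x ->
  (forall t : R, u (x + t *: v) = u x + t * L + t ^+ 2 * Q) -> 'D_v u x = L.
Proof.
move=> du h.
have du0 : differentiable u (x + 0 *: v) by rewrite scale0r addr0.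
have d1 := line_is_derive du0; rewrite scale0r addr0 in d1.
have d2 : is_derive (0 : R) 1 (fun t : R => u x + t * L + t ^+ 2 * Q) (0 + (0 *: 0 + L *: 1) + (0 ^+ 2 *: 0 + Q *: (0 *: 1 + 0 *: 1))).
  apply: is_deriveD; first apply: is_deriveD.
    exact: (is_deriveM (is_derive_id (0:R) 1) (is_derive_cst (L : R^o) (0:R) 1)).
  exact: (is_deriveM (is_deriveM (is_derive_id (0:R) 1) (is_derive_id (0:R) 1)) (is_derive_cst (Q : R^o) (0:R) 1)).
have E : (fun t : R => u (x + t *: v)) = (fun t : R => u x + t * L + t ^+ 2 * Q) by apply/funext => t; exact: h.
rewrite E in d1.
have e1 := @derive_val _ _ _ _ _ _ _ d1; have e2 := @derive_val _ _ _ _ _ _ _ d2.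
by rewrite -e1 e2 -![_ *: _]/(_ * _); ring.
Qed.

Lemma pd0_quad a b c d e f : pd 0 (quad a b c d e f) = quad b (2 * d) e 0 0 0.
Proof.
apply/funext => x; rewrite pdE; apply: (derive_line (Q := d)); first exact: cinf_diff (cinf_quad _ _ _ _ _ _).
by move=> t; rewrite /quad /= -![_ *: _]/(_ * _); ring.
Qed.

Lemma pd1_quad a b c d e f : pd 1 (quad a b c d e f) = quad c e (2 * f) 0 0 0.
Proof.
apply/funext => x; rewrite pdE; apply: (derive_line (Q := f)); first exact: cinf_diff (cinf_quad _ _ _ _ _ _).
by move=> t; rewrite /quad /= -![_ *: _]/(_ * _); ring.
Qed.

Lemma poly_le2P u : poly_le2 u <-> exists a b c d e f, u = quad a b c d e f.
Proof.
split.
  move=> [c h]; exists (c 0 0)%N, (c 1 0)%N, (c 0 1)%N, (c 2 0)%N, (c 1 1)%N, (c 0 2)%N.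
  apply/funext => x; rewrite h /quad.
  under eq_bigr => i _ do rewrite big_mkcond !big_ord_recl big_ord0 /=.
  rewrite !big_ord_recl big_ord0 /bump /=; ring.
move=> [a [b [c [d [e [f ->]]]]]].
exists (fun i j => nth 0 (nth [::] [:: [:: a; c; f]; [:: b; e]; [:: d]] i) j) => x.
rewrite /quad.
under [RHS]eq_bigr => i _ do rewrite big_mkcond !big_ord_recl big_ord0 /=.
rewrite !big_ord_recl big_ord0 /bump /=; ring.
Qed.

Lemma poly_cinf u : poly_le2 u -> cinf u.
Proof. by move=> /poly_le2P[a [b [c [d [e [f ->]]]]]]; exact: cinf_quad. Qed.

Lemma poly_hess u i j : poly_le2 u -> exists k : R, pd i (pd j u) = fun=> k.
Proof.
move=> /poly_le2P[a [b [c [d [e [f ->]]]]]].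
have Z k : quad k 0 0 0 0 0 = fun=> k by apply/funext => x; rewrite /quad; ring.
by case: (ord2P i) => ->; case: (ord2P j) => ->; rewrite ?pd0_quad ?pd1_quad ?pd0_quad ?pd1_quad !mulr0 Z; eexists.
Qed.

Lemma polyB u w : poly_le2 u -> poly_le2 w -> poly_le2 (fun x => u x - w x).
Proof.
move=> /poly_le2P[a [b [c [d [e [f ->]]]]]] /poly_le2P[a' [b' [c' [d' [e' [f' ->]]]]]].
apply/poly_le2P; exists (a - a'), (b - b'), (c - c'), (d - d'), (e - e'), (f - f').
by apply/funext => x; rewrite /quad; ring.
Qed.

Definition mid K i : R * R := 2^-1 *: (K (i + 1) + K (i + 1 + 1)).

(** An affine function has its midpoint value as mean. Thus the midpoint conditions on the gradient
    of a Morley function are conditions on edge means. *)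
Lemma seg_mean_quad (b d e : R) x y :
  seg_mean (quad b d e 0 0 0) x y = quad b d e 0 0 0 (2^-1 *: (x + y)).
Proof.
rewrite /seg_mean; pose g (t : R) := quad b d e 0 0 0 (x + t *: (y - x)).
pose F (t : R) := t * quad b d e 0 0 0 x + t ^+ 2 * (2^-1 * (d * (y.1 - x.1) + e * (y.2 - x.2))).
have dF (t : R) : is_derive t 1 F (g t).
  have h := is_deriveD (is_deriveM (is_derive_id t 1) (is_derive_cst (quad b d e 0 0 0 x : R^o) t 1))
    (is_deriveM (is_deriveM (is_derive_id t 1) (is_derive_id t 1)) (is_derive_cst (2^-1 * (d * (y.1 - x.1) + e * (y.2 - x.2)) : R^o) t 1)).
  by apply: is_derive_eq h _; rewrite /g /quad /= -![_ *: _]/(_ * _); field.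
have cg : continuous g.
  by apply: (seg_continuous (w := quad b d e 0 0 0)); apply: cinf_continuous; exact: cinf_quad.
rewrite /Rintegral (FTC_everywhere ltr01 dF cg) /= /F /quad /= -![_ *: _]/(_ * _).
by field.
Qed.

Lemma seg_mean_poly u i x y : poly_le2 u -> seg_mean (pd i u) x y = pd i u (2^-1 *: (x + y)).
Proof.
move=> /poly_le2P[a [b [c [d [e [f ->]]]]]].
by case: (ord2P i) => ->; rewrite ?pd0_quad ?pd1_quad seg_mean_quad.
Qed.

(** Second derivatives are listed as xx, xy, yy, that is by the order in the second variable. *)
Definition ord2 (c : 'I_3) : nat * nat := ((2 - c)%N, c : nat).

(** The mixed derivative occurs twice in the scalar product of Hessians. *)
Definition wt (c : 'I_3) : R := if c == 1 then 2 else 1.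

Definition Hc (c : 'I_3) u : R * R -> R := Dclassical (ord2 c) u.

Lemma Hc0 u : Hc 0 u = pd 0 (pd 0 u). Proof. by []. Qed.
Lemma Hc1 u : Hc 1 u = pd 0 (pd 1 u). Proof. by []. Qed.
Lemma Hc2 u : Hc o2 u = pd 1 (pd 1 u). Proof. by []. Qed.

Lemma cinf_Hc c u : cinf u -> cinf (Hc c u).
Proof. exact: cinf_Dclassical. Qed.

Lemma wt0 : wt 0 = 1. Proof. by []. Qed.
Lemma wt1 : wt 1 = 2. Proof. by []. Qed.
Lemma wt2 : wt o2 = 1. Proof. by []. Qed.

Lemma wt_ge0 c : 0 <= wt c. Proof. by rewrite /wt; case: ifP. Qed.

Lemma hess2E u x : cinf u -> hess2 u x = \sum_c wt c * Hc c u x ^+ 2.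
Proof.
move=> cu; have e : pd 1 (pd 0 u) x = pd 0 (pd 1 u) x by rewrite pd_comm.
rewrite sum3 wt0 wt1 wt2 Hc0 Hc1 Hc2.
rewrite [hess2]lock -lock.
have -> : hess2 u x = (pd 0 (pd 0 u) x ^+ 2 + pd 0 (pd 1 u) x ^+ 2) +
  (pd 1 (pd 0 u) x ^+ 2 + pd 1 (pd 1 u) x ^+ 2) by [].
rewrite e; move: (pd 0 (pd 0 u) x) (pd 0 (pd 1 u) x) (pd 1 (pd 1 u) x) => a b c; ring.
Qed.

(** The quadratic polynomial with second derivatives h and vertex values v: a pure quadratic form
    plus an affine correction at the vertices. *)
Definition nodal_quad K (h : 'I_3 -> R) (v : 'I_3 -> R) : R * R -> R :=
  let Q := quad 0 0 0 (h 0 / 2) (h 1) (h o2 / 2) in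
  fun x => Q x + \sum_i lam K i x * (v i - Q (K i)).

Lemma lam_quad K i : exists a b c, lam K i = quad a b c 0 0 0.
Proof.
have [c h] := lam_affine K i; exists c, (glam K i).1, (glam K i).2.
apply/funext => x; rewrite h /dot /quad; ring.
Qed.

Lemma nodal_quadE K (h v : 'I_3 -> R) : exists a b c, nodal_quad K h v = quad a b c (h 0 / 2) (h 1) (h o2 / 2).
Proof.
rewrite /nodal_quad; set Q := quad _ _ _ _ _ _.
have [a0 [b0 [c0 e0]]] := lam_quad K 0; have [a1 [b1 [c1 e1]]] := lam_quad K 1.
have [a2 [b2 [c2 e2]]] := lam_quad K o2.
pose p := v 0 - Q (K 0); pose q := v 1 - Q (K 1); pose r := v o2 - Q (K o2).
exists (a0 * p + a1 * q + a2 * r), (b0 * p + b1 * q + b2 * r), (c0 * p + c1 * q + c2 * r).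
apply/funext => x; rewrite sum3 -/p -/q -/r e0 e1 e2 /Q /quad; move: (p) (q) (r) => p1 q1 r1; ring.
Qed.

Lemma nodal_poly K (h v : 'I_3 -> R) : poly_le2 (nodal_quad K h v).
Proof. by apply/poly_le2P; have [a [b [c e]]] := nodal_quadE K h v; do 6 eexists; exact: e. Qed.

Lemma nodal_vertex K (h v : 'I_3 -> R) j : det K != 0 -> nodal_quad K h v (K j) = v j.
Proof.
move=> d0; rewrite /nodal_quad (bigD1 j) //= lam_vertex // eqxx mul1r big1 ?addr0.
  by rewrite addrC subrK.
by move=> i ij; rewrite lam_vertex // (negbTE ij) mul0r.
Qed.

Lemma nodal_Hc K (h v : 'I_3 -> R) c : Hc c (nodal_quad K h v) = fun=> h c.
Proof.
have [a [b [k ->]]] := nodal_quadE K h v.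
have Z l : quad l 0 0 0 0 0 = fun=> l by apply/funext => x; rewrite /quad; ring.
case: (ord3P c) => ->; rewrite ?Hc0 ?Hc1 ?Hc2.
- by rewrite !pd0_quad !mulr0 Z; apply/funext => _; field.
- by rewrite pd1_quad pd0_quad !mulr0 Z.
- by rewrite !pd1_quad !mulr0 Z; apply/funext => _; field.
Qed.

End Quadratics.

(** * Morley functions *)

Section MorleyPieces.
Context {R : realType}.
Notation mu := (@mu2 R).
Implicit Types (x y z : R * R) (K L : triangle R) (u v w : R * R -> R).
Variables (D : set (R * R)) (M : mesh R).
Hypotheses (oD : open D) (bD : bounded_set D) (lip : lipschitz_boundary D) (tM : triangulation D M).

Lemma conf_vertex K L i : K \in M -> L \in M -> tri L (K i) -> has_vertex (K i) L.
Proof.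
move=> KM LM tx; have d0 := mesh_det tM KM; have dL := mesh_det tM LM.
case: (eqVneq K L) => [->|/eqP ne]; first by apply/existsP; exists i.
case: (tM) => _ _ _ cM.
have xx : (tri K `&` tri L) (K i) by split => //; exact: tri_vertex.
case: (cM _ _ KM LM ne) => [e|[k [k' [ek e]]]|[k [j [k' [j' [kj kj' ek ej e]]]]]]; rewrite e in xx => //.
  by rewrite xx; apply/existsP; exists k'; rewrite ek.
have [l [lk lj]] := third kj.
have := segment_lam0 d0 lk lj xx; rewrite lam_vertex //.
case: (eqVneq l i) => [e1 /eqP|li _]; first by rewrite oner_eq0.
apply/existsP; have : i = k \/ i = j.
  by move: lk lj li kj; case: (ord3P i) => ->; case: (ord3P k) => ->; case: (ord3P j) => ->; case: (ord3P l) => ->; rewrite ?eqxx //; (by left) || (by right).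
by case=> ->; [exists k'; rewrite ek|exists j'; rewrite ej].
Qed.

Lemma mid_open_edge K i : det K != 0 -> open_edge K i (mid K i).
Proof.
move=> d0; have -> : mid K i = K (i + 1) + 2^-1 *: (K (i + 1 + 1) - K (i + 1)).
  by rewrite /mid; move: (K _) (K _) => a b; congr pair; rewrite /= -![_ *: _]/(_ * _); field.
by apply: open_edge_point => //; apply/andP; split; lra.
Qed.

Lemma share_mid K i L i' : share K i L i' -> mid K i = mid L i'.
Proof. by rewrite /share /mid => -[[-> ->]|[-> ->]] //; rewrite addrC. Qed.

Lemma edge_midpoint_mid z : edge_midpoint M z -> exists K i, K \in M /\ z = mid K i.
Proof.
move=> [K KM [i [j [ij ->]]]]; exists K.
have [l [li lj]] := third ij; exists l; split => //.
rewrite eq_sym in li; rewrite eq_sym in lj.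
by rewrite /mid; case: (ord3_other li) => ei; case: (ord3_other lj) => ej; subst; rewrite ?eqxx in ij => //; rewrite addrC.
Qed.

(** The Morley conditions indexed by vertices and edges of triangles instead of points; conditions
    on the boundary are stated for points of the mesh outside [D]. *)
Definition pieces (P : triangle R -> R * R -> R) : Prop :=
  [/\ forall K, K \in M -> poly_le2 (P K),
      forall K L i j, K \in M -> L \in M -> K i = L j -> P K (K i) = P L (L j),
      forall K i, K \in M -> ~ D (K i) -> P K (K i) = 0,
      forall K L i j l, K \in M -> L \in M -> share K i L j ->
        pd l (P K) (mid K i) = pd l (P L) (mid L j) &
      forall K i l, K \in M -> ~ D (mid K i) -> pd l (P K) (mid K i) = 0].

Lemma bd_D K z : K \in M -> tri K z -> ~ D z -> bd D z.
Proof. by move=> KM tz nD; split => //; exact: mesh_closure tM _ KM _ tz. Qed.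

Lemma morley_pieces v : morley D M v ->
  exists2 P, pieces P & forall K, K \in M -> forall x, (tri K)° x -> v x = P K x.
Proof.
move=> [P [h1 h2 h3 h4 h5]]; exists P; last by move=> K KM x; case: (h1 K KM) => _; apply.
have tv K i : K \in M -> tri K (K i) by move=> KM; apply: tri_vertex; exact: mesh_det tM _ KM.
have te K i : K \in M -> tri K (mid K i).
  by move=> KM; apply: open_edge_tri (mid_open_edge i _); exact: mesh_det tM _ KM.
have em K i : K \in M -> edge_midpoint M (mid K i).
  by move=> KM; exists K => //; exists (i + 1), (i + 1 + 1); rewrite eq_sym neqS.
have vx K i : K \in M -> vertex M (K i) by move=> KM; exists K => //; exists i.
split.
- by move=> K /h1[].
- move=> K L i j KM LM e; have tK := tv K i KM; have tL : tri L (K i) by rewrite e; exact: tv.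
  rewrite -e; have [Dz|nDz] := pselect (D (K i)); first exact: h2 (vx K i KM) Dz K L KM LM tK tL.
  have b := bd_D KM tK nDz; by rewrite (h3 _ (vx K i KM) b K KM tK) (h3 _ (vx K i KM) b L LM tL).
- by move=> K i KM nD; exact: (h3 _ (vx K i KM) (bd_D KM (tv K i KM) nD) K KM (tv K i KM)).
- move=> K L i j l KM LM sh; rewrite -(share_mid sh).
  have tK := te K i KM; have tL : tri L (mid K i) by rewrite (share_mid sh); exact: te.
  have [Dz|nDz] := pselect (D (mid K i)); first exact: (h4 _ l (em K i KM) Dz K L KM LM tK tL).
  have b := bd_D KM tK nDz; by rewrite (h5 _ l (em K i KM) b K KM tK) (h5 _ l (em K i KM) b L LM tL).
- move=> K i l KM nD; exact: (h5 _ l (em K i KM) (bd_D KM (te K i KM) nD) K KM (te K i KM)).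
Qed.

(** By conformity a mesh vertex or an edge midpoint lying in a closed triangle is a vertex or an
    edge midpoint of that triangle. *)
Lemma pieces_morley P v : pieces P -> (forall K, K \in M -> forall x, (tri K)° x -> v x = P K x) ->
  morley D M v.
Proof.
move=> [h1 h2 h3 h4 h5] hv; exists P.
have vert z K : vertex M z -> K \in M -> tri K z -> exists i, z = K i.
  move=> [L LM [i ->]] KM tz; have /existsP[j /eqP e] := conf_vertex LM KM tz; by exists j.
have edg z K : edge_midpoint M z -> K \in M -> tri K z -> exists i, z = mid K i.
  move=> /edge_midpoint_mid[L [i [LM ->]]] KM tz.
  have ot := mid_open_edge i (mesh_det tM LM).
  case: (eqVneq L K) => [<-|/eqP ne]; first by exists i.
  have [j sh] := conf_edge tM LM KM ne ot tz; exists j; exact: share_mid.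
split.
- by move=> K KM; split; [exact: h1|move=> x; exact: hv].
- move=> z vz Dz K L KM LM tK tL; have [i ei] := vert z K vz KM tK; have [j ej] := vert z L vz LM tL.
  by rewrite {1}ei ej; apply: h2 => //; rewrite -ei -ej.
- move=> z vz [_ nDz] K KM tK; have [i ei] := vert z K vz KM tK.
  by rewrite ei; apply: h3 => //; rewrite -ei.
- move=> z l ez Dz K L KM LM tK tL; have [i ei] := edg z K ez KM tK; have [j ej] := edg z L ez LM tL.
  case: (eqVneq K L) => [->//|/eqP ne].
  have ot : open_edge K i z by rewrite ei; exact: mid_open_edge (mesh_det tM KM).
  have [j' sh] := conf_edge tM KM LM ne ot tL.
  by rewrite ei (h4 K L i j' l KM LM sh) (share_mid sh).
- move=> z l ez [_ nDz] K KM tK; have [i ei] := edg z K ez KM tK.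
  by rewrite ei; apply: h5 => //; rewrite -ei.
Qed.

Lemma piecesB P Q : pieces P -> pieces Q -> pieces (fun K x => P K x - Q K x).
Proof.
move=> [a1 a2 a3 a4 a5] [b1 b2 b3 b4 b5].
have pdB K l x : K \in M -> pd l (fun y => P K y - Q K y) x = pd l (P K) x - pd l (Q K) x.
  move=> KM; have := pd_lin l 1 (-1) x (poly_cinf (a1 K KM)) (poly_cinf (b1 K KM)).
  rewrite mul1r mulN1r => <-; congr (pd l _ x); apply/funext => y; by rewrite mul1r mulN1r.
split.
- by move=> K KM; apply: polyB; [exact: a1|exact: b1].
- by move=> K L i j KM LM e; rewrite (a2 K L i j KM LM e) (b2 K L i j KM LM e).
- by move=> K i KM nD; rewrite a3 // b3 // subrr.
- move=> K L i j l KM LM sh; rewrite pdB // pdB //.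
  by rewrite (a4 K L i j l KM LM sh) (b4 K L i j l KM LM sh).
- by move=> K i l KM nD; rewrite pdB // a5 // b5 // subrr.
Qed.

(** The value on the edges is fixed to be 0; this gives a measurable representative of a Morley
    function. *)
Definition mesh_glue (P : triangle R -> R * R -> R) : R * R -> R :=
  fun x => \sum_(K <- M) P K x * \1_((tri K)° : set (R * R)) x.

Lemma glue_in P K x : K \in M -> (tri K)° x -> mesh_glue P x = P K x.
Proof.
move=> KM ix; have [uM _ _ /trivIsetP tV] := mesh_packed lip tM.
rewrite /mesh_glue (bigD1_seq K) //= indicE mem_set // mulr1 big1_seq ?addr0 // => L /andP[LK LM].
rewrite indicE memNset ?mulr0 // => iL.
by have : ((tri L)° `&` (tri K)°) x by []; rewrite tV.
Qed.

Let mD : measurable (D : set (Pl R)). Proof. exact: open_measurable2. Qed.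

Lemma L2_indic (E A : set (Pl R)) u : measurable E -> measurable A -> L2 E u ->
  L2 E (fun x => u x * \1_A x).
Proof.
move=> mE mA hu; have mm : measurable_fun E (fun x => u x * \1_A x).
  by apply: measurable_funM; [exact: L2_measurable hu|exact: (@measurable_indic _ (Pl R))].
split => //; apply: (le_L1 (v := fun x => u x ^+ 2)) => //; first exact: measurable_funX.
  move=> x _; rewrite ger0_norm ?sqr_ge0 // exprMn indicE.
  by case: (x \in A); rewrite ?expr1n ?mulr1 // expr0n mulr0 sqr_ge0.
exact: L2_L1sq hu.
Qed.

Lemma L2_glue P : (forall K, K \in M -> continuous (P K)) -> L2 D (mesh_glue P).
Proof.
move=> cP; rewrite /mesh_glue.
rewrite (_ : (fun x => _) = (fun x => \sum_(K <- M | K \in M) P K x * \1_((tri K)° : set (R * R)) x)).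
  apply: L2_sum => // K KM; apply: L2_indic => //; first exact: measurable_tri.
  by apply: L2_continuous => //; exact: cP.
by apply/funext => x; rewrite big_seq.
Qed.

Lemma ip_mesh u v : L2 D u -> L2 D v -> ip D u v = \sum_(K <- M) ip (tri K)° u v.
Proof.
move=> hu hv; rewrite ipE (Int_mesh oD lip tM) //.
have [_ _ sM _] := mesh_packed lip tM.
by move=> K KM; apply: L1S (L2_mul mD hu hv) => //; [exact: measurable_tri|exact: sM].
Qed.

Lemma L2K u K : K \in M -> L2 D u -> L2 (tri K)° u.
Proof.
have [_ _ sM _] := mesh_packed lip tM.
by move=> KM; apply: L2S => //; [exact: measurable_tri|exact: sM].
Qed.

(** Removes the null set of edges before any measurability of u is known; meant for the discrete
    solution, which is arbitrary there. *)
Lemma ip_int_eq f u v : (forall K, K \in M -> forall x, (tri K)° x -> u x = v x) ->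
  ip D f u = ip D f v.
Proof.
move=> h; have [s0 ms] := skel2_null oD tM.
rewrite !ipE (Int_setD_null _ mD ms s0) [RHS](Int_setD_null _ mD ms s0).
apply: eq_Int => x [Dx nx].
have : (\big[setU/set0]_(K <- M) ((tri K)° : set (Pl R))) x by apply: contrapT => hx; apply: nx.
by rewrite -bigcup_seq => -[K /= KM ix]; rewrite (h K KM x ix).
Qed.

(** Triples stand for Hessians and [B] for the integral of their matrix scalar product. *)
Definition B (h k : 'I_3 -> R * R -> R) : R := \sum_c wt c * ip D (h c) (k c).

Definition Bn h : R := Num.sqrt (B h h).

Definition L2t (h : 'I_3 -> R * R -> R) := forall c, L2 D (h c).

Definition subt (h k : 'I_3 -> R * R -> R) : 'I_3 -> R * R -> R := fun c x => h c x - k c x.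

Lemma BC h k : B h k = B k h.
Proof. by apply: eq_bigr => c _; rewrite ipC. Qed.

Lemma BBl h k l : L2t h -> L2t k -> L2t l -> B (subt h k) l = B h l - B k l.
Proof.
by move=> hh hk hl; rewrite /B -sumrB; apply: eq_bigr => c _; rewrite -mulrBr ipBl.
Qed.

Lemma BBr h k l : L2t h -> L2t k -> L2t l -> B l (subt h k) = B l h - B l k.
Proof. by move=> hh hk hl; rewrite BC BBl // !(BC _ l). Qed.

Lemma L2t_sub h k : L2t h -> L2t k -> L2t (subt h k).
Proof. by move=> hh hk c; exact: L2B. Qed.

Lemma B_ge0 h : 0 <= B h h.
Proof. by apply: sumr_ge0 => c _; rewrite mulr_ge0 ?wt_ge0 ?ip_ge0. Qed.

Lemma Bn_ge0 h : 0 <= Bn h. Proof. exact: sqrtr_ge0. Qed.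

Lemma Bn_sq h : Bn h ^+ 2 = B h h. Proof. by rewrite sqr_sqrtr // B_ge0. Qed.

Lemma B_le h k : L2t h -> L2t k -> `|B h k| <= Bn h * Bn k.
Proof.
move=> hh hk; apply: quadratic_ge0_discr => t.
have -> : B h h + 2 * t * B h k + t ^+ 2 * B k k =
    \sum_c wt c * ip D (fun x => h c x + t * k c x) (fun x => h c x + t * k c x).
  rewrite /B !mulr_sumr -!big_split /=; apply: eq_bigr => c _.
  have hc := hh c; have kc := hk c; have tk := L2Z t mD kc.
  have s := L2D mD hc tk.
  rewrite (ipDl mD hc tk s) !(ipDr mD hc tk _) // (ipZr _ mD kc hc) (ipZl _ mD kc hc) (ipZr _ mD kc tk) (ipZl _ mD kc kc).
  by rewrite (ipC D (k c)); ring.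
by apply: sumr_ge0 => c _; rewrite mulr_ge0 ?wt_ge0 ?ip_ge0.
Qed.

Lemma Bn_sub h k : L2t h -> L2t k -> Bn (subt h k) <= Bn h + Bn k.
Proof.
move=> hh hk; rewrite -(ler_pXn2r (n := 2)) ?nnegrE ?addr_ge0 ?Bn_ge0 //.
rewrite Bn_sq (BBl hh hk (L2t_sub hh hk)) !BBr // (BC k h) sqrrD !Bn_sq.
have := B_le hh hk; rewrite ler_norml => /andP[a b]; lra.
Qed.

(** A piecewise Hessian of u in any representative, as opposed to the chosen one in [hessian]. *)
Definition isH u (h : 'I_3 -> R * R -> R) : Prop :=
  L2t h /\ forall c K, K \in M -> weak_derivative (tri K)° (ord2 c) u (h c).

Lemma isHB u v h k : L2t (fun=> u) -> L2t (fun=> v) -> isH u h -> isH v k ->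
  isH (fun x => u x - v x) (subt h k).
Proof.
move=> hu hv [h1 h2] [k1 k2]; split; first exact: L2t_sub.
move=> c K KM; have mK := measurable_tri K.
by apply: (weak_derivativeB mK (L2K KM (hu c)) (L2K KM (hv c)) (L2K KM (h1 c)) (L2K KM (k1 c))); [exact: h2|exact: k2].
Qed.

Lemma isH_eq u v h : (forall K, K \in M -> forall x, (tri K)° x -> u x = v x) -> isH u h -> isH v h.
Proof. by move=> e [h1 h2]; split => // c K KM; apply: eq_weak_derivative (h2 c K KM) => x; exact: e. Qed.

Lemma isH_glue P : (forall K, K \in M -> cinf (P K)) -> isH (mesh_glue P) (fun c => mesh_glue (fun K => Hc c (P K))).
Proof.
move=> cP; split.
  by move=> c; apply: L2_glue => K KM; apply: cinf_continuous; apply: cinf_Hc; exact: cP.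
move=> c K KM p tp.
have -> : ip (tri K)° (mesh_glue (fun K => Hc c (P K))) p = ip (tri K)° (Hc c (P K)) p.
  by apply: eq_ip => // x ix; exact: glue_in KM ix.
rewrite -(@weak_derivative_classical _ (tri K)° (ord2 c) (P K) (cP K KM) p tp).
by apply: eq_ip => // x ix; exact: glue_in KM ix.
Qed.

(** On each open triangle the chosen weak derivatives agree almost everywhere with the
    representatives at hand. *)
Lemma aNC_B u v h k : isH u h -> isH v k -> aNC M u v = B h k.
Proof.
move=> [h1 h2] [k1 k2]; rewrite /aNC /B.
have -> : \sum_c wt c * ip D (h c) (k c) = \sum_(K <- M) \sum_c wt c * ip (tri K)° (h c) (k c).
  rewrite exchange_big /=; apply: eq_bigr => c _; by rewrite ip_mesh // mulr_sumr.
apply: eq_big_seq => K KM; have mK := measurable_tri K.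
have oK : open ((tri K)° : set (R * R)) by exact: open_interior.
have ex (g : R * R -> R) (l : 'I_3 -> R * R -> R) c : (forall c, L2 D (l c)) -> (forall c K, K \in M -> weak_derivative (tri K)° (ord2 c) g (l c)) ->
    L2 (tri K)° (wD (tri K)° (ord2 c) g) /\ {ae mu, forall x, (tri K)° x -> wD (tri K)° (ord2 c) g x = l c x}.
  move=> l1 l2; have Lk := L2K KM (l1 c); split.
    by have [] := wDP (ex_intro _ (l c) (conj Lk (l2 c K KM))).
  exact: wD_ae oK (bounded_tri K) Lk (l2 c K KM).
have Ec c : ip (tri K)° (wD (tri K)° (ord2 c) u) (wD (tri K)° (ord2 c) v) = ip (tri K)° (h c) (k c).
  have [a1 a2] := ex u h c h1 h2; have [b1 b2] := ex v k c k1 k2.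
  exact: (ip_ae_eq mK a1 (L2K KM (h1 c)) b1 (L2K KM (k1 c)) a2 b2).
have Lu c : L2 (tri K)° (wD (tri K)° (ord2 c) u) by case: (ex u h c h1 h2).
have Lv c : L2 (tri K)° (wD (tri K)° (ord2 c) v) by case: (ex v k c k1 k2).
have Lp c : L1 (tri K)° (fun x => wD (tri K)° (ord2 c) u x * wD (tri K)° (ord2 c) v x) by exact: L2_mul.
have key (a b e : R * R -> R) : L1 (tri K)° a -> L1 (tri K)° b -> L1 (tri K)° e ->
    1 * Int (tri K)° a + 2 * Int (tri K)° b + 1 * Int (tri K)° e =
    Int (tri K)° (fun x => a x + 2 * b x + e x).
  move=> ha hb he; have h2b := L1Z 2 mK hb.
  by rewrite !mul1r (IntD mK (L1D mK ha h2b) he) (IntD mK ha h2b) (IntZ 2 mK hb).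
have key2 (a b : 'I_3 -> R * R -> R) : (forall c, L1 (tri K)° (fun x => a c x * b c x)) ->
    \sum_c wt c * ip (tri K)° (a c) (b c) =
    Int (tri K)° (fun x => a 0 x * b 0 x + 2 * (a 1 x * b 1 x) + a o2 x * b o2 x).
  by move=> L; rewrite sum3 wt0 wt1 wt2 !ipE (key _ _ _ (L 0) (L 1) (L o2)).
apply: etrans; last by apply: eq_bigr => c _; rewrite -(Ec c).
apply: etrans; last exact: esym (key2 (fun c => wD (tri K)° (ord2 c) u) (fun c => wD (tri K)° (ord2 c) v) Lp).
clear Ec Lu Lv Lp key key2 ex.
apply: eq_Int => x _; rewrite /mxscalar !big_ord_recl !big_ord0 /hessian !mxE /=.
rewrite -[ord2 0]/(2, 0)%N -[ord2 1]/(1, 1)%N -[ord2 o2]/(0, 2)%N.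
move: (wD _ (2, 0)%N u x) (wD _ (2, 0)%N v x) (wD _ (1, 1)%N u x) (wD _ (1, 1)%N v x) (wD _ (0, 2)%N u x) (wD _ (0, 2)%N v x) => a a' b b' c c'.
rewrite /=; ring.
Qed.

Definition P0 (g : R * R -> R) : R * R -> R := mesh_glue (fun K => fun=> tmean K g).

Definition pwc (k : R * R -> R) : Prop := exists C : triangle R -> R,
  forall K, K \in M -> forall x, (tri K)° x -> k x = C K.

Lemma L2_P0 g : L2 D (P0 g).
Proof. by apply: L2_glue => K _ x; exact: cvg_cst. Qed.

Lemma pwc_P0 g : pwc (P0 g).
Proof. by exists (fun K => tmean K g) => K KM x ix; rewrite /P0 (glue_in _ KM ix). Qed.

(** A piecewise constant factor sees only the means; this is how a Morley Hessian is exchanged for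
    that of its companion. *)
Lemma ip_pwc g l k : L2 D g -> L2 D l -> L2 D k -> pwc k ->
  (forall K, K \in M -> Int (tri K)° g = Int (tri K)° l) -> ip D g k = ip D l k.
Proof.
move=> hg hl hk [C hC] E; rewrite !ip_mesh //; apply: eq_big_seq => K KM; rewrite !ipE.
have mK := measurable_tri K; have fK := fin_tri K.
have S w : L2 D w -> Int (tri K)° (fun x => w x * k x) = C K * Int (tri K)° w.
  move=> hw; rewrite -IntZ //; last by apply: L2_L1 => //; exact: L2K.
  by apply: eq_Int => x ix; rewrite (hC K KM x ix) mulrC.
by rewrite !S // E.
Qed.

Lemma Int_P0 g K : K \in M -> Int (tri K)° (P0 g) = Int (tri K)° g.
Proof.
move=> KM; rewrite (eq_Int (v := fun=> tmean K g)); last by move=> x ix; exact: glue_in KM ix.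
by rewrite Int_tri_cst /tmean divfK // gt_eqF // area_gt0 // (mesh_det tM).
Qed.

Lemma ip_P0 g k : L2 D g -> L2 D k -> pwc k -> ip D (P0 g) k = ip D g k.
Proof. by move=> hg hk pk; apply: ip_pwc => //; [exact: L2_P0|move=> K; exact: Int_P0]. Qed.

Lemma dev_P0 g : L2 D g -> ip D (fun x => g x - P0 g x) (fun x => g x - P0 g x) = \sum_(K <- M) dev K g.
Proof.
move=> hg; have hP := L2_P0 g; rewrite ip_mesh //; try exact: L2B.
apply: eq_big_seq => K KM; rewrite ipE /dev; apply: eq_Int => x ix.
by rewrite /P0 (glue_in _ KM ix) expr2.
Qed.

End MorleyPieces.

(** * The Morley interpolant of a test function *)

Section Interpolation.
Context {R : realType}.
Notation mu := (@mu2 R).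
Implicit Types (x y z : R * R) (K L : triangle R) (u v w : R * R -> R).
Variables (D : set (R * R)) (M : mesh R).
Hypotheses (oD : open D) (bD : bounded_set D) (lip : lipschitz_boundary D) (tM : triangulation D M).

Lemma pdB i u w x : cinf u -> cinf w -> pd i (fun y => u y - w y) x = pd i u x - pd i w x.
Proof.
move=> cu cw; have := pd_lin i 1 (-1) x cu cw.
rewrite mul1r mulN1r => <-; congr (pd i _ x); apply/funext => y; by rewrite mul1r mulN1r.
Qed.

Lemma pdBE i u w : cinf u -> cinf w -> pd i (fun y => u y - w y) = fun x => pd i u x - pd i w x.
Proof. by move=> cu cw; apply/funext => x; exact: pdB. Qed.

Lemma pd2B i j u w : cinf u -> cinf w ->
  pd i (pd j (fun y => u y - w y)) = fun x => pd i (pd j u) x - pd i (pd j w) x.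
Proof. by move=> cu cw; rewrite pdBE // pdBE //; exact: cinf_pd. Qed.

Lemma HcB c u w : cinf u -> cinf w -> Hc c (fun y => u y - w y) = fun x => Hc c u x - Hc c w x.
Proof.
by move=> cu cw; case: (ord3P c) => ->; rewrite ?Hc0 ?Hc1 ?Hc2; exact: pd2B.
Qed.

Lemma seg_meanB u w x y : continuous u -> continuous w ->
  seg_mean (fun z => u z - w z) x y = seg_mean u x y - seg_mean w x y.
Proof. by move=> cu cw; rewrite /seg_mean -RintB //; exact: seg_continuous. Qed.

Lemma seg_mean_edge K w i : continuous w ->
  seg_mean w (K 1) (K o2) = 0 -> seg_mean w (K 0) (K o2) = 0 -> seg_mean w (K 0) (K 1) = 0 ->
  seg_mean w (K (i + 1)) (K (i + 1 + 1)) = 0.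
Proof.
move=> cw h1 h2 h3; case: (ord3P i) => ->; rewrite ?o0S ?o1S ?o2S ?o0S //.
by rewrite seg_mean_sym.
Qed.

Variable p : R * R -> R.
Hypothesis tp : test_function D p.

Let cp : cinf p. Proof. exact: test_cinf tp. Qed.

(** Defined by vertex values and mean Hessian, which fixes a quadratic polynomial outright; the
    usual degrees of freedom, the edge means of the gradient, then come for free. *)
Definition interp K : R * R -> R := nodal_quad K (fun c => tmean K (Hc c p)) (fun i => p (K i)).

Let w K x := p x - interp K x.

Let ci K : cinf (interp K). Proof. by apply: poly_cinf; exact: nodal_poly. Qed.

Let cw K : cinf (w K). Proof. exact: cinfB. Qed.

Let w0 K i : det K != 0 -> w K (K i) = 0.
Proof. by move=> d0; rewrite /w /interp nodal_vertex // subrr. Qed.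

Let HcW K c : Hc c (w K) = fun x => Hc c p x - tmean K (Hc c p).
Proof. by rewrite /w HcB // /interp nodal_Hc. Qed.

Let IntHcW K c : det K != 0 -> Int (tri K)° (Hc c (w K)) = 0.
Proof.
move=> d0; rewrite HcW; have mK := measurable_tri K; have fK := fin_tri K.
rewrite IntB //; [|by apply: tri_L1; apply: cinf_continuous; exact: cinf_Hc|exact: L1_cst].
by rewrite Int_tri_cst /tmean divfK ?subrr // gt_eqF // area_gt0.
Qed.

(** The difference to p vanishes at the vertices and has a Hessian of mean 0, so its gradient has
    mean 0 on every edge. The value found depends on p and the edge only, hence is common to both
    neighbours. *)
Lemma interp_edge K i l : det K != 0 ->
  pd l (interp K) (mid K i) = seg_mean (pd l p) (K (i + 1)) (K (i + 1 + 1)).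
Proof.
move=> d0; have z0 : Int (tri K)° (pd 0 (pd 0 (w K))) = 0 by have := IntHcW 0 d0.
have z1 : Int (tri K)° (pd 0 (pd 1 (w K))) = 0 by have := IntHcW 1 d0.
have z2 : Int (tri K)° (pd 1 (pd 1 (w K))) = 0 by have := IntHcW o2 d0.
have z3 : Int (tri K)° (pd 1 (pd 0 (w K))) = 0 by rewrite -z1; apply: eq_Int => x _; rewrite pd_comm.
have all i' j' : Int (tri K)° (pd i' (pd j' (w K))) = 0.
  by case: (ord2P i') => ->; case: (ord2P j') => ->; [exact: z0|exact: z1|exact: z3|exact: z2].
have [h1 h2 h3] := seg_mean_pd0 d0 (@cw K) (fun i => w0 i d0) all l.
have := seg_mean_edge i (cinf_continuous (cinf_pd l (@cw K))) h1 h2 h3.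
have -> : pd l (w K) = fun x => pd l p x - pd l (interp K) x by exact: pdBE.
rewrite seg_meanB; try (by apply: cinf_continuous; exact: cinf_pd).
rewrite (seg_mean_poly l _ _ (nodal_poly K _ _)) => /eqP; rewrite subr_eq0 => /eqP ->.
by [].
Qed.

(** A point of [D] on the closed edge would put the whole open edge into [D]. On such an edge a test
    function and its derivatives vanish. *)
Lemma nD_edge K i (t : R) : K \in M -> ~ D (mid K i) -> 0 <= t <= 1 ->
  ~ D (K (i + 1) + t *: (K (i + 1 + 1) - K (i + 1))).
Proof.
move=> KM nD ht Dx; have d0 := mesh_det tM KM; have om := mid_open_edge i d0.
apply: nD; have [t0|tn] := eqVneq t 0.
  rewrite t0 scale0r addr0 in Dx; exact: (edge_end_D oD lip tM KM (neqS i) Dx om).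
have [t1|tn1] := eqVneq t 1.
  rewrite t1 scale1r addrC subrK in Dx; exact: (edge_end_D oD lip tM KM (neqSS i) Dx om).
apply: (open_edge_D oD lip tM KM _ om Dx); apply: open_edge_point => //.
by case/andP: ht => a b; rewrite !lt_neqAle eq_sym tn tn1 a b.
Qed.

Lemma interp_pieces : pieces D M interp.
Proof.
split.
- by move=> K _; exact: nodal_poly.
- move=> K L i j KM LM e; have dK := mesh_det tM KM; have dL := mesh_det tM LM.
  by rewrite /interp !nodal_vertex // e.
- move=> K i KM nD; rewrite /interp nodal_vertex ?(mesh_det tM KM) //; exact: test_notin tp nD.
- move=> K L i j l KM LM sh; have dK := mesh_det tM KM; have dL := mesh_det tM LM.
  apply: etrans (interp_edge i l dK) _; apply: etrans _ (esym (interp_edge j l dL)).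
  case: sh => -[e1 e2]; first exact: (congr2 (seg_mean (pd l p)) e1 e2).
  apply: etrans (congr2 (seg_mean (pd l p)) e1 e2) _.
  by apply: seg_mean_sym; apply: cinf_continuous; exact: cinf_pd.
- move=> K i l KM nD; have dK := mesh_det tM KM.
  rewrite interp_edge // /seg_mean /Rintegral integral0_eq // => t; rewrite /= in_itv /= => ht.
  by rewrite (test_notin (pd_test l tp)) //; exact: nD_edge.
Qed.

(** [L2_taylor] on each triangle; the constant 2 bounds the square root of 3. *)
Lemma interp_L2 : L2norm D (fun x => p x - mesh_glue M interp x) <=
  2 * meshsize M ^+ 2 * Bn D (subt (fun c => Hc c p) (fun c => P0 M (Hc c p))).
Proof.
have mD : measurable (D : set (Pl R)) by exact: open_measurable2.
have h0 := meshsize_ge0 M.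
have Lp : L2 D p by exact: test_L2 tp.
have LH c : L2 D (Hc c p) by apply: test_L2 => //; exact: Dclassical_test tp.
have LP c : L2 D (P0 M (Hc c p)) by exact: L2_P0.
have LG : L2 D (mesh_glue M interp) by apply: L2_glue => // K _; exact: cinf_continuous.
have Ld : L2 D (fun x => p x - mesh_glue M interp x) by exact: L2B.
have Ls c : L2 D (subt (fun c => Hc c p) (fun c => P0 M (Hc c p)) c) by exact: L2B.
rewrite -(ler_pXn2r (n := 2)) ?nnegrE ?L2norm_ge0 ?mulr_ge0 ?Bn_ge0 ?sqr_ge0 //.
rewrite L2norm_sq exprMn Bn_sq (ip_mesh oD lip tM Ld Ld).
set k := subt _ _ in Ls *.
have -> : B D k k = \sum_(K <- M) \sum_c wt c * ip (tri K)° (k c) (k c).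
  rewrite exchange_big; apply: eq_bigr => c _.
  by rewrite (ip_mesh oD lip tM (Ls c) (Ls c)) mulr_sumr.
rewrite mulr_sumr; apply: ler_sum_mem => K KM.
have d0 := mesh_det tM KM; have mK := measurable_tri K.
have -> : ip (tri K)° (fun x => p x - mesh_glue M interp x) (fun x => p x - mesh_glue M interp x) =
    Int (tri K)° (fun x => w K x ^+ 2).
  by rewrite ipE; apply: eq_Int => x ix; rewrite (glue_in lip tM _ KM ix) -expr2.
apply: le_trans (L2_taylor d0 (@cw K) (fun i => w0 i d0)) _.
have cH c : continuous (Hc c (w K)) by apply: cinf_continuous; exact: cinf_Hc.
have L1c c : L1 (tri K)° (fun x => wt c * Hc c (w K) x ^+ 2).
  by apply: L1Z => //; apply: L2_L1sq; exact: tri_L2.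
have -> : Int (tri K)° (hess2 (w K)) = \sum_c wt c * ip (tri K)°
    (subt (fun c => Hc c p) (fun c => P0 M (Hc c p)) c) (subt (fun c => Hc c p) (fun c => P0 M (Hc c p)) c).
  rewrite (eq_Int (v := fun x => \sum_c wt c * Hc c (w K) x ^+ 2)); last by move=> x _; exact: hess2E.
  rewrite Int_sum //; apply: eq_bigr => c _.
  rewrite IntZ //; last by apply: L2_L1sq; exact: tri_L2.
  congr (_ * _); rewrite ipE; apply: eq_Int => x ix; rewrite HcW /subt /P0 (glue_in lip tM _ KM ix).
  by rewrite expr2.
apply: ler_wpM2r.
  by apply: sumr_ge0 => c _; rewrite mulr_ge0 ?wt_ge0 ?ip_ge0.
rewrite exprMn -exprM; apply: ler_pM => //; first by rewrite exprn_ge0 // ltW // diam_gt0.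
  by rewrite expr2; lra.
by apply: lerXn2r; rewrite ?nnegrE ?(ltW (diam_gt0 d0)) // diam_le_meshsize.
Qed.

End Interpolation.

(** * Cut-off functions *)

Section Jets.
Context {R : realType}.
Implicit Types (x y z v : R * R) (u w : R * R -> R) (h A C : R).

Lemma pdD i u w : cinf u -> cinf w -> pd i (fun y => u y + w y) = fun x => pd i u x + pd i w x.
Proof.
move=> cu cw; apply/funext => x; rewrite !pdE.
exact: (f_equal (fun f => f x) (derive_addE (e_ i) (fun x => cinf_diff x cu) (fun x => cinf_diff x cw))).
Qed.

Lemma pdM i u w : cinf u -> cinf w ->
  pd i (fun y => u y * w y) = fun x => u x * pd i w x + w x * pd i u x.
Proof.
move=> cu cw; apply/funext => x; rewrite !pdE.
exact: (f_equal (fun f => f x) (derive_mulE (e_ i) (fun x => cinf_diff x cu) (fun x => cinf_diff x cw))).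
Qed.

Lemma pd_comp i (b : R -> R) u : cinf b -> cinf u ->
  pd i (fun y => b (u y)) = fun x => 'D_1 b (u x) * pd i u x.
Proof.
move=> cb cu; apply/funext => x; rewrite !pdE.
by apply: derive_compE; exact: cinf_diff.
Qed.

Lemma pd_cst i (c : R) : pd i (fun=> c) = fun=> 0.
Proof. by apply/funext => x; rewrite pdE derive_cst. Qed.

(** Scale-invariant bounds: a function of size h^2 with second derivatives of size A. *)
Definition jet h A u x : Prop :=
  [/\ `|u x| <= A * h ^+ 2, forall i, `|pd i u x| <= A * h & forall i j, `|pd i (pd j u) x| <= A].

(** The corresponding bounds for a cut-off function on the scale h. A product of the two kinds is
    again a [jet]. *)
Definition cjet h C u x : Prop :=
  [/\ `|u x| <= C, forall i, `|pd i u x| <= C / h & forall i j, `|pd i (pd j u) x| <= C / h ^+ 2].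

Lemma jetD h A A' u w x : cinf u -> cinf w -> jet h A u x -> jet h A' w x ->
  jet h (A + A') (fun y => u y + w y) x.
Proof.
move=> cu cw [a1 a2 a3] [b1 b2 b3]; split.
- by rewrite mulrDl; apply: le_trans (ler_normD _ _) (lerD _ _).
- by move=> i; rewrite pdD // mulrDl; apply: le_trans (ler_normD _ _) (lerD _ _).
- move=> i j; rewrite (pdD j cu cw) (pdD i (cinf_pd j cu) (cinf_pd j cw)).
  by apply: le_trans (ler_normD _ _) (lerD _ _).
Qed.

Lemma jet_le h A A' u x : 0 <= h -> A <= A' -> jet h A u x -> jet h A' u x.
Proof.
move=> h0 AA [a1 a2 a3]; split; [|move=> i|move=> i j; exact: le_trans AA].
  by apply: le_trans a1 _; rewrite ler_wpM2r ?sqr_ge0.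
by apply: le_trans (a2 i) _; rewrite ler_wpM2r.
Qed.

Lemma jetN h A u x : cinf u -> jet h A u x -> jet h A (fun y => - u y) x.
Proof.
move=> cu [a1 a2 a3].
have N i w : cinf w -> pd i (fun y => - w y) = fun x => - pd i w x.
  move=> cw; apply/funext => y; have := pd_lin i (-1) 0 y cw cw.
  rewrite mulN1r mul0r addr0 => <-; congr (pd i _ y); apply/funext => t; by rewrite mulN1r mul0r addr0.
split; [by rewrite normrN|move=> i; by rewrite N // normrN|move=> i j].
by rewrite (N j _ cu) (N i _ (cinf_pd j cu)) normrN.
Qed.

Lemma jetB h A A' u w x : cinf u -> cinf w -> jet h A u x -> jet h A' w x ->
  jet h (A + A') (fun y => u y - w y) x.
Proof. move=> cu cw ju jw; exact: (jetD cu (cinfN cw) ju (jetN cw jw)). Qed.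

Lemma ler_norm4 (p q r s k : R) : `|p| <= k -> `|q| <= k -> `|r| <= k -> `|s| <= k ->
  `|p + q + (r + s)| <= 4 * k.
Proof.
move=> a b d e; apply: le_trans (ler_normD _ _) _.
by have := ler_normD p q; have := ler_normD r s; lra.
Qed.

(** The factor 4 counts the terms of the Leibniz rule for a second derivative. *)
Lemma jetM h A C u w x : 0 < h -> cinf u -> cinf w -> cjet h C w x -> jet h A u x ->
  jet h (4 * C * A) (fun y => w y * u y) x.
Proof.
move=> h0 cu cw [c1 c2 c3] [a1 a2 a3].
have C0 : 0 <= C by exact: le_trans c1.
have A0 : 0 <= A by apply: le_trans (a3 0 0).
have CA0 : 0 <= C * A by exact: mulr_ge0.
have P (a b k l : R) : `|a| <= k -> `|b| <= l -> `|a * b| <= k * l.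
  by move=> ak bl; rewrite normrM; apply: ler_pM.
have hn : h != 0 by rewrite gt_eqF.
split.
- apply: le_trans (P _ _ _ _ c1 a1) _; rewrite mulrA; apply: ler_wpM2r; first exact: sqr_ge0.
  by rewrite -mulrA ler_peMl //; lra.
- move=> i; rewrite (pdM i cw cu); apply: le_trans (ler_normD _ _) _.
  have h1 := P _ _ _ _ c1 (a2 i); have h2 := P _ _ _ _ a1 (c2 i).
  have e : A * h ^+ 2 * (C / h) = C * A * h by field.
  rewrite e in h2; rewrite mulrA in h1.
  have : 0 <= C * A * h by rewrite mulr_ge0 // ltW.
  lra.
- move=> i j; rewrite (pdM j cw cu).
  have cuj := cinf_pd j cu; have cwj := cinf_pd j cw.
  rewrite (pdD i (cinfM cw cuj) (cinfM cu cwj)) (pdM i cw cuj) (pdM i cu cwj).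
  have h1 := P _ _ _ _ c1 (a3 i j); have h2 := P _ _ _ _ (a2 j) (c2 i).
  have h3 := P _ _ _ _ a1 (c3 i j); have h4 := P _ _ _ _ (c2 j) (a2 i).
  have e2 : A * h * (C / h) = C * A by field.
  have e3 : A * h ^+ 2 * (C / h ^+ 2) = C * A by field.
  have e4 : C / h * (A * h) = C * A by field.
  rewrite e2 in h2; rewrite e3 in h3; rewrite e4 in h4.
  rewrite -[4 * C * A]mulrA; exact: (ler_norm4 h1 h2 h3 h4).
Qed.

Lemma cjet_comp h C m (b : R -> R) u x : 0 < h -> 1 <= m -> cinf b -> cinf u ->
  (forall t, [/\ `|b t| <= C, `|'D_1 b t| <= C & `|'D_1 (fun s => 'D_1 b s) t| <= C]) ->
  (forall i, `|pd i u x| <= m / h) -> (forall i j, `|pd i (pd j u) x| <= m / h ^+ 2) ->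
  cjet h (2 * C * m ^+ 2) (fun y => b (u y)) x.
Proof.
move=> h0 m1 cb cu hb g1 g2; have [b0 _ _] := hb (u x).
have C0 : 0 <= C by exact: le_trans b0.
have P (a e k l : R) : `|a| <= k -> `|e| <= l -> `|a * e| <= k * l.
  by move=> ak bl; rewrite normrM; apply: ler_pM.
have m2 : m <= m ^+ 2 by rewrite expr2 ler_peMl // (le_trans _ m1).
have m0 : 0 <= m by exact: le_trans m1.
have hi : 0 <= h^-1 by rewrite invr_ge0 ltW.
have hi2 : 0 <= (h ^+ 2)^-1 by rewrite invr_ge0 sqr_ge0.
have Cm : C * m <= C * m ^+ 2 by rewrite ler_wpM2l.
have C1 : C <= C * m by rewrite ler_peMr.
have hn : h != 0 by rewrite gt_eqF.
split.
- by apply: le_trans b0 _; lra.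
- move=> i; rewrite (pd_comp i cb cu); have [_ b1 _] := hb (u x).
  apply: le_trans (P _ _ _ _ b1 (g1 i)) _; rewrite mulrA; apply: ler_wpM2r => //; lra.
- move=> i j; have cb1 : cinf (fun t : R => 'D_1 b t) by exact: cinf_derive.
  have cbu : cinf (fun y => 'D_1 b (u y)) by exact: (cinf_comp (g := u) cb1 cu).
  rewrite (pd_comp j cb cu) (pdM i cbu (cinf_pd j cu)) (pd_comp i cb1 cu).
  have [_ b1 b2] := hb (u x).
  apply: le_trans (ler_normD _ _) _.
  have h1 := P _ _ _ _ b1 (g2 i j); have h2 := P _ _ _ _ (g1 j) (P _ _ _ _ b2 (g1 i)).
  have e : m / h * (C * (m / h)) = C * m ^+ 2 / h ^+ 2 by field.
  rewrite e in h2.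
  have h3 : C * (m / h ^+ 2) <= C * m ^+ 2 / h ^+ 2 by rewrite mulrA ler_wpM2r.
  have -> : 2 * C * m ^+ 2 / h ^+ 2 = C * m ^+ 2 / h ^+ 2 + C * m ^+ 2 / h ^+ 2 by field.
  by apply: lerD h2; exact: le_trans h1 h3.
Qed.

(** Bounds from one zero z, the gradient at one point m and the Hessian. The differences between the
    affine functions at edges or vertices and the piece P have this form. *)
Lemma jet_quad h (a G : R) u z m x : 0 < h -> 0 <= a -> 0 <= G -> poly_le2 u ->
  en (x - m) <= h -> en (x - z) <= h -> en (z - m) <= h -> u z = 0 ->
  (forall i, `|pd i u m| <= G) -> (forall i j y, `|pd i (pd j u) y| <= a) ->
  jet h (4 * a + 2 * G / h) u x.
Proof.
move=> h0 a0 G0 pu xm xz zm uz hG ha; have cu := poly_cinf pu.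
have hn : h != 0 by rewrite gt_eqF.
have D2 (w : R * R -> R) (k : R) y (v : R * R) : cinf w -> 0 <= k -> (forall i y, `|pd i w y| <= k) ->
    `|w (y + v) - w y| <= 2 * k * en v.
  move=> cw k0 hk; have [t _ ->] := line_MVT y v cw; rewrite derive_pd; last exact: cinf_diff.
  apply: le_trans (ler_normD _ _) _; rewrite !normrM.
  have n1 := norm1_le_en v; have n2 := norm2_le_en v; have e0 := en_ge0 v.
  have h1 : `|v.1| * `|pd 0 w (y + t *: v)| <= en v * k by apply: ler_pM.
  have h2 : `|v.2| * `|pd 1 w (y + t *: v)| <= en v * k by apply: ler_pM.
  lra.
have g1 i y : en (y - m) <= h -> `|pd i u y| <= G + 2 * a * h.
  move=> ym; have := D2 (pd i u) a m (y - m) (cinf_pd i cu) a0 (fun j y => ha j i y).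
  rewrite [m + _]addrC subrK => h1.
  have h2 : 2 * a * en (y - m) <= 2 * a * h by rewrite ler_wpM2l // mulr_ge0.
  have := ler_normD (pd i u y - pd i u m) (pd i u m); rewrite subrK; have := hG i; lra.
have A0 : 0 <= 4 * a + 2 * G / h.
  by apply: addr_ge0; [exact: mulr_ge0|apply: divr_ge0; [exact: mulr_ge0|exact: ltW]].
have Gh : G / h * h = G by rewrite divfK.
have Gh2 : G / h * h ^+ 2 = G * h by rewrite expr2 mulrA divfK.
split.
- have [t /andP[t0 t1]] := line_MVT z (x - z) cu; rewrite [z + _]addrC subrK uz subr0 => ->.
  rewrite derive_pd; last exact: cinf_diff.
  have ym : en (z + t *: (x - z) - m) <= h.
    have -> : z + t *: (x - z) - m = (1 - t) *: (z - m) + t *: (x - m).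
      by move: (x) (z) (m) => p q r; plane_ring.
    apply: le_trans (enD _ _) _; rewrite !enZ !ger0_norm ?subr_ge0 //.
    have : (1 - t) * en (z - m) <= (1 - t) * h by rewrite ler_wpM2l ?subr_ge0.
    have : t * en (x - m) <= t * h by rewrite ler_wpM2l.
    lra.
  apply: le_trans (ler_normD _ _) _; rewrite !normrM.
  have n1 := norm1_le_en (x - z); have n2 := norm2_le_en (x - z).
  have h1 : `|(x - z).1| * `|pd 0 u (z + t *: (x - z))| <= h * (G + 2 * a * h).
    by apply: ler_pM => //; [exact: le_trans xz|exact: g1].
  have h2 : `|(x - z).2| * `|pd 1 u (z + t *: (x - z))| <= h * (G + 2 * a * h).
    by apply: ler_pM => //; [exact: le_trans xz|exact: g1].
  apply: le_trans (lerD h1 h2) _.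
  have -> : (4 * a + 2 * G / h) * h ^+ 2 = 4 * a * h ^+ 2 + 2 * (G / h * h ^+ 2) by ring.
  rewrite Gh2.
  by rewrite le_eqVlt; apply/orP; left; apply/eqP; ring.
- move=> i; apply: le_trans (g1 i x xm) _.
  have -> : (4 * a + 2 * G / h) * h = 4 * a * h + 2 * (G / h * h) by ring.
  rewrite Gh.
  have : 0 <= a * h by rewrite mulr_ge0 // ltW.
  rewrite -!mulrA; lra.
- move=> i j; apply: le_trans (ha i j x) _.
  have : 0 <= 2 * G / h by rewrite divr_ge0 ?mulr_ge0 // ltW.
  lra.
Qed.

Lemma near_differentiable u w x : (\forall y \near x, u y = w y) ->
  differentiable w x -> differentiable u x.
Proof.
move=> uw dw; have [cw ew] := (diff_locallyP _ _).1 dw.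
have ux : u x = w x by exact: nbhs_singleton uw.
have eu : u \o shift x = cst (u x) + 'd w x +o_ (0 : R * R) id.
  move/eqaddoP in ew; apply/eqaddoP => _/posnumP[e].
  have uw0 : \forall y \near (0 : R * R), u (y + x) = w (y + x).
    by move: uw; rewrite (near_shift 0 x) /= ; apply: filterS => y; rewrite subr0.
  near=> y; have -> : ((u \o shift x) - (cst (u x) + 'd w x)) y = ((w \o shift x) - (cst (w x) + 'd w x)) y.
    rewrite /= !fctE /= ux; congr (_ - _); by near: y.
  by near: y; exact: ew.
have ed := diff_unique cw eu.
by apply/diff_locallyP; rewrite ed.
Unshelve. all: by end_near. Qed.

(** By induction every iterated derivative again coincides with a smooth function near each point.
    This is what makes gluing by local coincidence legitimate. *)
Lemma smooth_local u : (forall x, exists2 w, cinf w & \forall y \near x, u y = w y) -> smooth u.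
Proof.
move=> H; have gen (l : seq 'I_2) x : exists2 w, cinf w & \forall y \near x, foldr pd u l y = w y.
  elim: l x => [|i l IH] x; first exact: H.
  have [w cw hw] := IH x; exists (pd i w); first exact: cinf_pd.
  have : \forall y \near x, \forall z \near y, foldr pd u l z = w z by exact: near_join hw.
  by apply: filterS => y hy /=; rewrite !pdE; exact: near_eq_derive.
by move=> l x; have [w cw hw] := gen l x; apply: near_differentiable hw (cinf_diff x cw).
Qed.

Lemma profile_bound (b : R -> R) (c1 c2 : R) : cinf b -> (forall t, t < 1 -> b t = c1) ->
  (forall t, 2 < t -> b t = c2) -> exists2 C, 0 < C &
  forall t, [/\ `|b t| <= C, `|'D_1 b t| <= C & `|'D_1 (fun s => 'D_1 b s) t| <= C].
Proof.
move=> cb h1 h2.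
have bnd (g : R -> R) (k1 k2 : R) : continuous g -> (forall t, t < 1 -> g t = k1) ->
    (forall t, 2 < t -> g t = k2) -> exists2 C, 0 < C & forall t, `|g t| <= C.
  move=> cg g1 g2.
  have : compact (g @` `[1, 2]).
    by apply: continuous_compact; [exact: continuous_subspaceT|exact: segment_compact].
  move=> /compact_bounded[M [_ HM]].
  have Mp : M < `|M| + 1 by rewrite (le_lt_trans (ler_norm _)) // ltrDl.
  exists (`|M| + 1 + `|k1| + `|k2|) => [|t].
    by rewrite -addrA ltr_wpDr ?addr_ge0 // ltr_wpDl.
  have n1 := normr_ge0 k1; have n2 := normr_ge0 k2; have n3 := normr_ge0 M.
  case: (ltP t 1) => [/g1 ->|t1]; first by lra.
  case: (ltP 2 t) => [/g2 ->|t2]; first by lra.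
  have : `|g t| <= `|M| + 1.
    by apply: (HM _ Mp); exists t => //; rewrite /= in_itv /= t1 t2.
  lra.
have d0 (g : R -> R) (k1 k2 : R) : (forall t, t < 1 -> g t = k1) -> (forall t, 2 < t -> g t = k2) ->
    (forall t, t < 1 -> 'D_1 g t = 0) /\ (forall t, 2 < t -> 'D_1 g t = 0).
  move=> g1 g2; split => t ht.
    rewrite (@near_eq_derive _ _ _ _ (fun=> k1)) ?derive_cst //.
    by apply: filterS (lt_nbhsl ht) => s; exact: g1.
  rewrite (@near_eq_derive _ _ _ _ (fun=> k2)) ?derive_cst //.
  by apply: filterS (lt_nbhsr ht) => s; exact: g2.
have cb1 : cinf (fun t : R => 'D_1 b t) by exact: cinf_derive.
have cb2 : cinf (fun t : R => 'D_1 (fun s => 'D_1 b s) t) by exact: cinf_derive.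
have [e1 e2] := d0 b _ _ h1 h2; have [f1 f2] := d0 _ _ _ e1 e2.
have [C C0 HC] := bnd b _ _ (cinf_continuous cb) h1 h2.
have [C' C0' HC'] := bnd _ _ _ (cinf_continuous cb1) e1 e2.
have [C'' C0'' HC''] := bnd _ _ _ (cinf_continuous cb2) f1 f2.
exists (C + C' + C'') => [|t]; first by rewrite !addr_gt0.
by split; [have := HC t|have := HC' t|have := HC'' t]; lra.
Qed.

(** Still 1 near 0 and 0 beyond 2, but not between 0 and 1 in general: t [cut](c t^2) has the
    derivative [pcut](c t^2), so the integral over an edge leaving the vertex is 0 once c >= 2. *)
Definition pcut (s : R) : R := cut s + 2 * s * 'D_1 cut s.

Lemma cinf_pcut : cinf pcut.
Proof.
apply: cinfD; first exact: cinf_cut.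
apply: cinfM; last exact: cinf_derive cinf_cut.
by apply: cinfM; [exact: cinf_cst|exact: cinf_id].
Qed.

Lemma cut_derive0 (t : R) : t < 1 \/ 2 < t -> 'D_1 cut t = 0.
Proof.
case=> ht.
  rewrite (@near_eq_derive _ _ _ _ (fun=> 1 : R^o)) ?derive_cst //.
  by apply: filterS (lt_nbhsl ht) => s /ltW; exact: cut_le1.
rewrite (@near_eq_derive _ _ _ _ (fun=> 0)) ?derive_cst //.
by apply: filterS (lt_nbhsr ht) => s /ltW; exact: cut_ge2.
Qed.

Lemma pcut_lt1 (t : R) : t < 1 -> pcut t = 1.
Proof. by move=> t1; rewrite /pcut cut_derive0 ?mulr0 ?addr0 ?cut_le1 ?ltW //; left. Qed.

Lemma pcut_gt2 (t : R) : 2 < t -> pcut t = 0.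
Proof. by move=> t2; rewrite /pcut cut_derive0 ?mulr0 ?addr0 ?cut_ge2 ?ltW //; right. Qed.

Definition sqd z x : R := (x.1 - z.1) ^+ 2 + (x.2 - z.2) ^+ 2.

Lemma sqd_en z x : sqd z x = en (x - z) ^+ 2. Proof. by rewrite en_sq. Qed.

Lemma sqd_quad z : sqd z = quad (z.1 ^+ 2 + z.2 ^+ 2) (- 2 * z.1) (- 2 * z.2) 1 0 1.
Proof. by apply/funext => x; rewrite /sqd /quad; ring. Qed.

Definition crd (i : 'I_2) x : R := if i == 0 then x.1 else x.2.

Lemma pd_sqd i z x : pd i (sqd z) x = 2 * crd i (x - z).
Proof.
by rewrite sqd_quad; case: (ord2P i) => ->; rewrite ?pd0_quad ?pd1_quad /quad /crd /=; ring.
Qed.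

Lemma pd2_sqd i j z x : pd i (pd j (sqd z)) x = if i == j then 2 else 0.
Proof.
rewrite sqd_quad; case: (ord2P i) => ->; case: (ord2P j) => ->;
  by rewrite ?pd0_quad ?pd1_quad ?pd0_quad ?pd1_quad /quad /=; ring.
Qed.

Definition aff z (c : R) (g : R * R) : R * R -> R := fun x => c + dot g (x - z).

Lemma aff_quad z c g : aff z c g = quad (c - dot g z) g.1 g.2 0 0 0.
Proof. by apply/funext => x; rewrite /aff /quad /dot /=; ring. Qed.

Lemma pd_aff i z c g : pd i (aff z c g) = fun=> crd i g.
Proof.
apply/funext => x; rewrite aff_quad; case: (ord2P i) => ->; rewrite ?pd0_quad ?pd1_quad /quad /crd /=; ring.
Qed.

Lemma cinf_aff z c g : cinf (aff z c g). Proof. rewrite aff_quad; exact: cinf_quad. Qed.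

Lemma poly_aff z c g : poly_le2 (aff z c g).
Proof. by apply/poly_le2P; rewrite aff_quad; do 6 eexists. Qed.

Definition bumpv z (rho : R) x : R := pcut (sqd z x / rho ^+ 2).

Lemma cinf_sqd z : cinf (sqd z). Proof. rewrite sqd_quad; exact: cinf_quad. Qed.

Lemma cinf_bumpv z rho : cinf (bumpv z rho).
Proof.
apply: (cinf_comp (g := fun x => sqd z x / rho ^+ 2)); first exact: cinf_pcut.
by apply: cinfM; [exact: cinf_sqd|exact: cinf_cst].
Qed.

(* The profile of the bump is chosen so that t Q(c t^2), with Q the plateau
   function, has derivative P(c t^2); both boundary terms then vanish. *)
Lemma seg_mean_bumpv a b (rho : R) (g : R * R) l : 0 < rho -> 2 * rho ^+ 2 < sqd a b ->
  seg_mean (pd l (fun x => bumpv a rho x * aff a 0 g x)) a b = 0.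
Proof.
move=> r0 hr; have r2 : 0 < rho ^+ 2 by rewrite exprn_gt0.
have rn : rho != 0 by rewrite gt_eqF.
pose d := b - a; pose N := d.1 ^+ 2 + d.2 ^+ 2; pose c := N / rho ^+ 2.
have NE : N = sqd a b by [].
have N0 : 0 < N by rewrite NE; apply: lt_trans hr; rewrite mulr_gt0.
have c2 : 2 < c by rewrite /c ltr_pdivlMr // NE.
have cu : cinf (fun x => sqd a x / rho ^+ 2) by apply: cinfM; [exact: cinf_sqd|exact: cinf_cst].
have pdu x : pd l (fun x => sqd a x / rho ^+ 2) x = 2 * crd l (x - a) / rho ^+ 2.
  rewrite (pdM l (cinf_sqd a) (cinf_cst _ (rho ^+ 2)^-1)) pd_cst pd_sqd mulr0 add0r; by rewrite mulrC.
have E x : pd l (fun x => bumpv a rho x * aff a 0 g x) x =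
    bumpv a rho x * crd l g + aff a 0 g x * ('D_1 pcut (sqd a x / rho ^+ 2) * (2 * crd l (x - a) / rho ^+ 2)).
  rewrite (pdM l (cinf_bumpv a rho) (cinf_aff a 0 g)) pd_aff.
  by rewrite (pd_comp l cinf_pcut cu) pdu.
have sE (t : R) : sqd a (a + t *: d) / rho ^+ 2 = c * (t * t).
  by rewrite /sqd /c /N /= -![_ *: _]/(_ * _); field.
pose k := crd l d * dot g d / N.
(* Since t [cut] has derivative [pcut], the difference t [pcut] - t [cut] has the derivative 2 c t^2
   [pcut]', which is the second term of the product rule. *)
pose F (t : R) := crd l g * (t * cut (c * (t * t))) + k * (t * pcut (c * (t * t)) - t * cut (c * (t * t))).
have dq (q : R -> R) (t : R) : cinf q -> is_derive t 1 (fun t : R => q (c * (t * t))) ('D_1 q (c * (t * t)) * (c * (t + t))).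
  move=> cq; have cm : cinf (fun t : R => c * (t * t)).
    by apply: cinfM; [exact: cinf_cst|apply: cinfM; exact: cinf_id].
  have dm : is_derive t 1 (fun t : R => c * (t * t)) (c * (t + t)).
    have h := is_deriveM (is_derive_cst (c : R^o) t 1) (is_deriveM (is_derive_id t 1) (is_derive_id t 1)).
    by apply: is_derive_eq h _; rewrite /= -![_ *: _]/(_ * _); ring.
  apply: DeriveDef; first by apply: diff_derivable; exact: cinf_diff t (cinf_comp cq cm).
  rewrite (derive_compE (g := fun t : R => c * (t * t)) (1 : R) (cinf_diff (c * (t * t)) cq) (cinf_diff t cm)).
  by congr (_ * _); exact: derive_val.
have dF (t : R) : is_derive t 1 F (pd l (fun x => bumpv a rho x * aff a 0 g x) (a + t *: d)).
  have h1 := is_deriveM (is_derive_id t 1) (dq _ t cinf_cut).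
  have h2 := is_deriveM (is_derive_id t 1) (dq _ t cinf_pcut).
  have h := is_deriveD (is_deriveM (is_derive_cst (crd l g : R^o) t 1) h1)
     (is_deriveM (is_derive_cst (k : R^o) t 1) (is_deriveB h2 h1)).
  apply: is_derive_eq h _; rewrite E /bumpv sE.
  have -> : aff a 0 g (a + t *: d) = t * dot g d.
    by rewrite /aff /dot /= -![_ *: _]/(_ * _); ring.
  have -> : crd l (a + t *: d - a) = t * crd l d.
    by rewrite /crd; case: ifP => _; rewrite /= -![_ *: _]/(_ * _); ring.
  have e1 : k * c = crd l d * dot g d / rho ^+ 2.
    by rewrite /k /c; field; rewrite rn gt_eqF.
  rewrite -![_ *: _]/(_ * _) /=.
  have e2 : t * dot g d * ('D_1 pcut (c * (t * t)) * (2 * (t * crd l d) / rho ^+ 2)) =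
     2 * (t * t) * 'D_1 pcut (c * (t * t)) * (k * c) by rewrite e1; ring.
  rewrite e2 /pcut; move: ('D_1 pcut _) ('D_1 cut _) (cut _) (crd l g) => p q s r; ring.
have cI : continuous (fun t : R => pd l (fun x => bumpv a rho x * aff a 0 g x) (a + t *: d)).
  apply: (@seg_continuous _ (pd l (fun x => bumpv a rho x * aff a 0 g x)) a b).
  by apply: pd_continuous; apply: cinfM; [exact: cinf_bumpv|exact: cinf_aff].
rewrite /seg_mean /Rintegral -/d (FTC_everywhere ltr01 dF cI) /= /F.
rewrite !mul1r !mulr1 pcut_gt2 // cut_ge2 ?(ltW c2) //; ring.
Qed.

End Jets.

(** * The companion function *)

Section Companion.
Context {R : realType}.
Implicit Types (x y z : R * R) (K L : triangle R) (u v w : R * R -> R).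

Definition grad u x : R * R := (pd 0 u x, pd 1 u x).

Lemma crd_grad l u x : crd l (grad u x) = pd l u x.
Proof. by rewrite /crd; case: (ord2P l) => ->. Qed.

Lemma aff_change z c g z' : aff z c g = aff z' (c + dot g (z' - z)) g.
Proof. by apply/funext => x; rewrite /aff /dot /=; ring. Qed.

Lemma quad_mid_edge u x y : poly_le2 u ->
  u x + dot (grad u (2^-1 *: (x + y))) (y - x) = u y.
Proof.
move=> /poly_le2P[a [b [c [d [e [f ->]]]]]].
rewrite /grad pd0_quad pd1_quad /quad /dot /= -![_ *: _]/(_ * _); by field.
Qed.

Lemma sqd_gt z x (r : R) : 0 <= r -> 2 * r < en (x - z) -> 2 < sqd z x / r ^+ 2 \/ r = 0.
Proof.
move=> r0 h; have [->|rn] := eqVneq r 0; [by right|left].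
have rp : 0 < r by rewrite lt_neqAle eq_sym rn.
rewrite ltr_pdivlMr ?exprn_gt0 // sqd_en.
have : (2 * r) ^+ 2 < en (x - z) ^+ 2 by rewrite ltr_pXn2r // nnegrE ?en_ge0 ?mulr_ge0.
rewrite exprMn; have : 0 < r ^+ 2 by rewrite exprn_gt0.
lra.
Qed.

Lemma bumpv_far z (r : R) x : 0 < r -> 2 * r < en (x - z) -> bumpv z r x = 0.
Proof.
by move=> r0 /(sqd_gt (ltW r0))[|r1]; [exact: pcut_gt2|rewrite r1 ltxx in r0].
Qed.

Lemma bumpv_near z (r : R) x : 0 < r -> en (x - z) < r -> bumpv z r x = 1.
Proof.
move=> r0 h; apply: pcut_lt1; rewrite ltr_pdivrMr ?exprn_gt0 // mul1r sqd_en.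
by rewrite ltr_pXn2r // nnegrE ?en_ge0 ?ltW.
Qed.

Lemma seg_meanD u w x y : continuous u -> continuous w ->
  seg_mean (fun z => u z + w z) x y = seg_mean u x y + seg_mean w x y.
Proof.
move=> cu cw; have cuw : continuous (fun z => u z + w z) by move=> z; apply: cvgD; [exact: cu|exact: cw].
apply/eqP; rewrite -subr_eq -(seg_meanB x y cuw cw); apply/eqP; congr seg_mean.
by apply/funext => z; rewrite addrK.
Qed.

Variables (D : set (R * R)) (M : mesh R) (kappa : R).
Hypotheses (oD : open D) (bD : bounded_set D) (lip : lipschitz_boundary D) (tM : triangulation D M).
Hypothesis sr : forall K, K \in M -> shape_regular kappa K.

Let N := nstar kappa.
(** Bump radius relative to the diameter of the fan representative. Diameters in a fan differ by a
    factor of at most kappa^N, so on each of its triangles the radius is at most diam / (8 kappa),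
    and bumps at different vertices stay apart. *)
Definition fan_size : R := (8 * kappa ^+ N.+1)^-1.
(** So narrow, in barycentric coordinates, that the overlap of two strips at a vertex lies where the
    bump is 1: twice the width times the diameter is below the bump radius. *)
Definition strip_width : R := (64 * kappa ^+ (2 * N).+1)^-1.

Lemma fan_sym_diam z K L : K \in M -> has_vertex z K -> fan M z K L ->
  diam (tri K) <= kappa ^+ N * diam (tri L).
Proof.
move=> KM zK KL; apply: (fan_diam lip tM sr (fan_M KM KL) (fan_vertex zK KL)).
exact: fan_sym.
Qed.

Variable P : triangle R -> R * R -> R.
Hypothesis pP : pieces D M P.

Definition vtri z : triangle R := head [ffun=> 0] (star M z).
(** The affine function to be used around z. Its value is common to all pieces at z, its gradient is
    borrowed from one of them; both are 0 at a boundary vertex. *)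
Definition pz z : R * R -> R :=
  aff z (if `[< D z >] then P (vtri z) z else 0) (if `[< D z >] then grad (P (vtri z)) z else 0).
(** Affine with the midpoint gradient. The increment of a quadratic along an edge is its midpoint
    gradient applied to the edge vector, so both end values of P are met and the neighbour produces
    the same function. *)
Definition pE K (i : 'I_3) : R * R -> R := aff (K (i + 1)) (P K (K (i + 1))) (grad (P K) (mid K i)).
Definition rho z K : R := fan_size * diam (tri (fan_rep M z K)).
Definition psi z K : R * R -> R := bumpv z (rho z K).
Definition strip (t : R) : R := cut (t / strip_width).
(** The piece P, replaced by the edge functions in strips along the edges. *)
Definition F1 K x : R := P K x + \sum_i strip (lam K i x) * (pE K i x - P K x).
(** Then replaced by the vertex functions near the vertices. *)
Definition F2 K x : R := F1 K x + \sum_i psi (K i) K x * (pz (K i) x - F1 K x).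
(** The form that [F2] takes near the open edge i: only data common to both neighbours occur. *)
Definition GE K (i : 'I_3) x : R := pE K i x +
  (psi (K (i + 1)) K x * (pz (K (i + 1)) x - pE K i x) +
   psi (K (i + 1 + 1)) K x * (pz (K (i + 1 + 1)) x - pE K i x)).

Lemma vtriP z K : K \in M -> has_vertex z K -> vtri z \in M /\ has_vertex z (vtri z).
Proof.
move=> KM zK; have : K \in star M z by rewrite mem_filter zK.
have : forall A, A \in star M z -> A \in M /\ has_vertex z A.
  by move=> A; rewrite mem_filter => /andP[].
rewrite /vtri; case: (star M z) => [//|A s] H _ /=.
by apply: H; rewrite mem_head.
Qed.

Lemma has_vertexP z K : reflect (exists i, z = K i) (has_vertex z K).
Proof. by apply: (iffP existsP) => -[i h]; exists i; [rewrite (eqP h)|rewrite h]. Qed.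

Lemma pz_vertex K i : K \in M -> pz (K i) (K i) = P K (K i).
Proof.
move=> KM; rewrite /pz /aff subrr /dot /= !mulr0 !addr0.
have [p1 p2 p3 _ _] := pP; case: asboolP => Di; last by rewrite p3.
have zK : has_vertex (K i) K by apply/has_vertexP; exists i.
have [LM /has_vertexP[j e]] := vtriP KM zK.
exact: etrans (f_equal (P (vtri (K i))) e) (esym (p2 _ _ _ _ KM LM e)).
Qed.

Lemma pE_alt K i : K \in M ->
  pE K i = aff (K (i + 1 + 1)) (P K (K (i + 1 + 1))) (grad (P K) (mid K i)).
Proof.
move=> KM; have [p1 _ _ _ _] := pP.
by rewrite /pE (aff_change _ _ _ (K (i + 1 + 1))) /mid (quad_mid_edge _ _ (p1 K KM)).
Qed.

Section OneTriangle.
Variables (K : triangle R).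
Hypothesis KM : K \in M.

Let dK : det K != 0. Proof. exact: (mesh_det tM KM). Qed.
Let h : R := diam (tri K).
Let h0 : 0 < h. Proof. exact: diam_gt0. Qed.
Let k1 : 1 <= kappa. Proof. exact: (kappa_ge1 tM sr KM). Qed.
Let k0 : 0 < kappa. Proof. exact: lt_le_trans k1. Qed.
Let vK i : has_vertex (K i) K. Proof. by apply/has_vertexP; exists i. Qed.

Lemma strip_width_gt0 : 0 < strip_width.
Proof. by rewrite invr_gt0 mulr_gt0 ?exprn_gt0. Qed.

Lemma rho_gt0 i : 0 < rho (K i) K.
Proof.
apply: mulr_gt0; first by rewrite invr_gt0 mulr_gt0 ?exprn_gt0.
exact/diam_gt0/(mesh_det tM)/(fan_M KM (fan_repP _ KM)).
Qed.

Lemma rho_le i : 8 * kappa * rho (K i) K <= h.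
Proof.
have := fan_diam lip tM sr KM (vK i) (fan_repP (K i) KM); rewrite -/N -/h => hd.
rewrite /rho /fan_size exprS.
have kN : 0 < kappa ^+ N by rewrite exprn_gt0.
have -> : 8 * kappa * ((8 * (kappa * kappa ^+ N))^-1 * diam (tri (fan_rep M (K i) K))) =
  diam (tri (fan_rep M (K i) K)) / kappa ^+ N.
  by field; rewrite !gt_eqF.
by rewrite ler_pdivrMr // mulrC.
Qed.

Lemma rho_ge i : h <= 8 * kappa ^+ (2 * N).+1 * rho (K i) K.
Proof.
have := fan_sym_diam KM (vK i) (fan_repP (K i) KM); rewrite -/h => hd.
have kN : 0 < kappa ^+ N by rewrite exprn_gt0.
have e : kappa ^+ (2 * N).+1 = kappa * (kappa ^+ N * kappa ^+ N) by rewrite exprS mul2n -addnn exprD.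
rewrite /rho /fan_size e [kappa ^+ N.+1]exprS.
have -> : 8 * (kappa * (kappa ^+ N * kappa ^+ N)) *
    ((8 * (kappa * kappa ^+ N))^-1 * diam (tri (fan_rep M (K i) K))) =
  kappa ^+ N * diam (tri (fan_rep M (K i) K)) by field; rewrite !gt_eqF.
exact: hd.
Qed.

Lemma strip_rho i : 2 * strip_width * h < rho (K i) K.
Proof.
have := rho_ge i; have r0 := rho_gt0 i.
have q0 : 0 < kappa ^+ (2 * N).+1 by rewrite exprn_gt0.
move=> hr; rewrite /strip_width.
have : 2 * (64 * kappa ^+ (2 * N).+1)^-1 * h <= 2 * (64 * kappa ^+ (2 * N).+1)^-1 * (8 * kappa ^+ (2 * N).+1 * rho (K i) K).
  by apply: ler_wpM2l hr; rewrite mulr_ge0 // invr_ge0 mulr_ge0 // ltW.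
have -> : 2 * (64 * kappa ^+ (2 * N).+1)^-1 * (8 * kappa ^+ (2 * N).+1 * rho (K i) K) = rho (K i) K / 4.
  by field; rewrite gt_eqF.
lra.
Qed.

(** The support has radius 2 rho <= diam / (4 kappa), on which a barycentric coordinate varies by at
    most 1/4. *)
Lemma psi_far i j x : 4^-1 < `|lam K j x - lam K j (K i)| -> psi (K i) K x = 0.
Proof.
move=> lt; apply: bumpv_far; first exact: rho_gt0.
have := lamB_le j x (K i) dK (sr KM); have := rho_le i; rewrite -/h => r1 r2.
have r3 : 4^-1 * h < `|lam K j x - lam K j (K i)| * h by rewrite ltr_pM2r.
rewrite -(ltr_pM2l k0); have := rho_gt0 i; nra.
Qed.

Lemma psi_low i x : lam K i x < 3 / 4 -> psi (K i) K x = 0.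
Proof.
move=> l1; apply: (@psi_far i i); rewrite lam_vertex // eqxx distrC.
rewrite (_ : true%:R = 1) //; by apply: lt_le_trans (ler_norm _); lra.
Qed.

Lemma psi_at i : \forall x \near K i, psi (K i) K x = 1.
Proof.
apply/nbhs_enP; exists (rho (K i) K); first exact: rho_gt0.
by move=> y; apply: bumpv_near; exact: rho_gt0.
Qed.

Lemma near_lam_lt i x (c : R) : lam K i x < c -> \forall y \near x, lam K i y < c.
Proof.
move=> l1; have := @lam_continuous _ K i x.
by move=> /(_ [set t | t < c]); apply; exact: lt_nbhsl.
Qed.

Lemma near_lam_gt i x (c : R) : c < lam K i x -> \forall y \near x, c < lam K i y.
Proof.
move=> l1; have := @lam_continuous _ K i x.
by move=> /(_ [set t | c < t]); apply; exact: lt_nbhsr.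
Qed.

Lemma strip_le1 t : t <= strip_width -> strip t = 1.
Proof. by move=> ht; apply: cut_le1; rewrite ler_pdivrMr ?mul1r ?strip_width_gt0. Qed.

Lemma strip_ge2 t : 2 * strip_width <= t -> strip t = 0.
Proof. by move=> ht; apply: cut_ge2; rewrite ler_pdivlMr ?strip_width_gt0. Qed.

Lemma psi_near0 i j : j != i -> \forall x \near K i, psi (K j) K x = 0.
Proof.
move=> ji; have l0 : lam K j (K i) < 3 / 4 by rewrite lam_vertex // (negbTE ji) divr_gt0.
by apply: filterS (near_lam_lt l0) => y; exact: psi_low.
Qed.

Lemma F2_cyc i x : F2 K x = F1 K x + (psi (K i) K x * (pz (K i) x - F1 K x) +
  psi (K (i + 1)) K x * (pz (K (i + 1)) x - F1 K x) +
  psi (K (i + 1 + 1)) K x * (pz (K (i + 1 + 1)) x - F1 K x)).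
Proof. by rewrite /F2 (sum_cyc _ i). Qed.

Lemma bump_here (f a b c s0 s1 s2 : R) : s0 = 1 -> s1 = 0 -> s2 = 0 ->
  f + (s0 * (a - f) + s1 * (b - f) + s2 * (c - f)) = a.
Proof. by move=> -> -> ->; ring. Qed.

Lemma bump_end1 (f e a b c s0 s1 s2 : R) : s0 = 0 -> s1 = 1 -> s2 = 0 ->
  f + (s0 * (a - f) + s1 * (b - f) + s2 * (c - f)) = e + (s1 * (b - e) + s2 * (c - e)).
Proof. by move=> -> -> ->; ring. Qed.

Lemma bump_end2 (f e a b c s0 s1 s2 : R) : s0 = 0 -> s1 = 0 -> s2 = 1 ->
  f + (s0 * (a - f) + s1 * (b - f) + s2 * (c - f)) = e + (s1 * (b - e) + s2 * (c - e)).
Proof. by move=> -> -> ->; ring. Qed.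

Lemma bump_edge (f e a b c s0 s1 s2 : R) : s0 = 0 -> f = e ->
  f + (s0 * (a - f) + s1 * (b - f) + s2 * (c - f)) = e + (s1 * (b - e) + s2 * (c - e)).
Proof. by move=> -> ->; ring. Qed.

Lemma F2_near_vertex i : \forall x \near K i, F2 K x = pz (K i) x.
Proof.
have p1 := psi_at i.
have p2 := psi_near0 (neqS i); have p3 := psi_near0 (neqSS i).
apply: filterS3 p1 p2 p3 => x e1 e2 e3; exact: etrans (F2_cyc i x) (bump_here _ _ _ _ e1 e2 e3).
Qed.

Lemma edge_end_dist i x : lam K i x = 0 ->
  en (x - K (i + 1)) = `|lam K (i + 1 + 1) x| * en (K (i + 1 + 1) - K (i + 1)) /\
  en (x - K (i + 1 + 1)) = `|lam K (i + 1) x| * en (K (i + 1) - K (i + 1 + 1)).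
Proof.
move=> l0; have s1 := sum_lam x dK; have sx := sum_lam_vertex x dK.
rewrite (sum_cyc _ i) l0 add0r in s1.
have e : x = lam K (i + 1) x *: K (i + 1) + lam K (i + 1 + 1) x *: K (i + 1 + 1).
  by rewrite -[LHS]sx; move: s1 l0; case: (ord3P i) => ->;
     rewrite ?o0S ?o1S ?o2S ?o0S ?o1S sum3 => s1 ->; rewrite scale0r; move: (K _) (K _) => a b; plane_ring.
split; rewrite -enZ; congr en; rewrite [in LHS]e.
  have -> : lam K (i + 1) x = 1 - lam K (i + 1 + 1) x by lra.
  move: (lam _ _ _) (K _) (K _) => t a b; plane_ring.
have -> : lam K (i + 1 + 1) x = 1 - lam K (i + 1) x by lra.
move: (lam _ _ _) (K _) (K _) => t a b; plane_ring.
Qed.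

Lemma near_bump_one i x : en (x - K i) < rho (K i) K -> \forall y \near x, psi (K i) K y = 1.
Proof.
move=> hx; apply/nbhs_enP; exists (rho (K i) K - en (x - K i)); first by rewrite subr_gt0.
move=> y hy; apply: bumpv_near; first exact: rho_gt0.
have -> : y - K i = (y - x) + (x - K i) by rewrite addrA subrK.
by apply: le_lt_trans (enD _ _) _; rewrite -ltrBrDr.
Qed.

(* Where two strips overlap, near the end of an edge, the bump at that end is
   identically 1. *)
Lemma F2_near_edge i x : open_edge K i x -> \forall y \near x, F2 K y = GE K i y.
Proof.
case=> l0 l1 l2; have s1 := sum_lam x dK; rewrite (sum_cyc _ i) l0 add0r in s1.
have [d1 d2] := edge_end_dist l0.
have td j j' : en (K j - K j') <= h by exact: tri_diam (tri_vertex _ dK) (tri_vertex _ dK).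
have q0 : \forall y \near x, psi (K i) K y = 0.
  have := @near_lam_lt i x (3 / 4); rewrite l0 => /(_ ltac:(by rewrite divr_gt0)).
  by apply: filterS => y; exact: psi_low.
have st0 : \forall y \near x, strip (lam K i y) = 1.
  have := @near_lam_lt i x strip_width; rewrite l0 => /(_ strip_width_gt0).
  by apply: filterS => y /ltW; exact: strip_le1.
have end_case j j' : j != j' -> lam K j' x <= 2 * strip_width -> 0 < lam K j' x ->
    en (x - K j) = `|lam K j' x| * en (K j' - K j) -> lam K j x = 1 - lam K j' x ->
    (\forall y \near x, psi (K j) K y = 1) /\ (\forall y \near x, psi (K j') K y = 0).
  move=> jj' s2 p0 dj lj; split.
    apply: near_bump_one; apply: le_lt_trans (strip_rho j); rewrite dj gtr0_norm //.
    by apply: ler_pM => //; [exact: ltW|exact: en_ge0].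
  have lw : lam K j' x < 3 / 4.
    apply: le_lt_trans s2 _; have := strip_rho j; have := rho_le j; have := rho_gt0 j.
    have hk : h <= kappa * h by rewrite ler_peMl // ltW.
    move=> r0 r1 r2; rewrite -(ltr_pM2r h0).
    have : rho (K j) K <= kappa * rho (K j) K by rewrite ler_peMl // ltW.
    lra.
  by apply: filterS (near_lam_lt lw) => y; exact: psi_low.
case: (leP (lam K (i + 1 + 1) x) (2 * strip_width)) => c2.
  have [e1 e2] := @end_case (i + 1) (i + 1 + 1) ltac:(by rewrite eq_sym neqS) c2 l2 d1 ltac:(by lra).
  apply: filterS3 q0 e1 e2 => y g0 g1 g2.
  exact: etrans (F2_cyc i y) (bump_end1 _ _ _ _ _ g0 g1 g2).
case: (leP (lam K (i + 1) x) (2 * strip_width)) => c1.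
  have [e1 e2] := @end_case (i + 1 + 1) (i + 1) (neqS _) c1 l1 d2 ltac:(by lra).
  apply: filterS3 q0 e2 e1 => y g0 g1 g2.
  exact: etrans (F2_cyc i y) (bump_end2 _ _ _ _ _ g0 g1 g2).
have st1 : \forall y \near x, strip (lam K (i + 1) y) = 0.
  by apply: filterS (near_lam_gt c1) => y /ltW; exact: strip_ge2.
have st2 : \forall y \near x, strip (lam K (i + 1 + 1) y) = 0.
  by apply: filterS (near_lam_gt c2) => y /ltW; exact: strip_ge2.
have F1E : \forall y \near x, F1 K y = pE K i y.
  apply: filterS3 st0 st1 st2 => y g0 g1 g2.
  exact: etrans (f_equal (fun t => P K y + t) (sum_cyc _ i)) (bump_here _ _ _ _ g0 g1 g2).
apply: filterS2 q0 F1E => y g0 g1.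
exact: etrans (F2_cyc i y) (bump_edge _ _ _ _ _ g0 g1).
Qed.

Lemma cinf_lam i : cinf (lam K i).
Proof. by have [a [b [c ->]]] := lam_quad K i; exact: cinf_quad. Qed.

Lemma cinf_strip i : cinf (fun x => strip (lam K i x)).
Proof.
apply: (cinf_comp (g := fun x => lam K i x / strip_width)); first exact: cinf_cut.
by apply: cinfM; [exact: cinf_lam|exact: cinf_cst].
Qed.

Lemma cinf_P : cinf (P K). Proof. by case: pP => p1 _ _ _ _; apply/poly_cinf/p1. Qed.

Lemma cinf_F1 : cinf (F1 K).
Proof.
apply: cinfD; first exact: cinf_P.
apply: (@cinf_sum _ _ _ _ _ (fun i x => strip (lam K i x) * (pE K i x - P K x))) => i.
by apply: (cinfM (cinf_strip i)); apply: cinfB; [exact: cinf_aff|exact: cinf_P].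
Qed.

Lemma cinf_F2 : cinf (F2 K).
Proof.
apply: cinfD; first exact: cinf_F1.
apply: (@cinf_sum _ _ _ _ _ (fun i x => psi (K i) K x * (pz (K i) x - F1 K x))) => i.
apply: (cinfM (cinf_bumpv _ _)).
by apply: cinfB; [exact: cinf_aff|exact: cinf_F1].
Qed.

Lemma cinf_GE i : cinf (GE K i).
Proof.
by apply: cinfD; [exact: cinf_aff|apply: cinfD; apply: (cinfM (cinf_bumpv _ _)); apply: cinfB; exact: cinf_aff].
Qed.

Lemma seg_mean_end i j (g : R * R) l : i != j ->
  seg_mean (pd l (fun x => psi (K i) K x * aff (K i) 0 g x)) (K i) (K j) = 0.
Proof.
move=> ij; apply: seg_mean_bumpv; first exact: rho_gt0.
have := edge_ge dK (sr KM) ij; have := rho_le i; rewrite -/h => r1 r2.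
have e1 : 8 * rho (K i) K <= en (K i - K j).
  by rewrite -(ler_pM2l k0); apply: le_trans r2; rewrite mulrCA mulrA.
rewrite sqd_en -enN opprB; have r0 := rho_gt0 i.
have : (8 * rho (K i) K) ^+ 2 <= en (K i - K j) ^+ 2 by rewrite ler_pXn2r // nnegrE ?en_ge0 // mulr_ge0 // ltW.
rewrite exprMn; have : 0 < rho (K i) K ^+ 2 by rewrite exprn_gt0.
lra.
Qed.

Lemma seg_mean_end_sym i j (g : R * R) l : i != j ->
  seg_mean (pd l (fun x => psi (K i) K x * aff (K i) 0 g x)) (K j) (K i) = 0.
Proof.
move=> ij; rewrite seg_mean_sym ?seg_mean_end //; apply: pd_continuous.
by apply: cinfM; [exact: cinf_bumpv|exact: cinf_aff].
Qed.

Lemma pz_pE z c g : pz z z = c -> (fun x => pz z x - aff z c g x) =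
  aff z 0 ((if `[< D z >] then grad (P (vtri z)) z else 0) - g).
Proof.
rewrite /pz {1}/aff subrr {1}/dot /= !mulr0 !addr0 => ->.
by apply/funext => x; rewrite /aff /dot /=; ring.
Qed.

(** The corrections at the two ends are bumps times affine functions vanishing at the vertex, whose
    gradients have edge mean 0. Only the constant gradient of [pE] is left. *)
Lemma seg_mean_GE i l : seg_mean (pd l (GE K i)) (K (i + 1)) (K (i + 1 + 1)) = pd l (P K) (mid K i).
Proof.
set a := K (i + 1); set b := K (i + 1 + 1).
have [g1 e1] : exists g, (fun x => pz a x - pE K i x) = aff a 0 g.
  by eexists; apply: pz_pE; exact: pz_vertex.
have [g2 e2] : exists g, (fun x => pz b x - pE K i x) = aff b 0 g.
  by eexists; rewrite (pE_alt i KM); apply: pz_pE; exact: pz_vertex.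
have E : GE K i = fun x => pE K i x + (psi a K x * aff a 0 g1 x + psi b K x * aff b 0 g2 x).
  by apply/funext => x; rewrite /GE -/a -/b -e1 -e2.
have c1 : cinf (fun x => psi a K x * aff a 0 g1 x) by apply: cinfM; [exact: cinf_bumpv|exact: cinf_aff].
have c2 : cinf (fun x => psi b K x * aff b 0 g2 x) by apply: cinfM; [exact: cinf_bumpv|exact: cinf_aff].
rewrite E (pdD l (cinf_aff _ _ _) (cinfD c1 c2)) (pdD l c1 c2).
rewrite seg_meanD; [|exact: pd_continuous (cinf_aff _ _ _)|].
  rewrite seg_meanD; [|exact: pd_continuous c1|exact: pd_continuous c2].
  have n1 : i + 1 != i + 1 + 1 by rewrite eq_sym neqS.
  have z1 := seg_mean_end g1 l n1; have z2 := seg_mean_end_sym g2 l (neqS (i + 1)).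
  apply: etrans (f_equal2 (fun s t => _ + (s + t)) z1 z2) _; rewrite !addr0.
  rewrite -(crd_grad l (P K)) pd_aff /seg_mean /Rintegral integral_cst //= lebesgue_measure_itv /= lte_fin ltr01.
  by rewrite oppr0 adde0 mule1.
move=> x; apply: continuousD; [exact: pd_continuous c1 x|exact: pd_continuous c2 x].
Qed.

Lemma seg_mean_F2 i l : seg_mean (pd l (F2 K)) (K (i + 1)) (K (i + 1 + 1)) = pd l (P K) (mid K i).
Proof.
(* [F2] and [GE] coincide around points of the open edge, so the ends of the parameter interval are
   dropped from the mean. *)
rewrite -seg_mean_GE; have q (w : R * R -> R) : cinf w ->
    seg_mean (pd l w) (K (i + 1)) (K (i + 1 + 1)) =
    \int[@lebesgue_measure R]_(t in `]0, 1[) pd l w (K (i + 1) + t *: (K (i + 1 + 1) - K (i + 1))).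
  move=> cw; have L := L1_itv (seg_continuous (x := K (i + 1)) (y := K (i + 1 + 1)) (pd_continuous (i := l) cw)).
  have s01 : `]0, 1[ `<=` (`[0, 1] : set R) by move=> t; rewrite /= !in_itv /= => /andP[a b]; rewrite !ltW.
  have s02 : `]0, 1] `<=` (`[0, 1] : set R) by move=> t; rewrite /= !in_itv /= => /andP[a ->]; rewrite ltW.
  rewrite /seg_mean -Rintegral_itv_obnd_cbnd; last by apply: integrableS L.
  by rewrite -Rintegral_itv_bndo_bndc; last by apply: integrableS L.
rewrite (q _ cinf_F2) (q _ (cinf_GE i)); apply: eq_Rintegral => t; rewrite inE /= in_itv /= => t01.
rewrite !pdE; apply: near_eq_derive; apply: F2_near_edge; exact: open_edge_point.
Qed.

(** The gradients of [F2] and P have equal means on the three edges. *)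
Lemma Int_Hc_F2 c : Int (tri K)° (Hc c (fun x => F2 K x - P K x)) = 0.
Proof.
pose w x := F2 K x - P K x.
have cw : cinf w by apply: cinfB; [exact: cinf_F2|exact: cinf_P].
have mean0 i l : seg_mean (pd l w) (K (i + 1)) (K (i + 1 + 1)) = 0.
  rewrite (pdBE l cinf_F2 cinf_P) seg_meanB; [|exact: pd_continuous cinf_F2|exact: pd_continuous cinf_P].
  by rewrite seg_mean_F2 seg_mean_poly ?subrr //; case: pP => p1 _ _ _ _; exact: p1.
have I0 k l : Int (tri K)° (pd k (pd l w)) = 0.
  apply: (Int_pd_eq0 dK (cinf_pd l cw)).
  - by have := mean0 0 l; rewrite o0S o1S.
  - by have := mean0 1 l; rewrite o1S o2S => h1; rewrite seg_mean_sym //; exact: pd_continuous.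
  - by have := mean0 o2 l; rewrite o2S o0S.
by case: (ord3P c) => ->; rewrite ?Hc0 ?Hc1 ?Hc2; exact: I0.
Qed.

End OneTriangle.
End Companion.

(** * The glued function is a test function *)

Section Gluing.
Context {R : realType}.
Implicit Types (x y z : R * R) (K L : triangle R) (u v w : R * R -> R).

Lemma near_all_mem (I : eqType) (s : seq I) (Q : I -> set (R * R)) x :
  (forall i, i \in s -> \forall y \near x, Q i y) -> \forall y \near x, forall i, i \in s -> Q i y.
Proof.
elim: s => [|j s IH] h; first by near=> y => i; rewrite in_nil.
have h1 := h j (mem_head _ _).
have h2 := IH (fun i si => h i (mem_behead (s := j :: s) si)).
by apply: filterS2 h1 h2 => y a b i; rewrite inE => /orP[/eqP ->|/b].
Unshelve. all: by end_near. Qed.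

Lemma mesh_en_le (M : mesh R) K x : K \in M -> tri K x -> en x <= \sum_(L <- M) \sum_i en (L i).
Proof.
move=> KM Kx; apply: le_trans (tri_en_le Kx) _; rewrite (big_rem K) //= lerDl.
by apply: sumr_ge0 => L _; apply: sumr_ge0 => i _; exact: en_ge0.
Qed.

Variables (D : set (R * R)) (M : mesh R) (kappa : R).
Hypotheses (oD : open D) (bD : bounded_set D) (lip : lipschitz_boundary D) (tM : triangulation D M).
Hypothesis sr : forall K, K \in M -> shape_regular kappa K.
Variable P : triangle R -> R * R -> R.
Hypothesis pP : pieces D M P.

Notation pzM := (pz D M P).
Notation F2M := (F2 D M kappa P).
Notation GEM := (GE D M kappa P).
Notation pEM := (pE P).
Notation psiM := (psi M kappa).

Lemma aff0 z : aff z 0 0 = fun=> 0 :> R.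
Proof. by apply/funext => x; rewrite /aff /dot /=; ring. Qed.

Lemma pz_out z : ~ D z -> pzM z = fun=> 0.
Proof. by move=> nD; rewrite /pz; case: asboolP => // _; exact: aff0. Qed.

Lemma share_adjacent K L i j z : K \in M -> L \in M -> share K i L j ->
  z = K (i + 1) \/ z = K (i + 1 + 1) -> fan M z K L.
Proof. by move=> KM LM sh zK; apply: fan_adjacent; apply/asboolP; split => //; exists i, j. Qed.

Lemma psi_share K L i j z : K \in M -> L \in M -> share K i L j ->
  z = K (i + 1) \/ z = K (i + 1 + 1) -> psiM z K = psiM z L.
Proof.
move=> KM LM sh zK; rewrite /psi /rho.
by rewrite (fan_rep_eq KM (share_adjacent KM LM sh zK)).
Qed.

Lemma pE_share K L i j : K \in M -> L \in M -> share K i L j -> pEM K i = pEM L j.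
Proof.
move=> KM LM sh; have [_ p2 _ p4 _] := pP.
have eg : grad (P K) (mid K i) = grad (P L) (mid L j) :=
  f_equal2 pair (p4 K L i j 0 KM LM sh) (p4 K L i j 1 KM LM sh).
case: sh => -[e1 e2].
  rewrite /pE eg; exact: (f_equal2 (fun z c => aff z c _) e1 (p2 _ _ _ _ KM LM e1)).
rewrite (pE_alt pP j LM) /pE eg; exact: (f_equal2 (fun z c => aff z c _) e1 (p2 _ _ _ _ KM LM e1)).
Qed.

Lemma GE_share K L i j : K \in M -> L \in M -> share K i L j -> GEM K i = GEM L j.
Proof.
move=> KM LM sh; apply/funext => x; rewrite /GE (pE_share KM LM sh).
rewrite (psi_share KM LM sh (or_introl erefl)) (psi_share KM LM sh (or_intror erefl)).
by case: sh => -[-> ->]; [by []|rewrite [psiM _ _ _ * _ + _]addrC].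
Qed.

Lemma open_edge_share K L i j x : K \in M -> L \in M -> K <> L -> share K i L j ->
  open_edge K i x -> tri L x -> open_edge L j x.
Proof.
move=> KM LM KL sh oK Lx; have [_ _ _ conf] := tM.
have dK := mesh_det tM KM; have dL := mesh_det tM LM.
have [l0 l1 l2] := oK.
have lj : lam L j x = 0 by rewrite (share_lam x dL dK (share_sym sh)) l0 mul0r.
have [iL|[m om]|[m em]] := tri_cases dL Lx.
- case: KL; apply/esym; exact: (conforming_interior conf LM KM dL iL (open_edge_tri dK oK)).
- have [->//|jm] := eqVneq j m; have [_ m1 m2] := om.
  by case: (ord3_other jm) => e; move: lj; rewrite e => lj; [move: m1|move: m2]; rewrite lj ltxx.
- have : has_vertex x K by rewrite em; apply: (conf_vertex tM LM KM); rewrite -em; exact: open_edge_tri oK.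
  case/has_vertexP => n en; move: l0 l1 l2; rewrite en !lam_vertex //.
  have [<-|ni] := eqVneq i n; first by move=> /eqP; rewrite oner_eq0.
  case: (ord3_other (i := i) (j := n) _); first by rewrite eq_sym.
    by move=> -> _ _; rewrite (negbTE (neqS _)) ltxx.
  by move=> ->; rewrite eq_sym (negbTE (neqS _)) ltxx.
Qed.

Lemma GE_out K i x : K \in M -> open_edge K i x -> ~ D x -> GEM K i = fun=> 0.
Proof.
move=> KM ox nD; have [_ _ p3 _ p5] := pP; have dK := mesh_det tM KM.
have nV j : j != i -> ~ D (K j) by move=> ji Dj; apply: nD; exact: (edge_end_D oD lip tM KM ji Dj ox).
have nM : ~ D (mid K i) by move=> Dm; apply: nD; exact: (open_edge_D oD lip tM KM (mid_open_edge i dK) ox Dm).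
have gm : grad (P K) (mid K i) = 0 := f_equal2 pair (p5 K i 0 KM nM) (p5 K i 1 KM nM).
have pE0 : pEM K i = fun=> 0.
  by rewrite /pE gm (p3 _ _ KM (nV _ (neqS i))) aff0.
apply/funext => x'; rewrite /GE pE0 (pz_out (nV _ (neqS i))) (pz_out (nV _ (neqSS i))).
by move: (psiM _ _ _) (psiM _ _ _) => a b; rewrite subrr !mulr0 !addr0.
Qed.

(** Around each point one smooth function represents all pieces [F2] of the triangles through it:
    [F2] itself inside, [GE] on an open edge, [pz] at a vertex. It is 0 at points outside [D]. *)
Lemma companion_local x : exists2 w, cinf w &
  (forall K, K \in M -> tri K x -> \forall y \near x, F2M K y = w y) /\ (~ D x -> w = fun=> 0).
Proof.
have [_ _ _ conf] := tM.
case: (pselect (exists2 K, K \in M & tri K x)) => [[K KM Kx]|no]; last first.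
  exists (fun=> 0); first exact: cinf_cst.
  by split => // K KM Kx; case: no; exists K.
have dK := mesh_det tM KM.
have [iK|[i ox]|[i ex]] := tri_cases dK Kx.
- exists (F2M K); first exact: (cinf_F2 kappa pP KM).
  split => [L LM Lx|nD]; last by case: nD; exact: (mesh_interior lip tM KM iK).
  by rewrite -(conforming_interior conf KM LM dK iK Lx); near=> y.
- exists (GEM K i); first exact: cinf_GE.
  split => [L LM Lx|]; last exact: GE_out ox.
  case: (pselect (K = L)) => [<-|KL]; first exact: F2_near_edge lip tM sr P K KM i x ox.
  have [j sh] := conf_edge tM KM LM KL ox Lx.
  rewrite (GE_share KM LM sh).
  exact: (F2_near_edge lip tM sr P LM (open_edge_share KM LM KL sh ox Lx)).
- exists (pzM x); first exact: cinf_aff.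
  split => [L LM Lx|]; last exact: pz_out.
  have : has_vertex x L by rewrite ex; apply: (conf_vertex tM KM LM); rewrite -ex.
  by case/has_vertexP => j ->; exact: F2_near_vertex.
Unshelve. all: by end_near. Qed.

(** Takes the first triangle containing the point; on edges and at vertices the choice is immaterial
    since the pieces [F2] agree there. *)
Definition companion x : R := if [seq K <- M | `[< tri K x >]] is K :: _ then F2M K x else 0.

Lemma companion_in K x : K \in M -> (tri K)° x -> companion x = F2M K x.
Proof.
move=> KM iK; have [_ _ _ conf] := tM.
have : K \in [seq K <- M | `[< tri K x >]].
  by rewrite mem_filter KM andbT; apply/asboolP; exact: interior_subset.
have : forall L, L \in [seq K <- M | `[< tri K x >]] -> L = K.
  move=> L; rewrite mem_filter => /andP[/asboolP Lx LM].
  by apply/esym; exact: (conforming_interior conf KM LM (mesh_det tM KM) iK Lx).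
rewrite /companion; case: [seq _ <- _ | _] => // L s h _; by rewrite (h L) ?mem_head.
Qed.

Lemma companion_near x : exists2 w, cinf w & (\forall y \near x, companion y = w y) /\ (~ D x -> w = fun=> 0).
Proof.
have [w cw [h1 h2]] := companion_local x; exists w => //; split => //.
have nt := near_tri tM x.
have na : \forall y \near x, forall K, K \in M -> tri K x -> F2M K y = w y.
  apply: near_all_mem => K KM; case: (pselect (tri K x)) => Kx; last by near=> y.
  by apply: filterS (h1 K KM Kx).
have nc : \forall y \near x, (exists2 K, K \in M & tri K y) \/ w y = 0.
  case: (pselect (D x)) => Dx; last by near=> y; right; rewrite (h2 Dx).
  have : nbhs x D by exact: open_nbhs_nbhs.
  by apply: filterS => y Dy; left; exact: mesh_cover tM y Dy.
apply: filterS3 nt na nc => y a b c; rewrite /companion.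
have : forall L, L \in [seq K <- M | `[< tri K y >]] -> F2M L y = w y.
  by move=> L; rewrite mem_filter => /andP[/asboolP Ly LM]; exact: b (a L LM Ly).
case: c => [[K KM Ky]|w0].
  have : K \in [seq K <- M | `[< tri K y >]] by rewrite mem_filter KM andbT; exact/asboolP.
  by case: [seq _ <- _ | _] => // L s _ h; apply: h; rewrite mem_head.
by case: [seq _ <- _ | _] => // L s h; apply: h; rewrite mem_head.
Unshelve. all: by end_near. Qed.

Lemma companion_test : test_function D companion.
Proof.
split; first by apply: smooth_local => x; have [w cw [h _]] := companion_near x; exists w.
(* The complement of Z is the support. It is closed by construction, bounded because it lies in the
   union of the triangles, and inside [D] because the companion is 0 around every other point. *)
pose Z := [set x : R * R | \forall y \near x, companion y = 0].
exists (~` Z); split.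
- pose r := \sum_(K <- M) \sum_i en (K i).
  apply: (@subclosed_compact _ _ (`[- r, r] `*` `[- r, r] : set (R * R))); last first.
  + move=> x nZ; suff [K KM Kx] : exists2 K, K \in M & tri K x.
      have h := mesh_en_le KM Kx; have n1 := norm1_le_en x; have n2 := norm2_le_en x.
      by split; rewrite /= in_itv /= -ler_norml; apply: le_trans h.
    apply: contrapT => no; apply: nZ.
    have nt := near_tri tM x; apply: filterS nt => y h; rewrite /companion.
    have : forall L, L \in [seq K <- M | `[< tri K y >]] -> False.
      move=> L; rewrite mem_filter => /andP[/asboolP Ly LM]; apply: no; exists L => //; exact: h.
    by case: [seq _ <- _ | _] => // L s hL; case: (hL L); rewrite mem_head.
  + by apply: compact_setX; exact: segment_compact.
  + apply: open_closedC; rewrite openE => x Zx; rewrite /interior /Z /=; exact: near_join Zx.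
- move=> x nZ; apply: contrapT => nD; apply: nZ.
  have [w _ [h1 h2]] := companion_near x; rewrite /Z /=; move: h1; rewrite (h2 nD); exact.
- by move=> x /contrapT; exact: nbhs_singleton.
Qed.

End Gluing.

(** * Gradients of the pieces around a vertex *)

Section CompanionJets.
Context {R : realType}.
Implicit Types (x y z v : R * R) (K L A B : triangle R) (u w : R * R -> R).

Lemma mvt_bound w (k : R) y v : cinf w -> 0 <= k -> (forall i y, `|pd i w y| <= k) ->
  `|w (y + v) - w y| <= 2 * k * en v.
Proof.
move=> cw k0 hk; have [t _ ->] := line_MVT y v cw; rewrite derive_pd; last exact: cinf_diff.
apply: le_trans (ler_normD _ _) _; rewrite !normrM.
have n1 := norm1_le_en v; have n2 := norm2_le_en v; have e0 := en_ge0 v.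
have h1 : `|v.1| * `|pd 0 w (y + t *: v)| <= en v * k by apply: ler_pM.
have h2 : `|v.2| * `|pd 1 w (y + t *: v)| <= en v * k by apply: ler_pM.
lra.
Qed.

(** For a quadratic polynomial the Hessian is constant; the origin is an arbitrary point of
    evaluation. *)
Definition hmag u : R := Num.sqrt (hess2 u 0).

Lemma hmag_ge0 u : 0 <= hmag u. Proof. exact: sqrtr_ge0. Qed.

Lemma sq4_congr (a b c d a' b' c' d' : R) : a = a' -> b = b' -> c = c' -> d = d' ->
  (a ^+ 2 + b ^+ 2) + (c ^+ 2 + d ^+ 2) = (a' ^+ 2 + b' ^+ 2) + (c' ^+ 2 + d' ^+ 2).
Proof. by move=> -> -> -> ->. Qed.

Lemma hmag_sq u x : poly_le2 u -> hess2 u x = hmag u ^+ 2.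
Proof.
move=> pu; rewrite (sqr_sqrtr (hess2_ge0 u 0)).
have h i j : pd i (pd j u) x = pd i (pd j u) 0.
  by have [a e] := poly_hess i j pu; exact: etrans (f_equal (fun f => f x) e) (esym (f_equal (fun f => f 0) e)).
apply: etrans (hess2_explicit u x) _; apply: etrans (esym (hess2_explicit u 0)).
by apply: sq4_congr; exact: h.
Qed.

Lemma sq_sum4 (a b c d m : R) : 0 <= m -> (a ^+ 2 + b ^+ 2) + (c ^+ 2 + d ^+ 2) = m ^+ 2 ->
  [/\ `|a| <= m, `|b| <= m, `|c| <= m & `|d| <= m].
Proof.
move=> m0 e; have s (t : R) : t ^+ 2 <= m ^+ 2 -> `|t| <= m.
  by move=> h; rewrite -(ger0_norm m0) -ler_sqr ?nnegrE // !real_normK ?num_real.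
have := sqr_ge0 a; have := sqr_ge0 b; have := sqr_ge0 c; have := sqr_ge0 d.
by split; apply: s; lra.
Qed.

Lemma hmag_pd u i j x : poly_le2 u -> `|pd i (pd j u) x| <= hmag u.
Proof.
move=> pu; have := etrans (esym (hess2_explicit u x)) (hmag_sq x pu) => /(sq_sum4 (hmag_ge0 u))[a b c d].
by case: (ord2P i) => ->; case: (ord2P j) => ->.
Qed.

Lemma grad_lip u x y : poly_le2 u -> en (grad u x - grad u y) <= 4 * hmag u * en (x - y).
Proof.
move=> pu; have cu := poly_cinf pu; have h i : `|pd i u x - pd i u y| <= 2 * hmag u * en (x - y).
  have := @mvt_bound (pd i u) (hmag u) y (x - y) (cinf_pd i cu) (hmag_ge0 u) (fun j z => hmag_pd j i z pu).
  by rewrite [y + _]addrC subrK.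
have g0 := h 0; have g1 := h 1.
apply: le_trans (en_le_norm _) _; rewrite prod_normE /=.
have -> : 4 * hmag u * en (x - y) = 2 * (2 * hmag u * en (x - y)) by ring.
by rewrite ler_pM2l // ge_max g0 g1.
Qed.

Lemma jet_sum3 h a (F : 'I_3 -> R * R -> R) x : (forall i, cinf (F i)) ->
  (forall i, jet h a (F i) x) -> jet h (3 * a) (fun y => \sum_i F i y) x.
Proof.
move=> cF jF; have -> : (fun y => \sum_i F i y) = fun y => F 0 y + F 1 y + F o2 y.
  by apply/funext => y; rewrite sum3.
have -> : 3 * a = a + a + a by ring.
exact: (jetD (cinfD (cF 0) (cF 1)) (cF o2) (jetD (cF 0) (cF 1) (jF 0) (jF 1)) (jF o2)).
Qed.

Lemma diam_ge0 K : 0 <= diam (tri K).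
Proof.
have h : tri K (K 0).
  exists (fun i => (i == 0)%:R); split; [by move=> i|by rewrite sum3 /= !addr0|].
  by rewrite sum3 /= !scale0r scale1r !addr0.
by have := tri_diam h h; rewrite subrr en0.
Qed.

Lemma pcut_bound : exists2 C : R, 0 < C &
  forall t, [/\ `|pcut t| <= C, `|'D_1 pcut t| <= C & `|'D_1 (fun s : R => 'D_1 pcut s) t| <= C].
Proof.
exact: (profile_bound (c1 := 1) (c2 := 0) cinf_pcut (@pcut_lt1 R) (@pcut_gt2 R)).
Qed.

Lemma cut_bound : exists2 C : R, 0 < C &
  forall t, [/\ `|cut t| <= C, `|'D_1 (@cut R) t| <= C & `|'D_1 (fun s : R => 'D_1 (@cut R) s) t| <= C].
Proof.
apply: (profile_bound (c1 := 1) (c2 := 0) cinf_cut) => t /ltW; [exact: cut_le1|exact: cut_ge2].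
Qed.

Section Mesh.
Variables (D : set (R * R)) (M : mesh R) (kappa : R).
Hypotheses (oD : open D) (lip : lipschitz_boundary D) (tM : triangulation D M).
Hypothesis sr : forall K, K \in M -> shape_regular kappa K.
Variable P : triangle R -> R * R -> R.
Hypothesis pP : pieces D M P.

Let N := nstar kappa.
Definition fan_mag z K : R := \sum_(A <- M | `[< fan M z K A >]) hmag (P A).
Definition star_mag K : R := \sum_i fan_mag (K i) K.

Definition gz z : R * R := if `[< D z >] then grad (P (vtri M z)) z else 0.

Let b A : R := 4 * hmag (P A) * diam (tri A).

Let polyP A : A \in M -> poly_le2 (P A). Proof. by case: pP => p1 _ _ _ _; exact: p1. Qed.

Let b_ge0 A : 0 <= b A.
Proof.
apply: mulr_ge0; first by apply: mulr_ge0 => //; exact: hmag_ge0.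
exact: diam_ge0.
Qed.

Lemma mid_tri A i : det A != 0 -> tri A (mid A i).
Proof. by move=> dA; exact: (open_edge_tri dA (mid_open_edge i dA)). Qed.

Let grad_mid A i z : A \in M -> tri A z -> en (grad (P A) z - grad (P A) (mid A i)) <= b A.
Proof.
move=> AM Az; apply: le_trans (grad_lip _ _ (polyP AM)) _; rewrite /b.
apply: ler_wpM2l; first by apply: mulr_ge0 => //; exact: hmag_ge0.
by apply: tri_diam Az _; apply: mid_tri; exact: (mesh_det tM AM).
Qed.

Let tri_has_vertex A z : A \in M -> has_vertex z A -> tri A z.
Proof. by move=> AM /has_vertexP[i ->]; apply: tri_vertex; exact: (mesh_det tM AM). Qed.

(** Both gradients agree at the midpoint of the common edge, and each varies by at most [b] on its
    triangle. *)
Lemma grad_adjacent z A B : adjacent M z A B ->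
  en (grad (P A) z - grad (P B) z) <= b A + b B.
Proof.
move=> adj; have /andP[zA zB] := adjacent_vertex adj.
move: adj => /asboolP[AM BM [i [j [sh _]]]].
have e : grad (P A) (mid A i) = grad (P B) (mid B j).
  by have [_ _ _ p4 _] := pP; exact: (f_equal2 pair (p4 A B i j 0 AM BM sh) (p4 A B i j 1 AM BM sh)).
have -> : grad (P A) z - grad (P B) z = (grad (P A) z - grad (P A) (mid A i)) +
    - (grad (P B) z - grad (P B) (mid B j)).
  by rewrite e; move: (grad _ _) (grad _ _) (grad _ _) => p q r; rewrite opprB addrA subrK.
apply: le_trans (enD _ _) _; rewrite enN.
by apply: lerD; apply: grad_mid => //; exact: tri_has_vertex.
Qed.

(** At a vertex in [D] a chain leads to the triangle that lends its gradient and costs 2 S. At a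
    boundary vertex a chain leads to a boundary edge, whose midpoint gradient is 0, and the way from
    z to that midpoint costs another S. *)
Lemma gz_bound K i : K \in M ->
  en (gz (K i) - grad (P K) (K i)) <= 3 * \sum_(A <- M | `[< fan M (K i) K A >]) b A.
Proof.
move=> KM; set z := K i; set S := \sum_(A <- M | _) b A.
have zK : has_vertex z K by apply/has_vertexP; exists i.
have S0 : 0 <= S by apply: sumr_ge0 => A _; exact: b_ge0.
have chain L : fan M z K L -> en (grad (P K) z - grad (P L) z) <= 2 * S.
  by move=> KL; apply: (chain_bound (G := fun A => grad (P A) z) KM b_ge0 _ KL) => A B; exact: grad_adjacent.
rewrite /gz; case: asboolP => Dz.
  have [LM zL] := vtriP KM zK.
  have KL := fan_interior oD lip tM KM LM zK zL Dz.
  by rewrite -enN opprB; apply: le_trans (chain _ KL) _; lra.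
have [L [j [KL zj oL]]] := fan_boundary oD lip tM KM zK Dz.
have LM := fan_M KM KL; have dL := mesh_det tM LM.
have gm : grad (P L) (mid L j) = 0.
  have [_ _ _ _ p5] := pP; have nM : ~ D (mid L j) by apply: oL; exact: mid_open_edge.
  exact: (f_equal2 pair (p5 L j 0 LM nM) (p5 L j 1 LM nM)).
have bL : b L <= S.
  rewrite /S (big_rem L) //= asboolT // lerDl; apply: sumr_ge0 => A _; exact: b_ge0.
rewrite sub0r enN.
have -> : grad (P K) z = (grad (P K) z - grad (P L) z) + (grad (P L) z - grad (P L) (mid L j)).
  by rewrite gm subr0 subrK.
apply: le_trans (enD _ _) _; have := chain _ KL.
have := grad_mid j LM (tri_has_vertex LM (fan_vertex zK KL)); lra.
Qed.

Lemma fan_b_le K i : K \in M ->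
  \sum_(A <- M | `[< fan M (K i) K A >]) b A <= 4 * kappa ^+ N * diam (tri K) * fan_mag (K i) K.
Proof.
move=> KM; rewrite /fan_mag mulr_sumr; apply: ler_sum => A /asboolP KA; rewrite /b.
have zK : has_vertex (K i) K by apply/has_vertexP; exists i.
have := fan_diam lip tM sr KM zK KA; rewrite -/N => hd.
have -> : 4 * kappa ^+ N * diam (tri K) * hmag (P A) = 4 * hmag (P A) * (kappa ^+ N * diam (tri K)) by ring.
by apply: ler_wpM2l hd; apply: mulr_ge0 => //; exact: hmag_ge0.
Qed.

Lemma fan_mag_ge0 z K : 0 <= fan_mag z K.
Proof. by apply: sumr_ge0 => A _; exact: hmag_ge0. Qed.

Lemma fan_mag_le K i : fan_mag (K i) K <= star_mag K.
Proof. by rewrite /star_mag (bigD1 i) //= lerDl; apply: sumr_ge0 => j _; exact: fan_mag_ge0. Qed.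

Lemma hmag_le_star K : K \in M -> hmag (P K) <= star_mag K.
Proof.
move=> KM; apply: le_trans (fan_mag_le K 0); rewrite /fan_mag (big_rem K) //= asboolT; last exact: fan_refl.
by rewrite lerDl; apply: sumr_ge0 => A _; exact: hmag_ge0.
Qed.

End Mesh.

End CompanionJets.

(** * Pointwise bound for the companion *)

Section CompanionJetBound.
Context {R : realType}.
Implicit Types (x y z v : R * R) (K L A B : triangle R) (u w : R * R -> R).

Lemma crd_le l (v : R * R) : `|crd l v| <= en v.
Proof. by rewrite /crd; case: ifP => _; [exact: norm1_le_en|exact: norm2_le_en]. Qed.

Lemma crdB l (v w : R * R) : crd l (v - w) = crd l v - crd l w.
Proof. by rewrite /crd; case: ifP. Qed.

Lemma crd_glam K i : exists c, lam K i = aff 0 c (glam K i).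
Proof.
have [c hc] := lam_affine K i; exists c; apply/funext => z.
by rewrite hc /aff subr0 addrC.
Qed.

Lemma cjet_strip (kappa C w h : R) K i x : det K != 0 -> shape_regular kappa K -> h = diam (tri K) ->
  0 < w -> w <= 1 -> 1 <= kappa ->
  (forall t, [/\ `|cut t| <= C, `|'D_1 (@cut R) t| <= C & `|'D_1 (fun s : R => 'D_1 (@cut R) s) t| <= C]) ->
  cjet h (2 * C * (kappa / w) ^+ 2) (fun y => cut (lam K i y / w)) x.
Proof.
move=> dK sr hE w0 w1 k1 hC; have h0 : 0 < h by rewrite hE diam_gt0.
have m1 : 1 <= kappa / w by rewrite ler_pdivlMr // mul1r (le_trans w1).
have [c e] := crd_glam K i.
have pu l : pd l (fun y => lam K i y / w) = fun=> crd l (glam K i) / w.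
  apply/funext => y; rewrite e (pdM l (cinf_aff _ _ _) (cinf_cst _ w^-1)) pd_cst pd_aff.
  by rewrite mulr0 add0r mulrC.
have cu : cinf (fun y => lam K i y / w).
  by rewrite e; apply: cinfM; [exact: cinf_aff|exact: cinf_cst].
apply: (cjet_comp (b := @cut R) (u := fun y => lam K i y / w) h0 m1 cinf_cut cu hC) => [l|l k].
  rewrite pu normrM (gtr0_norm (x := w^-1)) ?invr_gt0 // -mulrA [w^-1 * h^-1]mulrC mulrA.
  apply: ler_wpM2r; first by rewrite invr_ge0 ltW.
  rewrite ler_pdivlMr //; apply: le_trans (glam_le i dK sr); rewrite -hE.
  by apply: ler_wpM2r; [exact: ltW|exact: crd_le].
rewrite pu pd_cst normr0; apply: divr_ge0; last exact: sqr_ge0.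
exact: le_trans m1.
Qed.

Lemma cjet_bumpv (C q h r : R) z x : 0 < h -> 0 < r -> en (x - z) <= h -> 1 <= q -> h <= q * r ->
  (forall t, [/\ `|pcut t| <= C, `|'D_1 pcut t| <= C & `|'D_1 (fun s : R => 'D_1 pcut s) t| <= C]) ->
  cjet h (2 * C * (2 * q ^+ 2) ^+ 2) (bumpv z r) x.
Proof.
move=> h0 r0 xz q1 hq hC; have q0 : 0 < q by exact: lt_le_trans q1.
have hh : h ^+ 2 <= q ^+ 2 * r ^+ 2.
  by rewrite -exprMn ler_pXn2r // nnegrE ?mulr_ge0 ?ltW.
have m1 : 1 <= 2 * q ^+ 2 by have : 1 <= q ^+ 2 by [rewrite exprn_ege1]; lra.
have pu l y : pd l (fun x => sqd z x / r ^+ 2) y = 2 * crd l (y - z) / r ^+ 2.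
  rewrite (pdM l (cinf_sqd z) (cinf_cst _ (r ^+ 2)^-1)) pd_cst pd_sqd mulr0 add0r; by rewrite mulrC.
have cu : cinf (fun x => sqd z x / r ^+ 2) by apply: cinfM; [exact: cinf_sqd|exact: cinf_cst].
have r2 : 0 < r ^+ 2 by rewrite exprn_gt0.
have h2 : 0 < h ^+ 2 by rewrite exprn_gt0.
apply: (cjet_comp (b := pcut) (u := fun y => sqd z y / r ^+ 2) h0 m1 cinf_pcut cu hC) => [l|l k].
  rewrite pu !normrM (gtr0_norm (x := (r ^+ 2)^-1)) ?invr_gt0 // ger0_norm // ler_pdivrMr //.
  have -> : 2 * q ^+ 2 / h * r ^+ 2 = 2 * (q ^+ 2 * r ^+ 2 / h) by ring.
  rewrite ler_pM2l // ler_pdivlMr //; apply: le_trans hh; rewrite expr2.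
  by apply: ler_wpM2r; [exact: ltW|apply: le_trans xz; exact: crd_le].
have -> : pd k (fun y => sqd z y / r ^+ 2) = fun y => sqd z y * 0 + (r ^+ 2)^-1 * pd k (sqd z) y.
  by rewrite (pdM k (cinf_sqd z) (cinf_cst _ (r ^+ 2)^-1)) pd_cst.
have -> : (fun y => sqd z y * 0 + (r ^+ 2)^-1 * pd k (sqd z) y) = fun y => (r ^+ 2)^-1 * pd k (sqd z) y.
  by apply/funext => y; rewrite mulr0 add0r.
rewrite (pdM l (cinf_cst _ (r ^+ 2)^-1) (cinf_pd k (cinf_sqd z))) pd_cst mulr0 addr0 pd2_sqd.
rewrite normrM (gtr0_norm (x := (r ^+ 2)^-1)) ?invr_gt0 //.
have b2 : `|if l == k then 2 else 0 : R| <= 2 by case: ifP; rewrite ?normr0 ?normr_nat.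
rewrite mulrC ler_pdivrMr //; apply: le_trans b2 _.
have -> : 2 * q ^+ 2 / h ^+ 2 * r ^+ 2 = 2 * (q ^+ 2 * r ^+ 2 / h ^+ 2) by ring.
by rewrite ler_peMr // ler_pdivlMr // mul1r.
Qed.

Variables (kappa C1 C2 : R).
Hypothesis k1 : 1 <= kappa.
Hypothesis hC1 : forall t, [/\ `|cut t| <= C1, `|'D_1 (@cut R) t| <= C1 & `|'D_1 (fun s : R => 'D_1 (@cut R) s) t| <= C1].
Hypothesis hC2 : forall t, [/\ `|pcut t| <= C2, `|'D_1 pcut t| <= C2 & `|'D_1 (fun s : R => 'D_1 pcut s) t| <= C2].

Let N := nstar kappa.
Let k0 : 0 < kappa. Proof. exact: lt_le_trans k1. Qed.
Let w := strip_width kappa.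
Let q := 8 * kappa ^+ (2 * N).+1.
Definition Cstrip : R := 2 * C1 * (kappa / w) ^+ 2.
Definition Cbump : R := 2 * C2 * (2 * q ^+ 2) ^+ 2.
(** First term: three strips, Leibniz factor 4, edge differences of size 4. Second term: three
    bumps, Leibniz factor 4, applied to vertex differences of size 4 + 24 kappa^N minus the strip
    part. *)
Definition Cjet : R := 48 * Cstrip + 12 * Cbump * (4 + 24 * kappa ^+ N + 48 * Cstrip).

Lemma Cstrip_ge0 : 0 <= Cstrip.
Proof.
have [c _ _] := hC1 0; have C0 : 0 <= C1 by exact: le_trans c.
by apply: mulr_ge0; [exact: mulr_ge0|exact: sqr_ge0].
Qed.

Lemma Cbump_ge0 : 0 <= Cbump.
Proof.
have [c _ _] := hC2 0; have C0 : 0 <= C2 by exact: le_trans c.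
by apply: mulr_ge0; [exact: mulr_ge0|exact: sqr_ge0].
Qed.

Lemma Cjet_ge0 : 0 <= Cjet.
Proof.
have s0 := Cstrip_ge0; have b0 := Cbump_ge0.
have kN : 0 <= kappa ^+ N by rewrite exprn_ge0 // ltW.
rewrite /Cjet; apply: addr_ge0; first exact: mulr_ge0.
apply: mulr_ge0; first exact: mulr_ge0.
by rewrite !addr_ge0 // mulr_ge0.
Qed.

Variables (D : set (R * R)) (M : mesh R).
Hypotheses (oD : open D) (lip : lipschitz_boundary D) (tM : triangulation D M).
Hypothesis sr : forall K, K \in M -> shape_regular kappa K.
Variable P : triangle R -> R * R -> R.
Hypothesis pP : pieces D M P.

Variable K : triangle R.
Hypothesis KM : K \in M.
Let dK : det K != 0. Proof. exact: (mesh_det tM KM). Qed.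
Let h : R := diam (tri K).
Let h0 : 0 < h. Proof. exact: diam_gt0. Qed.
Let a : R := hmag (P K).
Let S : R := star_mag M P K.
Let pK : poly_le2 (P K). Proof. by case: pP => p1 _ _ _ _; exact: p1. Qed.
Let cK : cinf (P K). Proof. exact: poly_cinf. Qed.

Variable x : R * R.
Hypothesis Kx : tri K x.

Let aff_sub (f : R * R -> R) z c g (G : R) m : f = aff z c g -> f z = P K z -> tri K z -> tri K m -> 0 <= G ->
  (forall l, `|crd l g - pd l (P K) m| <= G) -> jet h (4 * a + 2 * G / h) (fun y => f y - P K y) x.
Proof.
move=> fE fz Kz Km G0 hG.
have pf : poly_le2 f by rewrite fE; exact: poly_aff.
have cf := poly_cinf pf.
apply: (@jet_quad _ h a G (fun y => f y - P K y) z m x h0 (hmag_ge0 _) G0 (polyB pf pK)).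
- exact: tri_diam.
- exact: tri_diam.
- exact: tri_diam.
- by rewrite fz subrr.
- by move=> l; rewrite (pdB l m cf cK) fE pd_aff.
- move=> i j y; rewrite (pd2B i j cf cK).
  have -> : pd i (pd j f) y = 0 by rewrite fE pd_aff pd_cst.
  by rewrite sub0r normrN; exact: hmag_pd.
Qed.

(** The difference vanishes at an end of the edge and its gradient vanishes at the midpoint, so only
    the Hessian contributes. *)
Let jet_pE i : jet h (4 * a) (fun y => pE P K i y - P K y) x.
Proof.
have -> : 4 * a = 4 * a + 2 * 0 / h by rewrite mulr0 mul0r addr0.
apply: (aff_sub (f := pE P K i) (m := mid K i) erefl) => //.
- by rewrite /pE /aff subrr /dot /= !mulr0 !addr0.
- exact: tri_vertex.
- exact: mid_tri.
- by move=> l; rewrite crd_grad subrr normr0.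
Qed.

Let jet_pz i : jet h (4 * a + 24 * kappa ^+ N * S) (fun y => pz D M P (K i) y - P K y) x.
Proof.
have S0 : 0 <= S by apply: sumr_ge0 => j _; exact: fan_mag_ge0.
have kN : 0 <= kappa ^+ N by rewrite exprn_ge0 // ltW.
pose G := 12 * kappa ^+ N * h * S.
have G0 : 0 <= G by rewrite /G; apply: mulr_ge0 => //; apply: mulr_ge0; [exact: mulr_ge0|exact: ltW].
have -> : 4 * a + 24 * kappa ^+ N * S = 4 * a + 2 * G / h by rewrite /G; field; rewrite gt_eqF.
apply: (aff_sub (f := pz D M P (K i)) (m := K i) erefl) => //.
- exact: (pz_vertex pP i KM).
- exact: tri_vertex.
- exact: tri_vertex.
- move=> l; rewrite -(crd_grad l (P K)) -crdB; apply: le_trans (crd_le _ _) _.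
  apply: le_trans (gz_bound oD lip tM pP i KM) _.
  have h1 := fan_b_le lip tM sr P i KM.
  have h2 : 4 * kappa ^+ N * h * fan_mag M P (K i) K <= 4 * kappa ^+ N * h * S.
    by apply: ler_wpM2l (fan_mag_le M P K i); apply: mulr_ge0; [exact: mulr_ge0|exact: ltW].
  have -> : G = 3 * (4 * kappa ^+ N * h * S) by rewrite /G; ring.
  by apply: ler_wpM2l => //; exact: le_trans h2.
Qed.

Lemma companion_jet : jet h (Cjet * S) (fun y => F2 D M kappa P K y - P K y) x.
Proof.
have S0 : 0 <= S by apply: sumr_ge0 => j _; exact: fan_mag_ge0.
have aS : a <= S by exact: hmag_le_star.
have a0 : 0 <= a by exact: hmag_ge0.
have kN : 0 <= kappa ^+ N by rewrite exprn_ge0 // ltW.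
have s0 := Cstrip_ge0; have b0 := Cbump_ge0.
have w0 : 0 < w by exact: (strip_width_gt0 tM sr KM).
have w1 : w <= 1.
  have kk : 1 <= kappa ^+ (2 * N).+1 by exact: exprn_ege1.
  rewrite /w /strip_width -/N; move: (kappa ^+ _) kk => t kk; rewrite invf_le1; lra.
have q1 : 1 <= q by rewrite /q; have : 1 <= kappa ^+ (2 * N).+1 by [exact: exprn_ege1]; lra.
pose E i y := pE P K i y - P K y; pose Z i y := pz D M P (K i) y - P K y.
have cE i : cinf (E i) by apply: cinfB; [exact: cinf_aff|exact: cK].
have cZ i : cinf (Z i) by apply: cinfB; [exact: cinf_aff|exact: cK].
pose b i y := strip kappa (lam K i y); pose p i y := psi M kappa (K i) K y.
have cb i : cinf (b i) by exact: cinf_strip.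
have cp i : cinf (p i) by exact: cinf_bumpv.
pose Bs y := \sum_i b i y * E i y.
have cBs : cinf Bs by apply: (@cinf_sum _ _ _ _ _ (fun i y => b i y * E i y)) => i; exact: cinfM.
have jBs : jet h (3 * (4 * Cstrip * (4 * a))) Bs x.
  apply: (jet_sum3 (F := fun i y => b i y * E i y)) => i; first exact: cinfM.
  apply: (jetM h0 (cE i) (cb i) _ (jet_pE i)).
  exact: (cjet_strip i x dK (sr KM) erefl w0 w1 k1 hC1).
have e : (fun y => F2 D M kappa P K y - P K y) = fun y => Bs y + \sum_i p i y * (Z i y - Bs y).
  apply/funext => y; rewrite /F2 /F1 -/(Bs y).
  have -> : \sum_i psi M kappa (K i) K y * (pz D M P (K i) y - (P K y + Bs y)) = \sum_i p i y * (Z i y - Bs y).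
    by apply: eq_bigr => i _; rewrite /Z opprD addrA.
  have alg (r s t : R) : r + s + t - r = s + t by ring.
  exact: alg.
rewrite e.
have cT i : cinf (fun y => p i y * (Z i y - Bs y)) by apply: cinfM => //; exact: cinfB.
have jT : jet h (3 * (4 * Cbump * (4 * a + 24 * kappa ^+ N * S + 3 * (4 * Cstrip * (4 * a)))))
    (fun y => \sum_i p i y * (Z i y - Bs y)) x.
  apply: (jet_sum3 (F := fun i y => p i y * (Z i y - Bs y))) => i; first exact: cT.
  apply: (jetM h0 (cinfB (cZ i) cBs) (cp i) _ (jetB (cZ i) cBs (jet_pz i) jBs)).
  apply: (cjet_bumpv h0 _ _ q1 _ hC2); first exact: (rho_gt0 tM sr KM).
    exact: tri_diam Kx (tri_vertex _ dK).
  exact: (rho_ge lip tM sr KM).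
have cS : cinf (fun y => \sum_i p i y * (Z i y - Bs y)).
  by apply: (@cinf_sum _ _ _ _ _ (fun i y => p i y * (Z i y - Bs y))).
apply: (jet_le (ltW h0) _ (jetD cBs cS jBs jT)).
rewrite /Cjet.
have sa : Cstrip * a <= Cstrip * S by exact: ler_wpM2l.
have h1 : 3 * (4 * Cstrip * (4 * a)) <= 48 * Cstrip * S by lra.
have h2 : 4 * a + 24 * kappa ^+ N * S + 3 * (4 * Cstrip * (4 * a)) <= (4 + 24 * kappa ^+ N + 48 * Cstrip) * S by lra.
have h3 := ler_wpM2l b0 h2.
move: h1 h3; move: (3 * (4 * Cstrip * (4 * a))) => t h1.
move: (4 * a + _ + t) => v h3.
have -> : (48 * Cstrip + 12 * Cbump * (4 + 24 * kappa ^+ N + 48 * Cstrip)) * S =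
  48 * Cstrip * S + 12 * (Cbump * ((4 + 24 * kappa ^+ N + 48 * Cstrip) * S)) by ring.
apply: lerD h1 _; have -> : 3 * (4 * Cbump * v) = 12 * (Cbump * v) by ring.
by rewrite ler_pM2l.
Qed.

End CompanionJetBound.

(** * Summation over the mesh *)

Section CompanionSums.
Context {R : realType}.
Implicit Types (x y z v : R * R) (K L A : triangle R) (u w : R * R -> R) (D : set (R * R)) (M : mesh R).

Lemma sq_sum_le (I : Type) (s : seq I) (c : I -> R) :
  (\sum_(i <- s) c i) ^+ 2 <= (size s)%:R * \sum_(i <- s) c i ^+ 2.
Proof.
elim: s => [|i s IH]; first by rewrite !big_nil expr0n mulr0.
rewrite !big_cons /= -natr1.
have h : 2 * c i * \sum_(j <- s) c j <= (size s)%:R * c i ^+ 2 + \sum_(j <- s) c j ^+ 2.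
  elim: s {IH} => [|j s IH]; first by rewrite !big_nil mulr0 mul0r addr0.
  rewrite !big_cons /= -natr1; have := sqr_ge0 (c i - c j); nra.
move: IH h; move: (\sum_(j <- s) c j) (\sum_(j <- s) c j ^+ 2) (c i) (size s)%:R => S Q a n; nra.
Qed.

Lemma sq_sum_filter_le (I : Type) (s : seq I) (p : pred I) (c : I -> R) (n : nat) :
  (count p s <= n)%N -> (\sum_(i <- s | p i) c i) ^+ 2 <= n%:R * \sum_(i <- s | p i) c i ^+ 2.
Proof.
move=> h; have e (F : I -> R) : \sum_(i <- s | p i) F i = \sum_(i <- seq.filter p s) F i by rewrite big_filter.
rewrite !e; apply: le_trans (sq_sum_le _ _) _; rewrite size_filter.
by apply: ler_wpM2r; [apply: sumr_ge0 => i _; exact: sqr_ge0|rewrite ler_nat].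
Qed.

Lemma sq_sum3_le (c : 'I_3 -> R) : (\sum_i c i) ^+ 2 <= 3 * \sum_i c i ^+ 2.
Proof.
rewrite !sum3; move: (c 0) (c 1) (c o2) => p q r.
have := sqr_ge0 (p - q); have := sqr_ge0 (p - r); have := sqr_ge0 (q - r); nra.
Qed.

Section Mesh.
Variables (D : set (R * R)) (M : mesh R) (kappa : R).
Hypotheses (oD : open D) (bD : bounded_set D) (lip : lipschitz_boundary D) (tM : triangulation D M).
Hypothesis sr : forall K, K \in M -> shape_regular kappa K.
Variable P : triangle R -> R * R -> R.
Hypothesis k1 : 1 <= kappa.
Let N := nstar kappa.
Let k0 : 0 < kappa. Proof. exact: lt_le_trans k1. Qed.

Lemma fan_count z K : has_vertex z K -> (count (fun A => `[< fan M z K A >]) M <= N)%N.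
Proof.
move=> zK; apply: leq_trans (star_le_nstar lip tM sr z).
rewrite /star size_filter; apply: sub_count => A /asboolP; exact: fan_vertex zK.
Qed.

Lemma area_fan z K A : K \in M -> has_vertex z K -> fan M z K A ->
  area K <= kappa ^+ (2 * N).+2 * area A.
Proof.
move=> KM zK KA; have AM := fan_M KM KA.
have dK := mesh_det tM KM; have dA := mesh_det tM AM.
rewrite !areaE // mulrA ler_pM2r ?invr_gt0 //.
have h1 := fan_sym_diam lip tM sr KM zK KA.
have h2 := det_ge dA (sr AM); have h3 := det_le dK.
have h4 : diam (tri K) ^+ 2 <= (kappa ^+ N * diam (tri A)) ^+ 2.
  apply: lerXn2r h1; rewrite nnegrE; first exact: diam_ge0.
  by apply: mulr_ge0; [rewrite exprn_ge0 // ltW|exact: diam_ge0].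
apply: le_trans h3 _; apply: le_trans h4 _; rewrite exprMn.
have -> : kappa ^+ (2 * N).+2 * `|det A| = (kappa ^+ N) ^+ 2 * (kappa ^+ 2 * `|det A|).
  by rewrite -addn2 exprD mulrA -exprM mulnC.
by apply: ler_wpM2l => //; exact: sqr_ge0.
Qed.

Lemma star_mag_sq K : (star_mag M P K) ^+ 2 <= 3 * N%:R * \sum_i \sum_(A <- M | `[< fan M (K i) K A >]) hmag (P A) ^+ 2.
Proof.
apply: le_trans (sq_sum3_le _) _; rewrite -mulrA ler_pM2l // mulr_sumr; apply: ler_sum => i _.
by apply: sq_sum_filter_le; apply: fan_count; apply/has_vertexP; exists i.
Qed.

(** Double counting: if A is in a fan of K then K has a vertex of A. There are three such vertices
    with at most N triangles each, and every K counts A at most three times. *)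
Lemma fan_overlap (f : triangle R -> R) : (forall A, 0 <= f A) ->
  \sum_(K <- M) \sum_i \sum_(A <- M | `[< fan M (K i) K A >]) f A <= 9 * N%:R * \sum_(A <- M) f A.
Proof.
move=> f0.
have -> : \sum_(K <- M) \sum_i \sum_(A <- M | `[< fan M (K i) K A >]) f A =
    \sum_(A <- M) \sum_(K <- M) \sum_i (if `[< fan M (K i) K A >] then f A else 0).
  apply: esym; rewrite exchange_big /=; apply: eq_bigr => K _; rewrite exchange_big /=.
  by apply: eq_bigr => i _; rewrite -big_mkcond.
rewrite mulr_sumr; apply: ler_sum => A _.
have step K : \sum_i (if `[< fan M (K i) K A >] then f A else 0) <=
    \sum_(j < 3) (if has_vertex (A j) K then 3 * f A else 0).
  have fle (b : bool) : (if b then f A else 0) <= f A by case: b.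
  case: (pselect (exists i, fan M (K i) K A)) => [[i KA]|no].
    have vK : has_vertex (K i) K by apply/has_vertexP; exists i.
    have /has_vertexP[j e] := fan_vertex vK KA.
    rewrite (bigD1 (P := xpredT) (F := fun j => if has_vertex (A j) K then 3 * f A else 0) j) //= -e vK.
    have h0 : 0 <= \sum_(l < 3 | l != j) (if has_vertex (A l) K then 3 * f A else 0).
      by apply: sumr_ge0 => l _; case: ifP => // _; exact: mulr_ge0.
    rewrite sum3; have := fle `[< fan M (K 0) K A >]; have := fle `[< fan M (K 1) K A >].
    have := fle `[< fan M (K o2) K A >].
    move: (if _ then _ else _) (if _ then _ else _) (if _ then _ else _) h0 => p q r; lra.
  rewrite big1 => [|i _]; first by apply: sumr_ge0 => l _; case: ifP => // _; exact: mulr_ge0.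
  by case: asboolP => // KA; case: no; exists i.
apply: le_trans (ler_sum _ (fun K _ => step K)) _; rewrite exchange_big /=.
have -> : 9 * N%:R * f A = \sum_(j < 3) N%:R * (3 * f A).
  by rewrite sum3; ring.
apply: ler_sum => j _; rewrite -big_mkcond /= big_const_seq iter_addr addr0 -[_ *+ _]mulr_natl.
apply: ler_wpM2r; first exact: mulr_ge0.
by rewrite ler_nat -size_filter; exact: star_le_nstar lip tM sr _.
Qed.

(** The constant is 3 N from Cauchy-Schwarz over three fans, 9 N from their overlap, and the ratio
    of areas in a fan. *)
Lemma star_mag_sum : \sum_(K <- M) area K * star_mag M P K ^+ 2 <=
  27 * N%:R ^+ 2 * kappa ^+ (2 * N).+2 * \sum_(K <- M) area K * hmag (P K) ^+ 2.
Proof.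
pose f A := if A \in M then area A * hmag (P A) ^+ 2 else 0.
have f0 A : 0 <= f A.
  rewrite /f; case: ifP => // AM; apply: mulr_ge0; last exact: sqr_ge0.
  exact/ltW/area_gt0/(mesh_det tM).
have kN : 0 <= kappa ^+ (2 * N).+2 by rewrite exprn_ge0 // ltW.
have -> : \sum_(K <- M) area K * hmag (P K) ^+ 2 = \sum_(K <- M) f K.
  by apply: eq_big_seq => K KM; rewrite /f KM.
pose c : R := 3 * N%:R * kappa ^+ (2 * N).+2.
have N0 : 0 <= N%:R :> R by exact: ler0n.
have c0 : 0 <= c by rewrite /c; apply: mulr_ge0 => //; exact: mulr_ge0.
have h1 : \sum_(K <- M) area K * star_mag M P K ^+ 2 <=
    \sum_(K <- M) c * (\sum_i \sum_(A <- M | `[< fan M (K i) K A >]) f A).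
  apply: ler_sum_mem => K KM.
  have aK : 0 <= area K by exact/ltW/area_gt0/(mesh_det tM).
  apply: le_trans (ler_wpM2l aK (star_mag_sq K)) _.
  have -> : area K * (3 * N%:R * \sum_i \sum_(A <- M | `[< fan M (K i) K A >]) hmag (P A) ^+ 2) =
    3 * N%:R * \sum_i \sum_(A <- M | `[< fan M (K i) K A >]) area K * hmag (P A) ^+ 2.
    rewrite mulrCA; congr (_ * _); rewrite mulr_sumr; apply: eq_bigr => i _; by rewrite mulr_sumr.
  have ec (X : R) : c * X = 3 * N%:R * (kappa ^+ (2 * N).+2 * X) by rewrite /c mulrA.
  rewrite ec; apply: ler_wpM2l; first exact: mulr_ge0.
  rewrite mulr_sumr; apply: ler_sum => i _.
  rewrite mulr_sumr; apply: ler_sum => A /asboolP KA; have AM := fan_M KM KA.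
  have vK : has_vertex (K i) K by apply/has_vertexP; exists i.
  rewrite /f AM mulrA; apply: ler_wpM2r; first exact: sqr_ge0.
  exact: area_fan vK KA.
apply: le_trans h1 _; rewrite -mulr_sumr.
apply: le_trans (ler_wpM2l c0 (fan_overlap f0)) _.
by rewrite /c le_eqVlt; apply/orP; left; apply/eqP; ring.
Qed.

Lemma B_mesh (h : 'I_3 -> R * R -> R) : L2t D h ->
  B D h h = \sum_(K <- M) \sum_c wt c * ip (tri K)° (h c) (h c).
Proof.
move=> Lh; rewrite exchange_big; apply: eq_bigr => c _.
by rewrite (ip_mesh oD lip tM (Lh c) (Lh c)) mulr_sumr.
Qed.

Lemma B_pieces : pieces D M P ->
  B D (fun c => mesh_glue M (fun K => Hc c (P K))) (fun c => mesh_glue M (fun K => Hc c (P K))) =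
  \sum_(K <- M) area K * hmag (P K) ^+ 2.
Proof.
move=> [p1 _ _ _ _]; rewrite B_mesh; last first.
  by move=> c; apply: L2_glue => // K KM; apply: cinf_continuous; apply: cinf_Hc; exact/poly_cinf/p1.
apply: eq_big_seq => K KM; have mK := measurable_tri K.
have cP := poly_cinf (p1 K KM).
have cH c : continuous (Hc c (P K)) by apply: cinf_continuous; exact: cinf_Hc.
have L1c c : L1 (tri K)° (fun x => wt c * Hc c (P K) x ^+ 2).
  by apply: L1Z => //; apply: L2_L1sq; exact: tri_L2.
rewrite mulrC -Int_tri_cst (eq_Int (v := fun x => \sum_c wt c * Hc c (P K) x ^+ 2)); last first.
  by move=> x _; rewrite -(hmag_sq x (p1 K KM)); exact: hess2E.
rewrite Int_sum //; apply: eq_bigr => c _.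
rewrite IntZ //; last by apply: L2_L1sq; exact: tri_L2.
by congr (_ * _); rewrite ipE; apply: eq_Int => x ix; rewrite (glue_in lip tM _ KM ix) expr2.
Qed.

End Mesh.

Lemma eq_open_Hc (E : set (R * R)) u w x c : open E -> (forall y, E y -> u y = w y) -> E x ->
  Hc c u x = Hc c w x.
Proof.
move=> oE uw Ex.
have h1 j y : E y -> pd j u y = pd j w y by move=> Ey; rewrite !pdE; exact: eq_open_derive oE Ey uw.
have h2 i j : pd i (pd j u) x = pd i (pd j w) x.
  by rewrite [LHS]pdE [RHS]pdE; apply: eq_open_derive oE Ex _ => y; exact: h1.
by case: (ord3P c) => ->; rewrite ?Hc0 ?Hc1 ?Hc2; exact: h2.
Qed.

Lemma wt_sum_le (f : 'I_3 -> R) (a : R) : (forall c, f c <= a) -> \sum_c wt c * f c <= 4 * a.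
Proof.
move=> h; rewrite sum3 wt0 wt1 wt2 !mul1r; have := h 0; have := h 1; have := h o2.
by move: (f 0) (f 1) (f o2) => p q r; lra.
Qed.

Lemma jet_Hc h (A : R) u x c : jet h A u x -> `|Hc c u x| <= A.
Proof. by case=> _ _ j; case: (ord3P c) => ->; rewrite ?Hc0 ?Hc1 ?Hc2; exact: j. Qed.

(** The constant is fixed by kappa before domain and mesh are given. Bounded pointwise on each
    triangle, the differences are squared, integrated and summed; the factor 2 is the square root of
    the total weight of the Hessian entries. *)
Lemma companion_exists (kappa : R) : 1 <= kappa -> exists2 C : R, 0 <= C &
  forall D M, open D -> bounded_set D -> lipschitz_boundary D -> triangulation D M ->
  (forall K, K \in M -> shape_regular kappa K) ->
  forall P, pieces D M P -> let g := fun c => mesh_glue M (fun K => Hc c (P K)) in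
  exists J, [/\ test_function D J,
    forall c K, K \in M -> Int (tri K)° (Hc c J) = Int (tri K)° (g c),
    Bn D (subt (fun c => Hc c J) g) <= C * Bn D g &
    L2norm D (fun x => J x - mesh_glue M P x) <= C * meshsize M ^+ 2 * Bn D g].
Proof.
move=> k1; have [C1 C10 hC1] := @cut_bound R; have [C2 C20 hC2] := @pcut_bound R.
pose N := nstar kappa; pose C := Cjet kappa C1 C2.
have C0 : 0 <= C by exact: Cjet_ge0 k1 hC1 hC2.
pose E : R := Num.sqrt (27 * N%:R ^+ 2 * kappa ^+ (2 * N).+2).
have kN : 0 <= kappa ^+ (2 * N).+2 by rewrite exprn_ge0 // (le_trans _ k1).
have E2 : E ^+ 2 = 27 * N%:R ^+ 2 * kappa ^+ (2 * N).+2.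
  by rewrite sqr_sqrtr //; apply: mulr_ge0 => //; apply: mulr_ge0 => //; exact: sqr_ge0.
have E0 : 0 <= E by exact: sqrtr_ge0.
exists (2 * C * E); first by rewrite !mulr_ge0.
move=> D M oD bD lip tM sr P pP g; have [p1 _ _ _ _] := pP.
have mD : measurable (D : set (Pl R)) by exact: open_measurable2.
pose J := companion D M kappa P; exists J.
have tJ : test_function D J by exact: (companion_test oD lip tM sr pP).
have cJ := test_cinf tJ.
have Lg c : L2 D (g c).
  by apply: L2_glue => // K KM; apply: cinf_continuous; apply: cinf_Hc; exact/poly_cinf/p1.
have LJ c : L2 D (Hc c J) by apply: test_L2 => //; exact: Dclassical_test tJ.
have JE K x : K \in M -> (tri K)° x -> J x = F2 D M kappa P K x by move=> KM ix; exact: (companion_in kappa tM P KM ix).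
have JH c K x : K \in M -> (tri K)° x -> Hc c J x = Hc c (F2 D M kappa P K) x.
  move=> KM ix; apply: (@eq_open_Hc (tri K)°) => //; [exact: open_interior|by move=> y iy; exact: JE].
have dH c K x : K \in M -> (tri K)° x -> Hc c J x - g c x = Hc c (fun y => F2 D M kappa P K y - P K y) x.
  move=> KM ix; rewrite (JH c K x KM ix) /g (glue_in lip tM _ KM ix).
  by rewrite (HcB c (cinf_F2 kappa pP KM) (poly_cinf (p1 K KM))).
have jb K x : K \in M -> (tri K)° x ->
    jet (diam (tri K)) (C * star_mag M P K) (fun y => F2 D M kappa P K y - P K y) x.
  move=> KM ix; apply: (companion_jet k1 hC1 hC2 oD lip tM sr pP KM); exact: interior_subset ix.
have S0 K : 0 <= star_mag M P K by apply: sumr_ge0 => j _; exact: fan_mag_ge0.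
have sumS : \sum_(K <- M) area K * (C * star_mag M P K) ^+ 2 <= (C * E) ^+ 2 * Bn D g ^+ 2.
  rewrite Bn_sq (B_pieces oD bD lip tM pP) exprMn E2.
  have -> : \sum_(K <- M) area K * (C * star_mag M P K) ^+ 2 = C ^+ 2 * \sum_(K <- M) area K * star_mag M P K ^+ 2.
    by rewrite mulr_sumr; apply: eq_bigr => K _; rewrite exprMn mulrCA.
  have cE (X : R) : C ^+ 2 * (27 * N%:R ^+ 2 * kappa ^+ (2 * N).+2) * X = C ^+ 2 * (27 * N%:R ^+ 2 * kappa ^+ (2 * N).+2 * X) by rewrite -!mulrA.
  by rewrite cE; apply: ler_wpM2l; [exact: sqr_ge0|exact: (star_mag_sum lip tM sr)].
have Ls c : L2 D (subt (fun c => Hc c J) g c) by exact: L2B.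
have CE : 0 <= C * E * Bn D g by rewrite !mulr_ge0 ?Bn_ge0.
have sqK K (u : R * R -> R) (k : R) : 0 <= k -> L2 (tri K)° u -> (forall x, (tri K)° x -> `|u x| <= k) ->
    ip (tri K)° u u <= area K * k ^+ 2.
  move=> k0 Lu hu; rewrite mulrC -Int_tri_cst ipE; apply: le_Int.
  - exact: measurable_tri.
  - exact: (L2_mul (measurable_tri K) Lu Lu).
  - by apply: tri_L1; exact: cst_continuous.
  - move=> x ix; rewrite -expr2 -(real_normK (num_real (u x))); apply: lerXn2r; rewrite ?nnegrE //; exact: hu.
have sqle (a b : R) : 0 <= b -> a ^+ 2 <= b ^+ 2 -> a <= b.
  move=> b0; apply: contraTT; rewrite -!ltNge => ba; apply: ltrXn2r => //.
split => //.
- move=> c K KM; apply/eqP; rewrite -subr_eq0; apply/eqP.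
  have L1K u : L2 D u -> L1 (tri K)° u.
    move=> Lu; apply: L2_L1; [exact: measurable_tri|exact: fin_tri|exact: (L2K oD lip tM KM Lu)].
  rewrite -IntB; [|exact: measurable_tri|exact: L1K|exact: L1K].
  rewrite (eq_Int (v := Hc c (fun y => F2 D M kappa P K y - P K y))); last by move=> x; exact: dH.
  exact: Int_Hc_F2.
- have -> : 2 * C * E * Bn D g = 2 * (C * E * Bn D g) by ring.
  apply: sqle; first exact: mulr_ge0.
  rewrite Bn_sq (B_mesh oD lip tM Ls).
  have h4 : 4 * (\sum_(K <- M) area K * (C * star_mag M P K) ^+ 2) <= (2 * (C * E * Bn D g)) ^+ 2.
    have -> : (2 * (C * E * Bn D g)) ^+ 2 = 4 * ((C * E) ^+ 2 * Bn D g ^+ 2) by ring.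
    by rewrite ler_pM2l.
  apply: le_trans h4; rewrite mulr_sumr; apply: ler_sum_mem => K KM.
  have h c : ip (tri K)° (subt (fun c => Hc c J) g c) (subt (fun c => Hc c J) g c) <= area K * (C * star_mag M P K) ^+ 2.
    apply: sqK; [exact: mulr_ge0|exact: (L2K oD lip tM KM (Ls c))|move=> x ix].
    by rewrite /subt (dH c K x KM ix); apply: jet_Hc; exact: jb.
  exact: wt_sum_le h.
- set m := meshsize M; have m0 : 0 <= m by exact: meshsize_ge0.
  have h2 : m ^+ 2 * (C * E * Bn D g) <= 2 * C * E * m ^+ 2 * Bn D g.
    have h0 : 0 <= m ^+ 2 * (C * E * Bn D g) by apply: mulr_ge0 => //; exact: sqr_ge0.
    have -> : 2 * C * E * m ^+ 2 * Bn D g = 2 * (m ^+ 2 * (C * E * Bn D g)) by ring.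
    by rewrite ler_peMl //; lra.
  apply: le_trans h2.
  have LP : L2 D (mesh_glue M P) by apply: L2_glue => // K KM; apply: cinf_continuous; exact/poly_cinf/p1.
  have Ld : L2 D (fun x => J x - mesh_glue M P x) by apply: L2B => //; exact: test_L2 tJ.
  apply: sqle; first by apply: mulr_ge0 => //; exact: sqr_ge0.
  rewrite L2norm_sq (ip_mesh oD lip tM Ld Ld).
  have h4 : (m ^+ 2) ^+ 2 * (\sum_(K <- M) area K * (C * star_mag M P K) ^+ 2) <= (m ^+ 2 * (C * E * Bn D g)) ^+ 2.
    have -> : (m ^+ 2 * (C * E * Bn D g)) ^+ 2 = (m ^+ 2) ^+ 2 * ((C * E) ^+ 2 * Bn D g ^+ 2) by ring.
    by apply: ler_wpM2l => //; exact: sqr_ge0.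
  apply: le_trans h4; rewrite mulr_sumr; apply: ler_sum_mem => K KM.
  have hm : diam (tri K) ^+ 2 <= m ^+ 2.
    by apply: lerXn2r (diam_le_meshsize KM); rewrite nnegrE //; exact: diam_ge0.
  have CS : 0 <= C * star_mag M P K by exact: mulr_ge0.
  rewrite mulrCA -exprMn; apply: sqK; [by rewrite mulr_ge0 ?sqr_ge0|exact: (L2K oD lip tM KM Ld)|move=> x ix].
  rewrite (JE K x KM ix) (glue_in lip tM _ KM ix); have [j _ _] := jb K x KM ix.
  by apply: le_trans j _; rewrite mulrC; apply: ler_wpM2r.
Qed.

End CompanionSums.

(** * Error estimates *)

Section ErrorEstimates.
Context {R : realType}.
Implicit Types (x y z v : R * R) (K L A : triangle R).

(** Removes the approximation error e after an estimate is shown for test functions within e of the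
    solution. *)
Lemma le_limit (G : R -> R) (X : R) : continuous G -> (forall e, 0 < e -> X <= G e) -> X <= G 0.
Proof.
move=> cG h; rewrite leNgt; apply/negP => lt.
have : \forall t \near (0 : R), G t < X by have := cG 0 [set t | t < X]; apply; exact: lt_nbhsl.
case/nbhs_ballP => e /= e0 he.
have := he (e / 2); rewrite /ball /= sub0r normrN gtr0_norm ?divr_gt0 // => /(_ ltac:(by lra)).
by rewrite ltNge h ?divr_gt0.
Qed.

Lemma norm7 (a1 a2 a3 a4 a5 a6 a7 b1 b2 b3 b4 b5 b6 b7 : R) :
  `|a1| <= b1 -> `|a2| <= b2 -> `|a3| <= b3 -> `|a4| <= b4 -> `|a5| <= b5 -> `|a6| <= b6 -> `|a7| <= b7 ->
  `|a1 + a2 - a3 + a4 - a5 - a6 + a7| <= b1 + b2 + b3 + b4 + b5 + b6 + b7.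
Proof.
rewrite !ler_norml => /andP[? ?] /andP[? ?] /andP[? ?] /andP[? ?] /andP[? ?] /andP[? ?] /andP[? ?].
by apply/andP; split; lra.
Qed.

Definition pwhess (M : mesh R) (P : triangle R -> R * R -> R) : 'I_3 -> R * R -> R :=
  fun c => mesh_glue M (fun K => Hc c (P K)).

Definition hessian_osc (D : set (R * R)) (M : mesh R) (h : 'I_3 -> R * R -> R) : R :=
  Bn D (subt h (fun c => P0 M (h c))).

Variables (D : set (R * R)) (M : mesh R).
Hypotheses (oD : open D) (bD : bounded_set D) (lip : lipschitz_boundary D) (tM : triangulation D M).
Let mD : measurable (D : set (Pl R)). Proof. exact: open_measurable2. Qed.

Lemma mesh_glueB P Q : mesh_glue M (fun K x => P K x - Q K x) = fun x => mesh_glue M P x - mesh_glue M Q x.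
Proof. by apply/funext => x; rewrite /mesh_glue -sumrB; apply: eq_bigr => K _; rewrite mulrBl. Qed.

Lemma pwhessB P Q : pieces D M P -> pieces D M Q ->
  pwhess M (fun K x => P K x - Q K x) = subt (pwhess M P) (pwhess M Q).
Proof.
move=> [p1 _ _ _ _] [q1 _ _ _ _]; apply/funext => c; apply/funext => x.
rewrite /pwhess /subt /mesh_glue -sumrB; apply: eq_big_seq => K KM.
by rewrite (HcB c (poly_cinf (p1 K KM)) (poly_cinf (q1 K KM))) mulrBl.
Qed.

Lemma L2t_pwhess P : pieces D M P -> L2t D (pwhess M P).
Proof.
move=> [p1 _ _ _ _] c; apply: L2_glue => // K KM.
by apply: cinf_continuous; apply: cinf_Hc; exact/poly_cinf/p1.
Qed.

Lemma L2_glue_pieces P : pieces D M P -> L2 D (mesh_glue M P).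
Proof. by move=> [p1 _ _ _ _]; apply: L2_glue => // K KM; apply: cinf_continuous; exact/poly_cinf/p1. Qed.

Lemma pwhess_interp p : pwhess M (interp p) = fun c => P0 M (Hc c p).
Proof.
apply/funext => c; rewrite /pwhess /P0; congr mesh_glue; apply/funext => K.
exact: nodal_Hc.
Qed.

Lemma L2t_P0 h : L2t D (fun c => P0 M (h c)). Proof. by move=> c; exact: L2_P0. Qed.

Lemma L2t_test p : test_function D p -> L2t D (fun c => Hc c p).
Proof. by move=> tp c; apply: test_L2 => //; exact: Dclassical_test tp. Qed.

Lemma B_P0 g k : L2t D g -> L2t D k -> (forall c, pwc M (k c)) -> B D (fun c => P0 M (g c)) k = B D g k.
Proof. by move=> Lg Lk pk; apply: eq_bigr => c _; congr (_ * _); apply: ip_P0. Qed.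

Lemma B_pwc g l k : L2t D g -> L2t D l -> L2t D k -> (forall c, pwc M (k c)) ->
  (forall c K, K \in M -> Int (tri K)° (g c) = Int (tri K)° (l c)) -> B D g k = B D l k.
Proof. by move=> Lg Ll Lk pk h; apply: eq_bigr => c _; congr (_ * _); apply: (ip_pwc oD lip tM) => //; exact: h. Qed.

Lemma Bn_subC g k : Bn D (subt g k) = Bn D (subt k g).
Proof.
rewrite /Bn /B; congr Num.sqrt; apply: eq_bigr => c _; congr (_ * _); apply: eq_Int => x _.
by rewrite /subt; ring.
Qed.

Lemma Bn_tri g k l : L2t D g -> L2t D k -> L2t D l ->
  Bn D (subt g l) <= Bn D (subt g k) + Bn D (subt k l).
Proof.
move=> Lg Lk Ll; have := Bn_sub oD (L2t_sub oD Lg Lk) (L2t_sub oD Ll Lk).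
rewrite (Bn_subC l k); congr (_ <= _); rewrite /Bn /B; congr Num.sqrt.
by apply: eq_bigr => c _; congr (_ * _); apply: eq_Int => x _; rewrite /subt; ring.
Qed.

Lemma Bn_le_add g k : L2t D g -> L2t D k -> Bn D k <= Bn D g + Bn D (subt g k).
Proof.
move=> Lg Lk; have := Bn_sub oD Lg (L2t_sub oD Lg Lk); congr (_ <= _); rewrite /Bn /B; congr Num.sqrt.
by apply: eq_bigr => c _; congr (_ * _); apply: eq_Int => x _; rewrite /subt; ring.
Qed.

Lemma B_sub_P0 h k : L2t D h -> L2t D k -> (forall c, pwc M (k c)) ->
  B D (subt h (fun c => P0 M (h c))) k = 0.
Proof.
move=> Lh Lk pk; rewrite (BBl oD Lh (L2t_P0 h) Lk) (B_P0 Lh Lk pk).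
exact: subrr.
Qed.

Lemma le_of_sq (X Y : R) : 0 <= Y -> X ^+ 2 <= X * Y -> X <= Y.
Proof.
move=> Y0 h; case: (leP X 0) => X0; first exact: le_trans X0 Y0.
by rewrite -(ler_pM2l X0) -expr2.
Qed.

Let pP0 (h : 'I_3 -> R * R -> R) c : pwc M (P0 M (h c)). Proof. exact: (pwc_P0 lip tM). Qed.

(** The piecewise mean is the orthogonal projection onto piecewise constants, hence the best
    approximation. *)
Lemma osc_best h k : L2t D h -> L2t D k -> hessian_osc D M h <= Bn D (subt h (fun c => P0 M (k c))).
Proof.
move=> Lh Lk; rewrite /hessian_osc; set a := subt h _.
have La : L2t D a := L2t_sub oD Lh (L2t_P0 h).
have o1 : B D a (fun c => P0 M (h c)) = 0 := B_sub_P0 Lh (L2t_P0 h) (pP0 h).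
have o2 : B D a (fun c => P0 M (k c)) = 0 := B_sub_P0 Lh (L2t_P0 k) (pP0 k).
apply: le_of_sq; first exact: Bn_ge0.
have e : Bn D a ^+ 2 = B D a (subt h (fun c => P0 M (k c))).
  by rewrite Bn_sq (BBr oD Lh (L2t_P0 k) La) {2}/a (BBr oD Lh (L2t_P0 h) La) o1 o2.
rewrite e; apply: le_trans (ler_norm _) _; exact: (B_le oD La (L2t_sub oD Lh (L2t_P0 k))).
Qed.

Lemma Bn_P0 h : L2t D h -> Bn D (fun c => P0 M (h c)) <= Bn D h.
Proof.
move=> Lh; apply: le_of_sq; first exact: Bn_ge0.
rewrite Bn_sq (B_P0 Lh (L2t_P0 h) (pP0 h)) mulrC; apply: le_trans (ler_norm _) _.
exact: (B_le oD Lh (L2t_P0 h)).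
Qed.

Lemma ip_le g k : L2 D g -> L2 D k -> `|ip D g k| <= L2norm D g * L2norm D k.
Proof. by move=> Lg Lk; exact: (ip_norm_le mD). Qed.

Lemma osc_test h p e : L2t D h -> test_function D p -> Bn D (subt h (fun c => Hc c p)) <= e ->
  hessian_osc D M (fun c => Hc c p) <= hessian_osc D M h + e /\
  Bn D (subt h (fun c => P0 M (Hc c p))) <= hessian_osc D M h + 2 * e.
Proof.
move=> Lh tp he; have Lp := L2t_test tp.
have h1 : hessian_osc D M (fun c => Hc c p) <= hessian_osc D M h + e.
  apply: le_trans (osc_best Lp Lh) _; apply: le_trans (Bn_tri Lp Lh (L2t_P0 h)) _.
  by rewrite Bn_subC addrC lerD2l.
split => //; apply: le_trans (Bn_tri Lh Lp (L2t_P0 _)) _; apply: le_trans (lerD he h1) _.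
by rewrite le_eqVlt; apply/orP; left; apply/eqP; ring.
Qed.

Section Solution.
Variables (f u : R * R -> R) (hu : 'I_3 -> R * R -> R).
Hypotheses (Lf : L2 D f) (Lu : L2 D u) (Lhu : L2t D hu).
Hypothesis app_u : forall e, 0 < e -> exists p, [/\ test_function D p,
  L2norm D (fun x => u x - p x) <= e & Bn D (subt hu (fun c => Hc c p)) <= e].
Hypothesis eq_u : forall p, test_function D p -> B D hu (fun c => Hc c p) = ip D f p.

Variable Ph : triangle R -> R * R -> R.
Hypothesis pPh : pieces D M Ph.
Hypothesis eq_h : forall Q, pieces D M Q -> B D (pwhess M Ph) (pwhess M Q) = ip D f (mesh_glue M Q).

Variable C : R.
Hypothesis C0 : 0 <= C.
Hypothesis comp : forall P, pieces D M P -> exists J, [/\ test_function D J,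
    forall c K, K \in M -> Int (tri K)° (Hc c J) = Int (tri K)° (pwhess M P c),
    Bn D (subt (fun c => Hc c J) (pwhess M P)) <= C * Bn D (pwhess M P) &
    L2norm D (fun x => J x - mesh_glue M P x) <= C * meshsize M ^+ 2 * Bn D (pwhess M P)].

Let m := meshsize M.
Let F := L2norm D f.
Let sig := hessian_osc D M hu.
Let err p := fun K x => interp p K x - Ph K x.

Lemma err_pieces p : test_function D p -> pieces D M (err p).
Proof. by move=> tp; apply: piecesB => //; exact: (interp_pieces oD lip tM tp). Qed.

Lemma err_hess p : test_function D p ->
  pwhess M (err p) = subt (fun c => P0 M (Hc c p)) (pwhess M Ph).
Proof.
by move=> tp; rewrite (pwhessB (interp_pieces oD lip tM tp) pPh) pwhess_interp.
Qed.

(** The discrete error is measured against the interpolant of p, which is a Morley function; trading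
    the Hessian of p for that of u costs 2 e. The identity below bounds E^2 by a multiple of E,
    which is then cancelled. *)
Lemma err_bound p e : test_function D p -> Bn D (subt hu (fun c => Hc c p)) <= e ->
  Bn D (pwhess M (err p)) <= (1 + C) * (sig + 2 * e) + C * m ^+ 2 * F.
Proof.
move=> tp he; have pe := err_pieces tp; have [J [tJ IJ h1 h2]] := comp pe.
set E := Bn D (pwhess M (err p)) in h1 h2 *; have E0 : 0 <= E by exact: Bn_ge0.
have Lp := L2t_test tp; have LJ := L2t_test tJ; have Le := L2t_pwhess pe; have Lh := L2t_pwhess pPh.
have Lw := L2t_P0 (fun c => Hc c p).
have [_ s2] := osc_test Lhu tp he; rewrite -/sig in s2.
have F0 : 0 <= F by exact: L2norm_ge0.
have m2 : 0 <= m ^+ 2 by exact: sqr_ge0.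
have key : E ^+ 2 = ip D f (fun x => J x - mesh_glue M (err p) x) -
    B D (subt hu (fun c => P0 M (Hc c p))) (fun c => Hc c J).
  have q1 : E ^+ 2 = B D (fun c => P0 M (Hc c p)) (pwhess M (err p)) - ip D f (mesh_glue M (err p)).
    by rewrite /E Bn_sq -(eq_h pe) -(BBl oD Lw Lh Le) -(err_hess tp).
  have q2 : B D (fun c => P0 M (Hc c p)) (pwhess M (err p)) = B D (fun c => P0 M (Hc c p)) (fun c => Hc c J).
    rewrite BC [RHS]BC; apply: (B_pwc Le LJ Lw (pP0 _)) => c K KM; exact/esym/IJ.
  rewrite q1 q2 (BBl oD Lhu Lw LJ) (eq_u tJ) (ipBr mD _ _ _) //; [ring|exact: test_L2 tJ|exact: L2_glue_pieces].
have b1 := ip_le Lf (L2B mD (test_L2 mD tJ) (L2_glue_pieces pe)).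
have b2 := B_le oD (L2t_sub oD Lhu Lw) LJ.
have b3 : Bn D (fun c => Hc c J) <= (1 + C) * E.
  have h3 := Bn_le_add Le LJ; rewrite Bn_subC in h3; apply: le_trans h3 _.
  apply: le_trans (lerD (lexx E) h1) _.
  by rewrite le_eqVlt; apply/orP; left; apply/eqP; ring.
have s0 : 0 <= sig + 2 * e by apply: le_trans s2; exact: Bn_ge0.
have b4 : Bn D (subt hu (fun c => P0 M (Hc c p))) * Bn D (fun c => Hc c J) <= (sig + 2 * e) * ((1 + C) * E).
  by apply: ler_pM => //; exact: Bn_ge0.
have b5 : F * L2norm D (fun x => J x - mesh_glue M (err p) x) <= F * (C * m ^+ 2 * E).
  by apply: ler_wpM2l.
apply: le_of_sq.
  by apply: addr_ge0; [apply: mulr_ge0 => //; exact: addr_ge0|apply: mulr_ge0 => //; exact: mulr_ge0].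
have c1 := le_trans (ler_norm _) (le_trans b1 b5).
have c2 : - B D (subt hu (fun c => P0 M (Hc c p))) (fun c => Hc c J) <= (sig + 2 * e) * ((1 + C) * E).
  by apply: le_trans b4; apply: le_trans b2; rewrite -normrN; exact: ler_norm.
rewrite key; apply: le_trans (lerD c1 c2) _.
by rewrite le_eqVlt; apply/orP; left; apply/eqP; ring.
Qed.

Theorem energy_error : Bn D (subt hu (pwhess M Ph)) <= (2 + C) * sig + C * m ^+ 2 * F.
Proof.
pose G (e : R) := (2 + C) * (sig + 2 * e) + C * m ^+ 2 * F.
have -> : (2 + C) * sig + C * m ^+ 2 * F = G 0 by rewrite /G mulr0 addr0.
apply: le_limit.
  apply: cinf_continuous; apply: cinfD; last exact: cinf_cst.
  by apply: cinfZ; apply: cinfD; [exact: cinf_cst|apply: cinfZ; exact: cinf_id].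
move=> e e0; have [p [tp _ he]] := app_u e0.
have Lw := L2t_P0 (fun c => Hc c p); have Lh := L2t_pwhess pPh.
apply: le_trans (Bn_tri Lhu Lw Lh) _; have [_ s2] := osc_test Lhu tp he.
have := err_bound tp he; rewrite (err_hess tp) /G -/sig; move: s2; rewrite -/sig.
move: (Bn _ _) (Bn _ _) => a b a1 b1; apply: le_trans (lerD a1 b1) _.
by rewrite le_eqVlt; apply/orP; left; apply/eqP; ring.
Qed.

Variables (phi xi : R * R -> R) (hxi : 'I_3 -> R * R -> R).
Hypotheses (Lphi : L2 D phi) (Lhxi : L2t D hxi).
Hypothesis app_xi : forall e, 0 < e -> exists q, test_function D q /\ Bn D (subt hxi (fun c => Hc c q)) <= e.
Hypothesis eq_xi : forall p, test_function D p -> B D hxi (fun c => Hc c p) = ip D phi p.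

Let Phi := L2norm D phi.
Let sigx := hessian_osc D M hxi.

Lemma functional_error_test p q e : 0 < e -> test_function D p -> test_function D q ->
  L2norm D (fun x => u x - p x) <= e -> Bn D (subt hu (fun c => Hc c p)) <= e ->
  Bn D (subt hxi (fun c => Hc c q)) <= e ->
  `|ip D phi u - ip D phi (mesh_glue M Ph)| <=
  Phi * e + Phi * (2 * m ^+ 2 * (sig + e)) + Phi * (C * m ^+ 2 * ((1 + C) * (sig + 2 * e) + C * m ^+ 2 * F)) +
  (sigx + 2 * e) * ((1 + C) * ((1 + C) * (sig + 2 * e) + C * m ^+ 2 * F)) +
  (Bn D hxi + e) * e + (sig + 2 * e) * (sigx + e) + F * (2 * m ^+ 2 * (sigx + e)).
Proof.
move=> e0 tp tq ue he xe.
have pe := err_pieces tp; have [J [tJ IJ h1 h2]] := comp pe.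
have EB := err_bound tp he.
set E := Bn D (pwhess M (err p)) in h1 h2 EB; have E0 : 0 <= E by exact: Bn_ge0.
set Ee := _ + _ * F in EB; rewrite -/Ee.
have Lp := L2t_test tp; have Lq := L2t_test tq; have LJ := L2t_test tJ.
have Le := L2t_pwhess pe; have Lh := L2t_pwhess pPh.
pose hp : 'I_3 -> R * R -> R := fun c => Hc c p; pose hq : 'I_3 -> R * R -> R := fun c => Hc c q.
pose hJ : 'I_3 -> R * R -> R := fun c => Hc c J.
pose hw : 'I_3 -> R * R -> R := fun c => P0 M (hp c); pose hz : 'I_3 -> R * R -> R := fun c => P0 M (hq c).
have Lw : L2t D hw := L2t_P0 hp; have Lz : L2t D hz := L2t_P0 hq.
have [s1 s2] := osc_test Lhu tp he; have [x1 x2] := osc_test Lhxi tq xe.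
rewrite -/sig in s1 s2; rewrite -/sigx in x1 x2.
have F0 : 0 <= F by exact: L2norm_ge0.
have Phi0 : 0 <= Phi by exact: L2norm_ge0.
have m2 : 0 <= m ^+ 2 by exact: sqr_ge0.
have pIp := interp_pieces oD lip tM tp; have pIq := interp_pieces oD lip tM tq.
have tLp := test_L2 mD tp; have tLq := test_L2 mD tq; have tLJ := test_L2 mD tJ.
have gIp := L2_glue_pieces pIp; have gIq := L2_glue_pieces pIq.
have gPh := L2_glue_pieces pPh; have ge := L2_glue_pieces pe.
pose a1 := ip D phi (fun x => u x - p x).
pose a2 := ip D phi (fun x => p x - mesh_glue M (interp p) x).
pose a3 := ip D phi (fun x => J x - mesh_glue M (err p) x).
pose a4 := B D (subt hxi hz) hJ.
pose a5 := B D hz (subt hu hp).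
pose a6 := B D (subt hu hw) (subt hq hz).
pose a7 := ip D f (fun x => q x - mesh_glue M (interp q) x).
(* The terms a1 and a5 are of order e and disappear in the limit; a2 and a7 are interpolation errors
   of p and q; a3 and a4 come from the companion standing in for the discrete error; a6 is a product
   of two oscillations. *)
have key : ip D phi u - ip D phi (mesh_glue M Ph) = a1 + a2 - a3 + a4 - a5 - a6 + a7.
  have eg : ip D phi (mesh_glue M (err p)) = ip D phi (mesh_glue M (interp p)) - ip D phi (mesh_glue M Ph).
    by rewrite /err mesh_glueB (ipBr mD gIp gPh Lphi).
  have d1 : a1 = ip D phi u - ip D phi p := ipBr mD Lu tLp Lphi.
  have d2 : a2 = ip D phi p - ip D phi (mesh_glue M (interp p)) := ipBr mD tLp gIp Lphi.
  have d3 : a3 = ip D phi J - ip D phi (mesh_glue M (err p)) := ipBr mD tLJ ge Lphi.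
  have d4 : a4 = B D hxi hJ - B D hz hJ := BBl oD Lhxi Lz LJ.
  have d5 : a5 = B D hz hu - B D hz hp := BBr oD Lhu Lp Lz.
  have d6 : a6 = B D hu (subt hq hz) - B D hw (subt hq hz) := BBl oD Lhu Lw (L2t_sub oD Lq Lz).
  have d6' : B D hu (subt hq hz) = B D hu hq - B D hu hz := BBr oD Lq Lz Lhu.
  have d6'' : B D hw (subt hq hz) = 0.
    by rewrite BC; exact: (B_sub_P0 Lq Lw (pP0 hp)).
  have d7 : a7 = ip D f q - ip D f (mesh_glue M (interp q)) := ipBr mD tLq gIq Lf.
  have e1 : B D hxi hJ = ip D phi J := eq_xi tJ.
  have e2 : B D hz hJ = B D hz (pwhess M (err p)).
    rewrite BC [RHS]BC; apply/esym; apply: (B_pwc Le LJ Lz (pP0 hq)) => c K KM; exact/esym/IJ.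
  have e3 : B D hz (pwhess M (err p)) = B D hz hw - B D hz (pwhess M Ph).
    by rewrite (err_hess tp); exact: (BBr oD Lw Lh Lz).
  have e4 : B D hz (pwhess M Ph) = ip D f (mesh_glue M (interp q)).
    by rewrite BC -(eq_h pIq) pwhess_interp.
  have e5 : B D hu hq = ip D f q := eq_u tq.
  have e6 : B D hz hw = B D hz hp.
    by rewrite BC [RHS]BC; exact: (B_P0 Lp Lz (pP0 hq)).
  have e7 : B D hu hz = B D hz hu by rewrite BC.
  clear -d1 d2 d3 d4 d5 d6 d6' d6'' d7 e1 e2 e3 e4 e5 e6 e7 eg.
  rewrite d1 d2 d3 d4 d5 d6 d6' d6'' d7 e1 e2 e3 e4 e5 e6 e7 eg.
  move: (ip D phi u) (ip D phi p) (ip D phi _) (ip D phi _) (ip D phi _) (ip D f _) (ip D f _) (B _ _ _) (B _ _ _).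
  by move=> *; ring.
have nle (t s : R) : `|t| <= s -> t <= s by exact: le_trans (ler_norm _).
have I2 t : test_function D t -> L2norm D (fun x => t x - mesh_glue M (interp t) x) <=
    2 * m ^+ 2 * hessian_osc D M (fun c => Hc c t) by move=> tt; exact: (interp_L2 oD bD lip tM tt).
have b1 : `|a1| <= Phi * e.
  by apply: le_trans (ip_le Lphi (L2B mD Lu tLp)) _; exact: ler_wpM2l.
have b2 : `|a2| <= Phi * (2 * m ^+ 2 * (sig + e)).
  apply: le_trans (ip_le Lphi (L2B mD tLp gIp)) _; apply: ler_wpM2l => //.
  by apply: le_trans (I2 p tp) _; apply: ler_wpM2l s1; exact: mulr_ge0.
have b3 : `|a3| <= Phi * (C * m ^+ 2 * Ee).
  apply: le_trans (ip_le Lphi (L2B mD tLJ ge)) _; apply: ler_wpM2l => //.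
  by apply: le_trans h2 _; apply: ler_wpM2l EB; exact: mulr_ge0.
have bJ : Bn D hJ <= (1 + C) * Ee.
  have h3 := Bn_le_add Le LJ; rewrite Bn_subC in h3; apply: le_trans h3 _.
  apply: le_trans (lerD (lexx E) h1) _.
  have -> : E + C * E = (1 + C) * E by ring.
  by apply: ler_wpM2l EB; exact: addr_ge0.
have b4 : `|a4| <= (sigx + 2 * e) * ((1 + C) * Ee).
  by apply: le_trans (B_le oD (L2t_sub oD Lhxi Lz) LJ) _; exact: (ler_pM (Bn_ge0 _ _) (Bn_ge0 _ _) x2 bJ).
have bz : Bn D hz <= Bn D hxi + e.
  apply: le_trans (Bn_P0 Lq) _; apply: le_trans (Bn_le_add Lhxi Lq) _; by rewrite lerD2l.
have b5 : `|a5| <= (Bn D hxi + e) * e.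
  by apply: le_trans (B_le oD Lz (L2t_sub oD Lhu Lp)) _; exact: (ler_pM (Bn_ge0 _ _) (Bn_ge0 _ _) bz he).
have b6 : `|a6| <= (sig + 2 * e) * (sigx + e).
  apply: le_trans (B_le oD (L2t_sub oD Lhu Lw) (L2t_sub oD Lq Lz)) _.
  exact: (ler_pM (Bn_ge0 _ _) (Bn_ge0 _ _) s2 x1).
have b7 : `|a7| <= F * (2 * m ^+ 2 * (sigx + e)).
  apply: le_trans (ip_le Lf (L2B mD tLq gIq)) _; apply: ler_wpM2l => //.
  have m20 : 0 <= 2 * m ^+ 2 by exact: mulr_ge0.
  exact: le_trans (I2 q tq) (ler_wpM2l m20 x1).
rewrite key; clear -b1 b2 b3 b4 b5 b6 b7.
exact: (norm7 b1 b2 b3 b4 b5 b6 b7).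
Qed.

Theorem functional_error :
  `|ip D phi u - ip D phi (mesh_glue M Ph)| <=
  Phi * (2 * m ^+ 2 * sig) + Phi * (C * m ^+ 2 * ((1 + C) * sig + C * m ^+ 2 * F)) +
  sigx * ((1 + C) * ((1 + C) * sig + C * m ^+ 2 * F)) + sig * sigx + F * (2 * m ^+ 2 * sigx).
Proof.
pose G (e : R) := Phi * e + Phi * (2 * m ^+ 2 * (sig + e)) + Phi * (C * m ^+ 2 * ((1 + C) * (sig + 2 * e) + C * m ^+ 2 * F)) +
  (sigx + 2 * e) * ((1 + C) * ((1 + C) * (sig + 2 * e) + C * m ^+ 2 * F)) +
  (Bn D hxi + e) * e + (sig + 2 * e) * (sigx + e) + F * (2 * m ^+ 2 * (sigx + e)).
have -> : Phi * (2 * m ^+ 2 * sig) + Phi * (C * m ^+ 2 * ((1 + C) * sig + C * m ^+ 2 * F)) +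
  sigx * ((1 + C) * ((1 + C) * sig + C * m ^+ 2 * F)) + sig * sigx + F * (2 * m ^+ 2 * sigx) = G 0.
  rewrite /G; ring.
apply: le_limit.
  apply: cinf_continuous; rewrite /G.
  have a (c d : R) : cinf (fun e : R => c + d * e) by apply: cinfD; [exact: cinf_cst|apply: cinfZ; exact: cinf_id].
  have a1 (c : R) : cinf (fun e : R => c + e) by apply: cinfD; [exact: cinf_cst|exact: cinf_id].
  have EE : cinf (fun e : R => (1 + C) * (sig + 2 * e) + C * m ^+ 2 * F).
    by apply: cinfD; [apply: cinfZ; exact: a|exact: cinf_cst].
  apply: cinfD; last by do 2 apply: cinfZ; exact: a1.
  apply: cinfD; last by apply: cinfM; [exact: a|exact: a1].
  apply: cinfD; last by apply: cinfM; [exact: a1|exact: cinf_id].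
  apply: cinfD; last by apply: cinfM; [exact: a|apply: cinfZ; exact: EE].
  apply: cinfD; last by do 2 apply: cinfZ; exact: EE.
  by apply: cinfD; [apply: cinfZ; exact: cinf_id|do 2 apply: cinfZ; exact: a1].
move=> e e0; have [p [tp ue he]] := app_u e0; have [q [tq xe]] := app_xi e0.
exact: (functional_error_test e0 tp tq ue he xe).
Qed.

End Solution.

End ErrorEstimates.

(** * Sobolev norms and the bilinear form on H^2_0 *)

Section SobolevFacts.
Context {R : realType}.
Notation mu := (@mu2 R).
Implicit Types (x y z v : R * R) (K L A : triangle R).
Variables (D : set (R * R)).
Hypotheses (oD : open D) (bD : bounded_set D).
Let mD : measurable (D : set (Pl R)). Proof. exact: open_measurable2. Qed.

Lemma weak_derivative00 u : weak_derivative D (0, 0)%N u u.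
Proof. by move=> p _; rewrite expr0 mul1r. Qed.

Lemma L2norm_wD a u g : L2 D g -> weak_derivative D a u g -> L2norm D (wD D a u) = L2norm D g.
Proof.
move=> Lg wg; have [Lw _] := wDP (ex_intro _ g (conj Lg wg)).
have ae := wD_ae oD bD Lg wg.
by rewrite /L2norm (ip_ae_eq mD Lw Lg Lw Lg ae ae).
Qed.

Lemma sobolev_norm_ge0 s u : 0 <= sobolev_norm s D u. Proof. exact: sqrtr_ge0. Qed.

Lemma L2norm_le_sobolev_norm s a u g : (a.1 + a.2 <= Num.truncn s)%N -> L2 D g ->
  weak_derivative D a u g -> L2norm D g <= sobolev_norm s D u.
Proof.
case: a => i j /= ij Lg wg; rewrite -(L2norm_wD Lg wg).
have := wD_le_sobolev_norm D u ij.
by rewrite ler_pXn2r // nnegrE ?L2norm_ge0 ?sobolev_norm_ge0.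
Qed.

Lemma L2norm_le_sobolev s u : L2 D u -> L2norm D u <= sobolev_norm s D u.
Proof. by move=> Lu; apply: L2norm_le_sobolev_norm Lu (weak_derivative00 u). Qed.

Let t2 : Num.truncn (2 : R) = 2%N. Proof. by apply: truncn_def; rewrite lexx ltr_nat. Qed.

Lemma ord2_sum c : ((ord2 c).1 + (ord2 c).2 = 2)%N.
Proof. by case: (ord3P c) => ->. Qed.

Lemma H20_test p : test_function D p -> H20 D p.
Proof.
move=> tp; split.
  rewrite /sobolev t2; split.
  - exact: (test_L2 mD tp).
  - move=> a _; exists (Dclassical a p); split; first exact: (test_L2 mD (Dclassical_test a tp)).
    exact: (weak_derivative_classical a (test_cinf tp)).
  - by rewrite ltxx.
move=> e e0; exists p; split => //.
suff -> : sobolev_norm 2 D (fun x => p x - p x) = 0 by [].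
have L0 : L2 D (fun=> 0) by have := L2B mD (test_L2 mD tp) (test_L2 mD tp); under eq_fun do rewrite subrr.
have w0 a : weak_derivative D a (fun x => p x - p x) (fun=> 0).
  have i0 (g : R * R -> R) : ip D (fun=> 0) g = 0.
    by rewrite ipE (eq_Int (v := fun=> 0)) ?Int0 // => x _; rewrite mul0r.
  have -> : (fun x => p x - p x) = fun=> 0 by apply/funext => x; rewrite subrr.
  by move=> q _; rewrite !i0 mulr0.
have n0 : L2norm D (fun=> 0) = 0.
  by rewrite /L2norm ipE (eq_Int (v := fun=> 0)) ?Int0 ?sqrtr0 // => x _; rewrite mul0r.
apply/eqP; rewrite -sqrf_eq0 sobolev_normsq t2 ltxx addr0 big1 // => i _; rewrite big1 // => j _.
by rewrite (L2norm_wD L0 (w0 _)) n0 expr0n.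
Qed.

Definition whess u : 'I_3 -> R * R -> R := fun c => wD D (ord2 c) u.

Section H2.
Variable u : R * R -> R.
Hypothesis Hu : H20 D u.

Lemma H20_L2 : L2 D u. Proof. by case: Hu => -[]. Qed.

Lemma whessP c : L2 D (whess u c) /\ weak_derivative D (ord2 c) u (whess u c).
Proof.
case: Hu => -[_ h _] _; apply: wDP; apply: h; rewrite t2; by rewrite ord2_sum.
Qed.

Lemma L2t_whess : L2t D (whess u). Proof. by move=> c; case: (whessP c). Qed.

Lemma H20_approx e : 0 < e -> exists p, [/\ test_function D p,
  L2norm D (fun x => u x - p x) <= e & Bn D (subt (whess u) (fun c => Hc c p)) <= e].
Proof.
(* Half of e for each entry, since the Hessian entries have total weight 4. *)
move=> e0; have e2 : 0 < e / 2 by rewrite divr_gt0.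
have [p [tp hp]] := Hu.2 _ e2; exists p.
have Lp := test_L2 mD tp; have Lu := H20_L2; have Ld := L2B mD Lu Lp.
have hc c : L2norm D (subt (whess u) (fun c => Hc c p) c) <= e / 2.
  have [Lh wh] := whessP c; have LH : L2 D (Hc c p) by apply: test_L2 => //; exact: Dclassical_test tp.
  apply: le_trans (ltW hp); apply: (@L2norm_le_sobolev_norm _ (ord2 c)).
  - by rewrite t2 ord2_sum.
  - exact: L2B.
  - apply: weak_derivativeB => //; apply: weak_derivative_classical; exact: test_cinf tp.
split => //.
  by apply: le_trans (L2norm_le_sobolev 2 Ld) _; apply: le_trans (ltW hp) _; lra.
have sqle (a b : R) : 0 <= b -> a ^+ 2 <= b ^+ 2 -> a <= b.
  by move=> b0; apply: contraTT; rewrite -!ltNge => ba; apply: ltrXn2r.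
apply: sqle; first exact: ltW.
rewrite Bn_sq /B; have -> : e ^+ 2 = 4 * (e / 2) ^+ 2 by field.
apply: wt_sum_le => c; rewrite -L2norm_sq; apply: lerXn2r (hc c); rewrite nnegrE ?L2norm_ge0 //; exact: ltW.
Qed.

Lemma H20_isH M : open D -> lipschitz_boundary D -> triangulation D M -> isH D M u (whess u).
Proof.
move=> _ lip tM; split; first exact: L2t_whess.
move=> c K KM; have [_ wh] := whessP c.
exact: (weak_derivative_subset (mesh_interior lip tM KM) wh).
Qed.

(* For a test function p, three integrations by parts turn the two mixed terms
   of the product of Laplacians into twice the product of mixed derivatives. *)
Lemma bilaplace_test p : test_function D p -> bilaplace_form D u p = B D (whess u) (fun c => Hc c p).
Proof.
move=> tp; have cp := test_cinf tp.
have tH c : test_function D (Hc c p) := Dclassical_test (ord2 c) tp.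
have LH c : L2 D (Hc c p) by exact: test_L2.
have Lh c := (whessP c).1; have wh c := (whessP c).2.
have aeH c : {ae mu, forall x, D x -> wD D (ord2 c) p x = Hc c p x}.
  by apply: wD_ae => //; exact: weak_derivative_classical.
have [Lw0 _] := wDP (ex_intro _ _ (conj (LH 0) (weak_derivative_classical (ord2 0) cp))).
have [Lw2 _] := wDP (ex_intro _ _ (conj (LH o2) (weak_derivative_classical (ord2 o2) cp))).
have Llu : L2 D (fun x => whess u 0 x + whess u o2 x) := L2D mD (Lh 0) (Lh o2).
have Llp : L2 D (fun x => Hc 0 p x + Hc o2 p x) := L2D mD (LH 0) (LH o2).
have E : bilaplace_form D u p = ip D (fun x => whess u 0 x + whess u o2 x) (fun x => Hc 0 p x + Hc o2 p x).
  apply: (ip_ae_eq mD Llu Llu (L2D mD Lw0 Lw2) Llp).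
    by apply: (@ae_imp _ (fun=> True)) => //; exact: aeW.
  by apply: ae_imp (ae_and (aeH 0) (aeH o2)) => x [h0 h2] Dx; rewrite h0 // h2.
have cross c c' : Dclassical (ord2 c) (Hc c' p) = Dclassical (ord2 1) (Hc 1 p) ->
    ip D (whess u c) (Hc c' p) = ip D (whess u 1) (Hc 1 p).
  move=> e; have h1 := wh c _ (tH c'); have h2 := wh 1 _ (tH 1).
  move: h1 h2; rewrite !ord2_sum sqrrN expr1n !mul1r => <- <-; by rewrite e.
have c1 := cinf_pd 1 cp; have c0 := cinf_pd 0 cp.
have x02 : ip D (whess u 0) (Hc o2 p) = ip D (whess u 1) (Hc 1 p).
  apply: cross; change (pd 0 (pd 0 (Hc o2 p)) = pd 0 (pd 1 (Hc 1 p))).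
  by rewrite Hc2 Hc1 -(pd_comm c1).
have x20 : ip D (whess u o2) (Hc 0 p) = ip D (whess u 1) (Hc 1 p).
  apply: cross; change (pd 1 (pd 1 (Hc 0 p)) = pd 0 (pd 1 (Hc 1 p))).
  rewrite Hc0 Hc1; apply: etrans (f_equal (pd 1) (esym (pd_comm c0))) _.
  apply: etrans (esym (pd_comm (cinf_pd 1 c0))) _.
  exact: (f_equal (fun g => pd 0 (pd 1 g)) (esym (pd_comm cp))).
have BE : B D (whess u) (fun c => Hc c p) =
    1 * ip D (whess u 0) (Hc 0 p) + 2 * ip D (whess u 1) (Hc 1 p) + 1 * ip D (whess u o2) (Hc o2 p).
  by rewrite /B sum3 wt0 wt1 wt2.
have alg (E0 s t t' p0 p1 p2 p3 q : R) : E0 = s -> s = t + t' -> t = p0 + p1 -> t' = p2 + p3 ->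
    p1 = q -> p2 = q -> E0 = 1 * p0 + 2 * q + 1 * p3.
  by move=> -> -> -> -> -> ->; ring.
apply: etrans _ (esym BE).
exact: (alg _ _ _ _ _ _ _ _ _ E (ipDl mD (Lh 0) (Lh o2) Llp) (ipDr mD (LH 0) (LH o2) (Lh 0))
  (ipDr mD (LH 0) (LH o2) (Lh o2)) x02 x20).
Qed.

End H2.

Lemma Hm2_ip f : L2 D f -> Hm2 D (ip D f).
Proof.
move=> Lf; split.
  move=> c u v Hu Hv; have Lu := H20_L2 Hu; have Lv := H20_L2 Hv.
  by rewrite (ipDr mD (L2Z c mD Lu) Lv Lf) (ipZr c mD Lu Lf).
exists (L2norm D f) => v Hv; have Lv := H20_L2 Hv.
apply: le_trans (ip_norm_le mD Lf Lv) _; apply: ler_wpM2l; first exact: L2norm_ge0.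
exact: L2norm_le_sobolev.
Qed.

(** [osc_bound] for each second derivative; the leading 2 accounts for the total weight 4. *)
Lemma hessian_osc_le M kappa s u : lipschitz_boundary D -> triangulation D M ->
  (forall K, K \in M -> shape_regular kappa K) -> 2 <= s -> H20 D u -> sobolev s D u ->
  hessian_osc D M (whess u) <= 2 * (1 + 128 * kappa ^+ 2) * meshsize M `^ Num.min 1 (s - 2) * sobolev_norm s D u.
Proof.
move=> lip tM sr s2 Hu Hs; set A := 1 + _; set h := _ `^ _; set S := sobolev_norm _ _ _.
have A1 : 1 <= A by rewrite /A lerDl; apply: mulr_ge0 => //; exact: sqr_ge0.
have h0 : 0 <= h by exact: powR_ge0.
have S0 : 0 <= S by exact: sobolev_norm_ge0.
have r0 : 0 <= 2 * A * h * S by apply: mulr_ge0 => //; apply: mulr_ge0 => //; lra.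
have sqle (a b : R) : 0 <= b -> a ^+ 2 <= b ^+ 2 -> a <= b.
  by move=> b0; apply: contraTT; rewrite -!ltNge => ba; apply: ltrXn2r.
apply: sqle => //; rewrite /hessian_osc Bn_sq /B.
have le c : ip D (subt (whess u) (fun c => P0 M (whess u c)) c) (subt (whess u) (fun c => P0 M (whess u c)) c) <=
    A * h ^+ 2 * S ^+ 2.
  rewrite /subt (dev_P0 oD bD lip tM (L2t_whess Hu c)).
  exact: (osc_bound oD bD (mesh_packed lip tM) sr s2 Hs (ord2_sum c)).
apply: le_trans (wt_sum_le le) _.
have -> : (2 * A * h * S) ^+ 2 = 4 * (A * (A * h ^+ 2 * S ^+ 2)) by ring.
rewrite ler_pM2l // ler_peMl //; apply: mulr_ge0; last exact: sqr_ge0.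
by apply: mulr_ge0; [lra|exact: sqr_ge0].
Qed.

End SobolevFacts.

(** * Constants and assembly *)

Section Final.
Context {R : realType}.
Implicit Types (x y z v : R * R) (K L A : triangle R) (f u : R * R -> R) (M : mesh R) (D : set (R * R)).

(** Turns the terms of order h^2 into the rate. Adding 1 to the bound on h makes the base at least
    1, so the exponent 2 - b may be raised to 2. *)
Lemma sq_le_powR (H h b : R) : 0 < h -> h <= H -> 0 <= b -> b <= 1 -> h ^+ 2 <= (H + 1) ^+ 2 * h `^ b.
Proof.
move=> h0 hH b0 b1; have hn : h != 0 by rewrite gt_eqF.
have H1 : 1 <= H + 1 by rewrite lerDr (le_trans (ltW h0)).
have -> : h ^+ 2 = h `^ (2 - b) * h `^ b.
  by rewrite -powRD ?hn ?implybT // subrK powR_mulrn // ltW.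
apply: ler_wpM2r; first exact: powR_ge0.
apply: le_trans (_ : _ <= (H + 1) `^ (2 - b)) _.
  apply: ge0_ler_powR; rewrite ?nnegrE; lra.
rewrite -powR_mulrn; last by lra.
by apply: ler_powR => //; lra.
Qed.

Lemma bounded_en D : bounded_set D -> exists2 H : R, 0 <= H & forall x y, D x -> D y -> en (x - y) <= H.
Proof.
move=> [r [_ hr]]; have h x : D x -> en x <= 2 * (`|r| + 1).
  move=> Dx; apply: le_trans (en_le_norm x) _; rewrite ler_pM2l //; apply: hr Dx.
  by rewrite (le_lt_trans (ler_norm _)) // ltrDl.
exists (4 * (`|r| + 1)); first by rewrite mulr_ge0 // addr_ge0.
move=> x y Dx Dy; apply: le_trans (enD _ _) _; rewrite enN.
by have := h x Dx; have := h y Dy; lra.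
Qed.

Lemma sum_sq_le (N : nat) (c : 'I_N -> R) : (forall i, 0 <= c i) -> \sum_i c i ^+ 2 <= (\sum_i c i) ^+ 2.
Proof.
move=> c0; rewrite [leRHS]expr2 mulr_suml; apply: ler_sum => i _; rewrite expr2; apply: ler_wpM2l => //.
by rewrite (bigD1 i) //= lerDl; apply: sumr_ge0.
Qed.

Lemma enorm_le (N : nat) (z : 'cV[R]_N) (c : 'I_N -> R) (Y : R) : 0 <= Y -> (forall i, 0 <= c i) ->
  (forall i, `|z i 0| <= c i * Y) -> enorm z <= (\sum_i c i) * Y.
Proof.
move=> Y0 c0 h; have S0 : 0 <= \sum_i c i by apply: sumr_ge0.
have SY : 0 <= (\sum_i c i) * Y by exact: mulr_ge0.
rewrite /enorm -(ger0_norm SY) -sqrtr_sqr; apply: ler_wsqrtr.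
apply: le_trans (_ : _ <= \sum_i (c i * Y) ^+ 2) _.
  apply: ler_sum => i _; rewrite -(real_normK (num_real (z i 0))).
  by apply: lerXn2r (h i); rewrite nnegrE // mulr_ge0.
apply: le_trans (sum_sq_le _) _; first by move=> i; exact: mulr_ge0.
by rewrite -mulr_suml.
Qed.

Lemma functional_const_ge0 (Phi C a b Q : R) : 0 <= Phi -> 0 <= C -> 0 <= a -> 0 <= b -> 0 <= Q ->
  0 <= Phi * (2 * Q * a) + Phi * (C * Q * ((1 + C) * a + C * Q)) + b * ((1 + C) * ((1 + C) * a + C * Q)) +
    a * b + 2 * Q * b.
Proof. by move=> *; repeat (apply: addr_ge0 || apply: mulr_ge0). Qed.

(** Every term on the left has two small factors. One supplies [ha] and the other [hb], where [h2]
    is used for whichever of them is missing. *)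
Lemma functional_numbers (Phi h2 sig sigx C F Fk ha hb a b Q : R) :
  0 <= Phi -> 0 <= h2 -> 0 <= sig -> 0 <= sigx -> 0 <= C -> 0 <= F -> 0 <= Fk -> 0 <= ha -> 0 <= hb ->
  0 <= a -> 0 <= b -> 0 <= Q -> sig <= a * (ha * Fk) -> sigx <= b * hb -> F <= Fk -> h2 <= Q * ha -> h2 <= Q * hb ->
  Phi * (2 * h2 * sig) + Phi * (C * h2 * ((1 + C) * sig + C * h2 * F)) +
  sigx * ((1 + C) * ((1 + C) * sig + C * h2 * F)) + sig * sigx + F * (2 * h2 * sigx) <=
  (Phi * (2 * Q * a) + Phi * (C * Q * ((1 + C) * a + C * Q)) + b * ((1 + C) * ((1 + C) * a + C * Q)) + a * b + 2 * Q * b)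
   * (ha * hb * Fk).
Proof.
move=> P0 h20 s0 x0 C0 F0 Fk0 ha0 hb0 a0 b0 Q0 hs hx hF h2a h2b.
have C1 : 0 <= 1 + C by exact: addr_ge0.
have hE : (1 + C) * sig + C * h2 * F <= ((1 + C) * a + C * Q) * (ha * Fk).
  have e1 : (1 + C) * sig <= (1 + C) * (a * (ha * Fk)) by exact: ler_wpM2l.
  have e2 : h2 * F <= Q * ha * Fk by exact: ler_pM.
  have e3 : C * (h2 * F) <= C * (Q * ha * Fk) by exact: ler_wpM2l.
  rewrite -mulrA; apply: le_trans (lerD e1 e3) _.
  by rewrite le_eqVlt; apply/orP; left; apply/eqP; ring.
have E0 : 0 <= (1 + C) * sig + C * h2 * F.
  by apply: addr_ge0; [exact: mulr_ge0|apply: mulr_ge0 => //; exact: mulr_ge0].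
move: hE E0; set E := (1 + C) * sig + _; set e := (1 + C) * a + C * Q => hE E0.
have t1 : Phi * (2 * (h2 * sig)) <= Phi * (2 * (Q * hb * (a * (ha * Fk)))).
  by apply: ler_wpM2l => //; apply: ler_wpM2l => //; exact: ler_pM.
have t2 : Phi * (C * (h2 * E)) <= Phi * (C * (Q * hb * (e * (ha * Fk)))).
  by apply: ler_wpM2l => //; apply: ler_wpM2l => //; exact: ler_pM.
have t3 : (1 + C) * (sigx * E) <= (1 + C) * (b * hb * (e * (ha * Fk))).
  by apply: ler_wpM2l => //; exact: ler_pM.
have t4 : sig * sigx <= a * (ha * Fk) * (b * hb) by exact: ler_pM.
have t5 : 2 * (F * (h2 * sigx)) <= 2 * (Fk * (Q * ha * (b * hb))).
  apply: ler_wpM2l => //; apply: ler_pM => //; first exact: mulr_ge0.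
  exact: ler_pM.
have -> : Phi * (2 * h2 * sig) + Phi * (C * h2 * E) + sigx * ((1 + C) * E) + sig * sigx + F * (2 * h2 * sigx) =
  Phi * (2 * (h2 * sig)) + Phi * (C * (h2 * E)) + (1 + C) * (sigx * E) + sig * sigx + 2 * (F * (h2 * sigx)) by ring.
apply: le_trans (lerD (lerD (lerD (lerD t1 t2) t3) t4) t5) _.
by rewrite le_eqVlt; apply/orP; left; apply/eqP; ring.
Qed.

End Final.

Theorem mainTheorem9 (R : realType) (Omega : set (R * R))
  (hOmega : bounded_polygonal_lipschitz_domain Omega)
  (T : ((R * R -> R) -> R) -> R * R -> R)
  (hT : solution_operator Omega T)
  (TT : set (mesh R))
  (hTT : forall M, TT M -> triangulation Omega M)
  (hreg : regular_family TT)
  (Th : mesh R -> (R * R -> R) -> R * R -> R)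
  (hTh : forall M, TT M -> discrete_solution_operator Omega M (Th M))
  (k : nat) (s : R) (hs : 2 <= s)
  (hTs : exists C : R, forall g, sobolev k%:R Omega g ->
    sobolev s Omega (T (ip Omega g)) /\
    sobolev_norm s Omega (T (ip Omega g)) <= C * sobolev_norm k%:R Omega g) :
  exists C : R, 0 < C /\
    (forall M, TT M -> forall f, sobolev k%:R Omega f ->
       normNC M (fun x => T (ip Omega f) x - Th M f x)
         <= C * meshsize M `^ Num.min 1 (s - 2) * sobolev_norm k%:R Omega f) /\
    forall (N : nat) (phi xi : 'I_N -> R * R -> R) (r : R),
      2 <= r ->
      (forall i, L2 Omega (phi i)) ->
      (forall i, H20 Omega (xi i) /\
         forall v, H20 Omega v -> bilaplace_form Omega (xi i) v = ip Omega (phi i) v) ->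
      (forall i, sobolev r Omega (xi i)) ->
      exists CN : R, 0 < CN /\
        forall M, TT M -> forall f, sobolev k%:R Omega f ->
          enorm (Phi Omega phi (T (ip Omega f)) - Phi Omega phi (Th M f))
            <= CN * meshsize M `^ (Num.min 1 (s - 2) + Num.min 1 (r - 2))
                  * sobolev_norm k%:R Omega f.
Proof.
have [[oD _ [x0 Dx0]] bD _ lip] := hOmega.
have [kappa0 hreg'] := hreg; have [CT hCT] := hTs.
(* The companion constant requires kappa >= 1 before any mesh is at hand; as soon as there is a mesh
   with a triangle, [kappa0] satisfies this itself. *)
pose kappa := Num.max 1 kappa0.
have k1 : 1 <= kappa by rewrite /kappa le_max lexx.
have [H H0 hH] := bounded_en bD.
have [C C0 comp] := companion_exists k1.
have sr M : TT M -> forall K, K \in M -> shape_regular kappa K.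
  move=> TM K KM; have k01 := kappa_ge1 (hTT M TM) (hreg' M TM) KM.
  have e : kappa = kappa0 := max_idPr k01.
  by rewrite /shape_regular e; exact: (hreg' M TM K KM).
(* The domain is nonempty, so a mesh has a triangle. Positivity of the mesh size is what permits
   adding exponents of powers. *)
have mesh_h M : TT M -> 0 < meshsize M /\ meshsize M <= H.
  move=> TM; have tM := hTT M TM; have [K KM _] := mesh_cover tM Dx0; split.
    by apply: lt_le_trans (diam_gt0 (mesh_det tM KM)) _; exact: diam_le_meshsize.
  rewrite /meshsize big_seq; apply: (big_ind (fun t => t <= H)) => // [a b ha hb|L LM].
    by rewrite ge_max ha hb.
  exact: (mesh_diam_le tM hH LM).
pose al := Num.min 1 (s - 2).
have al0 : 0 <= al by rewrite /al le_min ler01 subr_ge0.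
have al1 : al <= 1 by rewrite /al ge_min lexx.
pose A := 2 * (1 + 128 * kappa ^+ 2).
have A0 : 0 <= A by apply: mulr_ge0 => //; apply: addr_ge0 => //; apply: mulr_ge0 => //; exact: sqr_ge0.
pose Q := (H + 1) ^+ 2.
have Q0 : 0 <= Q by exact: sqr_ge0.
(* The regularity constant of the hypothesis carries no sign, hence the absolute value. *)
pose a := A * `|CT|.
have a0 : 0 <= a by exact: mulr_ge0.
have setup M f : TT M -> sobolev k%:R Omega f ->
  [/\ L2 Omega f, L2norm Omega f <= sobolev_norm k%:R Omega f, H20 Omega (T (ip Omega f)),
      hessian_osc Omega M (whess Omega (T (ip Omega f))) <= a * (meshsize M `^ al * sobolev_norm k%:R Omega f) &
      forall p, test_function Omega p -> B Omega (whess Omega (T (ip Omega f))) (fun c => Hc c p) = ip Omega f p].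
  move=> TM sf; have Lf : L2 Omega f by case: sf.
  have [Hu hu] := hT _ (Hm2_ip oD bD Lf); have [Su nu] := hCT f sf.
  split => //.
  - exact: (L2norm_le_sobolev oD bD _ Lf).
  - apply: le_trans (hessian_osc_le oD bD lip (hTT M TM) (sr M TM) hs Hu Su) _.
    rewrite -/A -/al; have -> : a * (meshsize M `^ al * sobolev_norm k%:R Omega f) =
      A * meshsize M `^ al * (`|CT| * sobolev_norm k%:R Omega f) by rewrite /a; ring.
    apply: ler_wpM2l; first by apply: mulr_ge0 => //; exact: powR_ge0.
    apply: le_trans nu _; apply: ler_wpM2r; [exact: sobolev_norm_ge0|exact: ler_norm].
  - by move=> p tp; rewrite -(bilaplace_test oD bD Hu tp); apply: hu; exact: (H20_test oD bD tp).
have discrete M f : TT M -> sobolev k%:R Omega f -> exists2 Ph, pieces Omega M Ph &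
  (forall K, K \in M -> forall x, (tri K)° x -> Th M f x = mesh_glue M Ph x) /\
  forall P, pieces Omega M P -> B Omega (pwhess M Ph) (pwhess M P) = ip Omega f (mesh_glue M P).
  move=> TM sf; have tM := hTT M TM; have Lf : L2 Omega f by case: sf.
  have [mo eq] := hTh M TM f Lf; have [Ph pPh hPh] := morley_pieces tM mo; exists Ph => //.
  have e K : K \in M -> forall x, (tri K)° x -> Th M f x = mesh_glue M Ph x.
    by move=> KM x ix; rewrite (hPh K KM x ix) (glue_in lip tM _ KM ix).
  split => // P pP.
  have gin K : K \in M -> forall x, (tri K)° x -> mesh_glue M P x = P K x.
    by move=> KM x ix; rewrite (glue_in lip tM _ KM ix).
  rewrite -(eq _ (pieces_morley tM pP gin)).
  have iP Q' : pieces Omega M Q' -> isH Omega M (mesh_glue M Q') (pwhess M Q').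
    by move=> [p1 _ _ _ _]; apply: (isH_glue oD bD lip tM) => K KM; exact/poly_cinf/p1.
  apply/esym; apply: (aNC_B oD lip tM) (iP P pP).
  by apply: isH_eq (iP Ph pPh) => K KM x ix; rewrite (e K KM x ix).
pose C1 := (2 + C) * a + C * Q.
have C10 : 0 <= C1 by apply: addr_ge0; apply: mulr_ge0 => //; exact: addr_ge0.
(* The summand 1 makes the constant strictly positive. *)
exists (C1 + 1); split; first by rewrite ltr_wpDl.
have powge (M : mesh R) t : 0 <= meshsize M `^ t by exact: powR_ge0.
split.
  move=> M TM f sf; have tM := hTT M TM; have [h0 hhH] := mesh_h M TM.
  have [Lf nF Hu osc equ] := setup M f TM sf; have [Ph pPh [inPh eqh]] := discrete M f TM sf.
  set u := T (ip Omega f) in Hu osc equ *.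
  have Fk0 : 0 <= sobolev_norm k%:R Omega f by exact: sobolev_norm_ge0.
  have comp' := comp Omega M oD bD lip tM (sr M TM).
  have E := energy_error oD bD lip tM Lf (L2t_whess Hu) (H20_approx oD bD Hu) equ pPh eqh C0 comp'.
  have iH : isH Omega M (fun x => u x - Th M f x) (subt (whess Omega u) (pwhess M Ph)).
    have [p1 _ _ _ _] := pPh.
    have h1 : isH Omega M (mesh_glue M Ph) (pwhess M Ph).
      by apply: (isH_glue oD bD lip tM) => K KM; exact/poly_cinf/p1.
    have h2 := isHB oD lip tM (fun=> H20_L2 Hu) (fun=> L2_glue_pieces oD bD pPh) (H20_isH Hu oD lip tM) h1.
    by apply: isH_eq h2 => K KM x ix; rewrite (inPh K KM x ix).
  rewrite /normNC (aNC_B oD lip tM iH iH) -/(Bn _ _); apply: le_trans E _.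
  have hq := sq_le_powR h0 hhH al0 al1; rewrite -/Q in hq.
  have e1 : (2 + C) * hessian_osc Omega M (whess Omega u) <= (2 + C) * (a * (meshsize M `^ al * sobolev_norm k%:R Omega f)).
    by apply: ler_wpM2l osc; exact: addr_ge0.
  have e2 : C * (meshsize M ^+ 2 * L2norm Omega f) <= C * (Q * meshsize M `^ al * sobolev_norm k%:R Omega f).
    by apply: ler_wpM2l => //; apply: ler_pM => //; [exact: sqr_ge0|exact: L2norm_ge0].
  rewrite -mulrA; apply: le_trans (lerD e1 e2) _.
  have -> : (C1 + 1) * meshsize M `^ al * sobolev_norm k%:R Omega f =
    (2 + C) * (a * (meshsize M `^ al * sobolev_norm k%:R Omega f)) + C * (Q * meshsize M `^ al * sobolev_norm k%:R Omega f)
    + meshsize M `^ al * sobolev_norm k%:R Omega f by rewrite /C1; ring.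
  have z0 : 0 <= meshsize M `^ al * sobolev_norm k%:R Omega f := mulr_ge0 (powge M al) Fk0.
  exact: (ler_wpDr z0 (lexx _)).
move=> N phi xi r hr Lphi hxi Sxi.
pose be := Num.min 1 (r - 2).
have be0 : 0 <= be by rewrite /be le_min ler01 subr_ge0.
have be1 : be <= 1 by rewrite /be ge_min lexx.
pose b i := A * sobolev_norm r Omega (xi i).
have b0 i : 0 <= b i by apply: mulr_ge0 => //; exact: sobolev_norm_ge0.
pose Cf i := L2norm Omega (phi i) * (2 * Q * a) + L2norm Omega (phi i) * (C * Q * ((1 + C) * a + C * Q)) +
  b i * ((1 + C) * ((1 + C) * a + C * Q)) + a * b i + 2 * Q * b i.
have Cf0 i : 0 <= Cf i.
  exact: (functional_const_ge0 (L2norm_ge0 Omega (phi i)) C0 a0 (b0 i) Q0).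
exists (\sum_i Cf i + 1); split; first by rewrite ltr_wpDl // sumr_ge0.
move=> M TM f sf; have tM := hTT M TM; have [h0 hhH] := mesh_h M TM.
have [Lf nF Hu osc equ] := setup M f TM sf; have [Ph pPh [inPh eqh]] := discrete M f TM sf.
set u := T (ip Omega f) in Hu osc equ *.
have Fk0 : 0 <= sobolev_norm k%:R Omega f by exact: sobolev_norm_ge0.
have comp' := comp Omega M oD bD lip tM (sr M TM).
have hn : meshsize M != 0 by rewrite gt_eqF.
pose Y := meshsize M `^ al * meshsize M `^ be * sobolev_norm k%:R Omega f.
have Y0 : 0 <= Y := mulr_ge0 (mulr_ge0 (powge M al) (powge M be)) Fk0.
rewrite -/al -/be powRD ?hn ?implybT // -mulrA -/Y mulrDl mul1r.
apply: le_trans (_ : _ <= (\sum_i Cf i) * Y) _; last by rewrite lerDl.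
apply: enorm_le => // i; rewrite !mxE.
have [Hxi exi] := hxi i.
(* The discrete solution is replaced under the integral by its glued polynomial pieces. *)
rewrite (ip_int_eq oD tM (phi i) inPh).
have app_xi e : 0 < e -> exists q, test_function Omega q /\ Bn Omega (subt (whess Omega (xi i)) (fun c => Hc c q)) <= e.
  by move=> e0; have [q [tq _ hq]] := H20_approx oD bD Hxi e0; exists q.
have eq_xi p : test_function Omega p -> B Omega (whess Omega (xi i)) (fun c => Hc c p) = ip Omega (phi i) p.
  by move=> tp; rewrite -(bilaplace_test oD bD Hxi tp); apply: exi; exact: (H20_test oD bD tp).
have E := functional_error oD bD lip tM Lf (H20_L2 Hu) (L2t_whess Hu) (H20_approx oD bD Hu) equ pPh eqh C0 comp'
  (Lphi i) (L2t_whess Hxi) app_xi eq_xi.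
apply: le_trans E _.
have oscx := hessian_osc_le oD bD lip tM (sr M TM) hr Hxi (Sxi i).
apply: functional_numbers => //; try exact: L2norm_ge0; try exact: Bn_ge0.
- exact: sqr_ge0.
- apply: le_trans oscx _; rewrite -/A -/be /b.
  by rewrite le_eqVlt; apply/orP; left; apply/eqP; ring.
- exact: (sq_le_powR h0 hhH al0 al1).
- exact: (sq_le_powR h0 hhH be0 be1).
Qed.
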